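(* Let $G$ be a connected Lie group with Levi decomposition $G=SR$, where $R$ is the solvable radical of $G$ (the largest connected solvable normal subgroup of $G$) and $S$ is a Levi subgroup. Then $G$ is type-absolutely connected (equivalently, $\mathcal{R}_{vN}(G)=G$ with respect to the discrete topology on $G$) if and only if $S$ has no nontrivial compact simple factors and $R=[G,R]$. In particular, every semisimple connected Lie group without compact factors, for example the topological universal cover $\widetilde{\mathrm{SL}_2(\mathbb{R})}$ of $\mathrm{SL}_2(\mathbb{R})$, is type-absolutely connected.
   Context: A subset $P$ of a group $G$ is $n$-thick if $P=P^{-1}$ and for every sequence $g_1,\dots,g_n$ in $G$ (not necessarily distinct) there are $1\le i<j\le n$ with $g_i^{-1}g_j\in P$; thick means $n$-thick for some $n\in\mathbb{N}$. A group $G$ (regarded as an abstract group) is type-absolutely connected if for any sufficiently saturated elementary extension $G^*$ of any first-order expansion $(G,\cdot,\dots)$ of $G$, one has $G^*={G^*}^{00}_G$, where ${G^*}^{00}_G$ is the smallest subgroup of $G^*$ of bounded index type-definable over $G$. Equivalently, for every family $\{P_n:n\in\mathbb{N}\}$ of thick subsets of $G$ with $P_{n+1}P_{n+1}\subseteq P_n$ for all $n$, one has $P_n=G$ for all $n$. The von Neumann radical $\mathcal{R}_{vN}(G)$ of a topological group $G$ is the kernel of the canonical continuous homomorphism $b\colon G\to bG$ into its Bohr compactification (the universal continuous homomorphism with dense image into a compact Hausdorff group). *)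

(* Defs.v *)
From HB Require Import structures.
From mathcomp Require Import all_boot all_order all_algebra.
From mathcomp Require Import all_classical all_reals all_analysis.
Import Order.TTheory GRing.Theory Num.Theory.
Import numFieldNormedType.Exports.

Set Implicit Arguments.
Unset Strict Implicit.
Unset Printing Implicit Defensive.

Local Open Scope classical_set_scope.
Local Open Scope ring_scope.
Local Open Scope card_scope.
Local Open Scope group_scope.

Definition is_subgroup (G : groupType) (H : set G) : Prop :=
  [/\ H 1, (forall x y, H x -> H y -> H (x * y)) & forall x, H x -> H x^-1].

Definition normalized_by (G : groupType) (K N : set G) : Prop :=
  forall g x, K g -> N x -> N (x ^ g).

Definition generated (G : groupType) (A : set G) : set G :=
  \bigcap_(H in [set H | is_subgroup H /\ A `<=` H]) H.

Definition commutator_subgroup (G : groupType) (A B : set G) : set G :=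
  generated [set z | exists a b, [/\ A a, B b & z = [~ a, b]]].

Definition solvable_set (G : groupType) (H : set G) : Prop :=
  exists n, iter n (fun K => commutator_subgroup K K) H `<=` [set 1].

Definition lcosets_of (G : groupType) (H : set G) : set (set G) :=
  range (fun g => [set g * h | h in H]).

(** The symbols of a language extending the language of groups; the
    multiplication symbol is built into [term], and the expansion interprets
    only the additional symbols. *)
Record language := Language {
  lfun : Type; lfun_arity : lfun -> nat;
  lrel : Type; lrel_arity : lrel -> nat }.

Record expansion (L : language) (G : Type) := Expansion {
  fun_interp : forall f : lfun L, ('I_(lfun_arity f) -> G) -> G;
  rel_interp : forall r : lrel L, ('I_(lrel_arity r) -> G) -> Prop }.

Inductive term (L : language) : Type :=
| TVar of nat
| TMul of term L & term L
| TFun (f : lfun L) of 'I_(lfun_arity f) -> term L.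

Inductive formula (L : language) : Type :=
| FEq of term L & term L
| FRel (r : lrel L) of 'I_(lrel_arity r) -> term L
| FFalse
| FImp of formula L & formula L
| FAll of nat & formula L.

Fixpoint teval (L : language) (G : groupType) (E : expansion L G)
    (v : nat -> G) (t : term L) : G :=
  match t with
  | TVar k => v k
  | TMul t1 t2 => teval E v t1 * teval E v t2
  | TFun f a => fun_interp E (fun i : 'I_(lfun_arity f) => teval E v (a i))
  end.

Fixpoint sat (L : language) (G : groupType) (E : expansion L G)
    (v : nat -> G) (p : formula L) : Prop :=
  match p with
  | FEq t1 t2 => teval E v t1 = teval E v t2
  | FRel r a => rel_interp E (fun i : 'I_(lrel_arity r) => teval E v (a i))
  | FFalse => False
  | FImp p1 p2 => sat E v p1 -> sat E v p2
  | FAll k p1 => forall x : G, sat E (fun l => if l == k then x else v l) p1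
  end.

Definition elementary_embedding (L : language) (G Gs : groupType)
    (E : expansion L G) (Es : expansion L Gs) (j : G -> Gs) : Prop :=
  forall (p : formula L) (v : nat -> G), sat E v p <-> sat Es (j \o v) p.

(** A formula in one free variable with parameters: the variable 0 is the free
    one, and the variable k.+1 is evaluated at the k-th parameter. *)
Definition pformula (L : language) (G : Type) : Type :=
  (formula L * (nat -> G))%type.

Definition holds_at (L : language) (G : groupType) (E : expansion L G)
    (x : G) (p : pformula L G) : Prop :=
  sat E (fun k => if k is k'.+1 then p.2 k' else x) p.1.

Definition pformulas_over (L : language) (G : Type) (A : set G) :
    set (pformula L G) :=
  [set p | forall k, A (p.2 k)].

Definition type_definable (L : language) (G : groupType) (E : expansion L G)
    (A H : set G) : Prop :=
  exists2 Phi : set (pformula L G), Phi `<=` pformulas_over A &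
    H = [set x | forall p, Phi p -> holds_at E x p].

(** Cardinals are represented by types: [~~ ([set: kappa] #<= A)] says that the
    cardinality of [A] is smaller than [kappa]. *)
Definition saturated (L : language) (G : groupType) (E : expansion L G)
    (kappa : Type) : Prop :=
  forall (A : set G), ~~ ([set: kappa] #<= A) ->
  forall Phi : set (pformula L G), Phi `<=` pformulas_over A ->
    (forall Psi, finite_set Psi -> Psi `<=` Phi ->
       exists x, forall p, Psi p -> holds_at E x p) ->
    exists x, forall p, Phi p -> holds_at E x p.

(** In a [kappa]-saturated model, bounded index means index less than [kappa]. *)
Definition tdef_bounded_subgroup (L : language) (G : groupType)
    (E : expansion L G) (kappa : Type) (A H : set G) : Prop :=
  [/\ is_subgroup H, type_definable E A H
    & ~~ ([set: kappa] #<= lcosets_of H)].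

(** [H] is the 00-component over [A]. *)
Definition is_component00 (L : language) (G : groupType) (E : expansion L G)
    (kappa : Type) (A H : set G) : Prop :=
  tdef_bounded_subgroup E kappa A H /\
  forall K, tdef_bounded_subgroup E kappa A K -> H `<=` K.

(** "Sufficiently saturated" is [kappa]-saturated for some [kappa] bigger than
    2 to the power |G| + |L| + aleph_0. An elementary extension of a group is a
    group, so its carrier is taken to be a [groupType]. *)
Definition type_absolutely_connected (G : groupType) : Prop :=
  forall (L : language) (E : expansion L G)
    (Gs : groupType) (Es : expansion L Gs) (j : G -> Gs) (kappa : Type),
    elementary_embedding E Es j ->
    ~~ ([set: kappa] #<= [set: set (nat + G + lfun L + lrel L)]) ->
    saturated Es kappa ->
    is_component00 Es kappa (range j) [set: Gs].

HB.mixin Record Group_isTopGroup G & Topological G & Group G := {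
  mulg_continuous : continuous (fun x : G * G => (x.1 * x.2 : G)) ;
  invg_continuous : continuous (fun x : G => x^-1) ;
}.

#[short(type="topGroupType")]
HB.structure Definition TopGroup :=
  {G of Topological G & Group G & Group_isTopGroup G}.

Section DiscreteGroup.
Variable G : groupType.

HB.instance Definition _ := Group.copy (discrete_topology G) G.

Let discrete_mulg_continuous :
  continuous (fun x : discrete_topology G * discrete_topology G =>
    (x.1 * x.2 : discrete_topology G)).
Proof.
move=> [x y] A /nbhs_singleton Axy.
exists ([set x], [set y]); first by split; exact: discrete_set1.
by move=> [a b] /= [-> ->].
Qed.

Let discrete_invg_continuous :
  continuous (fun x : discrete_topology G => x^-1).
Proof.
move=> x A /nbhs_singleton Ax.
by apply: (filterS _ (discrete_set1 (x : discrete_topology G))) => _ ->.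
Qed.

HB.instance Definition _ := Group_isTopGroup.Build (discrete_topology G)
  discrete_mulg_continuous discrete_invg_continuous.
End DiscreteGroup.

Definition is_continuous_hom (G H : topGroupType) (f : G -> H) : Prop :=
  {morph f : x y / x * y} /\ continuous f.

Definition is_bohr_compactification (G B : topGroupType) (b : G -> B) : Prop :=
  [/\ compact [set: B], hausdorff_space B, is_continuous_hom b,
      dense (range b)
    & forall (K : topGroupType) (f : G -> K),
        compact [set: K] -> hausdorff_space K -> is_continuous_hom f ->
        exists! g : B -> K, is_continuous_hom g /\ f = g \o b].

(** The Bohr compactification is unique up to isomorphism, so the kernel does
    not depend on the choice of [b]. *)
Definition von_neumann_radical (G : topGroupType) : set G :=
  [set x | forall (B : topGroupType) (b : G -> B),
     is_bohr_compactification b -> b x = 1].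
Arguments von_neumann_radical : clear implicits.

Section Smooth.
Variable R : realType.

Fixpoint Ck_on m n (k : nat) (U : set 'rV[R]_m) (f : 'rV[R]_m -> 'rV[R]_n) :
    Prop :=
  {in U, continuous f} /\
  if k is k'.+1 then
    forall i : 'I_m, {in U, forall x, derivable f x (delta_mx 0%R i)} /\
                     Ck_on k' U ('D_(delta_mx 0%R i) f)
  else True.

Definition smooth_on m n (U : set 'rV[R]_m) (f : 'rV[R]_m -> 'rV[R]_n) : Prop :=
  forall k, Ck_on k U f.

Record chart (n : nat) (M : Type) := Chart {
  chart_dom : set M;
  chart_fun : M -> 'rV[R]_n;
  chart_inv : 'rV[R]_n -> M }.

Definition chart_cod n M (c : chart n M) : set 'rV[R]_n :=
  chart_fun c @` chart_dom c.

Definition is_chart n (M : topologicalType) (c : chart n M) : Prop :=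
  [/\ open (chart_dom c), open (chart_cod c),
      {in chart_dom c, cancel (chart_fun c) (chart_inv c)},
      {in chart_dom c, continuous (chart_fun c)}
    & {in chart_cod c, continuous (chart_inv c)}].

Definition is_smooth_atlas n (M : topologicalType) (A : set (chart n M)) :
    Prop :=
  [/\ A `<=` @is_chart n M,
      \bigcup_(c in A) chart_dom c = [set: M]
    & forall c d, A c -> A d ->
        smooth_on (chart_fun c @` (chart_dom c `&` chart_dom d))
                  (chart_fun d \o chart_inv c)].

Definition smooth_map m n (M N : topologicalType)
    (A : set (chart m M)) (B : set (chart n N)) (f : M -> N) : Prop :=
  continuous f /\
  forall c d, A c -> B d ->
    smooth_on (chart_cod c `&` (f \o chart_inv c) @^-1` chart_dom d)
              (chart_fun d \o f \o chart_inv c).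

Definition prod_chart m n M N (c : chart m M) (d : chart n N) :
    chart (m + n) (M * N) :=
  Chart (chart_dom c `*` chart_dom d)
        (fun x => row_mx (chart_fun c x.1) (chart_fun d x.2))
        (fun z => (chart_inv c (lsubmx z), chart_inv d (rsubmx z))).

Definition prod_atlas m n M N (A : set (chart m M)) (B : set (chart n N)) :
    set (chart (m + n) (M * N)) :=
  [set e | exists c d, [/\ A c, B d & e = prod_chart c d]].

(** [A] is an atlas making the topological group [G] an [n]-dimensional real
    Lie group. *)
Definition is_lie_group n (G : topGroupType) (A : set (chart n G)) : Prop :=
  [/\ hausdorff_space G, @second_countable G, is_smooth_atlas A,
      smooth_map (prod_atlas A A) A (fun x : G * G => x.1 * x.2)
    & smooth_map A A (fun x : G => x^-1)].

End Smooth.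

Definition connected_solvable_normal (G : topGroupType) (N : set G) : Prop :=
  [/\ is_subgroup N, normalized_by [set: G] N, connected N & solvable_set N].

Definition is_solvable_radical (G : topGroupType) (Rad : set G) : Prop :=
  connected_solvable_normal Rad /\
  forall N, connected_solvable_normal N -> N `<=` Rad.

Definition connected_semisimple (G : topGroupType) : Prop :=
  connected [set: G] /\ is_solvable_radical [set 1 : G].

(** [H] is simple as a Lie group: it is connected, nonabelian, and has no
    connected normal subgroup besides 1 and [H]. *)
Definition simple_subgroup (G : topGroupType) (H : set G) : Prop :=
  [/\ is_subgroup H, connected H,
      exists x y, [/\ H x, H y & x * y <> y * x]
    & forall N, N `<=` H -> is_subgroup N -> normalized_by H N ->
        connected N -> N = [set 1] \/ N = H].

(** In a connected semisimple Lie group the simple factors, that is the analytic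
    subgroups of the simple ideals of the Lie algebra, are the closed normal
    subgroups which are simple. *)
Definition simple_factor (G : topGroupType) (H : set G) : Prop :=
  [/\ simple_subgroup H, normalized_by [set: G] H & closed H].

Definition no_compact_simple_factors (G : topGroupType) : Prop :=
  forall H : set G, simple_factor H -> ~ compact H.

(** [S], with its own Lie group topology, is a Levi subgroup of [G] via the
    injection [iota]; it need not be closed in [G]. An injective smooth
    homomorphism of Lie groups has constant rank, hence is an immersion. The
    last two conditions are the decomposition G = SR with S and R meeting in
    dimension 0. *)
Definition is_levi_subgroup (R : realType) n m (G S : topGroupType)
    (A : set (chart R n G)) (B : set (chart R m S))
    (Rad : set G) (iota : S -> G) : Prop :=
  [/\ is_lie_group B, connected_semisimple S,
      [/\ {morph iota : x y / x * y}, injective iota & smooth_map B A iota],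
      (forall g : G, exists s r, Rad r /\ g = iota s * r)
    & nbhs (1 : S) [set s | Rad (iota s) -> s = 1]].

Definition covering_map (E X : topologicalType) (B : set X) (p : E -> X) :
    Prop :=
  [/\ continuous p, range p = B
    & forall x, B x -> exists2 V : set X, open_nbhs x V &
        exists F : set (set E),
          [/\ trivIset F id, \bigcup_(U in F) U = p @^-1` V
            & forall U, F U -> open U /\
                exists s : X -> E, [/\ {within V `&` B, continuous s},
                  s @` (V `&` B) = U & {in V `&` B, cancel s p}]]].

Section UnitInterval.
Variable R : realType.

Definition simply_connected (T : topologicalType) : Prop :=
  let I : set R := `[0%R, 1%R]%classic in
  (forall x y : T, exists c : R -> T,
     [/\ {within I, continuous c}, c 0%R = x & c 1%R = y]) /\
  (forall c : R -> T, {within I, continuous c} -> c 0%R = c 1%R ->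
     exists h : R * R -> T, {within I `*` I, continuous h} /\
       forall t, I t -> [/\ h (t, 0%R) = c t, h (t, 1%R) = c 0%R,
                            h (0%R, t) = c 0%R & h (1%R, t) = c 0%R]).

Definition SL2 : set 'M[R]_2 := [set M | (\det M = 1)%R].

Definition is_universal_cover_SL2 (G : topGroupType) (p : G -> 'M[R]_2) :
    Prop :=
  [/\ simply_connected G, {morph p : x y / x * y >-> (x *m y)%R}
    & covering_map SL2 p].

End UnitInterval.

(* Main.v *)
Require Import Defs.
From HB Require Import structures.
From mathcomp Require Import all_boot all_order all_algebra.
From mathcomp Require Import all_classical all_reals all_analysis.
From mathcomp Require wochoice.
From mathcomp Require Import perm spectral complex zify ring lra.
Import Order.TTheory GRing.Theory Num.Theory numFieldNormedType.Exports.
Set Implicit Arguments.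
Unset Strict Implicit.
Unset Printing Implicit Defensive.
Local Open Scope classical_set_scope.
Local Open Scope ring_scope.

(** Call a set finitely colored if, for some finite coloring of G, it contains every g^-1 h with g and h
of the same color; these sets play the role of the thick sets. The elements lying in all members of all
sequences P_n of finitely colored sets with P_(n+1)^-1 P_(n+1) inside P_n form a normal subgroup, and both
type-absolute connectedness (by saturation) and triviality of the Bohr compactification (the space of
ultrafilters of G modulo such sequences) say that this subgroup is G.

It contains a one-parameter group which some element of G dilates by conjugation. In a connected semisimple
Lie group the real eigenvectors, with nonzero eigenvalue, of the real parts of the ad x generate an ideal.
If this ideal is everything, products of dilated one-parameter groups fill a neighbourhood of 1. Otherwise
the Killing form is negative definite on its orthogonal, and a minimal ideal k therein generates a compact
simple factor H. Its compactness needs that the center of H is torsion (Weyl): a character of the center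
with values in R extends to H up to a bounded error, averaging over H modulo its center makes the extension
a homomorphism, and this vanishes as H is perfect. Conversely the adjoint action on a compact factor gives
an invariant norm, hence proper finitely colored sets.

In general, if the subgroup is G then G is perfect, so modulo T = [G,R] the radical is covered by the
countable group of all s in S with s in R; by Baire's theorem T is open in R. If R = [G,R], then modulo the
subgroup, which contains S, one has R = [R,R], and R is solvable.

On the universal cover of SL_2 the charts are the left translates of a local inverse of the covering
composed with (a, b, c) |-> [[a, b], [c, (1 + bc)/a]], and the normal subgroups are central or map onto SL_2. *)

(** Colorings are preferred to thick sets because they pull back along homomorphisms and are
    intersected by pairing colors, without a Ramsey argument. Both notions give the same subgroup:
    if P is thick, finitely many translates of P cover G, and coloring by the first translate shows
    that P^-1 P is finitely colored.

    All Lie theory is drawn from one second order estimate on the product in a rescaled chart. The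
    exponential, the adjoint action and its differential are limits over dyadic subdivisions: an
    error of order 4^-k in each of 2^k factors costs 2^-k in the end. Hence neither power series nor
    differential equations occur.

    Root systems are replaced by the remark that an additive function of the eigenvalues of ad x
    defines a derivation. Complex conjugation yields the nondegeneracy of the Killing form; then
    derivations are inner, and the real part yields the hyperbolic elements.

    The delicate point is an analytic subgroup H not known to be closed. Its compactness modulo the
    center comes from Newton's method in the image of Ad, which turns an element with Ad close to 1
    into a central one. *)

Ltac mx_ring := apply/matrixP => ? ?; rewrite !mxE; ring.

Lemma le_of_eq (R : numDomainType) (x y : R) : x = y -> x <= y.
Proof. by move=> ->. Qed.

Lemma normD_le_trans (R : numDomainType) (V : normedZmodType R) (x y : V) M : `|x| + `|y| <= M -> `|x + y| <= M.
Proof. exact: le_trans (ler_normD _ _). Qed.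

(** * Geometric sequences and the sup norm *)

Section VectorSequences.
Variable R : realType.

Lemma halfX_gt0 k : 0 < (2^-1 : R) ^+ k.
Proof. by rewrite exprn_gt0 // invr_gt0. Qed.
Lemma exp2_halfX k : 2 ^+ k * (2^-1 : R) ^+ k = 1.
Proof. by rewrite -exprMn divff ?expr1n. Qed.
Lemma halfX_lt (e : R) : 0 < e -> exists k, forall j, (k <= j)%N -> 2^-1 ^+ j < e.
Proof.
move=> e0.
have H : geometric 1 (2^-1 : R) k @[k --> \oo] --> (0:R).
 by apply: cvg_geometric; rewrite ger0_norm; lra.
have [k _ Hk] := cvgr_lt 0 H e e0.
exists k => j kj; have := Hk j kj; by rewrite /geometric /= mul1r.
Qed.

Lemma le_of_halfX (a b M : R) :
 (exists K, forall k, (K <= k)%N -> a <= b + M * 2^-1 ^+ k) -> a <= b.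
Proof.
move=> [K H]; rewrite leNgt; apply/negP => ab.
have d0 : 0 < (a - b) / (`|M| + 1).
 by rewrite divr_gt0 ?subr_gt0 // ltr_wpDl.
have [k Hk] := halfX_lt d0.
have := H (maxn K k) (leq_maxl _ _).
have := Hk (maxn K k) (leq_maxr _ _).
set h := 2^-1 ^+ _; rewrite ltr_pdivlMr; last by rewrite ltr_wpDl.
move=> h1 h2.
have h0 : 0 < h := halfX_gt0 _.
have := ler_norm M; nra.
Qed.

Lemma mx_coord_le m n (x : 'M[R]_(m, n)) i j : `|x i j| <= `|x|.
Proof.
rewrite {2}/Num.Def.normr /= mx_normrE.
exact: (@le_bigmax _ _ _ 0 (fun ij : 'I_m * 'I_n => `|x ij.1 ij.2|) (i, j)).
Qed.

Lemma mx_norm_le m n (x : 'M[R]_(m, n)) (M : R) : 0 <= M ->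
 (forall i j, `|x i j| <= M) -> `|x| <= M.
Proof.
move=> M0 H; rewrite /Num.Def.normr /= mx_normrE.
by apply: bigmax_le=> // [] [i j] _ /=.
Qed.

Lemma norm_coord_le n (x : 'rV[R]_n) i : `|x ord0 i| <= `|x|.
Proof. exact: mx_coord_le. Qed.
Lemma norm_rV_le n (x : 'rV[R]_n) (M : R) : 0 <= M -> (forall i, `|x ord0 i| <= M) -> `|x| <= M.
Proof. by move=> M0 h; apply: mx_norm_le => // i j; rewrite (ord1 i). Qed.

Lemma dyadic_cauchy m n (u : nat -> 'M[R]_(m, n)) (C : R) :
 (forall k, `|u k.+1 - u k| <= C * 2^-1 ^+ k) ->
 exists l, forall k, `|u k - l| <= 2 * C * 2^-1 ^+ k.
Proof.
move=> H.
have C0 : 0 <= C by have := H 0%N; rewrite expr0 mulr1; apply: le_trans.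
have Hd k j : `|u (k + j)%N - u k| <= 2 * C * 2^-1 ^+ k.
 (* Strengthened by the part of the geometric series not yet spent, so that the induction closes. *)
 suff : `|u (k + j)%N - u k| <= 2 * C * (2^-1 ^+ k - 2^-1 ^+ (k + j)).
  by have := halfX_gt0 (k + j); nra.
 elim: j => [|j IH]; first by rewrite addn0 !subrr mulr0 normr0.
 rewrite addnS; have := H (k + j)%N; move: IH; rewrite exprS => h1 h2.
 rewrite -(subrK (u (k + j)%N) (u _.+1)) -addrA (le_trans (ler_normD _ _)) //; lra.
have /cauchy_cvgP ul : cauchy (u @ \oo).
 apply: cauchy_exP => e e0; have d0 : 0 < e / (2 * C + 1) by rewrite divr_gt0 // ltr_wpDl // mulr_ge0.
 have [k hk] := halfX_lt d0; exists (u k); exists k => // j /= kj.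
 rewrite -ball_normE /= distrC -(subnKC kj); apply: le_lt_trans (Hd _ _) _.
 have := hk k (leqnn k); rewrite ltr_pdivlMr ?ltr_wpDl ?mulr_ge0 //; have := halfX_gt0 k; lra.
exists (lim (u @ \oo)) => k; apply/ler_addgt0Pr => e e0.
have /cvgrPdist_lt /(_ e e0) [K _ hK] := ul; have := hK (k + K)%N (leq_addl _ _).
have := Hd k K; rewrite distrC => h1 /ltW; rewrite distrC => h2.
by rewrite -(subrK (u (k + K)%N) (u k)) -addrA (le_trans (ler_normD _ _)) // lerD.
Qed.
End VectorSequences.

(** * The exponential map of a local group law *)

Section LocalLaw.
Variables (R : realType) (n : nat).
Notation V := 'rV[R]_n.

(* A group law in coordinates around the unit 0, rescaled so that the constant of
  the second order estimate is 1/8 on the unit ball. *)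
Definition local_law (mu : V -> V -> V) : Prop :=
 [/\ mu 0 0 = 0,
   forall x x' y, `|x| <= 1 -> `|x'| <= 1 -> `|y| <= 1 ->
    8 * `|mu x y - mu x' y - (x - x')| <= `|x - x'| * `|y|
  & forall x y y', `|x| <= 1 -> `|y| <= 1 -> `|y'| <= 1 ->
    8 * `|mu x y - mu x y' - (y - y')| <= `|x| * `|y - y'|].

Variable mu : V -> V -> V.
Hypothesis muP : local_law mu.

Lemma norm0_le1 : `|0 : V| <= 1.
Proof. by rewrite normr0. Qed.
Lemma mux0 x : `|x| <= 1 -> mu x 0 = x.
Proof.
case: muP => m0 HL _ x1.
have := HL x 0 0 x1 norm0_le1 norm0_le1; rewrite normr0 mulr0 m0 !subr0.
rewrite pmulr_rle0 // normr_le0 subr_eq0 => /eqP //.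
Qed.

Lemma mu0x x : `|x| <= 1 -> mu 0 x = x.
Proof.
case: muP => m0 _ HR x1.
have := HR 0 x 0 norm0_le1 x1 norm0_le1; rewrite normr0 mul0r m0 !subr0.
rewrite pmulr_rle0 // normr_le0 subr_eq0 => /eqP //.
Qed.

Lemma mu_sum_le x y : `|x| <= 1 -> `|y| <= 1 -> 8 * `|mu x y - (x + y)| <= `|x| * `|y|.
Proof.
case: muP => m0 HL _ x1 y1.
have := HL x 0 y x1 norm0_le1 y1; rewrite mu0x // !subr0.
by have -> : mu x y - y - x = mu x y - (x + y) by rewrite opprD addrA addrAC.
Qed.

Lemma mu_lip x y x' y' : `|x| <= 1 -> `|y| <= 1 -> `|x'| <= 1 -> `|y'| <= 1 ->
 8 * `|mu x y - mu x' y' - ((x + y) - (x' + y'))| <= `|x - x'| * `|y| + `|x'| * `|y - y'|.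
Proof.
case: muP => m0 HL HR x1 y1 x1' y1'.
have := HL x x' y x1 x1' y1; have := HR x' y y' x1' y1 y1'.
have -> : mu x y - mu x' y' - ((x + y) - (x' + y')) =
 (mu x y - mu x' y - (x - x')) + (mu x' y - mu x' y' - (y - y')).
 by mx_ring.
have := ler_normD (mu x y - mu x' y - (x - x')) (mu x' y - mu x' y' - (y - y')).
lra.
Qed.

Definition sqr x := mu x x.

Lemma sqr_lip x y : `|x| <= 1 -> `|y| <= 1 ->
 8 * `|sqr x - sqr y - 2 *: (x - y)| <= (`|x| + `|y|) * `|x - y|.
Proof.
move=> x1 y1; have := mu_lip x1 x1 y1 y1; rewrite /sqr.
have -> : x + x - (y + y) = 2 *: (x - y).
 by rewrite scalerBr !scaler_nat !mulr2n.
by move=> h; apply: le_trans h _; lra.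
Qed.

Lemma sqr0 : sqr 0 = 0. Proof. by case: muP. Qed.

Lemma norm_sub_scale (u v : V) (a : R) : 0 <= a -> `|u| <= `|u - a *: v| + a * `|v|.
Proof.
move=> a0; have -> : a * `|v| = `|a *: v| by rewrite normrZ ger0_norm.
by rewrite -{1}(subrK (a *: v) u) ler_normD.
Qed.

(** Each squaring doubles a difference up to a relative error of the order of the norms involved.
    These norms grow geometrically up to a, so the relative errors add up to O(a): the k-th iterate
    of squaring is 2^k times the identity up to the factor 2 a. *)
Lemma iter_sqr_le k (x y : V) (s : R) : `|x| <= s -> `|y| <= s -> 2 ^+ k * s <= 2^-1 ->
 let a := 2 ^+ k * s in let d := 2 ^+ k * `|x - y| in
 [/\ `|iter k sqr x| <= a * (1 + 2 * a), `|iter k sqr y| <= a * (1 + 2 * a),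
   `|iter k sqr x - iter k sqr y| <= d * (1 + 2 * a)
  & `|iter k sqr x - iter k sqr y - 2 ^+ k *: (x - y)| <= d * (2 * a)].
Proof.
have S0 : `|x| <= s -> 0 <= s by apply: le_trans.
elim: k => [|k IH] xs ys.
 rewrite expr0 !mul1r /= scale1r subrr normr0 => h; have := normr_ge0 (x - y).
 have := S0 xs; split; nra.
have := S0 xs => s0.
have p0 : 0 < (2 : R) ^+ k by rewrite exprn_gt0.
rewrite exprS => h a d.
have h' : 2 ^+ k * s <= 2^-1 by nra.
have := IH xs ys h'; rewrite /=.
set b := 2 ^+ k * s; set e := 2 ^+ k * `|x - y|.
have -> : a = 2 * b by rewrite /a /b mulrA.
have -> : d = 2 * e by rewrite /d /e mulrA.
have b4 : b <= 4^-1 by rewrite /b; nra.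
have b0 : 0 <= b by rewrite /b; nra.
have e0 : 0 <= e by rewrite /e mulr_ge0 // ltW.
set X := iter k sqr x; set Y := iter k sqr y; move=> [hX hY hD hE].
have c0 : b * (1 + 2 * b) <= b * (3 / 2) by nra.
have X1 : `|X| <= 1 by nra.
have Y1 : `|Y| <= 1 by nra.
have sz (Z : V) : `|Z| <= b * (1 + 2 * b) -> `|Z| <= 1 -> `|sqr Z| <= 2 * b * (1 + 2 * (2 * b)).
 move=> hZ Z1; have := sqr_lip Z1 norm0_le1; rewrite sqr0 !subr0 normr0 addr0 => q.
 have := norm_sub_scale (sqr Z) Z (ler0n R 2).
 have Z0 := normr_ge0 Z.
 have : `|Z| * `|Z| <= `|Z| * (b * (3/2)) by apply: ler_wpM2l=> //; lra.
 nra.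
have q := sqr_lip X1 Y1.
have D0 := normr_ge0 (X - Y).
have bb : (`|X| + `|Y|) * `|X - Y| <= (b * 3) * (e * (3 / 2)).
 apply: ler_pM=> //; first by lra.
 by apply: le_trans hD _; apply: ler_wpM2l=> //; lra.
split=> //=; rewrite -/X -/Y.
- exact: sz.
- exact: sz.
- have := norm_sub_scale (sqr X - sqr Y) (X - Y) (ler0n R 2).
 nra.
- have -> : sqr X - sqr Y - (2 * 2 ^+ k) *: (x - y) =
  (sqr X - sqr Y - 2 *: (X - Y)) + 2 *: (X - Y - 2 ^+ k *: (x - y)).
  by mx_ring.
 apply: normD_le_trans; rewrite normrZ ger0_norm //; nra.
Qed.

Definition dyadic_power (X : V) (k : nat) := iter k sqr (2^-1 ^+ k *: X).

Lemma norm_halfX (X : V) k : `|2^-1 ^+ k *: X| = 2^-1 ^+ k * `|X|.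
Proof. by rewrite normrZ ger0_norm // ltW // halfX_gt0. Qed.
(** With u = 2^-(k+1) X, both terms are k-th iterates of [sqr], at [sqr u] and at 2 u. These points
    differ by O(4^-k), and k squarings amplify a difference by about 2^k only. *)
Lemma dyadic_power_cauchy X k : `|X| <= 4^-1 ->
 `|dyadic_power X k.+1 - dyadic_power X k| <= `|X| ^+ 2 / 16 * 2^-1 ^+ k.
Proof.
move=> X4; rewrite /dyadic_power iterSr.
set u := 2^-1 ^+ k.+1 *: X; set v := 2^-1 ^+ k *: X; set h := 2^-1 ^+ k.
have h0 : 0 < h := halfX_gt0 R k.
have h1 : h <= 1 by rewrite exprn_ile1 // invr_le1 ?unitfE // ler1n.
have ph : 2 ^+ k * h = 1 := exp2_halfX R k.
have uE : `|u| = h / 2 * `|X| by rewrite norm_halfX exprS [2^-1 * _]mulrC.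
have X0 := normr_ge0 X.
have u1 : `|u| <= 1 by rewrite uE; nra.
have v2 : v = 2 *: u by rewrite /u /v scalerA exprS mulrA divff // mul1r.
have q := sqr_lip u1 norm0_le1; rewrite sqr0 !subr0 normr0 addr0 -v2 uE in q.
have vE : `|v| = h * `|X| by exact: norm_halfX.
have vs : `|v| <= h / 2 by rewrite vE; nra.
have hs : `|sqr u| <= h / 2.
 have t4 : h * `|X| <= h / 4 by nra.
 have : h / 2 * `|X| * (h / 2 * `|X|) <= h / 8 * 8^-1 by apply: ler_pM; nra.
 have := ler_normD (sqr u - v) v; rewrite subrK vE; lra.
have e2 : 2 ^+ k * (h / 2) = 2^-1 by rewrite mulrA ph mul1r.
have e1 : 2 ^+ k * (h / 2) <= 2^-1 by rewrite e2.
have [_ _ + _] := iter_sqr_le hs vs e1; rewrite e2 => hh.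
apply: (le_trans hh).
have -> : 1 + 2 * 2^-1 = 2 :> R by lra.
have p0 : 0 < (2 : R) ^+ k by rewrite exprn_gt0.
have hX2 : 8 * `|sqr u - v| <= h * (h * (`|X| ^+ 2 / 4)) by apply: le_trans q _; rewrite expr2; lra.
have := ler_wpM2l (ltW p0) hX2; rewrite [X in _ <= X]mulrA ph mul1r; lra.
Qed.

Lemma lexp_exists (X : V) : exists l, `|X| <= 4^-1 ->
 forall k, `|dyadic_power X k - l| <= `|X| ^+ 2 / 8 * 2^-1 ^+ k.
Proof.
have [X4|_] := boolP (`|X| <= 4^-1); last by exists 0.
have [l Hl] := dyadic_cauchy (fun k => dyadic_power_cauchy k X4).
by exists l => _ k; have -> : `|X| ^+ 2 / 8 = 2 * (`|X| ^+ 2 / 16) by lra.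
Qed.

(** The exponential map read in the coordinates, as limit of the 2^k-th powers of 2^-k X. Only its
    values on the ball of radius 1/4 are meaningful. *)
Definition lexp (X : V) : V := projT1 (cid (lexp_exists X)).

Lemma lexpP X k : `|X| <= 4^-1 -> `|dyadic_power X k - lexp X| <= `|X| ^+ 2 / 8 * 2^-1 ^+ k.
Proof. by move=> X4; rewrite /lexp; case: cid => l /= /(_ X4). Qed.
Lemma lexp_near X : `|X| <= 4^-1 -> `|lexp X - X| <= `|X| ^+ 2 / 8.
Proof.
move=> X4; have := lexpP 0 X4.
by rewrite /dyadic_power /= expr0 scale1r mulr1 distrC.
Qed.

Lemma lexp_lip X Y s : `|X| <= s -> `|Y| <= s -> s <= 4^-1 ->
 `|lexp X - lexp Y - (X - Y)| <= 2 * s * `|X - Y|.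
Proof.
move=> Xs Ys s4.
have s0 : 0 <= s by apply: le_trans Xs.
have X4 : `|X| <= 4^-1 by lra.
have Y4 : `|Y| <= 4^-1 by lra.
apply: (le_of_halfX (M := (`|X| ^+ 2 / 8 + `|Y| ^+ 2 / 8))); exists 0%N => k _.
have hX := lexpP k X4; have hY := lexpP k Y4.
set h := 2^-1 ^+ k.
have h0 : 0 < h := halfX_gt0 R k.
have ph : 2 ^+ k * h = 1 := exp2_halfX R k.
have xs : `|h *: X| <= h * s by rewrite norm_halfX; apply: ler_wpM2l=> //; apply: ltW.
have ys : `|h *: Y| <= h * s by rewrite norm_halfX; apply: ler_wpM2l=> //; apply: ltW.
have e1 : 2 ^+ k * (h * s) <= 2^-1 by rewrite mulrA ph; lra.
have e2 : 2 ^+ k * (h * `|X - Y|) = `|X - Y| by rewrite mulrA ph mul1r.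
have e3 : 2 ^+ k * (h * s) = s by rewrite mulrA ph mul1r.
have [_ _ _] := iter_sqr_le xs ys e1.
rewrite -scalerBr normrZ (ger0_norm (ltW h0)) e2 e3 scalerA ph scale1r.
rewrite -/(dyadic_power X k) -/(dyadic_power Y k) => hE.
have -> : lexp X - lexp Y - (X - Y) = (dyadic_power X k - dyadic_power Y k - (X - Y))
  + ((dyadic_power Y k - lexp Y) - (dyadic_power X k - lexp X)).
 by mx_ring.
apply: normD_le_trans.
have := ler_normB (dyadic_power Y k - lexp Y) (dyadic_power X k - lexp X).
rewrite -/h in hX hY *; lra.
Qed.

Lemma lexp0 : lexp 0 = 0.
Proof.
have h : `|0 : V| <= 4^-1 by rewrite normr0.
have := lexp_near h; rewrite normr0 expr2 mul0r mul0r subr0 normr_le0 => /eqP //.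
Qed.

Lemma norm_lexp_le X : `|X| <= 4^-1 -> `|lexp X| <= 2 * `|X|.
Proof.
move=> X4; have := lexp_near X4; have := ler_normD (lexp X - X) X; rewrite subrK.
have := normr_ge0 X; rewrite expr2; nra.
Qed.

Lemma lexp_dist X Y : `|X| <= 4^-1 -> `|Y| <= 4^-1 ->
 `|lexp X - lexp Y| <= 2 * `|X - Y| /\ `|X - Y| <= 2 * `|lexp X - lexp Y|.
Proof.
move=> X4 Y4; have := lexp_lip X4 Y4 (lexx _).
have := ler_normD (lexp X - lexp Y - (X - Y)) (X - Y); rewrite subrK.
have := ler_distD (lexp X - lexp Y) (X - Y) 0; rewrite !subr0 [`|X - Y - _|]distrC.
by move=> h1 h2 h3; split; lra.
Qed.

Lemma lexp_inj X Y : `|X| <= 4^-1 -> `|Y| <= 4^-1 -> lexp X = lexp Y -> X = Y.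
Proof.
move=> X4 Y4 h; have [_] := lexp_dist X4 Y4; rewrite h subrr normr0 mulr0 normr_le0 subr_eq0.
by move/eqP.
Qed.

Lemma sqr_dist x y : `|x| <= 1 -> `|y| <= 1 -> `|sqr x - sqr y| <= 3 * `|x - y|.
Proof.
move=> x1 y1; have := sqr_lip x1 y1.
have := norm_sub_scale (sqr x - sqr y) (x - y) (ler0n R 2).
have := normr_ge0 (x - y); nra.
Qed.

(** Both sides are limits of the same approximants, with the index shifted by one. *)
Lemma lexp_double X : `|X| <= 4^-1 -> lexp X = sqr (lexp (2^-1 *: X)).
Proof.
move=> X4.
have h4 : `|2^-1 *: X| <= 4^-1 by rewrite normrZ ger0_norm //; lra.
apply/eqP; rewrite -subr_eq0 -normr_le0.
apply: (le_of_halfX (M := 8)); exists 0%N => k _.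
have := lexpP k.+1 X4; have := lexpP k h4.
have -> : dyadic_power X k.+1 = sqr (dyadic_power (2^-1 *: X) k).
 by rewrite /dyadic_power scalerA -exprSr.
set p := dyadic_power _ k; set l := lexp (2^-1 *: X) => h1.
have l1 : `|l| <= 2^-1 by apply: (le_trans (norm_lexp_le h4)); lra.
have h0 := halfX_gt0 R k.
have k1 : (2^-1 : R) ^+ k <= 1 by rewrite exprn_ile1 //; lra.
have hX : `|2^-1 *: X| ^+ 2 / 8 * 2^-1 ^+ k <= 2^-1 * 2^-1 ^+ k.
 by apply: ler_wpM2r; [exact: ltW|rewrite expr2; have := normr_ge0 (2^-1 *: X); nra].
have p1 : `|p| <= 1.
 have := ler_normD (p - l) l; rewrite subrK; nra.
have l1' : `|l| <= 1 by lra.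
have := sqr_dist p1 l1'.
have hX2 : `|X| ^+ 2 / 8 * 2^-1 ^+ k.+1 <= 2^-1 * 2^-1 ^+ k.
 have : `|X| ^+ 2 / 16 * 2^-1 ^+ k <= 2^-1 * 2^-1 ^+ k.
  by apply: ler_wpM2r; [exact: ltW|rewrite expr2; have := normr_ge0 X; nra].
 by rewrite [2^-1 ^+ k.+1]exprS; lra.
have := ler_distD (sqr p) (lexp X) (sqr l); rewrite [`|lexp X - sqr p|]distrC.
lra.
Qed.

(** Any sequence agreeing with 2^-k X to second order may replace it in the definition of the
    exponential. This freedom is the source of the identities for [Exp]: addition, multiples,
    inverses. *)
Lemma lexp_lim X (a : nat -> V) (M : R) : `|X| <= 4^-1 ->
 (exists K, forall k, (K <= k)%N -> `|a k - 2^-1 ^+ k *: X| <= M * 4^-1 ^+ k) ->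
 exists K, forall k, (K <= k)%N ->
  [/\ `|a k| <= 2^-1 * 2^-1 ^+ k & `|iter k sqr (a k) - lexp X| <= (2 * M + 1) * 2^-1 ^+ k].
Proof.
move=> X4 [K1 H].
have M0 : 0 <= M.
 have := H K1 (leqnn _) => h; have := le_trans (normr_ge0 _) h.
 by rewrite pmulr_lge0 // exprn_gt0.
have [K2 HK2] := @halfX_lt R (4^-1 / (M + 1)) ltac:(by rewrite divr_gt0 // ltr_wpDl).
exists (maxn K1 K2) => k; rewrite geq_max => /andP[k1 k2].
have := HK2 k k2; rewrite ltr_pdivlMr; last by rewrite ltr_wpDl.
have := H k k1; have -> : 4^-1 ^+ k = 2^-1 ^+ k * 2^-1 ^+ k :> R by rewrite -exprMn; congr (_ ^+ _); lra.
have := lexpP k X4; rewrite /dyadic_power.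
have := norm_halfX X k.
set h := 2^-1 ^+ k; set u := h *: X; set w := a k.
have h0 : 0 < h := halfX_gt0 R k.
have ph : 2 ^+ k * h = 1 := exp2_halfX R k.
move=> uE hl hw hM.
have us : `|u| <= h / 2 by rewrite uE; nra.
have ws : `|w| <= h / 2.
 have := ler_normD (w - u) u; rewrite subrK uE; nra.
split; first by lra.
have e2 : 2 ^+ k * (h / 2) = 2^-1 by rewrite mulrA ph mul1r.
have e1 : 2 ^+ k * (h / 2) <= 2^-1 by rewrite e2.
have [_ _ + _] := iter_sqr_le ws us e1; rewrite e2 => hh.
have p0 : 0 < (2 : R) ^+ k by rewrite exprn_gt0.
have h3 : 2 ^+ k * `|w - u| <= M * h.
 have := ler_wpM2l (ltW p0) hw.
 have -> : 2 ^+ k * (M * (h * h)) = (2 ^+ k * h) * (M * h) by ring.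
 by rewrite ph mul1r.
have := ler_normD (iter k sqr w - iter k sqr u) (iter k sqr u - lexp X); rewrite addrA subrK.
have : `|X| ^+ 2 / 8 * h <= h.
 by rewrite ler_piMl ?ltW // expr2; have := normr_ge0 X; nra.
lra.
Qed.
End LocalLaw.

(** * Local surjectivity of maps close to the identity *)

Section LocalSurjectivity.
Variables (R : realType) (n : nat).
Notation V := 'rV[R]_n.

(** Fixed point iteration x |-> x + (z - f x): each step halves the residual z - f x, and the
    iterates stay in the ball of radius 2 |z|. *)
Lemma near_id_surj (f : V -> V) (r : R) : 0 <= r -> f 0 = 0 ->
 (forall x y, `|x| <= r -> `|y| <= r -> `|f x - f y - (x - y)| <= 2^-1 * `|x - y|) ->
 forall z, `|z| <= r / 2 -> exists2 x, `|x| <= 2 * `|z| & f x = z.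
Proof.
move=> r0 f0 H z zr.
pose x k : V := iter k (fun x : V => x + (z - f x)) 0.
have xS k : x k.+1 = x k + (z - f (x k)) by [].
have z0 := normr_ge0 z.
have hx k : `|x k| <= 2 * `|z| * (1 - 2^-1 ^+ k) /\ `|z - f (x k)| <= 2^-1 ^+ k * `|z|.
 elim: k => [|k [IH1 IH2]]; first by rewrite /= f0 subr0 normr0 expr0; lra.
 have h0 := halfX_gt0 R k.
 have s1 : `|x k.+1| <= 2 * `|z| * (1 - 2^-1 ^+ k.+1).
  by rewrite xS exprS; apply: normD_le_trans; lra.
 split=> //.
 have k0 := halfX_gt0 R k.+1.
 have := H (x k.+1) (x k) ltac:(nra) ltac:(nra).
 have -> : f (x k.+1) - f (x k) - (x k.+1 - x k) = - (z - f (x k.+1)).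
  by rewrite xS; mx_ring.
 have -> : x k.+1 - x k = z - f (x k) by rewrite xS addrC addKr.
 rewrite normrN exprS; lra.
have [l Hl] : exists l : V, forall k, `|x k - l| <= 2 * `|z| * 2^-1 ^+ k.
 apply: dyadic_cauchy => k.
 by rewrite xS [x k + _]addrC addrK mulrC; exact: (hx k).2.
have lz : `|l| <= 2 * `|z|.
 apply: (le_of_halfX (M := 2 * `|z|)); exists 0%N => k _.
 have := Hl k; have := hx k; have := ler_normB (x k) (x k - l).
 rewrite opprB addrC subrK; have := halfX_gt0 R k; nra.
exists l=> //; apply/eqP; rewrite -subr_eq0 -normr_le0.
apply: (le_of_halfX (M := 5 * `|z|)); exists 0%N => k _.
have h0 := halfX_gt0 R k.
have [h1 h2] := hx k.
have hf := H l (x k) ltac:(nra) ltac:(nra).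
have hl := Hl k.
have -> : f l - z = (f l - f (x k) - (l - x k)) - ((x k - l) + (z - f (x k))).
 by mx_ring.
apply: (le_trans (ler_normB _ _)); apply: (le_trans (lerD hf (ler_normD _ _))).
by rewrite [`|l - x k|]distrC; nra.
Qed.

Lemma lexp_surj (mu : V -> V -> V) (muP : local_law mu) z :
 `|z| <= 8^-1 -> exists2 X, `|X| <= 2 * `|z| & lexp muP X = z.
Proof.
move=> z8.
have H x y : `|x| <= 4^-1 -> `|y| <= 4^-1 ->
  `|lexp muP x - lexp muP y - (x - y)| <= 2^-1 * `|x - y|.
 by move=> x4 y4; apply: (le_trans (lexp_lip muP x4 y4 (lexx _))); lra.
have [||X h1 h2] := near_id_surj _ (lexp0 muP) H (z := z); [lra|lra|].
by exists X.
Qed.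
End LocalSurjectivity.

(** * Limits in topological groups *)

Section TopGroups.
Variable G : topGroupType.

Lemma cvgMg (T : Type) (F : set_system T) (u v : T -> G) (a b : G) : Filter F ->
 u @ F --> a -> v @ F --> b -> (fun t => u t * v t)%g @ F --> (a * b)%g.
Proof.
move=> FF ua vb.
by apply: (cvg_comp _ (fun x : G * G => (x.1 * x.2)%g) (cvg_pair ua vb)); exact: (mulg_continuous (a, b)).
Qed.

Lemma cvgVg (T : Type) (F : set_system T) (u : T -> G) (a : G) : Filter F ->
 u @ F --> a -> (fun t => (u t)^-1)%g @ F --> (a^-1)%g.
Proof. by move=> FF ua; exact: (cvg_comp _ _ ua (@invg_continuous G a)). Qed.
Lemma cvgXg (T : Type) (F : set_system T) (u : T -> G) (a : G) k : Filter F ->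
 u @ F --> a -> (fun t => u t ^+ k)%g @ F --> (a ^+ k)%g.
Proof.
move=> FF ua; elim: k => [|k IH]; first exact: cvg_cst.
rewrite expgS; under eq_fun do rewrite expgS; exact: cvgMg.
Qed.

Lemma cvgJg (T : Type) (F : set_system T) (u v : T -> G) (a b : G) : Filter F ->
 u @ F --> a -> v @ F --> b -> (fun t => u t ^ v t)%g @ F --> (a ^ b)%g.
Proof. by move=> FF ua vb; apply: cvgMg; [exact: cvgVg|exact: cvgMg]. Qed.
Lemma nbhs1_translate (g : G) (U : set G) : nbhs g U -> nbhs (1%g : G) [set h | U (g * h)%g].
Proof.
move=> gU; have : (fun h : G => (g * h)%g) @ (1%g : G) --> g.
 by rewrite -{2}[g]mulg1; apply: cvgMg; [exact: cvg_cst|exact: cvg_id].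
exact.
Qed.

Lemma nbhs_translate1 (g : G) (U : set G) : nbhs (1%g : G) U -> nbhs g [set h | U (g^-1 * h)%g].
Proof.
move=> gU; have : (fun h : G => (g^-1 * h)%g) @ g --> (1%g : G).
 by rewrite -[1%g](mulVg g); apply: cvgMg; [exact: cvg_cst|exact: cvg_id].
exact.
Qed.
End TopGroups.

Lemma cvg_at (T : Type) (U V : topologicalType) (F : set_system T) (u : T -> U) (f : U -> V) (a : U) :
 u @ F --> a -> f @ a --> f a -> (fun t => f (u t)) @ F --> f a.
Proof. by move=> h1 h2; exact: (cvg_comp _ _ h1 h2). Qed.
Lemma cvg_of_shift (T : Type) (u : nat -> T) (F : set_system T) j :
 (fun k => u (k + j)%N) @ \oo --> F -> u @ \oo --> F.
Proof.
move=> H A /H [K _ HK]; exists (K + j)%N=> // k /= hk.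
have jk : (j <= k)%N by apply: leq_trans hk; apply: leq_addl.
by have := HK (k - j)%N; rewrite /= subnK // leq_subRL // addnC; apply.
Qed.

Section DyadicReals.
Variable R : realType.

Lemma dyadic_approx (s : R) : 0 <= s -> exists j : nat -> nat,
 forall k, `|(j k)%:R * 2^-1 ^+ k - s| <= 2^-1 ^+ k.
Proof.
move=> s0; exists (fun k => Num.trunc (2 ^+ k * s)) => k.
have p0 : 0 < (2 : R) ^+ k by rewrite exprn_gt0.
have h0 := halfX_gt0 R k; have ph := exp2_halfX R k.
have /andP[] := Num.Theory.truncn_itv (mulr_ge0 (ltW p0) s0).
set j := Num.trunc _ => h1 h2.
have := ler_wpM2r (ltW h0) h1; have := ler_wpM2r (ltW h0) (ltW h2).
have -> : 2 ^+ k * s * 2^-1 ^+ k = s by rewrite mulrAC ph mul1r.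
by rewrite -natr1 mulrDl mul1r ler_distl => a b; apply/andP; split; lra.
Qed.

Lemma cvg_halfX_le (V : normedModType R) (u : nat -> V) (l : V) (M : R) :
 (exists K, forall k, (K <= k)%N -> `|u k - l| <= M * 2^-1 ^+ k) -> u @ \oo --> l.
Proof.
move=> [K H]; apply/cvgrPdist_lt => e e0.
have e1 : 0 < e / (`|M| + 1) by rewrite divr_gt0 // ltr_wpDl.
have [k Hk] := halfX_lt e1.
exists (maxn K k)=> // j /=; rewrite geq_max => /andP[j1 j2].
have := Hk j j2; rewrite ltr_pdivlMr ?(ltr_wpDl (normr_ge0 M)) // => h.
rewrite distrC; apply: (le_lt_trans (H j j1)).
have := halfX_gt0 R j; have := ler_norm M; nra.
Qed.
End DyadicReals.

(** * The exponential map and the adjoint representation of a Lie group *)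

Section LieChart.
Variables (R : realType) (n : nat) (G : topGroupType).
Notation V := 'rV[R]_n.

(** All that is retained of the smooth structure: coordinates at 1 in which the product satisfies
    the second order estimates of [local_law]. The field [lc_nbhs] expresses that [lc_psi] is open
    at 0. *)
Record lie_chart := LieChart {
 lc_phi : G -> V;
 lc_psi : V -> G;
 lc_mu : V -> V -> V;
 lc_law : local_law lc_mu;
 lc_psi0 : lc_psi 0 = 1%g;
 lc_phiK : forall x, `|x| <= 1 -> lc_phi (lc_psi x) = x;
 lc_psiM : forall x y, `|x| <= 1 -> `|y| <= 1 -> lc_psi (lc_mu x y) = (lc_psi x * lc_psi y)%g;
 lc_phiM : forall x y, `|x| <= 1 -> `|y| <= 1 -> lc_phi (lc_psi x * lc_psi y)%g = lc_mu x y;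
 lc_cont : forall x, `|x| <= 1 -> {for x, continuous lc_psi};
 lc_nbhs : forall e : R, 0 < e -> nbhs (1%g : G) [set g | exists2 x, `|x| < e & g = lc_psi x] }.

Hypothesis G_hausdorff : hausdorff_space G.
Variable c : lie_chart.
Notation phi := (lc_phi c).
Notation psi := (lc_psi c).
Notation mu := (lc_mu c).
Let muP := lc_law c.
Notation sq := (sqr mu).
Notation ex := (lexp muP).

Lemma psi_iter_sqr k x : `|x| <= 2^-1 * 2^-1 ^+ k -> psi (iter k sq x) = (psi x ^+ (2 ^ k))%g.
Proof.
move=> hx; have p (j : nat) : (j <= k)%N -> psi (iter j sq x) = (psi x ^+ (2 ^ j))%g /\ `|iter j sq x| <= 1.
 elim: j => [|j IH] jk.
  split; rewrite //=; apply: (le_trans hx); have := halfX_gt0 R k.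
  have : (2^-1 : R) ^+ k <= 1 by rewrite exprn_ile1 //; lra.
  by lra.
 have [IH1 IH2] := IH (ltnW jk); split.
  by rewrite iterS /sqr lc_psiM // IH1 -expgnDr addnn -mul2n expnS.
 have e1 : 2 ^+ j.+1 * `|x| <= 2^-1.
  have := ler_wpM2l (exprn_ge0 j.+1 (ler0n R 2)) hx; move/le_trans; apply.
  have -> : k = (j.+1 + (k - j.+1))%N by rewrite subnKC.
  have -> : 2 ^+ j.+1 * (2^-1 * 2^-1 ^+ (j.+1 + (k - j.+1))) =
    2^-1 * (2 ^+ j.+1 * 2^-1 ^+ j.+1) * 2^-1 ^+ (k - j.+1) :> R by rewrite exprD; ring.
  by rewrite exp2_halfX mulr1 ler_piMr // exprn_ile1 //; lra.
 have [h _ _ _] := iter_sqr_le muP (lexx `|x|) (lexx `|x|) e1.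
 apply: (le_trans h); have : 0 <= 2 ^+ j.+1 * `|x| by rewrite mulr_ge0 ?exprn_ge0.
 by nra.
exact: (p k (leqnn k)).1.
Qed.

Lemma psi_lexp_cvg X (g : nat -> G) (M : R) : `|X| <= 4^-1 ->
 (exists K, forall k, (K <= k)%N ->
   exists2 a, g k = psi a & `|a - 2^-1 ^+ k *: X| <= M * 4^-1 ^+ k) ->
 (fun k => g k ^+ (2 ^ k))%g @ \oo --> psi (ex X).
Proof.
move=> X4 [K H].
have /choice[a Ha] : forall k, exists a, (K <= k)%N -> g k = psi a /\ `|a - 2^-1 ^+ k *: X| <= M * 4^-1 ^+ k.
 move=> k; have [Kk|_] := boolP (K <= k)%N; last by exists 0.
 by have [a h1 h2] := H k Kk; exists a.
have [K2 H2] := lexp_lim muP X4 (ex_intro _ K (fun k hk => (Ha k hk).2)).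
have eX1 : `|ex X| <= 1 by apply: (le_trans (norm_lexp_le muP X4)); lra.
have hc : (fun k => iter k sq (a k)) @ \oo --> ex X.
 by apply: (cvg_halfX_le (M := 2 * M + 1)); exists K2 => k /H2[].
have := cvg_comp _ _ hc (@lc_cont c _ eX1).
apply: cvg_trans; apply: near_eq_cvg; exists (maxn K K2)=> // k /=; rewrite geq_max => /andP[k1 k2].
by rewrite (Ha k k1).1 psi_iter_sqr //; case: (H2 k k2).
Qed.

Lemma scale_small (X : V) : exists k, `|2^-1 ^+ k *: X| <= 4^-1.
Proof.
have e0 : 0 < (4 : R)^-1 / (`|X| + 1) by rewrite divr_gt0 ?ltr_wpDl // invr_gt0.
have [k Hk] := halfX_lt e0; exists k; have := Hk k (leqnn k).
rewrite norm_halfX ltr_pdivlMr ?ltr_wpDl //; have := halfX_gt0 R k; nra.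
Qed.

(** The local exponential is extended to all vectors by Exp X = Exp (2^-k X) ^+ (2^k); independence
    of k is [ExpE]. *)
Definition Exp (X : V) : G :=
 let k := projT1 (cid (scale_small X)) in (psi (ex (2^-1 ^+ k *: X)) ^+ (2 ^ k))%g.

Lemma psi_lexp_scale (X : V) k : `|X| <= 4^-1 ->
 psi (ex X) = (psi (ex (2^-1 ^+ k *: X)) ^+ (2 ^ k))%g.
Proof.
move=> X4; elim: k => [|k IH]; first by rewrite expr0 scale1r.
have hk : `|2^-1 ^+ k *: X| <= 4^-1.
 rewrite norm_halfX; have : (2^-1 : R) ^+ k <= 1 by rewrite exprn_ile1 //; lra.
 by have := halfX_gt0 R k; have := normr_ge0 X; nra.
rewrite IH (lexp_double muP hk) scalerA -exprS /sqr lc_psiM; last 2 first.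
- have h4 : `|2^-1 ^+ k.+1 *: X| <= 4^-1.
  by rewrite exprS -scalerA normrZ ger0_norm ?invr_ge0 //; lra.
 by apply: (le_trans (norm_lexp_le muP h4)); lra.
- have h4 : `|2^-1 ^+ k.+1 *: X| <= 4^-1.
  by rewrite exprS -scalerA normrZ ger0_norm ?invr_ge0 //; lra.
 by apply: (le_trans (norm_lexp_le muP h4)); lra.
by rewrite -expg2 -expgnA -expnS.
Qed.

Lemma ExpE (X : V) k : `|2^-1 ^+ k *: X| <= 4^-1 ->
 Exp X = (psi (ex (2^-1 ^+ k *: X)) ^+ (2 ^ k))%g.
Proof.
move=> hk; rewrite /Exp; case: cid => /= j hj.
have p (i l : nat) : `|2^-1 ^+ i *: X| <= 4^-1 ->
  (psi (ex (2^-1 ^+ i *: X)) ^+ (2 ^ i))%g = (psi (ex (2^-1 ^+ (i + l) *: X)) ^+ (2 ^ (i + l)))%g.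
 move=> hi; rewrite (psi_lexp_scale l hi) scalerA -exprD -expgnA -expnD.
 by rewrite [(l + i)%N]addnC.
by rewrite (p j k hj) (p k j hk) addnC.
Qed.

Lemma Exp_small X : `|X| <= 4^-1 -> Exp X = psi (ex X).
Proof. by move=> X4; rewrite (@ExpE X 0) expr0 scale1r. Qed.
Lemma Exp0 : Exp 0 = 1%g.
Proof. by rewrite Exp_small ?normr0 // lexp0 lc_psi0. Qed.
Lemma Exp_half X k : Exp X = (Exp (2^-1 ^+ k *: X) ^+ (2 ^ k))%g.
Proof.
have [j hj] := scale_small (2^-1 ^+ k *: X).
by rewrite (ExpE hj) scalerA -exprD (@ExpE X (j + k)) ?exprD -?scalerA // -expgnA expnD mulnC.
Qed.

(** Global form of [lexp_lim]. Identities for [Exp] are proved by computing the limit of one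
    sequence of powers in two ways. *)
Lemma Exp_cvg X (g : nat -> G) (M : R) :
 (exists K, forall k, (K <= k)%N ->
   exists2 a, g k = psi a & `|a - 2^-1 ^+ k *: X| <= M * 4^-1 ^+ k) ->
 (fun k => g k ^+ (2 ^ k))%g @ \oo --> Exp X.
Proof.
move=> [K H]; have [j hj] := scale_small X.
apply: (@cvg_of_shift _ _ _ j); rewrite (Exp_half X j).
have e : (fun k => g (k + j)%N ^+ (2 ^ (k + j)))%g = (fun k => (g (k + j)%N ^+ (2 ^ k)) ^+ (2 ^ j))%g.
 by apply/funext => k; rewrite expnD expgnA.
rewrite e; apply: cvgXg; rewrite (Exp_small hj).
apply: (psi_lexp_cvg (M := M * 4^-1 ^+ j))=> //; exists K => k hk.
have [a ga ha] := H (k + j)%N (leq_trans hk (leq_addr _ _)).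
exists a=> //; rewrite scalerA -exprD; apply: (le_trans ha).
by rewrite exprD mulrA mulrAC.
Qed.

Lemma cvg_unique_G (u : nat -> G) (a b : G) : u @ \oo --> a -> u @ \oo --> b -> a = b.
Proof. by move=> ua ub; apply: (cvg_unique _ ua ub). Qed.
Lemma psi_expn_coord (j : nat) : exists2 d : R, 0 < d & exists2 M, 0 <= M &
 forall x, `|x| <= d -> exists2 a, (psi x ^+ j)%g = psi a & `|a - j%:R *: x| <= M * `|x| ^+ 2.
Proof.
elim: j => [|j [d d0 [M M0 H]]].
 exists 1=> //; exists 0=> // x x1; exists 0; first by rewrite expg0 lc_psi0.
 by rewrite scale0r subrr normr0 mul0r.
pose d' := Num.min d (Num.min 1 ((M + j%:R + 1)^-1)).
have d'0 : 0 < d' by rewrite !lt_min d0 ltr01 invr_gt0 ltr_wpDl // addr_ge0.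
exists d' => //; exists (M + (M + j%:R)); first by rewrite !addr_ge0.
move=> x; rewrite !le_min => /andP[xd /andP[x1 xM]].
have [a pa ha] := H x xd.
have j0 : (0 : R) <= j%:R by [].
have xM' : (M + j%:R + 1) * `|x| <= 1.
 by rewrite -ler_pdivlMl ?mulr1 // ltr_wpDl // addr_ge0.
have na : `|a| <= (M + j%:R) * `|x|.
 have := norm_sub_scale a x j0; rewrite expr2 in ha.
 have x0 := normr_ge0 x; have : M * (`|x| * `|x|) <= M * `|x|.
  by apply: ler_wpM2l=> //; nra.
 by lra.
have a1 : `|a| <= 1 by have := normr_ge0 x; nra.
exists (mu a x); first by rewrite expgSr pa lc_psiM.
have := mu_sum_le muP a1 x1.
have -> : mu a x - j.+1%:R *: x = (mu a x - (a + x)) + (a - j%:R *: x).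
 by rewrite -natr1 scalerDl scale1r; mx_ring.
have := ler_normD (mu a x - (a + x)) (a - j%:R *: x).
have : `|a| * `|x| <= (M + j%:R) * `|x| * `|x| by apply: ler_wpM2r.
rewrite expr2 in ha *; nra.
Qed.

Lemma psi_inv_coord : exists2 d : R, 0 < d &
 forall x, `|x| <= d -> exists2 a, (psi x)^-1%g = psi a & `|a + x| <= `|x| ^+ 2.
Proof.
have h0 : `|0 : V| <= 1 by rewrite normr0.
have h := @cvgVg G V (nbhs (0 : V)) psi (psi 0) _ (@lc_cont c 0 h0).
have : nbhs ((psi 0)^-1%g) [set g | exists2 x, `|x| < 1 & g = psi x].
 by rewrite lc_psi0 invg1; exact: lc_nbhs.
move=> /h /nbhs_ballP[d d0 Hd].
pose d' := Num.min (d / 2) 1.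
have d'0 : 0 < d' by rewrite lt_min ltr01 divr_gt0.
exists d' => // x; rewrite le_min => /andP[xd x1].
have [|a a1 ea] := Hd x.
 by rewrite /= -ball_normE /= sub0r normrN; have : 0 < d := d0; lra.
exists a=> //.
have : mu x a = 0.
 by rewrite -(lc_phiM c) ?(ltW a1) // -ea mulgV -(lc_psi0 c) lc_phiK // normr0.
move=> e; have := mu_sum_le muP x1 (ltW a1); rewrite e sub0r normrN => h1.
have := ler_normB (x + a) x; rewrite addrAC subrr add0r => h2.
rewrite addrC expr2; have := normr_ge0 x; have := normr_ge0 a; nra.
Qed.

Lemma half_small (d : R) (X : V) : 0 < d -> exists K, forall k, (K <= k)%N -> `|2^-1 ^+ k *: X| <= d.
Proof.
move=> d0; have e0 : 0 < d / (`|X| + 1) by rewrite divr_gt0 ?ltr_wpDl.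
have [K HK] := halfX_lt e0; exists K => k /HK.
rewrite norm_halfX ltr_pdivlMr ?ltr_wpDl //; have := halfX_gt0 R k; nra.
Qed.

Lemma quarter_expn k : (4^-1 : R) ^+ k = 2^-1 ^+ k * 2^-1 ^+ k.
Proof. by rewrite -exprMn; congr (_ ^+ _); lra. Qed.
Lemma psi_dyadic_cvg X : (fun k => psi (2^-1 ^+ k *: X) ^+ (2 ^ k))%g @ \oo --> Exp X.
Proof.
apply: (Exp_cvg (M := 0)); exists 0%N => k _; exists (2^-1 ^+ k *: X)=> //.
by rewrite subrr normr0 mul0r.
Qed.

Lemma ExpMn X j : Exp (j%:R *: X) = (Exp X ^+ j)%g.
Proof.
have [d d0 [M M0 H]] := psi_expn_coord j.
apply: (@cvg_unique_G (fun k => (psi (2^-1 ^+ k *: X) ^+ j) ^+ (2 ^ k))%g).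
 have [K HK] := half_small X d0.
 apply: (Exp_cvg (M := M * `|X| ^+ 2)); exists K => k kK.
 have [a pa ha] := H _ (HK k kK).
 exists a=> //; rewrite scalerA [_ * j%:R]mulrC -scalerA; apply: (le_trans ha).
 by rewrite norm_halfX quarter_expn !expr2; apply: le_of_eq; ring.
have -> : (fun k => (psi (2^-1 ^+ k *: X) ^+ j) ^+ (2 ^ k))%g =
     (fun k => (psi (2^-1 ^+ k *: X) ^+ (2 ^ k)) ^+ j)%g.
 by apply/funext => k; rewrite expgnAC.
by apply: cvgXg; exact: psi_dyadic_cvg.
Qed.

Lemma ExpN X : Exp (- X) = (Exp X)^-1%g.
Proof.
have [d d0 H] := psi_inv_coord.
apply: (@cvg_unique_G (fun k => (psi (2^-1 ^+ k *: X))^-1 ^+ (2 ^ k))%g).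
 have [K HK] := half_small X d0.
 apply: (Exp_cvg (M := `|X| ^+ 2)); exists K => k kK.
 have [a pa ha] := H _ (HK k kK).
 exists a=> //; rewrite scalerN opprK; apply: (le_trans ha).
 by rewrite norm_halfX quarter_expn !expr2; apply: le_of_eq; ring.
under eq_fun do rewrite expVgn.
by apply: cvgVg; exact: psi_dyadic_cvg.
Qed.

Lemma lexp_dyadic_coord X : exists K, forall k, (K <= k)%N ->
 Exp (2^-1 ^+ k *: X) = psi (ex (2^-1 ^+ k *: X)) /\
 `|ex (2^-1 ^+ k *: X) - 2^-1 ^+ k *: X| <= `|X| ^+ 2 * 4^-1 ^+ k.
Proof.
have [K HK] := @half_small 4^-1 X ltac:(by rewrite invr_gt0).
exists K => k /HK hk; split; first exact: Exp_small.
apply: (le_trans (lexp_near muP hk)); rewrite norm_halfX quarter_expn.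
rewrite exprMn [X in X * _ / _]expr2; set h := 2^-1 ^+ k.
have : 0 <= h * h * `|X| ^+ 2 by rewrite mulr_ge0 ?sqr_ge0 // -expr2 sqr_ge0.
lra.
Qed.

Lemma Trotter X Y : (fun k => (Exp (2^-1 ^+ k *: X) * Exp (2^-1 ^+ k *: Y)) ^+ (2 ^ k))%g
 @ \oo --> Exp (X + Y).
Proof.
have [K1 H1] := lexp_dyadic_coord X; have [K2 H2] := lexp_dyadic_coord Y.
have [K3 H3] := @half_small 4^-1 X ltac:(by rewrite invr_gt0).
have [K4 H4] := @half_small 4^-1 Y ltac:(by rewrite invr_gt0).
apply: (Exp_cvg (M := `|X| ^+ 2 + `|Y| ^+ 2 + `|X| * `|Y|)).
exists (maxn (maxn K1 K2) (maxn K3 K4)) => k; rewrite !geq_max => /andP[/andP[k1 k2] /andP[k3 k4]].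
have [e1 a1] := H1 k k1; have [e2 a2] := H2 k k2.
have b1 := norm_lexp_le muP (H3 k k3); have b2 := norm_lexp_le muP (H4 k k4).
have c1 : `|ex (2^-1 ^+ k *: X)| <= 1 by have := H3 k k3; lra.
have c2 : `|ex (2^-1 ^+ k *: Y)| <= 1 by have := H4 k k4; lra.
exists (mu (ex (2^-1 ^+ k *: X)) (ex (2^-1 ^+ k *: Y))); first by rewrite e1 e2 lc_psiM.
have := mu_sum_le muP c1 c2; rewrite scalerDr.
move: b1 b2; rewrite !norm_halfX; move: a1 a2.
set x := ex _; set y := ex _; set u := _ *: X; set v := _ *: Y => a1 a2 b1 b2 hm.
have -> : mu x y - (u + v) = (mu x y - (x + y)) + ((x - u) + (y - v)).
 by mx_ring.
apply: normD_le_trans; have := ler_normD (x - u) (y - v).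
have h0 := halfX_gt0 R k.
have : `|x| * `|y| <= (2 * (2^-1 ^+ k * `|X|)) * (2 * (2^-1 ^+ k * `|Y|)).
 by apply: ler_pM.
have : 0 <= `|X| * `|Y| * (2^-1 ^+ k * 2^-1 ^+ k) by rewrite !mulr_ge0 // ltW.
move: a1 a2; rewrite quarter_expn; nra.
Qed.

Lemma Exp_continuous : continuous Exp.
Proof.
move=> X; have [k hk] := scale_small X.
have [K HK] := @half_small 8^-1 X ltac:(by rewrite invr_gt0).
pose f Y := (psi (ex (2^-1 ^+ K *: Y)) ^+ (2 ^ K))%g.
have h0 := halfX_gt0 R K.
have hK := HK K (leqnn K).
have hX : {near X, f =1 Exp}.
 apply/nbhs_ballP; exists 8^-1 => /=; first by rewrite invr_gt0.
 move=> Y; rewrite -ball_normE /= => XY; rewrite /f -ExpE //.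
 have -> : 2^-1 ^+ K *: Y = 2^-1 ^+ K *: X - 2^-1 ^+ K *: (X - Y).
  by rewrite -scalerBr opprB addrC subrK.
 apply: (le_trans (ler_normB _ _)); rewrite [`|_ *: (X - Y)|]norm_halfX.
 have : (2^-1 : R) ^+ K <= 1 by rewrite exprn_ile1 //; lra.
 have := normr_ge0 (X - Y); nra.
have e : Exp X = f X by rewrite (@ExpE X K) //; lra.
rewrite /continuous_at e; apply: (cvg_trans (near_eq_cvg hX)).
apply: cvgXg.
have l4 : `|2^-1 ^+ K *: X| <= 4^-1 by lra.
have l1 : `|ex (2^-1 ^+ K *: X)| <= 1 by apply: (le_trans (norm_lexp_le muP l4)); lra.
apply: (cvg_at (f := psi) _ (@lc_cont c _ l1)).
apply/cvgrPdist_le => e' e'0; apply/nbhs_ballP.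
exists (Num.min 8^-1 (e' / 2)) => /=; first by rewrite lt_min invr_gt0 ltr0n divr_gt0.
move=> Y; rewrite -ball_normE /= lt_min => /andP[XY1 XY2].
have m4 : `|2^-1 ^+ K *: Y| <= 4^-1.
 have -> : 2^-1 ^+ K *: Y = 2^-1 ^+ K *: X - 2^-1 ^+ K *: (X - Y).
  by rewrite -scalerBr opprB addrC subrK.
 apply: (le_trans (ler_normB _ _)); rewrite [`|_ *: (X - Y)|]norm_halfX.
 have : (2^-1 : R) ^+ K <= 1 by rewrite exprn_ile1 //; lra.
 have := normr_ge0 (X - Y); nra.
have [+ _] := lexp_dist muP l4 m4; rewrite -scalerBr norm_halfX.
have : (2^-1 : R) ^+ K <= 1 by rewrite exprn_ile1 //; lra.
have := normr_ge0 (X - Y); nra.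
Qed.

Lemma Exp_scale_cvg (T : Type) (F : set_system T) (u : T -> R) (s : R) X : Filter F ->
 u @ F --> s -> (fun t => Exp (u t *: X)) @ F --> Exp (s *: X).
Proof.
move=> FF us; apply: (cvg_at (f := Exp) _ (@Exp_continuous (s *: X))).
exact: cvgZr_tmp.
Qed.

(** For nonnegative dyadic multiples this is [ExpMn]; approximation and continuity give all s, t >=
    0, and [ExpN] the remaining signs. *)
Lemma ExpD X (s t : R) : Exp ((s + t) *: X) = (Exp (s *: X) * Exp (t *: X))%g.
Proof.
have dy (k i : nat) Y : Exp (i%:R * 2^-1 ^+ k *: Y) = (Exp (2^-1 ^+ k *: Y) ^+ i)%g.
 by rewrite -scalerA ExpMn.
have pos Y (a b : R) : 0 <= a -> 0 <= b -> Exp ((a + b) *: Y) = (Exp (a *: Y) * Exp (b *: Y))%g.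
 move=> a0 b0; have [ja Ha] := dyadic_approx a0; have [jb Hb] := dyadic_approx b0.
 have ca : (fun k => (ja k)%:R * 2^-1 ^+ k : R^o) @ \oo --> (a : R^o).
  by apply: (cvg_halfX_le (M := 1)); exists 0%N => k _; rewrite mul1r.
 have cb : (fun k => (jb k)%:R * 2^-1 ^+ k : R^o) @ \oo --> (b : R^o).
  by apply: (cvg_halfX_le (M := 1)); exists 0%N => k _; rewrite mul1r.
 apply: (@cvg_unique_G (fun k => Exp (((ja k)%:R * 2^-1 ^+ k + (jb k)%:R * 2^-1 ^+ k) *: Y))).
  by apply: Exp_scale_cvg; apply: cvgD.
 have -> : (fun k => Exp (((ja k)%:R * 2^-1 ^+ k + (jb k)%:R * 2^-1 ^+ k) *: Y)) =
   (fun k => Exp ((ja k)%:R * 2^-1 ^+ k *: Y) * Exp ((jb k)%:R * 2^-1 ^+ k *: Y))%g.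
  by apply/funext => k; rewrite -mulrDl -natrD !dy expgnDr.
 by apply: cvgMg; exact: Exp_scale_cvg.
wlog st : s t / 0 <= s + t.
 move=> W; case: (leP 0 (s + t)) => [|st]; first exact: W.
 have : 0 <= (- t) + (- s) by rewrite -opprD addrC oppr_ge0 ltW.
 by move/W; rewrite -opprD !scaleNr !ExpN -invgM => /invg_inj <-; rewrite addrC.
case: (leP 0 s) => [s0|s0]; case: (leP 0 t) => [t0|t0]; first exact: pos.
- have h : 0 <= - t by rewrite oppr_ge0 ltW.
 have := pos X _ _ st h; rewrite addrK => ->.
 by rewrite scaleNr ExpN mulgVK.
- have h : 0 <= - s by rewrite oppr_ge0 ltW.
 have := pos X _ _ h st; rewrite addKr => ->.
 by rewrite scaleNr ExpN mulVKg.
- by exfalso; lra.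
Qed.

Lemma lexp_image_nbhs (e : R) : 0 < e -> nbhs (1%g : G) [set g | exists2 X, `|X| < e & g = Exp X].
Proof.
move=> e0; pose d := Num.min (e / 2) 8^-1.
have d0 : 0 < d by rewrite lt_min; apply/andP; split; lra.
apply: filterS (lc_nbhs c d0) => g [x]; rewrite lt_min => /andP[x1 x2] ->.
have [X hX eX] := lexp_surj muP (ltW x2); exists X; first by lra.
by rewrite Exp_small ?eX //; lra.
Qed.

Lemma Exp_inj X Y : `|X| <= 4^-1 -> `|Y| <= 4^-1 -> Exp X = Exp Y -> X = Y.
Proof.
move=> X4 Y4; rewrite !Exp_small // => /(congr1 phi).
rewrite !lc_phiK; [exact: lexp_inj| |].
 by apply: (le_trans (norm_lexp_le muP Y4)); lra.
by apply: (le_trans (norm_lexp_le muP X4)); lra.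
Qed.

Lemma Exp_line_inj X Y : (forall t : R, Exp (t *: X) = Exp (t *: Y)) -> X = Y.
Proof.
move=> H; have [K1 H1] := @half_small 4^-1 X ltac:(by rewrite invr_gt0).
have [K2 H2] := @half_small 4^-1 Y ltac:(by rewrite invr_gt0).
have := Exp_inj (H1 _ (leq_maxl K1 K2)) (H2 _ (leq_maxr K1 K2)) (H _).
by move/(scalerI (lt0r_neq0 (halfX_gt0 R _))).
Qed.

(** Square roots near 1 are unique, so the logarithms of g (2^-k t0) halve exactly from one k to the
    next. Then g and the exponential of a line agree at dyadic times, hence everywhere by
    continuity. *)
Lemma one_param_Exp (g : R -> G) : (forall s t, g (s + t) = (g s * g t)%g) ->
 {for 0, continuous g} -> exists X, forall t, g t = Exp (t *: X).
Proof.
move=> gD gc.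
have g0 : g 0 = 1%g by apply: (mulgI (g 0)); rewrite -gD addr0 mulg1.
have gN t : g (- t) = (g t)^-1%g by apply/esym/mulg1_eq; rewrite -gD subrr g0.
have gM t j : g (j%:R * t) = (g t ^+ j)%g.
 elim: j => [|j IH]; first by rewrite mul0r g0.
 by rewrite -natr1 mulrDl mul1r gD IH expgSr.
have gC t : {for t, continuous g}.
 have e : g = (fun s => g t * g (s - t))%g by apply/funext => s; rewrite -gD addrCA subrr addr0.
 have h : (fun s => g t * g (s - t))%g @ t --> (g t * g 0)%g.
  apply: cvgMg; first exact: cvg_cst.
  have hs : (fun s : R^o => s - t) @ (t : R^o) --> (t - t : R^o).
   by apply: cvgB; [exact: cvg_id|exact: cvg_cst].
  rewrite subrr in hs; exact: (cvg_at (f := g) hs gc).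
 by rewrite -e g0 mulg1 in h.
(* The radius 1/8 keeps the double of a logarithm in the ball of radius 1/4, on which [Exp] is
   injective. *)
have e8 : 0 < (8^-1 : R) by rewrite invr_gt0.
have := lexp_image_nbhs e8; rewrite -g0 => /gc /nbhs_ballP[d d0 Hd].
pose t0 := d / 2; have t00 : 0 < t0 by rewrite divr_gt0.
have /choice[Y HY] : forall k, exists Y, `|Y| < 8^-1 /\ g (2^-1 ^+ k * t0) = Exp Y.
 move=> k; have [|Y h1 h2] := Hd (2^-1 ^+ k * t0); last by exists Y.
 rewrite -ball_normE /= sub0r normrN ger0_norm; last by rewrite mulr_ge0 // ltW // halfX_gt0.
 have : (2^-1 : R) ^+ k <= 1 by rewrite exprn_ile1 //; lra.
 by rewrite /t0; have := d0 : 0 < d; nra.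
have YS k : Y k = 2 *: Y k.+1.
 have [y1 e1] := HY k; have [y2 e2] := HY k.+1.
 apply: Exp_inj; first by lra.
  by rewrite normrZ ger0_norm //; lra.
 by rewrite ExpMn -e1 -e2 -gM exprS !mulrA divff // mul1r.
have Yk k : Y k = 2^-1 ^+ k *: Y 0%N.
 elim: k => [|k IH]; first by rewrite expr0 scale1r.
 by rewrite exprS -scalerA -IH (YS k) scalerA mulVf // scale1r.
have main t : 0 <= t -> g (t * t0) = Exp (t *: Y 0%N).
 move=> h; have [j Hj] := dyadic_approx h.
 have cj : (fun k => (j k)%:R * 2^-1 ^+ k : R^o) @ \oo --> (t : R^o).
  by apply: (cvg_halfX_le (M := 1)); exists 0%N => k _; rewrite mul1r.
 apply: (@cvg_unique_G (fun k => Exp ((j k)%:R * 2^-1 ^+ k *: Y 0%N))); last exact: Exp_scale_cvg.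
 have -> : (fun k => Exp ((j k)%:R * 2^-1 ^+ k *: Y 0%N)) = (fun k => g ((j k)%:R * 2^-1 ^+ k * t0)).
  apply/funext => k; rewrite -scalerA ExpMn -Yk -(HY k).2 -gM mulrA //.
 apply: (cvg_at (f := g) _ (gC _)); apply: (cvgM cj); exact: cvg_cst.
exists (t0^-1 *: Y 0%N) => t; rewrite scalerA.
have tE : t = (t / t0) * t0 by rewrite divfK // lt0r_neq0.
case: (leP 0 t) => ht; first by rewrite {1}tE main // divr_ge0 // ltW.
rewrite -[LHS]invgK -gN -[RHS]invgK -ExpN -scaleNr; congr (_^-1)%g.
have -> : - t = (- t / t0) * t0 by rewrite divfK // lt0r_neq0.
by rewrite main ?mulNr // -mulNr divr_ge0 ?oppr_ge0 // ltW.
Qed.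

(** Conjugation carries one-parameter groups to one-parameter groups, and the induced map on
    velocities is additive because conjugation commutes with the limit in [Trotter]. Vectors are
    rows and x ^ g is g^-1 x g, which makes [Ad] multiplicative in the same order. *)
Lemma Ad_exists (g : G) : exists M : 'M[R]_n, forall v, Exp (v *m M) = (Exp v ^ g)%g.
Proof.
have /choice[f Hf] : forall v, exists w, forall t, Exp (t *: w) = (Exp (t *: v) ^ g)%g.
 move=> v; have [||w Hw] := @one_param_Exp (fun t => Exp (t *: v) ^ g)%g.
 - by move=> s t; rewrite ExpD conjMg.
 - by apply: cvgJg; [apply: Exp_scale_cvg; exact: cvg_id|exact: cvg_cst].
 by exists w => t; rewrite Hw.
have fZ a v : f (a *: v) = a *: f v.
 by apply: Exp_line_inj => t; rewrite Hf !scalerA Hf.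
have fD u v : f (u + v) = f u + f v.
 apply: Exp_line_inj => t.
 apply: (@cvg_unique_G (fun k => (Exp (2^-1 ^+ k *: (t *: f u)) * Exp (2^-1 ^+ k *: (t *: f v))) ^+ (2 ^ k))%g).
  have -> : (fun k => (Exp (2^-1 ^+ k *: (t *: f u)) * Exp (2^-1 ^+ k *: (t *: f v))) ^+ (2 ^ k))%g =
   (fun k => ((Exp (2^-1 ^+ k *: (t *: u)) * Exp (2^-1 ^+ k *: (t *: v))) ^+ (2 ^ k)) ^ g)%g.
   by apply/funext => k; rewrite conjXg conjMg !scalerA !Hf.
  by rewrite Hf scalerDr; apply: cvgJg; [exact: Trotter|exact: cvg_cst].
 by rewrite scalerDr; exact: Trotter.
exists (\matrix_i f (delta_mx 0 i)) => v.
have -> : v *m (\matrix_i f (delta_mx 0 i)) = f v.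
 rewrite mulmx_sum_row [in RHS](row_sum_delta v) (big_morph f fD (_ : f 0 = 0)).
  by apply: eq_bigr => i _; rewrite rowK fZ.
 by rewrite -[0 in LHS](scale0r 0) fZ scale0r.
by have := Hf v 1; rewrite !scale1r.
Qed.

Definition Ad (g : G) : 'M[R]_n := projT1 (cid (Ad_exists g)).

Lemma AdE g v : Exp (v *m Ad g) = (Exp v ^ g)%g.
Proof. by rewrite /Ad; case: cid. Qed.
Lemma Ad_unique g M : (forall v, Exp (v *m M) = (Exp v ^ g)%g) -> M = Ad g.
Proof.
move=> H; apply/row_matrixP => i; rewrite !rowE.
by apply: Exp_line_inj => t; rewrite !scalemxAl H AdE.
Qed.

Lemma Ad1 : Ad 1%g = 1%:M.
Proof. by apply/esym/Ad_unique => v; rewrite mulmx1 conjg1. Qed.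
Lemma AdM g h : Ad (g * h)%g = Ad g *m Ad h.
Proof. by apply/esym/Ad_unique => v; rewrite mulmxA !AdE conjgM. Qed.
Lemma AdV g : Ad g *m Ad g^-1%g = 1%:M.
Proof. by rewrite -AdM mulgV Ad1. Qed.
Lemma AdVl g : Ad g^-1%g *m Ad g = 1%:M.
Proof. by rewrite -AdM mulVg Ad1. Qed.

Lemma conj_coord_near : exists2 d : R, 0 < d & exists2 M, 0 <= M & forall x y, `|x| <= d -> `|y| <= d ->
 `|phi (psi x ^ psi y)%g - x| <= M * `|x| * `|y| /\ psi (phi (psi x ^ psi y)%g) = (psi x ^ psi y)%g.
Proof.
have [d1 d10 H1] := psi_inv_coord.
exists (Num.min d1 4^-1); first by rewrite lt_min d10; lra.
exists 4=> // x y; rewrite !le_min => /andP[x1 x4] /andP[y1 y4].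
have [a pa ha] := H1 y y1.
have na : `|a| <= 2 * `|y|.
 by have := ler_normB (a + y) y; rewrite addrK expr2 in ha *; have := normr_ge0 y; nra.
have nx1 : `|x| <= 1 by lra.
have ny1 : `|y| <= 1 by lra.
have na1 : `|a| <= 1 by lra.
have h1 := mu_sum_le muP nx1 ny1.
have nz : `|mu x y| <= 1.
 have := ler_normD (mu x y - (x + y)) (x + y); rewrite subrK.
 have := ler_normD x y; have := normr_ge0 x; have := normr_ge0 y; nra.
have e : (psi x ^ psi y)%g = (psi a * psi (mu x y))%g.
 by rewrite conjgE pa (lc_psiM c nx1 ny1).
rewrite e (lc_phiM c) // lc_psiM //; split=> //.
have ay : mu a y = 0.
 by rewrite -(lc_phiM c) // -pa mulVg -(lc_psi0 c) lc_phiK // normr0.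
case: (muP) => _ HL HR.
have h2 := HR x y 0 nx1 ny1 (norm0_le1 _ _).
have z0 : `|0 : V| <= 1 by rewrite normr0.
have h3 := HR a (mu x y) y na1 nz ny1; rewrite ay in h3.
have h4 := HL x 0 y nx1 z0 ny1; rewrite (mu0x muP ny1) !subr0 in h4.
have -> : mu a (mu x y) - x = (mu a (mu x y) - 0 - (mu x y - y)) + (mu x y - y - x).
 by mx_ring.
apply: normD_le_trans.
have h5 : `|mu x y - y| <= 2 * `|x|.
 have := ler_normD (mu x y - y - x) x; rewrite subrK; have := normr_ge0 x; nra.
have : `|a| * `|mu x y - y| <= (2 * `|y|) * (2 * `|x|) by apply: ler_pM.
have := normr_ge0 x; have := normr_ge0 y; nra.
Qed.
End LieChart.

(** * Matrix norms and bounded additive maps *)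

Section MatrixNorm.
Variable R : realType.

Lemma norm_mulmx_le m n p (A : 'M[R]_(m, n)) (B : 'M[R]_(n, p)) :
 `|A *m B| <= n%:R * `|A| * `|B|.
Proof.
apply: mx_norm_le => [|i j]; first by rewrite !mulr_ge0.
rewrite mxE; apply: (le_trans (ler_norm_sum _ _ _)).
apply: (@le_trans _ _ (\sum_(k < n) `|A| * `|B|)).
 by apply: ler_sum => k _; rewrite normrM; apply: ler_pM=> //; exact: mx_coord_le.
by rewrite sumr_const card_ord -[X in X <= _]mulr_natl mulrA.
Qed.

Lemma mulmx_le_trans m p q (A : 'M[R]_(m, p)) (B : 'M[R]_(p, q)) M : p%:R * `|A| * `|B| <= M -> `|A *m B| <= M.
Proof. exact: le_trans (norm_mulmx_le _ _). Qed.

Lemma mx_norm_le_op n p (A : 'M[R]_(n, p)) (C : R) : 0 <= C ->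
 (forall v : 'rV_n, `|v *m A| <= C * `|v|) -> `|A| <= C.
Proof.
move=> C0 H; apply: mx_norm_le=> // i j.
have := H (delta_mx 0 i); rewrite -rowE => h.
have -> : A i j = row i A 0 j by rewrite mxE.
apply: (le_trans (mx_coord_le _ _ _)); apply: (le_trans h).
rewrite ler_piMr //; apply: mx_norm_le=> // a b; rewrite mxE.
by case: (_ && _); rewrite ?normr1 ?normr0.
Qed.

Lemma additive_bounded_scale m n p q (f : 'M[R]_(m, n) -> 'M[R]_(p, q)) (C : R) :
 (forall x y, f (x + y) = f x + f y) -> (forall x, `|f x| <= C * `|x|) ->
 forall (a : R) x, f (a *: x) = a *: f x.
Proof.
move=> fD fB a x.
have f0 : f 0 = 0 by apply: (addrI (f 0)); rewrite -fD !addr0.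
have fN y : f (- y) = - f y by apply: (addrI (f y)); rewrite -fD !subrr f0.
have fn y k : f (k%:R *: y) = k%:R *: f y.
 by elim: k => [|k IH]; rewrite ?scale0r // -natr1 !scalerDl !scale1r fD IH.
wlog a0 : a / 0 <= a.
 move=> W; case: (leP 0 a) => ha; first exact: W.
 have : 0 <= - a by rewrite oppr_ge0 ltW.
 by move/W; rewrite !scaleNr fN => /oppr_inj.
apply/eqP; rewrite -subr_eq0 -normr_le0.
have [j Hj] := dyadic_approx a0.
apply: (le_of_halfX (M := 2 * `|C| * `|x|)); exists 0%N => k _.
have h0 := halfX_gt0 R k.
pose t : R := (j k)%:R * 2^-1 ^+ k.
have e : f (t *: x) = t *: f x.
 rewrite /t -scalerA fn -scalerA; congr (_ *: _).
 have := fn (2^-1 ^+ k *: x) (2 ^ k)%N; rewrite natrX scalerA exp2_halfX scale1r => ->.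
 by rewrite scalerA mulrC exp2_halfX scale1r.
have -> : f (a *: x) - a *: f x = f ((a - t) *: x) - (a - t) *: f x.
 rewrite !scalerBl fD fN e; set u := f _; set v := _ *: f x; set w := _ *: f x.
 by rewrite opprB addrA subrK.
apply: (le_trans (ler_normB _ _)); rewrite add0r normrZ.
have ta : `|a - t| <= 2^-1 ^+ k by rewrite distrC; exact: Hj.
have hf (y : 'M[R]_(m, n)) : `|f y| <= `|C| * `|y|.
 by apply: (le_trans (fB y)); apply: ler_wpM2r=> //; exact: ler_norm.
have := hf ((a - t) *: x); rewrite normrZ => h1.
have : `|a - t| * `|f x| <= 2^-1 ^+ k * (`|C| * `|x|) by apply: ler_pM=> //; exact: hf.
have : `|C| * (`|a - t| * `|x|) <= `|C| * (2^-1 ^+ k * `|x|).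
 by apply: ler_wpM2l=> //; apply: ler_wpM2r.
lra.
Qed.
End MatrixNorm.

(** * The differential of the adjoint representation *)

Section Adjoint.
Variables (R : realType) (n : nat) (G : topGroupType) (hG : hausdorff_space G).
Variable c : lie_chart R n G.
Notation V := 'rV[R]_n.
Notation phi := (lc_phi c).
Notation psi := (lc_psi c).
Notation mu := (lc_mu c).
Let muP := lc_law c.
Notation ex := (lexp muP).
Notation Exp := (Exp c).
Notation Ad := (Ad hG c).

(** [conj_coord_near] bounds the displacement of small vectors under conjugation; as [Ad] is linear,
    a vector v is first scaled down by 2^-k. *)
Lemma Ad_near1 : exists2 d : R, 0 < d & exists2 C, 0 <= C &
 forall Y, `|Y| <= d -> `|Ad (Exp Y) - 1%:M| <= C * `|Y|.
Proof.
have [d1 d10 [M M0 H]] := conj_coord_near c.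
pose d := Num.min (d1 / 2) 8^-1.
exists d; first by rewrite /d lt_min; apply/andP; split; lra.
exists (8 * M); first by rewrite mulr_ge0.
move=> Y; rewrite le_min => /andP[Y1 Y8].
apply: mx_norm_le_op => [|v]; first by rewrite !mulr_ge0.
have [K1 HK1] := @half_small R n (Num.min (d1 / 2) 4^-1) v ltac:(by rewrite lt_min; apply/andP; split; lra).
have [K2 HK2] := @half_small R n 4^-1 (v *m Ad (Exp Y)) ltac:(by rewrite invr_gt0).
pose k := maxn K1 K2; set h := (2^-1 : R) ^+ k.
have h0 : 0 < h := halfX_gt0 R k.
have := HK1 k (leq_maxl _ _); rewrite le_min => /andP[u1 u4].
have w4 := HK2 k (leq_maxr _ _).
set u := h *: v; set w := h *: (v *m Ad (Exp Y)).
have Y4 : `|Y| <= 4^-1 by lra.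
have eY := norm_lexp_le muP Y4; have eu := norm_lexp_le muP u4.
have hu : Exp w = psi (phi (psi (ex u) ^ psi (ex Y))%g).
 have [_ ->] := H (ex u) (ex Y) ltac:(rewrite -/h -/u in u1 *; lra) ltac:(lra).
 by rewrite /w scalemxAl AdE !Exp_small.
have [h1 _] := H (ex u) (ex Y) ltac:(rewrite -/h -/u in u1 *; lra) ltac:(lra).
have ew : phi (psi (ex u) ^ psi (ex Y))%g = ex w.
 have h2 : psi (ex w) = (psi (ex u) ^ psi (ex Y))%g.
  by rewrite -!Exp_small // /w scalemxAl AdE.
 by rewrite -h2 lc_phiK //; apply: (le_trans (norm_lexp_le muP w4)); lra.
rewrite ew in h1.
have [_ h2] := lexp_dist muP w4 u4.
rewrite mulmxBr mulmx1.
have e3 : `|w - u| = h * `|v *m Ad (Exp Y) - v| by rewrite /w /u -scalerBr normrZ ger0_norm // ltW.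
have eun : `|u| = h * `|v| by rewrite /u normrZ ger0_norm // ltW.
have h3 : M * `|ex u| * `|ex Y| <= M * (2 * `|u|) * (2 * `|Y|).
 by apply: ler_pM=> //; [rewrite mulr_ge0|apply: ler_wpM2l].
have : h * `|v *m Ad (Exp Y) - v| <= h * (8 * M * `|Y| * `|v|).
 rewrite -e3; apply: (le_trans h2); rewrite -/h -/u -/w in h1 *.
 have -> : h * (8 * M * `|Y| * `|v|) = 2 * (M * (2 * `|u|) * (2 * `|Y|)) by rewrite eun; ring.
 by lra.
by rewrite ler_pM2l.
Qed.

Lemma Exp_add_near : exists2 d : R, 0 < d & exists2 C, 0 <= C & forall X Y, `|X| <= d -> `|Y| <= d ->
 exists2 Z, `|Z| <= C * (`|X| + `|Y|) ^+ 2 & Exp (X + Y) = (Exp X * Exp Y * Exp Z)%g.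
Proof.
have [d1 d10 H1] := psi_inv_coord c.
pose d := Num.min (d1 / 16) 128^-1.
exists d; first by rewrite /d lt_min; apply/andP; split; lra.
exists 8=> // X Y; rewrite !le_min => /andP[X1 X2] /andP[Y1 Y2].
have X4 : `|X| <= 4^-1 by lra.
have Y4 : `|Y| <= 4^-1 by lra.
have nXY := ler_normD X Y.
have Z4 : `|X + Y| <= 4^-1 by lra.
have eX := lexp_near muP X4; have eY := lexp_near muP Y4; have eZ := lexp_near muP Z4.
have lX := norm_lexp_le muP X4; have lY := norm_lexp_le muP Y4; have lZ := norm_lexp_le muP Z4.
set p := mu (ex X) (ex Y); set q := ex (X + Y).
have hx1 : `|ex X| <= 1 by lra.
have hy1 : `|ex Y| <= 1 by lra.
have hm := mu_sum_le muP hx1 hy1; rewrite -/p in hm.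
set s := `|X| + `|Y|.
have X0 := normr_ge0 X; have Y0 := normr_ge0 Y.
have hXY : `|ex X| * `|ex Y| <= (2 * `|X|) * (2 * `|Y|) by apply: ler_pM.
have Zs : `|X + Y| ^+ 2 <= s ^+ 2 by rewrite ler_sqr ?nnegrE ?addr_ge0.
have hpq : `|q - p| <= s ^+ 2.
 have -> : q - p = (q - (X + Y)) - ((p - (ex X + ex Y)) + ((ex X - X) + (ex Y - Y))).
  by mx_ring.
 apply: (le_trans (ler_normB _ _)).
 have := ler_normD (p - (ex X + ex Y)) ((ex X - X) + (ex Y - Y)).
 have := ler_normD (ex X - X) (ex Y - Y).
 have : s ^+ 2 = `|X| ^+ 2 + 2 * (`|X| * `|Y|) + `|Y| ^+ 2 by rewrite /s; ring.
 rewrite -/q in eZ *; have := sqr_ge0 `|X|; have := sqr_ge0 `|Y|.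
 have : 0 <= `|X| * `|Y| by rewrite mulr_ge0.
 lra.
have np : `|p| <= 4 * s.
 have := ler_normD (p - (ex X + ex Y)) (ex X + ex Y); rewrite subrK.
 have := ler_normD (ex X) (ex Y).
 have : `|ex X| * `|ex Y| <= 1 * (2 * `|Y|) by apply: ler_pM.
 by rewrite /s; lra.
have nq : `|q| <= 2 * s by rewrite /q /s; lra.
have [a pa ha] := H1 p ltac:(rewrite /s in np; lra).
have na : `|a| <= 1.
 have := ler_normB (a + p) p; rewrite addrK expr2 in ha *.
 have : `|p| * `|p| <= `|p| * 1 by apply: ler_wpM2l=> //; rewrite /s in np; lra.
 rewrite /s in np; lra.
have np1 : `|p| <= 1 by rewrite /s in np; lra.
have nq1 : `|q| <= 1 by rewrite /s in nq; lra.
have hap : mu a p = 0 by rewrite -(lc_phiM c) // -pa mulVg -(lc_psi0 c) lc_phiK // normr0.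
case: (muP) => _ _ HR; have h2 := HR a q p na nq1 np1; rewrite hap subr0 in h2.
set r := mu a q in h2.
have nr : `|r| <= 2 * s ^+ 2.
 have := ler_normD (r - (q - p)) (q - p); rewrite subrK.
 have : `|a| * `|q - p| <= 1 * `|q - p| by apply: ler_wpM2r.
 have := sqr_ge0 s; lra.
have s1 : s <= 64^-1 by rewrite /s; lra.
have s0 : 0 <= s by rewrite addr_ge0.
have [|Z nZ eZZ] := @lexp_surj _ _ _ muP r.
 by apply: (le_trans nr); rewrite expr2; nra.
have nZ4 : `|Z| <= 4 * s ^+ 2 by lra.
exists Z; first by have := sqr_ge0 s; lra.
have Z44 : `|Z| <= 4^-1 by apply: (le_trans nZ4); rewrite expr2; nra.
rewrite !Exp_small // eZZ /r lc_psiM // -pa -lc_psiM // -/p -/q mulVKg //.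
Qed.

Let T X := Ad (Exp X) - 1%:M.

Lemma T_double X : T (2 *: X) = 2 *: T X + T X *m T X.
Proof.
rewrite /T (ExpMn hG) expg2 AdM mulmxBr !mulmxBl !mulmx1 !mul1mx scaler_nat mulr2n.
set A := Ad _; set B := A *m A; rewrite opprB !addrA.
by mx_ring.
Qed.

(** The derivative at 0 of t |-> Ad (Exp (t X)) along t = 2^-k, together with a rate of
    convergence. *)
Definition ad_limit X (L : 'M[R]_n) := exists M K, forall k, (K <= k)%N ->
 `|2 ^+ k *: T (2^-1 ^+ k *: X) - L| <= M * 2^-1 ^+ k.

(** With x = 2^-(k+1) X, [T_double] gives 2^(k+1) T x - 2^k T (2 x) = - 2^k (T x)^2. Since T x =
    O(|x|), the difference quotients form a dyadic Cauchy sequence, with an error quadratic in X. *)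
Lemma ad_limit_exists : exists2 d : R, 0 < d & exists2 C, 0 <= C & forall X, exists2 L, ad_limit X L &
 `|L| <= C * `|X| /\ (`|X| <= d -> `|T X - L| <= C * `|X| ^+ 2).
Proof.
have [d d0 [C C0 H]] := Ad_near1; exists d=> //.
pose C2 := n%:R * C ^+ 2.
have C20 : 0 <= C2 by rewrite mulr_ge0 // sqr_ge0.
have key X k : `|2^-1 ^+ k.+1 *: X| <= d ->
  `|2 ^+ k.+1 *: T (2^-1 ^+ k.+1 *: X) - 2 ^+ k *: T (2^-1 ^+ k *: X)| <= C2 * `|X| ^+ 2 * 2^-1 ^+ k.
 move=> hk; have e : 2^-1 ^+ k *: X = 2 *: (2^-1 ^+ k.+1 *: X).
  by rewrite scalerA exprS mulrA divff // mul1r.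
 set x := _ *: X in hk e *; rewrite e T_double (scalerDr _ (2 *: T x)) scalerA -exprSr opprD addrA subrr add0r.
 rewrite normrN normrZ ger0_norm ?exprn_ge0 //.
 have h1 := norm_mulmx_le (T x) (T x).
 have h2 : `|T x| <= C * `|x| := H x hk.
 have h3 : `|T x| * `|T x| <= (C * `|x|) * (C * `|x|) by apply: ler_pM.
 have p0 : 0 < (2 : R) ^+ k by rewrite exprn_gt0.
 have : 2 ^+ k * `|T x *m T x| <= 2 ^+ k * (n%:R * ((C * `|x|) * (C * `|x|))).
  apply: ler_wpM2l; first exact: ltW.
  by apply: (le_trans h1); rewrite -mulrA; apply: ler_wpM2l.
 move/le_trans; apply.
 have -> : `|x| = 2^-1 ^+ k.+1 * `|X| by exact: norm_halfX.
 have ph := exp2_halfX R k.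
 rewrite exprS; set hh := 2^-1 ^+ k in ph *; set pp := 2 ^+ k in ph p0 *.
 have -> : pp * (n%:R * (C * (2^-1 * hh * `|X|) * (C * (2^-1 * hh * `|X|)))) =
   (pp * hh) * (hh * (C2 * `|X| ^+ 2) / 4) by rewrite /C2; field.
 rewrite ph mul1r; have : 0 <= hh * (C2 * `|X| ^+ 2).
  by rewrite !mulr_ge0 ?sqr_ge0 // ltW // halfX_gt0.
 by lra.
exists (C + 2 * C2); first by rewrite addr_ge0 // mulr_ge0.
move=> X; have [K HK] := half_small X d0.
pose u k := 2 ^+ (k + K) *: T (2^-1 ^+ (k + K) *: X).
have [|L HL] := @dyadic_cauchy R n n u (C2 * `|X| ^+ 2).
 move=> k; rewrite /u addSn; apply: (le_trans (key X _ (HK _ _))).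
  by rewrite -addSn leq_addl.
 rewrite exprD; have k1 : (2^-1 : R) ^+ K <= 1 by rewrite exprn_ile1 //; lra.
 have h0 := halfX_gt0 R k; apply: ler_wpM2l; first by rewrite mulr_ge0 // sqr_ge0.
 by rewrite ler_piMr // ltW.
have HL' : ad_limit X L.
 exists (2 * (C2 * `|X| ^+ 2) * 2 ^+ K), K => k kK.
 have := HL (k - K)%N; rewrite /u subnK // => h; apply: (le_trans h).
 have -> : 2^-1 ^+ (k - K) = 2 ^+ K * 2^-1 ^+ k :> R.
  by rewrite -{2}(subnK kK) exprD mulrCA exp2_halfX mulr1.
 by rewrite -!mulrA.
exists L=> //; split.
 apply: (le_of_halfX (M := 2 * (C2 * `|X| ^+ 2))); exists 0%N => k _.
 have := HL k; rewrite -[`|L|]normrN => h.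
 have : `|u k| <= C * `|X|.
  rewrite /u normrZ ger0_norm ?exprn_ge0 //.
  have := ler_wpM2l (exprn_ge0 (k + K) (ler0n R 2)) (H _ (HK _ (leq_addl k K))).
  rewrite norm_halfX => hh; apply: (le_trans hh).
  have -> : 2 ^+ (k + K) * (C * (2^-1 ^+ (k + K) * `|X|)) =
    (2 ^+ (k + K) * 2^-1 ^+ (k + K)) * (C * `|X|) by ring.
  by rewrite exp2_halfX mul1r.
 have := ler_normB (u k - L) (u k); rewrite addrAC subrr add0r.
 have : 0 <= C2 * `|X| by rewrite mulr_ge0.
 by lra.
move=> Xd; have k1 k : `|2^-1 ^+ k *: X| <= d.
 rewrite norm_halfX; apply: le_trans Xd; rewrite ler_piMl // exprn_ile1 //; lra.
have [|L' HL2] := @dyadic_cauchy R n n (fun k => 2 ^+ k *: T (2^-1 ^+ k *: X)) (C2 * `|X| ^+ 2).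
 by move=> k; exact: key.
have e : L = L'.
 apply/eqP; rewrite -subr_eq0 -normr_le0.
 apply: (le_of_halfX (M := 4 * (C2 * `|X| ^+ 2))); exists 0%N => k _.
 have := HL k; have := HL2 (k + K)%N; rewrite -/(u k) => h1 h2.
 have := ler_normB (u k - L') (u k - L).
 have -> : u k - L' - (u k - L) = L - L' by mx_ring.
 have : 2^-1 ^+ (k + K) <= (2^-1 : R) ^+ k.
  by rewrite exprD; apply: ler_piMr; [exact: ltW (halfX_gt0 R k)|rewrite exprn_ile1 //; lra].
 have : 0 <= C2 * `|X| ^+ 2 by rewrite mulr_ge0 // sqr_ge0.
 nra.
have := HL2 0%N; rewrite !expr0 !scale1r mulr1 -e.
have : 0 <= C * `|X| ^+ 2 by rewrite mulr_ge0 // sqr_ge0.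
lra.
Qed.

Lemma ad_limit_unique X L L' : ad_limit X L -> ad_limit X L' -> L = L'.
Proof.
move=> [M [K H]] [M' [K' H']]; apply/eqP; rewrite -subr_eq0 -normr_le0.
apply: (le_of_halfX (M := M + M')); exists (maxn K K') => k; rewrite geq_max => /andP[k1 k2].
have := H k k1; have := H' k k2; set u := _ *: T _.
have := ler_normB (u - L') (u - L).
have -> : u - L' - (u - L) = L - L' by mx_ring.
lra.
Qed.

Lemma ad_fun_exists : exists ad : V -> 'M[R]_n, forall X, ad_limit X (ad X).
Proof.
have [d _ [C _ H]] := ad_limit_exists.
have /choice[f Hf] : forall X : V, exists L, ad_limit X L by move=> X; have [L] := H X; exists L.
by exists f.
Qed.

Definition ad : V -> 'M[R]_n := projT1 (cid ad_fun_exists).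

Lemma adP X : ad_limit X (ad X).
Proof. by rewrite /ad; case: cid. Qed.
Lemma ad_bounds : exists2 d : R, 0 < d & exists2 C, 0 <= C &
 (forall X, `|ad X| <= C * `|X|) /\
 (forall X, `|X| <= d -> `|Ad (Exp X) - 1%:M - ad X| <= C * `|X| ^+ 2).
Proof.
have [d d0 [C C0 H]] := ad_limit_exists; exists d=> //; exists C=> //.
by split=> X; have [L HL [h1 h2]] := H X; rewrite (ad_limit_unique (adP X) HL).
Qed.

(** By [Exp_add_near], T (x + y) is T x + T y up to O((|x| + |y|)^2). At x = 2^-k X, y = 2^-k Y this
    error is O(4^-k) and vanishes after multiplication by 2^k. *)
Lemma adD X Y : ad (X + Y) = ad X + ad Y.
Proof.
have [d1 d10 [C1 C10 H1]] := Ad_near1; have [d2 d20 [C2 C20 H2]] := Exp_add_near.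
have [MX [KX HX]] := adP X; have [MY [KY HY]] := adP Y; apply: (ad_limit_unique (adP (X + Y))).
pose N : R := n%:R; have N0 : 0 <= N by exact: ler0n.
pose Q := N * C1 ^+ 2 + C1 * C2 + N * (4 * C1 + 4 * (N * C1 ^+ 2)) * (C1 * C2).
pose e := Num.min (Num.min d1 d2) (Num.min 1 (d1 / (4 * C2 + 1))).
have q0 : 0 < 4 * C2 + 1 by lra.
have e0 : 0 < e by rewrite !lt_min d10 d20 ltr01 divr_gt0.
have key x y : `|x| <= e -> `|y| <= e -> `|T (x + y) - T x - T y| <= Q * (`|x| + `|y|) ^+ 2.
 rewrite !le_min !ler_pdivlMr // => /andP[/andP[x1 x2] /andP[x3 x4]] /andP[/andP[y1 y2] /andP[y3 y4]].
 have [z nz ez] := H2 x y x2 y2; have x0 := normr_ge0 x; have y0 := normr_ge0 y.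
 have hx := H1 x x1; have hy := H1 y y1; move: nz x4 y4.
 set t := `|x| + `|y| => nz x4 y4.
 have t0 : 0 <= t by exact: addr_ge0.
 have t2 : t <= 2 by rewrite /t; lra.
 have tt : t ^+ 2 <= 2 * t by rewrite expr2 ler_wpM2r.
 have hz : `|T z| <= C1 * C2 * t ^+ 2.
  rewrite -mulrA; apply: (le_trans (H1 z _)); last exact: ler_wpM2l.
  by have := ler_wpM2l C20 tt; move: nz; rewrite /t; nra.
 have eA u : Ad (Exp u) = 1%:M + T u by rewrite addrC subrK.
 have -> : T (x + y) - T x - T y = T x *m T y + T z + (T x + T y + T x *m T y) *m T z.
  rewrite {1}/T ez !AdM !eA; move: (T x) (T y) (T z) => a b c'.
  rewrite !(mulmxDl, mulmxDr, mulmx1, mul1mx).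
  move: (a *m b) (b *m c') (a *m c') => p1 p2 p3; move: (p1 *m c') => p4.
  by mx_ring.
 have {}hx : `|T x| <= C1 * t by apply: (le_trans hx); rewrite ler_wpM2l // lerDl.
 have {}hy : `|T y| <= C1 * t by apply: (le_trans hy); rewrite ler_wpM2l // lerDr.
 have hxy : `|T x *m T y| <= N * C1 ^+ 2 * t ^+ 2.
  apply: mulmx_le_trans; have -> : N * C1 ^+ 2 * t ^+ 2 = N * ((C1 * t) * (C1 * t)) by ring.
  by rewrite -mulrA ler_wpM2l //; exact: ler_pM.
 have hS : `|T x + T y + T x *m T y| <= 4 * C1 + 4 * (N * C1 ^+ 2).
  apply: normD_le_trans; have := ler_normD (T x) (T y); have := ler_wpM2l C10 t2.
  have : N * C1 ^+ 2 * t ^+ 2 <= N * C1 ^+ 2 * 4 by rewrite ler_wpM2l ?mulr_ge0 ?sqr_ge0 //; lra.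
  by move: hx hy hxy; clear; lra.
 have hSz : `|(T x + T y + T x *m T y) *m T z| <= N * (4 * C1 + 4 * (N * C1 ^+ 2)) * (C1 * C2) * t ^+ 2.
  by apply: mulmx_le_trans; rewrite -[leRHS]mulrA; apply: ler_pM => //; rewrite ?mulr_ge0 // ler_wpM2l.
 apply: normD_le_trans; have := ler_normD (T x *m T y) (T z); move: hxy hz hSz; rewrite /Q; clear; lra.
have [K1 HK1] := half_small X e0; have [K2 HK2] := half_small Y e0.
exists (MX + MY + Q * (`|X| + `|Y|) ^+ 2), (maxn (maxn KX KY) (maxn K1 K2)) => k.
rewrite !geq_max => /andP[/andP[/HX hX /HY hY] /andP[/HK1 k1 /HK2 k2]].
have := key _ _ k1 k2; rewrite -scalerDr !norm_halfX -mulrDr exprMn.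
move: hX hY; set h := 2^-1 ^+ k => hX hY hT.
have h0 : 0 < h := halfX_gt0 R k; have ph : 2 ^+ k * h = 1 := exp2_halfX R k.
have -> : 2 ^+ k *: T (h *: (X + Y)) - (ad X + ad Y) = (2 ^+ k *: T (h *: X) - ad X) + (2 ^+ k *: T (h *: Y) - ad Y) +
  2 ^+ k *: (T (h *: (X + Y)) - T (h *: X) - T (h *: Y)) by mx_ring.
apply: normD_le_trans; have := ler_normD (2 ^+ k *: T (h *: X) - ad X) (2 ^+ k *: T (h *: Y) - ad Y).
rewrite [`|2 ^+ k *: (_ - _ - _)|]normrZ ger0_norm ?exprn_ge0 //.
have := ler_wpM2l (exprn_ge0 k (ler0n R 2)) hT.
have -> : 2 ^+ k * (Q * (h ^+ 2 * (`|X| + `|Y|) ^+ 2)) = (2 ^+ k * h) * (Q * (`|X| + `|Y|) ^+ 2 * h) by ring.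
rewrite ph mul1r; move: hX hY; clear; lra.
Qed.

Lemma adZ (a : R) X : ad (a *: X) = a *: ad X.
Proof.
have [d _ [C _ [H _]]] := ad_bounds.
exact: (additive_bounded_scale adD H).
Qed.

Lemma ad_self X : X *m ad X = 0.
Proof.
have [M [K H]] := adP X.
apply/eqP; rewrite -normr_le0.
apply: (le_of_halfX (M := n%:R * `|X| * M)); exists K => k kK.
have e : X *m T (2^-1 ^+ k *: X) = 0.
 rewrite /T mulmxBr mulmx1; apply/eqP; rewrite subr_eq0; apply/eqP.
 apply: (Exp_line_inj (c := c)) => t; rewrite scalemxAl AdE.
 have h : commute (Exp (t *: X)) (Exp (2^-1 ^+ k *: X)).
  by rewrite /commute -!(ExpD hG) addrC.
 by rewrite conjgE h mulKg.
have := H k kK; set L := ad X; set u := _ *: T _ => h.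
have -> : X *m L = X *m (L - u) by rewrite mulmxBr -scalemxAr e scaler0 subr0.
rewrite add0r; apply: mulmx_le_trans; rewrite -[leRHS]mulrA distrC.
by apply: ler_wpM2l=> //; rewrite mulr_ge0.
Qed.

Lemma ad_conj g X : ad (X *m Ad g) = Ad g^-1%g *m ad X *m Ad g.
Proof.
apply: (ad_limit_unique (adP _)); have [M [K H]] := adP X.
exists (n%:R * (n%:R * `|Ad g^-1%g|) * `|Ad g| * M), K => k kK.
have -> : T (2^-1 ^+ k *: (X *m Ad g)) = Ad g^-1%g *m T (2^-1 ^+ k *: X) *m Ad g.
 rewrite /T scalemxAl AdE mulmxBr mulmx1 mulmxBl AdVl; congr (_ - _).
 by rewrite conjgE !AdM mulmxA.
have -> : 2 ^+ k *: (Ad g^-1%g *m T (2^-1 ^+ k *: X) *m Ad g) - Ad g^-1%g *m ad X *m Ad g =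
  Ad g^-1%g *m (2 ^+ k *: T (2^-1 ^+ k *: X) - ad X) *m Ad g.
 by move: (T _) => Q; rewrite mulmxBr mulmxBl -scalemxAr -scalemxAl.
apply: mulmx_le_trans.
have h1 := norm_mulmx_le (Ad g^-1%g) (2 ^+ k *: T (2^-1 ^+ k *: X) - ad X).
have h2 := H k kK.
have h3 : `|Ad g^-1%g *m (2 ^+ k *: T (2^-1 ^+ k *: X) - ad X)| <= n%:R * `|Ad g^-1%g| * (M * 2^-1 ^+ k).
 by apply: (le_trans h1); apply: ler_wpM2l=> //; rewrite mulr_ge0.
have := ler_wpM2l (ler0n R n) h3 => h4.
have := ler_wpM2r (normr_ge0 (Ad g)) h4.
by move/le_trans; apply; apply: le_of_eq; ring.
Qed.

(** The equivariance [ad_conj] at g = Exp y reads Ad g ad (X Ad g) = ad X Ad g. Expanding Ad g = 1 +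
    W with W close to ad y, the terms linear in y are the Jacobi identity; for y = 2^-k Y the others
    are O(4^-k), and one division by 2^-k is affordable. *)
Lemma ad_jacobi X Y : ad (X *m ad Y) = ad X *m ad Y - ad Y *m ad X.
Proof.
have [d d0 [C C0 [HB H]]] := ad_bounds; have [d1 d10 [C1 C10 H1]] := Ad_near1.
have [K HK] := @half_small R n (Num.min d d1) Y ltac:(by rewrite lt_min d0).
apply/eqP; rewrite -subr_eq0 -normr_le0.
pose N : R := n%:R; have N0 : 0 <= N := ler0n R n; pose A := `|ad X|; have A0 : 0 <= A := normr_ge0 _.
pose Q : R := C * `|Y| ^+ 2; pose P : R := C1 * `|Y|.
pose D : R := 2 * (N * A * Q) + N * P * (C * (N * `|X| * P)) + C * (N * `|X| * Q).
apply: (le_of_halfX (M := D)); exists K => k kK; rewrite add0r.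
have h0 := halfX_gt0 R k; have yE := norm_halfX Y k; have := HK k kK; rewrite le_min.
move: h0 yE; set h := 2^-1 ^+ k => h0; set y := h *: Y => yE /andP[yd yd1].
have hE : `|T y - ad y| <= C * `|y| ^+ 2 := H y yd; have hW : `|T y| <= C1 * `|y| := H1 y yd1.
have := congr1 (mulmx (Ad (Exp y))) (ad_conj (Exp y) X); rewrite !mulmxA AdV mul1mx.
have -> : Ad (Exp y) = 1%:M + T y by rewrite addrC subrK.
rewrite yE in hE hW; move: (T y) hE hW => W.
rewrite mulmxDr mulmx1 adD !(mulmxDl, mulmxDr, mul1mx, mulmx1); set E := W - ad y => hE hW eX.
have {}hE : `|E| <= h * (h * Q) by apply: (le_trans hE); rewrite le_of_eq // /Q; ring.
have {}hW : `|W| <= h * P by apply: (le_trans hW); rewrite le_of_eq // /P; ring.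
have e1 : ad (X *m ad y) - (ad X *m ad y - ad y *m ad X) = ad X *m E - E *m ad X - W *m ad (X *m W) - ad (X *m E).
 have -> : ad (X *m E) = ad (X *m W) - ad (X *m ad y) by rewrite mulmxBr -scaleN1r adD adZ scaleN1r.
 rewrite mulmxBr mulmxBl; move: eX; move: (W *m ad (X *m W)) (ad X *m W) (W *m ad X) => p1 p2 p3 /eqP.
 rewrite -addrA (inj_eq (addrI _)) => /eqP <-.
 by move: (ad (X *m W)) (ad (X *m ad y)) (ad X *m ad y) (ad y *m ad X) => *; mx_ring.
rewrite -(ler_pM2l h0) -{1}(gtr0_norm h0) -normrZ.
have -> : h *: (ad (X *m ad Y) - (ad X *m ad Y - ad Y *m ad X)) = ad (X *m ad y) - (ad X *m ad y - ad y *m ad X).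
 by rewrite /y adZ -!scalemxAr -scalemxAl adZ !scalerBr.
have b1 : `|ad X *m E| <= N * A * (h * (h * Q)) by apply: mulmx_le_trans; rewrite ler_wpM2l ?mulr_ge0.
have b2 : `|E *m ad X| <= N * A * (h * (h * Q)) by apply: mulmx_le_trans; rewrite mulrAC ler_wpM2l ?mulr_ge0.
have bX M e : `|M| <= e -> `|ad (X *m M)| <= C * (N * `|X| * e).
 by move=> Me; apply: (le_trans (HB _)); rewrite ler_wpM2l //; apply: mulmx_le_trans; rewrite ler_wpM2l ?mulr_ge0.
have b3 : `|W *m ad (X *m W)| <= N * (h * P) * (C * (N * `|X| * (h * P))).
 by apply: mulmx_le_trans; apply: ler_pM; rewrite ?mulr_ge0 ?ler_wpM2l ?bX.
have b4 := bX _ _ hE; rewrite e1.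
have n1 := ler_normB (ad X *m E - E *m ad X - W *m ad (X *m W)) (ad (X *m E)).
have n2 := ler_normB (ad X *m E - E *m ad X) (W *m ad (X *m W)); have n3 := ler_normB (ad X *m E) (E *m ad X).
by move: b1 b2 b3 b4 n1 n2 n3; rewrite /D; clear; lra.
Qed.
End Adjoint.

Local Notation e_ i := (delta_mx 0 i).

(** * From a smooth atlas to a local group law *)

Section CoordinateEstimates.
Variable R : realType.

(** The coordinates of x' are replaced by those of x one at a time. The intermediate points stay in
    the ball because the norm is the sup norm. *)
Lemma lip_of_coord N (H : 'rV[R]_N -> R) (c : 'rV[R]_N) (r K : R) : 0 <= K ->
 (forall z i (s : R), `|z - c| <= r -> `|z + s *: e_ i - c| <= r ->
   `|H (z + s *: e_ i) - H z| <= K * `|s|) ->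
 forall x x', `|x - c| <= r -> `|x' - c| <= r -> `|H x - H x'| <= N%:R * K * `|x - x'|.
Proof.
move=> K0 HH x x' xr xr'.
have r0 : 0 <= r by apply: le_trans xr.
pose z (k : nat) : 'rV[R]_N := \row_j (if (j < k)%N then x 0 j else x' 0 j).
have zr k : `|z k - c| <= r.
 apply: norm_rV_le=> // j; rewrite !mxE; case: ifP => _.
  by apply: le_trans xr; have := norm_coord_le (x - c) j; rewrite !mxE.
 by apply: le_trans xr'; have := norm_coord_le (x' - c) j; rewrite !mxE.
have zS k (kN : (k < N)%N) : z k.+1 = z k + (x - x') 0 (Ordinal kN) *: delta_mx 0 (Ordinal kN).
 apply/rowP => j; rewrite !mxE eqxx /= ltnS leq_eqVlt -val_eqE /=.
 have [jk|jk] := eqVneq (j : nat) k; last by rewrite mulr0 addr0.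
 have -> : j = Ordinal kN by apply: val_inj.
 by rewrite /= ltnn mulr1 addrCA subrr addr0.
have main k : (k <= N)%N -> `|H (z k) - H (z 0%N)| <= k%:R * K * `|x - x'|.
 elim: k => [|k IH] kN; first by rewrite subrr normr0 !mul0r.
 have -> : H (z k.+1) - H (z 0%N) = (H (z k.+1) - H (z k)) + (H (z k) - H (z 0%N)) by ring.
 apply: normD_le_trans.
 have h1 : `|H (z k.+1) - H (z k)| <= K * `|x - x'|.
  rewrite zS; apply: (@le_trans _ _ (K * `|(x - x') 0 (Ordinal kN)|)).
   by apply: HH=> //; rewrite -zS.
  by apply: ler_wpM2l=> //; exact: norm_coord_le.
 have := IH (ltnW kN); rewrite -natr1; lra.
have zN : z N = x by apply/rowP => j; rewrite mxE ltn_ord.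
have z0 : z 0%N = x' by apply/rowP => j; rewrite mxE ltn0.
by have := main N (leqnn N); rewrite zN z0.
Qed.

Lemma coord_is_derive m n (f : 'rV[R]_m -> 'rV[R]_n) (z v : 'rV[R]_m) (s : R) l :
 derivable f (z + s *: v) v ->
 is_derive s (1 : R) (fun t : R => f (z + t *: v) 0 l) ('D_v f (z + s *: v) 0 l).
Proof.
move=> df.
have h : (fun h : R => h^-1 *: ((fun t : R => f (z + t *: v) 0 l) (h *: 1 + s) - f (z + s *: v) 0 l)) @ 0^'
  --> 'D_v f (z + s *: v) 0 l.
 have df' : (fun h : R => h^-1 *: (f (h *: v + (z + s *: v)) - f (z + s *: v))) @ 0^' --> 'D_v f (z + s *: v).
  exact: df.
 have := cvg_at (f := fun w : 'rV[R]_n => w 0 l) df' (@coord_continuous _ _ _ _ _ _).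
 apply: cvg_trans; apply: near_eq_cvg; near=> t.
 rewrite !mxE; congr (_ * (f _ _ _ - _)).
 have -> : t%:A = t :> R by rewrite /GRing.scale /= mulr1.
 by rewrite scalerDl addrCA.
by apply: DeriveDef; [apply/cvg_ex; eexists; exact: h|apply/cvg_lim=> //; exact: h].
Unshelve. all: by end_near.
Qed.

Lemma partial_bound_lip m n (f : 'rV[R]_m -> 'rV[R]_n) (c : 'rV[R]_m) (r B : R) l : 0 <= B ->
 (forall z i, `|z - c| <= r -> derivable f z (e_ i)) ->
 (forall z i, `|z - c| <= r -> `|'D_(e_ i) f z 0 l| <= B) ->
 forall x x', `|x - c| <= r -> `|x' - c| <= r -> `|f x 0 l - f x' 0 l| <= m%:R * B * `|x - x'|.
Proof.
move=> B0 df hB; apply: (lip_of_coord (H := fun x => f x 0 l))=> // z i s zr zsr.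
have seg t : t \in `[Num.min 0 s, Num.max 0 s] -> `|z + t *: e_ i - c| <= r.
 rewrite in_itv /= => /andP[t1 t2].
 have r0 : 0 <= r by apply: le_trans zr.
 apply: norm_rV_le=> // j; rewrite !mxE eqxx /=.
 have h1 := norm_coord_le (z - c) j; have h2 := norm_coord_le (z + s *: e_ i - c) j.
 move: h1 h2; rewrite !mxE eqxx /=; set b : R := (_ == _)%:R => h1 h2.
 have := le_trans h1 zr; have := le_trans h2 zsr; rewrite !ler_norml => /andP[a1 a2] /andP[a3 a4].
 have b01 : b = 0 \/ b = 1 by rewrite /b; case: (_ == _); [right|left].
 case: b01 a1 a2 a3 a4 => ->; rewrite ?mulr0 ?mulr1 => a1 a2 a3 a4; apply/andP; split; move: t1 t2;
  rewrite ?ge_min ?le_max => /orP[t1|t1] /orP[t2|t2]; lra.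
have der t : t \in `[Num.min 0 s, Num.max 0 s] -> is_derive t (1 : R) (fun t : R => f (z + t *: e_ i) 0 l)
  ('D_(e_ i) f (z + t *: e_ i) 0 l).
 by move=> ht; apply: coord_is_derive; apply: df; exact: seg.
have mm : Num.min 0 s <= Num.max 0 s by rewrite ge_min !le_max lexx.
pose g (t : R) := f (z + t *: e_ i) 0 l.
pose dg (t : R) := 'D_(e_ i) f (z + t *: e_ i) 0 l.
have H1 (t : R) : t \in `]Num.min 0 s, Num.max 0 s[ -> is_derive t (1 : R) g (dg t).
 by move=> ht; apply: der; apply: subset_itv_oo_cc.
have H2 : {within `[Num.min 0 s, Num.max 0 s], continuous g}.
 by apply: derivable_within_continuous => t ht; case: (der t ht).
have [t ht e] := MVT_segment mm H1 H2.
have hb := hB _ i (seg t ht).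
have : `|f (z + Num.max 0 s *: e_ i) 0 l - f (z + Num.min 0 s *: e_ i) 0 l| <= B * `|s|.
 rewrite -/(g _) -/(g _) e normrM; apply: ler_pM=> //.
 by case: (leP 0 s) => s0; rewrite ?subr0 ?sub0r ?normrN.
by case: (leP 0 s) => s0; rewrite scale0r addr0 // distrC.
Qed.
End CoordinateEstimates.

Section LieChartOfAtlas.
Variables (R : realType) (n : nat).
Notation V := 'rV[R]_n.

Lemma row_mx_norm_le (x y : V) (r : R) : `|x| <= r -> `|y| <= r -> `|row_mx x y : 'rV[R]_(n + n)| <= r.
Proof.
move=> xr yr; have r0 : 0 <= r by apply: le_trans xr.
apply: norm_rV_le=> // i; rewrite mxE; case: (fintype.split i) => j.
 by apply: le_trans xr; exact: norm_coord_le.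
by apply: le_trans yr; exact: norm_coord_le.
Qed.

Lemma lipschitz1_continuous (m k : nat) (h : 'rV[R]_m -> 'rV[R]_k) :
 (forall x y, `|h x - h y| <= `|x - y|) -> forall x : 'rV[R]_m, h y @[y --> x] --> h x.
Proof.
move=> H x; apply/(@cvgrPdist_lt _ _ _ (nbhs x) _ h (h x)) => d d0; apply/nbhs_ballP; exists d=> // z.
by rewrite -ball_normE /= => hz; apply: le_lt_trans hz; exact: H.
Qed.

Lemma lsubmx_dist (m k : nat) (x y : 'rV[R]_(m + k)) : `|lsubmx x - lsubmx y| <= `|x - y|.
Proof.
apply: norm_rV_le=> // i; have := norm_coord_le (x - y) (lshift k i).
by rewrite !mxE.
Qed.

Lemma rsubmx_dist (m k : nat) (x y : 'rV[R]_(m + k)) : `|rsubmx x - rsubmx y| <= `|x - y|.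
Proof.
apply: norm_rV_le=> // i; have := norm_coord_le (x - y) (rshift m i).
by rewrite !mxE.
Qed.

(** The second difference is the increment from z' to z of y |-> F (y + w) - F y. Its partial
    derivatives are increments of those of F along w, hence O(|w|) by a bound on the second partial
    derivatives near z0. *)
Lemma smooth_second_difference N (F : 'rV[R]_N -> V) (W : set 'rV[R]_N) (z0 : 'rV[R]_N) :
 smooth_on W F -> nbhs z0 W -> exists2 r : R, 0 < r & exists2 C : R, 0 <= C &
 (forall z, `|z - z0| <= r -> W z) /\
 forall z z' w, `|z - z0| <= r -> `|z' - z0| <= r -> `|w| <= r ->
  `|F (z + w) - F z - (F (z' + w) - F z')| <= C * `|w| * `|z - z'|.
Proof.
move=> sF Wz; have [_ HF] := sF 2%N.
have W0 : z0 \in W by rewrite inE; exact: nbhs_singleton Wz.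
have dF i z : W z -> derivable F z (e_ i).
 by move=> Wz'; have [h _] := HF i; apply: h; rewrite inE.
have dDF i j z : W z -> derivable ('D_(e_ i) F) z (e_ j).
 by move=> Wz'; have [_ [_ h]] := HF i; have [h1 _] := h j; apply: h1; rewrite inE.
have cD i j : {for z0, continuous ('D_(e_ j) ('D_(e_ i) F))}.
 by have [_ [_ h]] := HF i; have [_ [h1 _]] := h j; exact: h1.
pose D (ij : 'I_N * 'I_N) z : V := 'D_(delta_mx 0%R ij.2) ('D_(delta_mx 0%R ij.1) F) z.
pose B := 1 + \sum_ij `|D ij z0|.
have B0 : 0 <= B by rewrite addr_ge0 // sumr_ge0.
have nB : \forall z \near z0, forall ij, `|D ij z| <= B.
 apply: (@filter_forall _ _ (fun ij z => `|D ij z| <= B) (nbhs z0)) => ij.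
 have h : D ij z @[z --> z0] --> D ij z0 by exact: cD.
 have /cvgrPdist_lt /(_ 1 ltr01) h1 := h; near=> z.
 have : `|D ij z0 - D ij z| < 1 by near: z.
 have := ler_normB (D ij z0) (D ij z0 - D ij z); rewrite opprB addrC subrK.
 have : `|D ij z0| <= \sum_ij `|D ij z0| by rewrite (bigD1 ij) //= lerDl sumr_ge0.
 move=> h2 h3 h4; apply: (le_trans h3); rewrite /B [1 + _]addrC; apply: lerD=> //; exact: ltW.
have /nbhs_ballP[e e0 He] : nbhs z0 [set z | W z /\ forall ij, `|D ij z| <= B] by exact: filterI Wz nB.
pose r := e / 4.
have e0' : 0 < e := e0.
have inb z : `|z - z0| <= 2 * r -> W z /\ forall ij, `|D ij z| <= B.
 move=> hz; apply: He; rewrite -ball_normE /= distrC /r in hz *; lra.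
exists r; first by rewrite /r; lra.
exists (N%:R * (N%:R * B)); first by rewrite !mulr_ge0.
split=> [z hz|z z' w zr zr' wr]; first by apply: (inb z _).1; rewrite /r in hz *; lra.
have r0 : 0 <= r by apply: le_trans wr.
have lipD i l x x' : `|x - z0| <= 2 * r -> `|x' - z0| <= 2 * r ->
  `|'D_(e_ i) F x 0 l - 'D_(e_ i) F x' 0 l| <= N%:R * B * `|x - x'|.
 move=> hx hx'; apply: (@partial_bound_lip R N n ('D_(e_ i) F) z0 (2 * r) B l B0 _ _ x x' hx hx') => y j hy.
  exact: dDF (inb y hy).1.
 by apply: le_trans (norm_coord_le _ _) _; exact: (inb y hy).2 (i, j).
have wsh x : `|x - z0| <= r -> `|x + w - z0| <= 2 * r.
 by move=> hx; rewrite addrAC; apply: normD_le_trans; lra.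
have shift i x : `|x - z0| <= r -> derivable (fun y => F (y + w)) x (e_ i) /\
  'D_(e_ i) (fun y => F (y + w)) x = 'D_(e_ i) F (x + w).
 move=> hx; have e1 : (fun h : R => h^-1 *: ((fun y => F (y + w)) (h *: e_ i + x) - (fun y => F (y + w)) x)) =
   (fun h : R => h^-1 *: (F (h *: e_ i + (x + w)) - F (x + w))).
  by apply/funext => h /=; rewrite addrA.
 have := dF i (x + w) (inb _ (wsh x hx)).1.
 by rewrite /derivable /derive /= e1.
apply: norm_rV_le => [|l]; first by rewrite !mulr_ge0.
rewrite !mxE.
have := @partial_bound_lip R N n (fun y => F (y + w) - F y) z0 r (N%:R * B * `|w|) l.
move=> /(_ _ _ _ z z' zr zr'); rewrite !mxE => h.
have -> : N%:R * (N%:R * B) * `|w| * `|z - z'| = N%:R * (N%:R * B * `|w|) * `|z - z'| by rewrite !mulrA.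
apply: h; first by rewrite !mulr_ge0.
- move=> y i hy; apply: derivableB; first exact: (shift i y hy).1.
 by apply: dF; apply: (inb y _).1; lra.
move=> y i hy; rewrite deriveB; last 2 first.
- exact: (shift i y hy).1.
- by apply: dF; apply: (inb y _).1; lra.
rewrite (shift i y hy).2 !mxE.
have -> : `|w| = `|y + w - y| by rewrite addrAC subrr add0r.
by apply: lipD; [exact: wsh|lra].
Unshelve. all: by end_near.
Qed.

Lemma lie_chart_of_atlas (G : topGroupType) (A : set (chart R n G)) :
 is_lie_group A -> inhabited (lie_chart R n G).
Proof.
move=> [_ _ [Ach Acov Atr] [mc msm] _].
have [c Ac c1] : exists2 c, A c & chart_dom c 1%g.
 have : [set: G] 1%g by [].
 by rewrite -Acov => -[c Ac h]; exists c.
have [oU oV cK cphi cpsi] := Ach c Ac.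
pose f0 := chart_fun c; pose g0 := chart_inv c; pose e := f0 1%g.
have Vg x : chart_cod c x -> chart_dom c (g0 x) /\ f0 (g0 x) = x.
 by move=> [g gU <-]; rewrite /g0 /f0 cK ?inE.
have Ve : chart_cod c e by exists 1%g.
have ge : g0 e = 1%g by rewrite /g0 /e /f0 cK ?inE.
pose F (z : 'rV[R]_(n + n)) : V := f0 (g0 (lsubmx z) * g0 (rsubmx z))%g.
pose W := chart_cod (prod_chart c c) `&`
  (((fun x : G * G => (x.1 * x.2)%g) \o chart_inv (prod_chart c c)) @^-1` chart_dom c).
have sF : smooth_on W F.
 by apply: msm=> //; exists c, c.
have codE z : chart_cod (prod_chart c c) z <-> chart_cod c (lsubmx z) /\ chart_cod c (rsubmx z).
 split=> [[[g h] [/= gU hU] <-]|[[g gU eg] [h hU eh]]].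
  by rewrite row_mxKl row_mxKr; split; [exists g|exists h].
 by exists (g, h)=> //=; rewrite /prod_chart /= eg eh hsubmxK.
have nW : nbhs (row_mx e e) W.
 have cl := @lipschitz1_continuous (n + n) n (@lsubmx R 1 n n) (@lsubmx_dist n n) (row_mx e e).
 rewrite row_mxKl in cl.
 have cr := @lipschitz1_continuous (n + n) n (@rsubmx R 1 n n) (@rsubmx_dist n n) (row_mx e e).
 rewrite row_mxKr in cr.
 have Vnb : nbhs e (chart_cod c) by exact: open_nbhs_nbhs.
 have cg : g0 @ e --> g0 e by apply: cpsi; rewrite inE.
 apply: filterI.
  have h1 : nbhs (row_mx e e) [set z | chart_cod c (lsubmx z)] by exact: cl.
  have h2 : nbhs (row_mx e e) [set z | chart_cod c (rsubmx z)] by exact: cr.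
  by apply: filterS (filterI h1 h2) => z /= [h3 h4]; apply/codE.
 have cm : (fun z => g0 (lsubmx z) * g0 (rsubmx z))%g @ (row_mx e e : 'rV[R]_(n + n)) --> (1 : G)%g.
  have -> : (1 : G)%g = (g0 e * g0 e)%g by rewrite ge mulg1.
  have cgl : g0 (lsubmx z) @[z --> row_mx e e] --> g0 e by exact: (cvg_comp _ _ cl cg).
  have cgr : g0 (rsubmx z) @[z --> row_mx e e] --> g0 e by exact: (cvg_comp _ _ cr cg).
  exact: cvgMg cgl cgr.
 by apply: cm; exact: open_nbhs_nbhs.
have [r r0 [C C0 [HW HF]]] := smooth_second_difference sF nW.
(* Rescaling by rho multiplies second differences by rho^2 but divides the result by rho only, so C
   becomes C rho <= 1/8. The half of r keeps all rescaled points in the domain of the estimate. *)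
pose rho := Num.min (r / 2) (8 * (C + 1))^-1.
have C1 : 0 < 8 * (C + 1) by lra.
have rho0 : 0 < rho by rewrite lt_min invr_gt0 C1 andbT; lra.
have rhor : rho <= r / 2 by rewrite ge_min lexx.
have rhoC : 8 * (C * rho) <= 1.
 have : rho <= (8 * (C + 1))^-1 by rewrite ge_min lexx orbT.
 by rewrite -[_^-1]mulr1 ler_pdivlMl //; nra.
pose S (x : V) : V := e + rho *: x.
have Sn x : `|x| <= 1 -> `|S x - e| <= rho.
 move=> x1; rewrite /S addrAC subrr add0r normrZ (gtr0_norm rho0); nra.
have Sr (x y : V) : `|x| <= 1 -> `|y| <= 1 -> `|row_mx (S x) (S y) - row_mx e e| <= r.
 move=> x1 y1; rewrite opp_row_mx add_row_mx; apply: row_mx_norm_le.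
  by have := Sn x x1; lra.
 by have := Sn y y1; lra.
have SW x y : `|x| <= 1 -> `|y| <= 1 -> [/\ chart_cod c (S x), chart_cod c (S y) & chart_dom c (g0 (S x) * g0 (S y))%g].
 move=> x1 y1; have [/codE[]] := HW _ (Sr x y x1 y1).
 by rewrite row_mxKl row_mxKr /= row_mxKl row_mxKr.
have n01 : `|0 : V| <= 1 by rewrite normr0.
pose phi (g : G) : V := rho^-1 *: (f0 g - e).
pose psi (x : V) : G := g0 (S x).
pose mu (x y : V) : V := phi (psi x * psi y)%g.
have muE x y : mu x y = rho^-1 *: (F (row_mx (S x) (S y)) - e).
 by rewrite /mu /phi /psi /F row_mxKl row_mxKr.
have S0 : S 0 = e by rewrite /S scaler0 addr0.
have psi0 : psi 0 = 1%g by rewrite /psi S0.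
have phiS x : `|x| <= 1 -> phi (psi x) = x.
 move=> x1; have [Vx _ _] := SW x 0 x1 n01.
 by rewrite /phi /psi (Vg _ Vx).2 /S addrAC subrr add0r scalerA mulVf ?scale1r // gt_eqF.
have FxE x : `|x| <= 1 -> F (row_mx (S x) e) = S x.
 by move=> x1; have [Vx _ _] := SW x 0 x1 n01; rewrite /F row_mxKl row_mxKr ge mulg1 (Vg _ Vx).2.
have FEx x : `|x| <= 1 -> F (row_mx e (S x)) = S x.
 by move=> x1; have [Vx _ _] := SW x 0 x1 n01; rewrite /F row_mxKl row_mxKr ge mul1g (Vg _ Vx).2.
have en0 : `|row_mx e e - row_mx e e : 'rV[R]_(n + n)| <= r by rewrite subrr normr0 ltW.
have SB x x' : S x - S x' = rho *: (x - x').
 by rewrite /S opprD addrACA subrr add0r -scalerBr.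
have r2 x : `|x| <= 1 -> `|rho *: x| <= r.
 by move=> x1; rewrite normrZ (gtr0_norm rho0); have := normr_ge0 x; nra.
(* Here p and q lie on one axis of the product chart, where the product with the unit is known, and
   w displaces along the other axis. Both estimates of [local_law] are instances. *)
have fin p q w (d y : V) : `|p - row_mx e e| <= r -> `|q - row_mx e e| <= r -> `|y| <= 1 -> `|w| <= rho * `|y| ->
 `|p - q| <= rho * `|d| -> F p - F q = rho *: d -> 8 * `|rho^-1 *: (F (p + w) - F (q + w)) - d| <= `|d| * `|y|.
 move=> hp hq y1 hw hpq Fpq; have wr : `|w| <= r by have := normr_ge0 y; nra.
 have -> : rho^-1 *: (F (p + w) - F (q + w)) - d = rho^-1 *: (F (p + w) - F p - (F (q + w) - F q)).
  have -> : d = rho^-1 *: (F p - F q) by rewrite Fpq scalerA mulVf ?scale1r // gt_eqF.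
  by rewrite -scalerBr; congr (_ *: _); mx_ring.
 rewrite normrZ gtr0_norm ?invr_gt0 // mulrCA ler_pdivrMl //.
 have h1 := HF p q w hp hq wr; have d0 := normr_ge0 d; have y0 := normr_ge0 y.
 have h2 : C * `|w| * `|p - q| <= C * (rho * `|y|) * (rho * `|d|).
  by apply: ler_pM=> //; [rewrite mulr_ge0|apply: ler_wpM2l].
 have h3 : 8 * (C * rho) * (rho * (`|d| * `|y|)) <= 1 * (rho * (`|d| * `|y|)).
  by apply: ler_wpM2r=> //; rewrite !mulr_ge0 // ltW.
 nra.
have rn (x y : V) : `|row_mx (rho *: x) (rho *: y) : 'rV[R]_(n + n)| <= rho * Num.max `|x| `|y|.
 by apply: row_mx_norm_le; rewrite normrZ (gtr0_norm rho0) ler_wpM2l ?(ltW rho0) // le_max lexx ?orbT.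
have law : local_law mu.
 split.
 - by rewrite muE {2}S0 FxE // S0 subrr scaler0.
 - move=> x x' y x1 x1' y1; rewrite !muE -scalerBr opprB addrA subrK.
  have SE z : row_mx (S z) (S y) = row_mx (S z) e + row_mx 0 (rho *: y) by rewrite add_row_mx addr0.
  have hS z : `|z| <= 1 -> `|row_mx (S z) e - row_mx e e| <= r by move=> z1; rewrite -{1}S0; exact: Sr.
  rewrite !SE; apply: fin; rewrite ?hS // ?FxE //.
  + by have := rn 0 y; rewrite scaler0 normr0 (max_idPr (normr_ge0 _)).
  + by have := rn (x - x') 0; rewrite opp_row_mx add_row_mx subrr SB scaler0 normr0 (max_idPl (normr_ge0 _)).
 - move=> x y y' x1 y1 y1'; rewrite !muE -scalerBr opprB addrA subrK [leRHS]mulrC.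
  have SE z : row_mx (S x) (S z) = row_mx e (S z) + row_mx (rho *: x) 0 by rewrite add_row_mx addr0.
  have hS z : `|z| <= 1 -> `|row_mx e (S z) - row_mx e e| <= r by move=> z1; rewrite -{1}S0; exact: Sr.
  rewrite !SE; apply: fin; rewrite ?hS // ?FEx //.
  + by have := rn x 0; rewrite scaler0 normr0 (max_idPl (normr_ge0 _)).
  + by have := rn 0 (y - y'); rewrite opp_row_mx add_row_mx subrr SB scaler0 normr0 (max_idPr (normr_ge0 _)).
have psiM x y : `|x| <= 1 -> `|y| <= 1 -> psi (mu x y) = (psi x * psi y)%g.
 move=> x1 y1; have [_ _ dom] := SW x y x1 y1.
 rewrite {1}/psi /S /mu /phi scalerA divff ?gt_eqF // scale1r addrC subrK.
 by rewrite /g0 /f0 cK ?inE.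
have cont x : `|x| <= 1 -> {for x, continuous psi}.
 move=> x1; have [Vx _ _] := SW x 0 x1 n01.
 apply: (cvg_at (f := g0) (u := S) (a := S x)).
  apply: lipschitz1_continuous => u v; rewrite SB normrZ (gtr0_norm rho0).
  have rho1 : rho <= 1 by apply: (@le_trans _ _ (8 * (C + 1))^-1); [rewrite ge_min lexx orbT|rewrite invf_le1 //; lra].
  by have := normr_ge0 (u - v); move: rho1; clear; nra.
 by apply: cpsi; rewrite inE.
have nb (d : R) : 0 < d -> nbhs (1%g : G) [set g | exists2 x, `|x| < d & g = psi x].
 move=> d0; have cf : f0 @ (1%g : G) --> e by apply: cphi; rewrite inE.
 have nU : nbhs (1%g : G) (chart_dom c) by exact: open_nbhs_nbhs.
 have rd : 0 < rho * d by rewrite mulr_gt0.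
 have /cvgrPdist_lt /(_ _ rd) hd := cf.
 apply: filterS (filterI nU hd) => g [gU /= hg]; exists (phi g).
  by rewrite /phi normrZ gtr0_norm ?invr_gt0 // ltr_pdivrMl // distrC.
 by rewrite /psi /S /phi scalerA divff ?gt_eqF // scale1r addrC subrK /g0 /f0 cK ?inE.
by constructor; exact: (@LieChart R n G phi psi mu law psi0 phiS psiM (fun x y _ _ => erefl) cont nb).
Qed.
End LieChartOfAtlas.

(** * Functions of a complex matrix *)

Section SpectralCalculus.
Variables (C : numClosedFieldType) (n : nat).
Implicit Types (M D T : 'M[C]_n.+1) (p q s : {poly C}).

(** Chinese remaindering, adding one root at a time through a Bezout relation. *)
Lemma poly_interpolation (r : seq C) N (f : C -> C) : uniq r ->
 exists s : {poly C}, forall a, a \in r -> (('X - a%:P) ^+ N %| s - (f a)%:P).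
Proof.
elim: r => [|b r IH] /=; first by exists 0.
move=> /andP[br ur]; have [s Hs] := IH ur.
pose Q : {poly C} := \prod_(a <- r) ('X - a%:P) ^+ N.
have cop : coprimep Q (('X - b%:P) ^+ N).
 rewrite /Q; elim: (r) br => [|a r' IHr] /=; first by rewrite big_nil coprime1p.
 rewrite inE negb_or => /andP[ab br']; rewrite big_cons coprimepMl IHr // andbT.
 by rewrite coprimep_expl // coprimep_expr // coprimep_XsubC2 // subr_eq0.
have /Bezout_eq1_coprimepP[[u v] /= e] := cop.
exists (s + Q * u * ((f b)%:P - s)) => a; rewrite inE => /orP[/eqP ->|ar].
 have -> : s + Q * u * ((f b)%:P - s) - (f b)%:P = (s - (f b)%:P) * (1 - u * Q) by ring.
 by rewrite -e addrAC subrr add0r dvdp_mull // dvdp_mull.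
rewrite addrAC dvdp_add ?Hs // dvdp_mulr // dvdp_mulr // /Q (big_rem a) //=.
exact: dvdp_mulIl.
Qed.

Lemma trig_mulE T U : is_trig_mx T -> is_trig_mx U ->
 is_trig_mx (T *m U) /\ forall i, (T *m U) i i = T i i * U i i.
Proof.
move=> /is_trig_mxP hT /is_trig_mxP hU; split.
 apply/is_trig_mxP => i j ij; rewrite mxE big1 // => k _.
 have [ik|ki] := ltnP i k; first by rewrite hT ?mul0r.
 by rewrite hU ?mulr0 // (leq_ltn_trans ki).
move=> i; rewrite mxE (bigD1 i) //= big1 ?addr0 // => k ki.
have [ik|] := ltnP i k; first by rewrite hT ?mul0r.
by rewrite leq_eqVlt => /orP[/eqP/val_inj ek|kki]; [rewrite ek eqxx in ki|rewrite hU ?mulr0].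
Qed.

Lemma horner_mx_trig T p : is_trig_mx T ->
 is_trig_mx (horner_mx T p) /\ forall i, (horner_mx T p) i i = p.[T i i].
Proof.
move=> hT; elim/poly_ind: p => [|p c [IH1 IH2]].
 by rewrite rmorph0 mx0_is_trig; split=> // i; rewrite mxE horner0.
have [h1 h2] := trig_mulE IH1 hT.
rewrite rmorphD rmorphM /= horner_mx_X horner_mx_C; split.
 apply/is_trig_mxP => i j ij; rewrite mxE (is_trig_mxP h1 _ _ ij).
 by rewrite (is_trig_mxP (scalar_mx_is_trig _ c) _ _ ij) addr0.
by move=> i; rewrite mxE h2 IH2 !mxE eqxx !hornerE.
Qed.

Lemma horner_mx_intertwine (P M T : 'M[C]_n.+1) p : P *m M = T *m P ->
 P *m horner_mx M p = horner_mx T p *m P.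
Proof.
move=> h; elim/poly_ind: p => [|p c IH]; first by rewrite !rmorph0 mulmx0 mul0mx.
rewrite !rmorphD !rmorphM /= !horner_mx_X !horner_mx_C mulmxDr mulmxDl.
rewrite -!mulmxE mulmxA IH -(mulmxA _ P M) h mulmxA; congr (_ + _).
by rewrite mul_mx_scalar mul_scalar_mx.
Qed.

Lemma triangularization M : exists (P T : 'M[C]_n.+1), [/\ P \in unitmx, is_trig_mx T & P *m M = T *m P].
Proof.
have [P uP hT] := @Schur C n.+1 M isT.
have uu : P \in unitmx by apply: unitarymx_unit.
exists P, (P *m M *m invmx P); split=> //; last by rewrite mulmxKV.
by have := hT; rewrite /similar_to /= conjumx.
Qed.

Definition gen_eigen M (a : C) N (v : 'rV[C]_n.+1) := v *m (M - a%:M) ^+ N == 0.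

Lemma horner_mx_XsubC M (a : C) N : horner_mx M (('X - a%:P) ^+ N) = (M - a%:M) ^+ N.
Proof. by rewrite rmorphXn rmorphB /= horner_mx_X horner_mx_C. Qed.
(** By Cayley-Hamilton a product of powers of X - z, over distinct z, annihilates M. Bezout
    relations between the factors split every vector into generalized eigenvectors. *)
Lemma gen_eigen_span M (Q : 'rV[C]_n.+1 -> Prop) : (forall u v, Q u -> Q v -> Q (u + v)) -> Q 0 ->
 (forall a v, gen_eigen M a n.+1 v -> Q v) -> forall v, Q v.
Proof.
move=> QD Q0 Qe v.
have [rs ers] := closed_field_poly_normal (char_poly M).
rewrite (monicP (char_poly_monic M)) scale1r in ers.
have sz : size rs = n.+1.
 by have := size_char_poly M; rewrite ers size_prod_XsubC => -[].
pose P := \prod_(z <- undup rs) (('X - z%:P) ^+ n.+1).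
have PM : horner_mx M P = 0.
 have : char_poly M %| P.
  rewrite ers /P prodrXl -sz.
  have : all (fun z => z \in undup rs) rs by apply/allP => z; rewrite mem_undup.
  elim: (rs) (undup rs) => [|z l IH] r /=; first by rewrite big_nil dvd1p.
  move=> /andP[zr lr]; rewrite big_cons exprS dvdp_mul ?IH //.
  by rewrite (big_rem z) //= dvdp_mulIl.
 by move/dvdpP => [q ->]; rewrite rmorphM /= Cayley_Hamilton mulr0.
have main (r : seq C) w : uniq r -> w *m horner_mx M (\prod_(z <- r) (('X - z%:P) ^+ n.+1)) = 0 -> Q w.
 elim: r w => [|b r IH] w; first by rewrite big_nil rmorph1 mulmx1 => _ ->.
 move=> /= /andP[br ur]; rewrite big_cons; set B := \prod_(z <- r) _; set A := _ ^+ _ => h.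
 have cop : coprimep A B.
  rewrite /B; elim: (r) br => [|a r' IHr] /=; first by rewrite big_nil coprimep1.
  rewrite inE negb_or => /andP[ab br']; rewrite big_cons coprimepMr IHr // andbT.
  by rewrite coprimep_expl // coprimep_expr // coprimep_XsubC2 // subr_eq0 eq_sym.
 have /Bezout_eq1_coprimepP[[x y] /= e] := cop.
 have -> : w = w *m horner_mx M (x * A) + w *m horner_mx M (y * B).
  by rewrite -mulmxDr -rmorphD e rmorph1 mulmx1.
 apply: QD.
  apply: IH=> //; rewrite -mulmxA mulmxE -rmorphM /=.
  have -> : x * A * B = (A * B) * x by ring.
  by rewrite rmorphM -mulmxE mulmxA h mul0mx.
 apply: (Qe b); rewrite /gen_eigen -horner_mx_XsubC -/A -mulmxA mulmxE -rmorphM /=.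
 have -> : y * B * A = (A * B) * y by ring.
 by rewrite rmorphM -mulmxE mulmxA h mul0mx.
by apply: (main (undup rs)); rewrite ?undup_uniq // -/P PM mulmx0.
Qed.

(** The numbers [d i] are the diagonal of a triangular form. D is s(M) for a polynomial s congruent
    to f(a) modulo a power of X - a at each of them; the function f is arbitrary, which permits
    complex conjugation and the real part. *)
Lemma spectral_calculus M : exists d : 'I_n.+1 -> C,
 [/\ forall a, (M - a%:M \in unitmx) = [forall i, d i != a],
   \tr (M *m M) = \sum_i d i ^+ 2
  & forall (f : C -> C) N, exists D,
    [/\ forall E : 'M[C]_n.+1, M *m E = E *m M -> D *m E = E *m D,
      forall a v, gen_eigen M a N.+1 v -> v *m D = f a *: v
     & \tr (M *m D) = \sum_i d i * f (d i)]].
Proof.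
have [P [T [uP tT h]]] := triangularization M.
have eM : M = invmx P *m T *m P by rewrite -mulmxA -h mulKmx.
have trE p : \tr (horner_mx M p) = \sum_i p.[T i i].
 have -> : horner_mx M p = invmx P *m (horner_mx T p *m P).
  by rewrite -(horner_mx_intertwine p h) mulKmx.
 rewrite mxtrace_mulC mulmxK //; apply: eq_bigr => i _.
 by rewrite (horner_mx_trig p tT).2.
exists (fun i => T i i).
have unitE a : (M - a%:M \in unitmx) = [forall i, T i i != a].
 have -> : M - a%:M = invmx P *m (T - a%:M) *m P.
  rewrite mulmxBr mulmxBl -eM; congr (_ - _).
  by rewrite mul_mx_scalar -scalemxAl mulVmx // scalemx1.
 rewrite !unitmx_mul unitmx_inv uP andbT /= unitmxE det_trig.
  rewrite unitfE prodf_seq_neq0; apply/allP/forallP => /= H i.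
   by have := H i; rewrite mem_index_enum !mxE eqxx subr_eq0 => /(_ isT).
  by move=> _; rewrite !mxE eqxx subr_eq0.
 apply/is_trig_mxP => i j ij; rewrite !mxE (is_trig_mxP tT _ _ ij) sub0r.
 by rewrite -val_eqE /= ltn_eqF // oppr0.
split=> //.
 by have := trE ('X ^+ 2); rewrite rmorphXn /= horner_mx_X expr2 -mulmxE => ->; apply: eq_bigr => i _; rewrite hornerXn.
move=> f N; pose r := undup [seq T i i | i <- enum 'I_n.+1].
have har i : T i i \in r by rewrite mem_undup; apply/mapP; exists i; rewrite ?mem_enum.
have [s Hs] := @poly_interpolation r N.+1 f (undup_uniq _).
exists (horner_mx M s); split.
- by move=> E ME; apply: comm_horner_mx.
- move=> a v; rewrite /gen_eigen => /eqP hv.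
 have [ar|ar] := boolP (a \in r).
  have /dvdpP[q e] := Hs a ar.
  have -> : horner_mx M s = horner_mx M (('X - a%:P) ^+ N.+1 * q + (f a)%:P).
   by rewrite mulrC -e subrK.
  rewrite rmorphD rmorphM /= horner_mx_XsubC horner_mx_C mulmxDr -mulmxE mulmxA hv mul0mx add0r.
  by rewrite mul_mx_scalar.
 have : M - a%:M \in unitmx.
  rewrite unitE; apply/forallP => i; apply: contra ar => /eqP <-; exact: har.
 move=> u; have : (M - a%:M) ^+ N.+1 \in unitmx by exact: unitrX.
 move=> u2; have -> : v = 0 by rewrite -[v](mulmxK u2) hv mul0mx.
 by rewrite mul0mx scaler0.
- have -> : M *m horner_mx M s = horner_mx M ('X * s) by rewrite rmorphM /= horner_mx_X.
 rewrite trE; apply: eq_bigr => i _; rewrite hornerM hornerX; congr (_ * _).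
 have /dvdpP[q e] := Hs _ (har i).
 have : (s - (f (T i i))%:P).[T i i] = 0.
  by rewrite e hornerM exprS hornerM hornerXsubC subrr mul0r mulr0.
 by rewrite !hornerE => /eqP; rewrite subr_eq0 => /eqP.
Qed.
End SpectralCalculus.

(** * Lie algebras: Killing form, derivations, Engel's theorem *)

Section LieAlgebra.
Variables (F : fieldType) (n : nat).
Notation V := 'rV[F]_n.

(* The Lie algebra structure on [V] with bracket [v, x] := v *m adm a x, given by
  the matrices of the adjoint action of the standard basis. *)
Definition adm (a : 'I_n -> 'M[F]_n) (x : V) : 'M[F]_n := \sum_i x 0 i *: a i.

Definition lie_alg (a : 'I_n -> 'M[F]_n) : Prop :=
 (forall x, x *m adm a x = 0) /\
 (forall x y, adm a (x *m adm a y) = adm a x *m adm a y - adm a y *m adm a x).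

Variable a : 'I_n -> 'M[F]_n.
Notation ad := (adm a).

Lemma admD x y : ad (x + y) = ad x + ad y.
Proof. by rewrite /adm -big_split /=; apply: eq_bigr => i _; rewrite mxE scalerDl. Qed.
Lemma admZ c x : ad (c *: x) = c *: ad x.
Proof. by rewrite /adm scaler_sumr; apply: eq_bigr => i _; rewrite mxE scalerA. Qed.
Lemma adm0 : ad 0 = 0.
Proof. by rewrite -[0](scale0r 0) admZ scale0r. Qed.
Lemma admN x : ad (- x) = - ad x.
Proof. by rewrite -scaleN1r admZ scaleN1r. Qed.
Lemma admB x y : ad (x - y) = ad x - ad y.
Proof. by rewrite admD admN. Qed.
Lemma adm_sum I (r : seq I) (P : pred I) (f : I -> V) :
 ad (\sum_(i <- r | P i) f i) = \sum_(i <- r | P i) ad (f i).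
Proof. exact: (big_morph _ admD adm0). Qed.
Lemma adm_delta i : ad (delta_mx 0 i) = a i.
Proof.
rewrite /adm (bigD1 i) //= big1 ?addr0 => [|j ji]; rewrite mxE eqxx.
 by rewrite eqxx scale1r.
by rewrite (negbTE ji) scale0r.
Qed.

Definition killing (x y : V) : F := \tr (ad x *m ad y).

Lemma killingC x y : killing x y = killing y x.
Proof. exact: mxtrace_mulC. Qed.
Lemma killingDl x y z : killing (x + y) z = killing x z + killing y z.
Proof. by rewrite /killing admD mulmxDl mxtraceD. Qed.
Lemma killingDr x y z : killing x (y + z) = killing x y + killing x z.
Proof. by rewrite !(killingC x) killingDl. Qed.
Lemma killingZl c x z : killing (c *: x) z = c * killing x z.
Proof. by rewrite /killing admZ -scalemxAl mxtraceZ. Qed.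
Lemma killingZr c x z : killing x (c *: z) = c * killing x z.
Proof. by rewrite !(killingC x) killingZl. Qed.
Lemma killing0l z : killing 0 z = 0.
Proof. by rewrite -(scale0r 0) killingZl mul0r. Qed.
Lemma killingNl x z : killing (- x) z = - killing x z.
Proof. by rewrite -scaleN1r killingZl mulN1r. Qed.

Definition killing_mx : 'M[F]_n := \matrix_(i, j) killing (delta_mx 0 i) (delta_mx 0 j).

Lemma killingE x y : killing x y = (x *m killing_mx *m y^T) 0 0.
Proof.
rewrite {1}[y]row_sum_delta -mulmxA mxE {1}[x]row_sum_delta.
transitivity (\sum_i \sum_j x 0 i * y 0 j * killing (delta_mx 0 i) (delta_mx 0 j)).
 rewrite /killing adm_sum mulmx_suml raddf_sum; apply: eq_bigr => i _ /=.
 rewrite admZ -scalemxAl mxtraceZ adm_sum mulmx_sumr raddf_sum mulr_sumr; apply: eq_bigr => j _ /=.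
 by rewrite admZ -scalemxAr mxtraceZ mulrA.
apply: eq_bigr => i _; rewrite mxE mulr_sumr; apply: eq_bigr => j _.
by rewrite !mxE -mulrA; congr (_ * _); rewrite mulrC.
Qed.

Hypothesis aP : lie_alg a.

Lemma adm_self x : x *m ad x = 0. Proof. by case: aP. Qed.

Lemma adm_anti x y : x *m ad y = - (y *m ad x).
Proof.
have := adm_self (x + y); rewrite admD mulmxDl !mulmxDr !adm_self add0r addr0.
by move=> h; apply/eqP; rewrite -addr_eq0 h.
Qed.

Lemma adm_jacobi x y : ad (x *m ad y) = ad x *m ad y - ad y *m ad x.
Proof. by case: aP. Qed.
Lemma killing_invariant x y z : killing (x *m ad y) z = - killing x (z *m ad y).
Proof.
rewrite /killing !adm_jacobi mulmxBl mulmxBr raddfB [in RHS]raddfB /= opprB.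
rewrite -[ad y *m ad x *m ad z]mulmxA [\tr (ad y *m _)]mxtrace_mulC.
by rewrite !mulmxA.
Qed.

Definition derivation (D : 'M[F]_n) := forall u, ad (u *m D) = ad u *m D - D *m ad u.

Lemma derivationB D E : derivation D -> derivation E -> derivation (D - E).
Proof.
move=> hD hE u; rewrite mulmxBr admB hD hE mulmxBl mulmxBr.
by mx_ring.
Qed.

Lemma derivation_adm x : derivation (ad x).
Proof. by move=> u; rewrite adm_jacobi. Qed.
(** Nondegeneracy gives h with tr (D ad z) = B(h, z). The difference E = D - ad h is a derivation
    with tr (E ad z) = 0 for all z. By the derivation rule B(z E, w) is up to sign tr (E ad [z, w]),
    which vanishes, so z E = 0. *)
Lemma derivation_inner D : killing_mx \in unitmx -> derivation D -> exists h, D = ad h.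
Proof.
move=> uK hD.
pose f := \row_i \tr (D *m a i).
have fE z : \tr (D *m ad z) = (f *m z^T) 0 0.
 rewrite /adm mulmx_sumr raddf_sum /= mxE; apply: eq_bigr => i _.
 by rewrite -scalemxAr mxtraceZ !mxE mulrC.
pose h := f *m invmx killing_mx.
exists h; apply/eqP; rewrite -subr_eq0; apply/eqP.
have hE := derivationB hD (derivation_adm h).
set E := D - ad h in hE *.
have Ez z : \tr (E *m ad z) = 0.
 by rewrite mulmxBl raddfB /= fE -/(killing h z) killingE /h mulmxKV // subrr.
apply/row_matrixP => i; rewrite row0 rowE.
set z := delta_mx 0 i.
have : (z *m E) *m killing_mx = 0.
 apply/rowP => j; rewrite [RHS]mxE.
 have -> : (z *m E *m killing_mx) 0 j = killing (z *m E) (delta_mx 0 j).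
  by rewrite killingE trmx_delta -colE [RHS]mxE.
 rewrite /killing hE mulmxBl raddfB /= [X in _ - X]mxtrace_mulC -mulmxA.
 have := Ez (z *m ad (delta_mx 0 j)); rewrite adm_jacobi mulmxBr raddfB /=.
 set w := ad (delta_mx 0 j).
 rewrite [\tr (ad z *m (E *m w))]mxtrace_mulC -[E *m w *m ad z]mulmxA.
 rewrite [\tr (w *m (E *m ad z))]mxtrace_mulC -[E *m ad z *m w]mulmxA.
 by move=> e; rewrite -opprB e oppr0.
by move/(congr1 (mulmx^~ (invmx killing_mx))); rewrite mulmxK // mul0mx.
Qed.

Definition ideal m (W : 'M[F]_(m, n)) := forall x, (W *m ad x <= W)%MS.

Definition orth m (W : 'M[F]_(m, n)) : 'M[F]_n := kermx (killing_mx *m W^T).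

Lemma orthP m (W : 'M[F]_(m, n)) x :
 reflect (forall w, (w <= W)%MS -> killing x w = 0) (x <= orth W)%MS.
Proof.
apply: (iffP sub_kermxP) => [h w /submxP[c ->]|H].
 by rewrite killingE trmx_mul -mulmxA [killing_mx *m _]mulmxA [x *m _]mulmxA h mul0mx mxE.
apply/rowP => i; rewrite [RHS]mxE mulmxA -(H (row i W) (row_sub i W)) killingE.
by rewrite [LHS]mxE [RHS]mxE; apply: eq_bigr => j _; rewrite !mxE.
Qed.

Lemma ideal_orth m (W : 'M[F]_(m, n)) : ideal W -> ideal (orth W).
Proof.
move=> hW x; apply/row_subP => i; rewrite row_mul; apply/orthP => w hw.
rewrite killing_invariant; have /orthP -> := row_sub i (orth W); first by rewrite oppr0.
by apply: submx_trans (hW x); apply: submxMr.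
Qed.

Lemma ideal_cap m1 m2 (W1 : 'M[F]_(m1, n)) (W2 : 'M[F]_(m2, n)) :
 ideal W1 -> ideal W2 -> ideal (W1 :&: W2)%MS.
Proof.
move=> h1 h2 x; rewrite sub_capmx; apply/andP; split.
 by apply: submx_trans (h1 x); apply: submxMr; exact: capmxSl.
by apply: submx_trans (h2 x); apply: submxMr; exact: capmxSr.
Qed.

Lemma ideal_sub m (W : 'M[F]_(m, n)) (u x : V) : ideal W -> (u <= W)%MS -> (u *m ad x <= W)%MS.
Proof. by move=> hW uW; apply: submx_trans (hW x); apply: submxMr. Qed.

Definition no_abelian_ideals := forall W : 'M[F]_n, ideal W ->
 (forall u v : V, (u <= W)%MS -> (v <= W)%MS -> u *m ad v = 0) -> W = 0.

Definition subalgebra m (P : 'M[F]_(m, n)) := forall x y : V, (x <= P)%MS -> (y <= P)%MS -> (x *m ad y <= P)%MS.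

(** The form relative to a pair U < W lets the induction hypothesis serve twice: for a subalgebra Q
    acting on P modulo Q, which enlarges Q until only one line spanned by a normalizing A is
    missing, and for that Q acting on W modulo U. *)
Lemma Engel r (P : 'M[F]_n) : (\rank P <= r)%N -> subalgebra P ->
 (forall x : V, (x <= P)%MS -> exists k, ad x ^+ k = 0) ->
 forall U W : 'M[F]_n, (U < W)%MS ->
 (forall x : V, (x <= P)%MS -> (U *m ad x <= U)%MS /\ (W *m ad x <= W)%MS) ->
 exists2 v : V, (v <= W)%MS && ~~ (v <= U)%MS & forall x : V, (x <= P)%MS -> (v *m ad x <= U)%MS.
Proof.
elim: r P => [|r IH] P rP sP nP U W UW stab.
 have P0 : P = 0 by apply/eqP; rewrite -mxrank_eq0 -leqn0.
 have := UW; rewrite ltmxE => /andP[UW1 /row_subPn[i hi]].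
 exists (row i W); first by rewrite row_sub.
 by move=> x; rewrite P0 submx0 => /eqP ->; rewrite adm0 mulmx0 sub0mx.
have [P0|P0] := eqVneq P 0.
 by apply: (IH P)=> //; rewrite P0 mxrank0.
have key k (Q : 'M[F]_n) : (\rank P - \rank Q <= k)%N -> subalgebra Q -> (Q < P)%MS ->
  exists Q' : 'M[F]_n, exists2 A : V, (A <= P)%MS &
  [/\ subalgebra Q', (Q' < P)%MS, (P <= Q' + A)%MS & forall B, (B <= Q')%MS -> (A *m ad B <= Q')%MS].
 elim: k Q => [|k IHk] Q hk sQ QP.
  by have := rank_ltmx QP; rewrite -subn_gt0 ltnNge hk.
 have QP' := ltmxW QP.
 have rQ : (\rank Q <= r)%N by have := leq_trans (rank_ltmx QP) rP.
 have [||A] := IH Q rQ sQ _ Q P QP.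
 - by move=> x xQ; apply: nP; apply: submx_trans QP'.
 - move=> x xQ; split; apply/row_subP => i; rewrite row_mul.
   by apply: sQ=> //; exact: row_sub.
  by apply: sP; [exact: row_sub|exact: submx_trans QP'].
 move=> /andP[AP AQ] HA.
 pose Q2 := (Q + A)%MS.
 have Q2P : (Q2 <= P)%MS by rewrite addsmx_sub QP' AP.
 have [PQ2|PQ2] := boolP (P <= Q2)%MS; first by exists Q, A.
 have sQ2 : subalgebra Q2.
  move=> x y /sub_addsmxP[[x1 x2] /= ->] /sub_addsmxP[[y1 y2] /= ->].
  have [c1 ->] : exists c, x2 *m A = c *: A by exists (x2 0 0); rewrite [x2]mx11_scalar mul_scalar_mx !mxE eqxx.
  have [c2 ->] : exists c, y2 *m A = c *: A by exists (y2 0 0); rewrite [y2]mx11_scalar mul_scalar_mx !mxE eqxx.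
  rewrite admD admZ mulmxDl !mulmxDr -!scalemxAl -!scalemxAr adm_self !scaler0 addr0.
  apply: submx_trans (addsmxSl Q A); rewrite !addmx_sub //.
  - by apply: sQ; exact: submxMl.
  - by rewrite scalemx_sub // adm_anti eqmx_opp HA // submxMl.
  - by rewrite scalemx_sub // HA // submxMl.
 have [||Q' [A' A'P H']] := IHk Q2 _ sQ2 _.
 - have : (\rank Q < \rank Q2)%N.
   apply: rank_ltmx; rewrite ltmxE addsmxSl /=; apply: contra AQ.
   by apply: submx_trans; exact: addsmxSr.
  by move: hk; lia.
 - by rewrite ltmxE Q2P.
 by exists Q', A'.
have [|||Q [A AP [sQ QP PQA hA]]] := key (\rank P) 0.
- by rewrite leq_subr.
- by move=> x y; rewrite !submx0 => /eqP -> _; rewrite mul0mx.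
- by rewrite lt0mx.
have rQ : (\rank Q <= r)%N by have := leq_trans (rank_ltmx QP) rP.
have QP' := ltmxW QP.
have [||v /andP[vW vU] hv] := IH Q rQ sQ _ U W UW.
- by move=> x xQ; apply: nP; apply: submx_trans QP'.
- by move=> x xQ; apply: stab; apply: submx_trans QP'.
have [k hk] := nP A AP.
have [UA WA] := stab A AP.
pose w j := v *m ad A ^+ j.
have wW j : (w j <= W)%MS.
 elim: j => [|j IHj]; first by rewrite /w expr0 mulmx1.
 by rewrite /w exprSr -mulmxE mulmxA; apply: submx_trans WA; apply: submxMr.
have wQ j B : (B <= Q)%MS -> (w j *m ad B <= U)%MS.
 elim: j B => [|j IHj] B BQ; first by rewrite /w expr0 mulmx1 hv.
 have -> : w j.+1 *m ad B = w j *m ad B *m ad A - w j *m ad (B *m ad A).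
  rewrite adm_jacobi mulmxBr !mulmxA opprB addrC subrK.
  by rewrite {1}/w exprSr -mulmxE mulmxA.
 rewrite addmx_sub //.
  by apply: submx_trans UA; apply: submxMr; exact: IHj.
 by rewrite eqmx_opp IHj // adm_anti eqmx_opp hA.
(* All v (ad A)^j are killed by Q modulo U since A normalizes Q. The last of them outside U is
   killed by A as well; it exists because ad A is nilpotent. *)
have : exists j, (w j <= U)%MS by exists k; rewrite /w hk mulmx0 sub0mx.
move=> /ex_minnP[[|j] hj jmin]; first by move: hj; rewrite /w expr0 mulmx1 (negbTE vU).
exists (w j).
 rewrite wW /=; apply/negP => /jmin; by rewrite ltnn.
move=> x xP; have /sub_addsmxP[[x1 x2] /= ->] := submx_trans xP PQA.
have -> : x2 *m A = x2 0 0 *: A by rewrite [x2 in LHS]mx11_scalar mul_scalar_mx.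
rewrite admD admZ mulmxDr -scalemxAr addmx_sub ?wQ ?submxMl //.
rewrite scalemx_sub //; move: hj; by rewrite /w exprSr -mulmxE mulmxA.
Qed.

Definition center_of (p : 'M[F]_n) : 'M[F]_n := (p :&: \bigcap_i kermx (ad (row i p)))%MS.

Lemma center_ofP (p : 'M[F]_n) (v : V) :
 reflect ((v <= p)%MS /\ forall x : V, (x <= p)%MS -> v *m ad x = 0) (v <= center_of p)%MS.
Proof.
rewrite sub_capmx; apply: (iffP andP) => [[vp /sub_bigcapmxP h]|[vp h]]; split=> //.
 move=> x /submxP[c ->]; rewrite (mulmx_sum_row c p) adm_sum mulmx_sumr big1 // => i _.
 by rewrite admZ -scalemxAr (sub_kermxP (h i isT)) scaler0.
by apply/sub_bigcapmxP => i _; apply/sub_kermxP; rewrite h // row_sub.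
Qed.

(** Engel's theorem with U = 0 gives a nonzero element of the center of p, and the center of an
    ideal is an abelian ideal. *)
Lemma nilpotent_ideal_eq0 (p : 'M[F]_n) : no_abelian_ideals -> ideal p ->
 (forall x : V, (x <= p)%MS -> exists k, ad x ^+ k = 0) -> p = 0.
Proof.
move=> nab ip np; apply/eqP; apply: contraT => p0.
have sp : subalgebra p by move=> x y xp _; apply: ideal_sub.
have [||v /andP[vp v0] hv] := Engel (leqnn _) sp np (U := 0) (W := p); first by rewrite lt0mx.
 by move=> x _; rewrite mul0mx submx_refl; split=> //; exact: ip.
have zv : (v <= center_of p)%MS.
 by apply/center_ofP; split=> // x xp; apply/eqP; rewrite -submx0; exact: hv.
have z0 : center_of p = 0.
 apply: nab => [y|u w /center_ofP[_ hu] /center_ofP[wp _]]; last exact: hu.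
 apply/row_subP => i; rewrite row_mul; set u := row i _.
 have /center_ofP[up hu] : (u <= center_of p)%MS by exact: row_sub.
 apply/center_ofP; split; first exact: ideal_sub.
 move=> x xp; have := adm_jacobi y x => h.
 have : u *m ad y *m ad x = u *m ad x *m ad y + u *m ad (y *m ad x).
  by rewrite h mulmxBr !mulmxA addrC subrK.
 rewrite (hu x xp) mul0mx add0r => ->; rewrite hu //.
 by rewrite adm_anti eqmx_opp; exact: ideal_sub.
by rewrite z0 in zv; rewrite zv in v0.
Qed.
End LieAlgebra.

Section LieBasis.
Variables (F : fieldType) (n : nat) (a : 'I_n -> 'M[F]_n).
Notation V := 'rV[F]_n.
Hypothesis F2 : (2 : F) != 0.

Lemma lie_alg_basis :
 (forall i j, (delta_mx 0 i : V) *m a j = - ((delta_mx 0 j : V) *m a i)) ->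
 (forall i j, adm a ((delta_mx 0 i : V) *m a j) = a i *m a j - a j *m a i) -> lie_alg a.
Proof.
move=> anti jac.
have bil x y : x *m adm a y = \sum_i \sum_j (x 0 i * y 0 j) *: ((delta_mx 0 i : V) *m a j).
 rewrite {1}[x]row_sum_delta mulmx_suml; apply: eq_bigr => i _.
 rewrite /adm mulmx_sumr; apply: eq_bigr => j _.
 by rewrite -scalemxAr -scalemxAl scalerA mulrC.
split=> [x|x y].
 have h : x *m adm a x = - (x *m adm a x).
  rewrite {1}bil exchange_big /= bil -sumrN; apply: eq_bigr => i _.
  rewrite -sumrN; apply: eq_bigr => j _; rewrite anti scalerN mulrC //.
 have : 2 *: (x *m adm a x) = 0 by rewrite scaler_nat mulr2n {2}h subrr.
 by move/eqP; rewrite scaler_eq0 (negbTE F2) => /eqP.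
have e1 u v : adm a u *m adm a v = \sum_i \sum_j (u 0 i * v 0 j) *: (a i *m a j).
 rewrite /adm mulmx_suml; apply: eq_bigr => i _; rewrite mulmx_sumr; apply: eq_bigr => j _.
 by rewrite -scalemxAl -scalemxAr scalerA.
rewrite bil adm_sum.
transitivity (\sum_i \sum_j (x 0 i * y 0 j) *: (a i *m a j - a j *m a i)).
 apply: eq_bigr => i _; rewrite adm_sum; apply: eq_bigr => j _.
 by rewrite admZ jac.
rewrite !e1 [X in _ = _ - X]exchange_big -sumrB; apply: eq_bigr => i _ /=.
by rewrite -sumrB; apply: eq_bigr => j _; rewrite scalerBr [y 0 j * _]mulrC.
Qed.
End LieBasis.

(** * Cartan's criterion and hyperbolic elements *)

Section CartanCriterion.
Variables (R : rcfType) (n : nat).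
Notation C := R[i].
Notation V := 'rV[R]_n.+1.
Notation VC := 'rV[C]_n.+1.
Variable a : 'I_n.+1 -> 'M[R]_n.+1.
Hypothesis aP : lie_alg a.
Hypothesis nab : no_abelian_ideals a.

Local Notation cx := (map_mx (real_complex R)).
Let aC i : 'M[C]_n.+1 := cx (a i).

Lemma cx_inj m p : injective (@map_mx _ _ (real_complex R) m p).
Proof. by apply: map_mx_inj => x y []. Qed.
Lemma adm_cx (x : V) : adm aC (cx x) = cx (adm a x).
Proof.
by rewrite /adm map_mx_sum /=; apply: eq_bigr => i _; rewrite map_mxZ mxE.
Qed.

Lemma cx_delta i : cx (delta_mx 0 i : V) = delta_mx 0 i.
Proof. by rewrite map_delta_mx. Qed.
Lemma aC_lie : lie_alg aC.
Proof.
apply: lie_alg_basis => [|i j|i j]; first by rewrite pnatr_eq0.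
 rewrite -!cx_delta -!map_mxM -map_mxN; congr (cx _).
 by have := adm_anti aP (delta_mx 0 i) (delta_mx 0 j); rewrite !adm_delta.
rewrite -cx_delta -map_mxM adm_cx /aC -!map_mxM -map_mxB; congr (cx _).
by have := adm_jacobi aP (delta_mx 0 i) (delta_mx 0 j); rewrite !adm_delta.
Qed.

Lemma killing_cx (x y : V) : killing aC (cx x) (cx y) = real_complex R (killing a x y).
Proof. by rewrite /killing !adm_cx -map_mxM trace_map_mx. Qed.
Lemma killing_mx_cx : killing_mx aC = cx (killing_mx a).
Proof. by apply/matrixP => i j; rewrite !mxE -!cx_delta killing_cx. Qed.
Lemma adm_XsubC (x u v : VC) (s t : C) :
 (v *m adm aC u) *m (adm aC x - (s + t)%:M) =
 v *m adm aC (u *m (adm aC x - s%:M)) + v *m (adm aC x - t%:M) *m adm aC u.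
Proof.
rewrite !mulmxBr mulmxBl admB mulmxBr !mul_mx_scalar admZ (adm_jacobi aC_lie) mulmxBr !mulmxA.
rewrite -!scalemxAl -!scalemxAr scalerDl.
move: (v *m adm aC u *m adm aC x) (v *m adm aC x *m adm aC u) (v *m adm aC u) => p q w.
by mx_ring.
Qed.

(** By the Leibniz rule [adm_XsubC], each application of ad x - (s + t) to the bracket consumes one
    power on one of the two arguments. *)
Lemma gen_eigen_bracket (x : VC) N1 N2 (s t : C) (u v : VC) :
 gen_eigen (adm aC x) s N1 u -> gen_eigen (adm aC x) t N2 v ->
 gen_eigen (adm aC x) (s + t) (N1 + N2) (v *m adm aC u).
Proof.
rewrite /gen_eigen; move: {2}(N1 + N2)%N (leqnn (N1 + N2)) => m.
elim: m N1 N2 u v => [|m IH] [|N1] [|N2] u v hm /eqP hu /eqP hv.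
- by rewrite -[u]mulmx1 -[1%:M](expr0 (adm aC x - s%:M)) hu adm0 mulmx0 mul0mx.
- by [].
- by [].
- by [].
- by rewrite -[u]mulmx1 -[1%:M](expr0 (adm aC x - s%:M)) hu adm0 mulmx0 mul0mx.
- by rewrite -[u]mulmx1 -[1%:M](expr0 (adm aC x - s%:M)) hu adm0 mulmx0 mul0mx.
- by rewrite -[v]mulmx1 -[1%:M](expr0 (adm aC x - t%:M)) hv !mul0mx.
rewrite addSn exprS -mulmxE mulmxA adm_XsubC mulmxDl.
have h1 : v *m adm aC (u *m (adm aC x - s%:M)) *m (adm aC x - (s + t)%:M) ^+ (N1 + N2.+1) = 0.
 apply/eqP; apply: IH; [by rewrite -ltnS -addSn | | exact/eqP].
 by rewrite -mulmxA mulmxE -exprS hu.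
have h2 : v *m (adm aC x - t%:M) *m adm aC u *m (adm aC x - (s + t)%:M) ^+ (N1 + N2.+1) = 0.
 rewrite addnS -addSn; apply/eqP; apply: IH; [by rewrite -ltnS -addnS|exact/eqP |].
 by rewrite -mulmxA mulmxE -exprS hv.
by rewrite h1 h2 addr0.
Qed.

(** Eigenvalues of ad x add up under the bracket by [gen_eigen_bracket], so scaling generalized
    eigenspaces by an additive function of the eigenvalue obeys the Leibniz rule. The exponent n.+1
    + n.+1 accommodates the bracket of two generalized eigenvectors. *)
Lemma additive_derivation (x : VC) (f : C -> C) D : (forall s t, f (s + t) = f s + f t) ->
 (forall s v, gen_eigen (adm aC x) s (n.+1 + n.+1) v -> v *m D = f s *: v) -> derivation aC D.
Proof.
move=> fD hD.
have up s v : gen_eigen (adm aC x) s n.+1 v -> gen_eigen (adm aC x) s (n.+1 + n.+1) v.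
 by rewrite /gen_eigen exprD -mulmxE mulmxA => /eqP ->; rewrite mul0mx.
apply: (gen_eigen_span (M := adm aC x)) => [u w hu hw||s u hu].
- rewrite mulmxDl !admD hu hw mulmxDl mulmxDr opprD addrACA //.
- by rewrite mul0mx adm0 mul0mx mulmx0 subr0.
have fix_row (A B : 'M[C]_n.+1) : (forall v : VC, v *m A = v *m B) -> A = B.
 by move=> h; apply/row_matrixP => i; rewrite !rowE.
apply: fix_row; apply: (gen_eigen_span (M := adm aC x)) => [v w hv hw||t v hv].
- by rewrite !mulmxDl hv hw.
- by rewrite !mul0mx.
have := hD _ _ (gen_eigen_bracket hu hv).
rewrite mulmxBr !mulmxA (hD _ _ (up _ _ hu)) admZ -scalemxAr => ->.
by rewrite (hD _ _ (up _ _ hv)) -scalemxAl fD scalerDl addrK.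
Qed.

Lemma nilpotent_of_spectrum (M : 'M[C]_n.+1) :
 (forall s, s != 0 -> M - s%:M \in unitmx) -> M ^+ n.+1 = 0.
Proof.
move=> H.
have h : forall v : VC, v *m M ^+ n.+1 = 0.
 apply: (gen_eigen_span (M := M)) => [u v hu hv||s v].
 - by rewrite mulmxDl hu hv addr0.
 - by rewrite mul0mx.
 rewrite /gen_eigen; have [->|s0] := eqVneq s 0; first by rewrite raddf0 subr0 => /eqP.
 have u : (M - s%:M) ^+ n.+1 \in unitmx by apply: unitrX; exact: H.
 by move=> /eqP hv; rewrite -[v](mulmxK u) hv !mul0mx.
by apply/row_matrixP => i; rewrite rowE h row0.
Qed.

Lemma trace_commutator_derivation (D : 'M[C]_n.+1) (u y : VC) : derivation aC D ->
 \tr (adm aC (u *m adm aC y) *m D) = killing aC u (y *m D).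
Proof.
move=> hD; rewrite (adm_jacobi aC_lie) /killing hD mulmxBl mulmxBr !raddfB /= !mulmxA.
by rewrite -[adm aC y *m _ *m _]mulmxA [\tr (adm aC y *m _)]mxtrace_mulC.
Qed.

(** Let r be the radical of the form and p = [r, g]. For x in p take the derivation D whose
    eigenvalues are conjugate to those of ad x. Then tr (ad x D) is 0, as tr (ad [u, y] D) = B(u, y
    D) with u in r, but it is also the sum of the squared moduli of the eigenvalues. So p consists
    of ad-nilpotent elements and is 0; r is then an abelian ideal. *)
Theorem killing_nondegenerate : killing_mx a \in unitmx.
Proof.
rewrite -row_free_unit -kermx_eq0.
pose r := kermx (killing_mx a).
have rP (u : V) : (u <= r)%MS -> forall y : VC, killing aC (cx u) y = 0.
 move=> ur y; have /sub_kermxP hu := ur.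
 by rewrite killingE killing_mx_cx -map_mxM hu map_mx0 mul0mx mxE.
have rE : (r == orth a 1%:M)%MS.
 rewrite /orth trmx1 mulmx1; exact/andP.
have ir : ideal a r.
 move=> x; have := ideal_orth aP (W := 1%:M) _ x.
 rewrite /orth trmx1 mulmx1; apply => y; exact: submx1.
pose p := (\sum_i << r *m a i>>)%MS.
have pE (P : V -> Prop) : (forall u v, P u -> P v -> P (u + v)) -> P 0 ->
 (forall u i, (u <= r)%MS -> P (u *m a i)) -> forall x, (x <= p)%MS -> P x.
 move=> PD P0 Pu x /sub_sumsmxP[w ->].
 apply: (big_ind P)=> // i _.
 have : (w i *m << r *m a i>> <= r *m a i)%MS by rewrite (submx_trans (submxMl _ _)) // genmxE.
 by move=> /submxP[z ->]; rewrite mulmxA; apply: Pu; exact: submxMl.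
have rp (u y : V) : (u <= r)%MS -> (u *m adm a y <= p)%MS.
 move=> ur; rewrite /adm mulmx_sumr summx_sub // => i _.
 by rewrite -scalemxAr scalemx_sub // (sumsmx_sup i) // genmxE submxMr.
have ip : ideal a p.
 move=> y; apply/row_subP => i; rewrite row_mul.
 apply: (pE (fun z => (z *m adm a y <= p)%MS)) (row_sub i p) => [u v hu hv||u j ur].
 - by rewrite mulmxDl addmx_sub.
 - by rewrite mul0mx sub0mx.
 have e := adm_jacobi aP (delta_mx 0 j) y; rewrite adm_delta in e.
 have -> : u *m a j *m adm a y = u *m adm a y *m a j + u *m adm a (delta_mx 0 j *m adm a y).
  by rewrite e mulmxBr !mulmxA addrC subrK.
 rewrite addmx_sub ?rp //; have := rp (u *m adm a y) (delta_mx 0 j) _.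
 by rewrite adm_delta; apply; exact: ideal_sub.
have p0 : p = 0.
 apply: (nilpotent_ideal_eq0 aP nab ip) => x xp; exists n.+1.
 apply: cx_inj; rewrite map_mx0 rmorphXn /=.
 have [d [dU _ /(_ (fun z => z^*) (n.+1 + n)%N) [D [Dc DE DT]]]] := spectral_calculus (adm aC (cx x)).
 have hD : derivation aC D.
  apply: (additive_derivation (x := cx x) (f := fun z => z^*)); first exact: rmorphD.
  by move=> s v; rewrite addnS => /DE.
 have : \tr (adm aC (cx x) *m D) = 0.
  apply: (pE (fun z => \tr (adm aC (cx z) *m D) = 0)) xp => [u v hu hv||u i ur].
  - by rewrite map_mxD admD mulmxDl mxtraceD hu hv addr0.
  - by rewrite map_mx0 adm0 mul0mx mxtrace0.
  rewrite map_mxM -/(aC i) -(adm_delta aC i) trace_commutator_derivation //.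
  exact: rP.
 rewrite DT => /eqP; rewrite psumr_eq0 => [/allP hd|i _]; last exact: mul_conjC_ge0.
 rewrite -adm_cx; apply: nilpotent_of_spectrum => s s0; rewrite dU; apply/forallP => i.
 by have := hd i (mem_index_enum _); rewrite mul_conjC_eq0 => /eqP ->; rewrite eq_sym.
apply/eqP; apply: nab; first exact: ir.
by move=> u v ur vr; apply/eqP; rewrite -submx0 -p0 rp.
Qed.

Definition hyperbolic (y : V) := exists h s, s != 0 /\ y *m adm a h = s *: y.

Definition cxRe (v : VC) : V := map_mx (@complex.Re R) v.
Definition cxIm (v : VC) : V := map_mx (@complex.Im R) v.

Lemma cxRe_mul (v : VC) (M : 'M[R]_n.+1) : cxRe (v *m cx M) = cxRe v *m M.
Proof.
apply/rowP => j; rewrite !mxE raddf_sum; apply: eq_bigr => k _; rewrite !mxE.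
by case: (v 0 k) => x y /=; rewrite mulr0 subr0.
Qed.

Lemma cxIm_mul (v : VC) (M : 'M[R]_n.+1) : cxIm (v *m cx M) = cxIm v *m M.
Proof.
apply/rowP => j; rewrite !mxE raddf_sum; apply: eq_bigr => k _; rewrite !mxE.
by case: (v 0 k) => x y /=; rewrite mulr0 add0r.
Qed.

Lemma cx_eq0 (v : VC) : cxRe v = 0 -> cxIm v = 0 -> v = 0.
Proof.
move=> /rowP h1 /rowP h2; apply/rowP => i; have := h1 i; have := h2 i; rewrite !mxE.
by case: (v 0 i) => x y /= -> ->.
Qed.

Lemma cxRe_scale (c : R) (v : VC) : cxRe (real_complex R c *: v) = c *: cxRe v.
Proof. by apply/rowP => i; rewrite !mxE; case: (v 0 i) => x y /=; rewrite mul0r subr0. Qed.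
Lemma cxIm_scale (c : R) (v : VC) : cxIm (real_complex R c *: v) = c *: cxIm v.
Proof. by apply/rowP => i; rewrite !mxE; case: (v 0 i) => x y /=; rewrite mul0r addr0. Qed.
Lemma Re_additive : forall s t : C, real_complex R (complex.Re (s + t)) =
 real_complex R (complex.Re s) + real_complex R (complex.Re t).
Proof. by move=> s t; rewrite raddfD rmorphD. Qed.

(** Taking real parts of the eigenvalues of ad x is a derivation of the complexification, hence
    inner, say ad h. It is fixed by complex conjugation, since the eigenvalues of the real matrix ad
    x are exchanged with their conjugates; so h may be replaced by its real part. *)
Lemma hyperbolic_part (x : V) : exists h : V, forall (s : C) (v : VC),
 v *m cx (adm a x) = s *: v -> v *m cx (adm a h) = real_complex R (complex.Re s) *: v.
Proof.
pose f (s : C) := real_complex R (complex.Re s).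
have [d [_ _ /(_ f (n.+1 + n)%N) [D [_ DE _]]]] := spectral_calculus (adm aC (cx x)).
have hD : derivation aC D.
 by apply: (additive_derivation (x := cx x) (f := f)) => [|s v]; [exact: Re_additive|rewrite addnS => /DE].
have uK : killing_mx aC \in unitmx by rewrite killing_mx_cx map_unitmx killing_nondegenerate.
have [h hE] := derivation_inner aC_lie uK hD.
pose hc := map_mx (@conjc R) h.
have cE : map_mx (@conjc R) D = D.
 have fix_row (A B : 'M[C]_n.+1) : (forall v : VC, v *m A = v *m B) -> A = B.
  by move=> H; apply/row_matrixP => i; rewrite !rowE.
 apply: fix_row; apply: (gen_eigen_span (M := adm aC (cx x))) => [v w hv hw||t v hv].
 - by rewrite !mulmxDl hv hw.
 - by rewrite !mul0mx.
 have up s w : gen_eigen (adm aC (cx x)) s n.+1 w -> gen_eigen (adm aC (cx x)) s (n.+1 + n).+1 w.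
  by rewrite -addnS /gen_eigen exprD -mulmxE mulmxA => /eqP ->; rewrite mul0mx.
 have hv' : gen_eigen (adm aC (cx x)) (conjc t) n.+1 (map_mx (@conjc R) v).
  rewrite /gen_eigen; have := hv; rewrite /gen_eigen => /eqP hv0.
  have -> : (adm aC (cx x) - (conjc t)%:M) ^+ n.+1 = map_mx (@conjc R) ((adm aC (cx x) - t%:M) ^+ n.+1).
   rewrite rmorphXn; congr (_ ^+ _); rewrite /= map_mxB map_scalar_mx adm_cx; congr (_ - _).
   by apply/matrixP => i j; rewrite !mxE; apply/eqP; rewrite eq_complex /= oppr0 !eqxx.
  by rewrite -map_mxM hv0 map_mx0.
 rewrite (DE _ _ (up _ _ hv)).
 have := DE _ _ (up _ _ hv'); move/(congr1 (map_mx (@conjc R))).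
 rewrite map_mxM map_mxZ; have -> : map_mx (@conjc R) (map_mx (@conjc R) v) = v.
  by apply/rowP => i; rewrite !mxE conjcK.
 by move=> ->; congr (_ *: _); case: (t) => u w; apply/eqP; rewrite eq_complex /= oppr0 !eqxx.
have e2 : adm aC hc = D.
 rewrite -cE hE /adm map_mx_sum /=; apply: eq_bigr => i _; rewrite map_mxZ mxE; congr (_ *: _).
 by apply/matrixP => j k; rewrite !mxE; apply/eqP; rewrite eq_complex /= oppr0 !eqxx.
exists (cxRe h) => s v hv.
have -> : cx (adm a (cxRe h)) = D.
 rewrite -adm_cx; have -> : cx (cxRe h) = (2^-1 : C) *: (h + hc).
  apply/rowP => i; rewrite !mxE; case: (h 0 i) => u w.
  by apply/eqP; rewrite eq_complex /=; apply/andP; split; apply/eqP; simpc => /=; field.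
 by rewrite admZ admD -hE e2 scalerDr -scalerDl -{2}[D]scale1r; congr (_ *: _); field.
have hs : gen_eigen (adm aC (cx x)) s (n.+1 + n).+1 v.
 rewrite /gen_eigen exprS -mulmxE mulmxA mulmxBr adm_cx hv mul_mx_scalar subrr mul0mx //.
exact: DE hs.
Qed.

Lemma spectrum_imaginary_killing (x : V) :
 (forall (s : C) (v : VC), v != 0 -> v *m cx (adm a x) = s *: v -> complex.Re s = 0) ->
 killing a x x <= 0.
Proof.
move=> H; have [d [dU dT _]] := spectral_calculus (adm aC (cx x)).
have hd i : d i ^+ 2 = - (real_complex R (complex.Im (d i) ^+ 2)).
 have : ~~ (adm aC (cx x) - (d i)%:M \in unitmx).
  by rewrite dU; apply/forallPn; exists i; rewrite negbK.
 rewrite -row_free_unit -kermx_eq0 => /rowV0Pn[v /sub_kermxP].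
 rewrite mulmxBr mul_mx_scalar => /eqP; rewrite subr_eq0 adm_cx => /eqP hv v0.
 have := H _ _ v0 hv; case: (d i) => u w /= ->.
 by apply/eqP; rewrite expr2 eq_complex /=; apply/andP; split; apply/eqP; ring.
have : real_complex R (killing a x x) = real_complex R (- \sum_i complex.Im (d i) ^+ 2).
 rewrite -killing_cx /killing dT rmorphN rmorph_sum -sumrN /=; apply: eq_bigr => i _; exact: hd.
by move=> [->]; rewrite oppr_le0 sumr_ge0 // => i _; exact: sqr_ge0.
Qed.

Lemma killing_radical_eq0 (u : V) : (forall y, killing a u y = 0) -> u = 0.
Proof.
move=> H; have : u *m killing_mx a = 0.
 by apply/rowP => j; rewrite [RHS]mxE -(H (delta_mx 0 j)) killingE trmx_delta -colE [RHS]mxE.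
by move/(congr1 (mulmx^~ (invmx (killing_mx a)))); rewrite mulmxK ?killing_nondegenerate // mul0mx.
Qed.

(** For u, v in the intersection, B([u, v], y) is up to sign B(u, [y, v]), which vanishes; thus the
    intersection is an abelian ideal. *)
Lemma ideal_cap_orth m (W : 'M[R]_(m, n.+1)) : ideal a W -> (W :&: orth a W)%MS = 0.
Proof.
move=> iW; have iO := ideal_orth aP iW.
have key : forall U : 'M[R]_n.+1, (U <= W)%MS -> (U <= orth a W)%MS -> ideal a U -> U = 0.
 move=> U UW UO iU; apply: nab=> // u v uU vU; apply: killing_radical_eq0 => y.
 rewrite killing_invariant //; have uO := submx_trans uU UO.
 have /orthP -> := uO; first by rewrite oppr0.
 rewrite adm_anti // eqmx_opp; apply: submx_trans UW.
 by apply: ideal_sub iU vU.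
by apply: key; [exact: capmxSl|exact: capmxSr|exact: ideal_cap].
Qed.

Lemma rank_orth m (W : 'M[R]_(m, n.+1)) : \rank (orth a W) = (n.+1 - \rank W)%N.
Proof.
rewrite mxrank_ker -mxrank_tr trmx_mul trmxK mxrankMfree //.
by rewrite row_free_unit unitmx_tr killing_nondegenerate.
Qed.

Lemma ideal_add_orth m (W : 'M[R]_(m, n.+1)) : ideal a W -> (1%:M <= W + orth a W)%MS.
Proof.
move=> iW; rewrite sub1mx /row_full.
have := mxrank_sum_cap W (orth a W); rewrite ideal_cap_orth // mxrank0 addn0 => ->.
by rewrite rank_orth subnKC ?rank_leq_col.
Qed.

(** If ad x had an eigenvalue with nonzero real part, real and imaginary part of an eigenvector
    would be eigenvectors of the real ad h of [hyperbolic_part], hence in N; being in the image of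
    ad x they are also in the orthogonal, so they vanish. Imaginary eigenvalues make B(x, x)
    nonpositive, and an isotropic vector of a semidefinite form is in its radical. *)
Theorem orth_hyperbolic_definite m (N : 'M[R]_(m, n.+1)) : ideal a N ->
 (forall y, hyperbolic y -> (y <= N)%MS) ->
 forall x : V, (x <= orth a N)%MS -> killing a x x <= 0 /\ (killing a x x = 0 -> x = 0).
Proof.
move=> iN hN; have iO := ideal_orth aP iN.
have imag x : (x <= orth a N)%MS -> killing a x x <= 0.
 move=> xO; apply: spectrum_imaginary_killing => s v v0 hv; apply/eqP; apply: contraT => s0.
 have [h Hh] := hyperbolic_part x; have {Hh}hh := Hh _ _ hv.
 have sn0 : s != 0 by apply: contraNneq s0 => ->.
 have vE : v = s^-1 *: v *m cx (adm a x) by rewrite -scalemxAl hv scalerA mulVf // scale1r.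
 have hyp (y : V) : y *m adm a h = complex.Re s *: y -> (exists w, y = w *m adm a x) -> y = 0.
  move=> hy [w yw]; apply/eqP; rewrite -submx0 -(ideal_cap_orth iN) sub_capmx.
  apply/andP; split; first by apply: hN; exists h, (complex.Re s).
  by rewrite yw adm_anti // eqmx_opp; exact: ideal_sub.
 move/eqP: v0; case; apply: cx_eq0; apply: hyp.
 - by rewrite -cxRe_mul hh cxRe_scale.
 - by exists (cxRe (s^-1 *: v)); rewrite -cxRe_mul -vE.
 - by rewrite -cxIm_mul hh cxIm_scale.
 - by exists (cxIm (s^-1 *: v)); rewrite -cxIm_mul -vE.
move=> x xO; split; first exact: imag.
move=> x0; have xy y : (y <= orth a N)%MS -> killing a x y = 0.
 move=> yO; have h (t : R) : t * 2 * killing a x y + t ^+ 2 * killing a y y <= 0.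
  have := imag (x + t *: y) (addmx_sub xO (scalemx_sub t yO)).
  rewrite !(killingDl, killingDr) !(killingZl, killingZr) x0 (killingC a y x).
  by rewrite expr2; lra.
 have h1 := imag y yO.
 have [k0|k0] := eqVneq (killing a y y) 0.
  by have := h 1; have := h (-1); rewrite k0; lra.
 have k1 : killing a y y < 0 by rewrite lt_neqAle k0.
 set p := killing a x y in h *; set q := killing a y y in h k1 *.
 have := h (- (p / q)); rewrite sqrrN.
 have -> : - (p / q) * 2 * p + (p / q) ^+ 2 * q = - (p ^+ 2 / q) by field.
 rewrite oppr_le0 => h2; have : p ^+ 2 <= 0.
  by have := mulr_le0_ge0 (ltW k1) h2; rewrite mulrC divfK.
 by move=> h3; apply/eqP; rewrite -sqrf_eq0 eq_le h3 sqr_ge0.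
apply: killing_radical_eq0 => y.
have /sub_addsmxP[[w1 w2] /= ->] := submx_trans (submx1 y) (ideal_add_orth iN).
rewrite killingDr (xy (w2 *m _)) ?submxMl // addr0.
by have /orthP -> := xO; rewrite ?submxMl.
Qed.
End CartanCriterion.

Local Open Scope group_scope.
Ltac free_group := rewrite /commg /conjg
 ?(invgM, invgK, mulgA, mulgK, mulgVK, mulgV, mulVg, mul1g, mulg1, invg1).

(** * Finitely colored sets and their chains *)

Section Chains.
Variable G : groupType.

Definition finitely_colored (P : set G) :=
 exists (I : finType) (c : G -> I), forall g h, c g = c h -> P (g^-1 * h).

Definition chain (P : nat -> set G) :=
 (forall n, finitely_colored (P n)) /\
 (forall n x y, P n.+1 x -> P n.+1 y -> P n (x^-1 * y)).

Definition chain_radical : set G := [set g | forall P, chain P -> forall n, P n g].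

(** Minimal almost periodicity of the abstract group, in combinatorial form. *)
Definition minap := forall g, chain_radical g.

Lemma finitely_colored1 P : finitely_colored P -> P 1.
Proof. by move=> [I [c H]]; rewrite -(mulVg 1); exact: H. Qed.
Lemma finitely_coloredS (P Q : set G) : P `<=` Q -> finitely_colored P -> finitely_colored Q.
Proof. by move=> PQ [I [c H]]; exists I, c => g h /H /PQ. Qed.
Lemma finitely_coloredI (P Q : set G) :
 finitely_colored P -> finitely_colored Q -> finitely_colored (P `&` Q).
Proof.
move=> [I [c H]] [J [d K]]; exists (I * J)%type, (fun g => (c g, d g)) => g h [h1 h2].
by split; [exact: H|exact: K].
Qed.

Lemma finitely_colored_bigI (T : eqType) (s : seq T) (P : T -> set G) :
 (forall x, x \in s -> finitely_colored (P x)) ->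
 finitely_colored [set g | forall x, x \in s -> P x g].
Proof.
elim: s => [|a s IH] H; first by exists unit, (fun=> tt).
have h1 := H a (mem_head _ _).
have h2 := IH (fun x xs => H x (mem_behead (s := a :: s) xs)).
by apply: finitely_coloredS (finitely_coloredI h1 h2) => g [p1 p2] x; rewrite inE => /orP[/eqP ->|/p2].
Qed.

Lemma finitely_colored_reps (P : set G) : finitely_colored P ->
 exists s : seq G, forall g, exists2 x, x \in s & P (x^-1 * g).
Proof.
move=> [I [c H]].
pose r (i : I) : G := if pselect (exists g, c g = i) is left e then projT1 (cid e) else 1.
exists [seq r i | i : I] => g; exists (r (c g)); first by apply: map_f; rewrite mem_enum.
rewrite /r; case: pselect => [e|[]]; last by exists g.
by apply: H; case: cid.
Qed.

(** Coloring by the first translate of P that contains the element. This passes from thickness to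
    colorings at the price of one step of a chain. *)
Lemma finitely_colored_cover (P Q : set G) (s : seq G) : (forall g, exists2 x, x \in s & P (x^-1 * g)) ->
 (forall x y, P x -> P y -> Q (x^-1 * y)) -> finitely_colored Q.
Proof.
move=> hs PQ; pose F (g : G) := find (fun x : G => `[< P (x^-1 * g) >]) s.
have lt (g : G) : (F g < size s)%N.
 by rewrite -has_find; apply/hasP; have [x xs hx] := hs g; exists x=> //; apply/asboolP.
exists 'I_(size s).+1, (fun g : G => inord (F g)) => g h e.
have /(congr1 val) := e; rewrite /= !inordK ?ltnS 1?ltnW ?lt // => e1.
have hg (y : G) : P ((nth 1 s (F y))^-1 * y).
 by have := lt y; rewrite -has_find => /(nth_find 1) /asboolP.
have := hg g; rewrite e1 => hg1.
have -> : g^-1 * h = ((nth 1 s (F h))^-1 * g)^-1 * ((nth 1 s (F h))^-1 * h) by free_group.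
exact: PQ.
Qed.

Lemma chain1 P n : chain P -> P n 1.
Proof. by move=> [h _]; exact: finitely_colored1. Qed.
Lemma chainV P n x : chain P -> P n.+1 x -> P n x^-1.
Proof. by move=> cP Px; rewrite -[x^-1]mulg1; apply: cP.2=> //; exact: chain1. Qed.
Lemma chain_sub P n x : chain P -> P n.+1 x -> P n x.
Proof. by move=> cP Px; have := cP.2 n _ _ (chain1 n.+1 cP) Px; rewrite invg1 mul1g. Qed.
Lemma chain_le P m n x : chain P -> (m <= n)%N -> P n x -> P m x.
Proof.
move=> cP /subnKC <-; elim: (n - m)%N => [|k IH]; first by rewrite addn0.
by rewrite addnS => /(chain_sub cP).
Qed.

Lemma chainM P n x y : chain P -> P n.+2 x -> P n.+2 y -> P n (x * y).
Proof.
move=> cP Px Py; rewrite -[x]invgK; apply: cP.2; first exact: chainV.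
exact: chain_sub Py.
Qed.

Lemma chain_shift P k : chain P -> chain (fun n => P (k + n)%N).
Proof. by move=> cP; split=> [n|n x y]; [exact: cP.1|rewrite addnS; exact: cP.2]. Qed.
Lemma chainI P Q : chain P -> chain Q -> chain (fun n => P n `&` Q n).
Proof.
move=> cP cQ; split=> [n|n x y [x1 x2] [y1 y2]]; first exact: finitely_coloredI (cP.1 n) (cQ.1 n).
by split; [exact: cP.2|exact: cQ.2].
Qed.

Lemma chain_conj P a : chain P -> chain (fun n => [set x | P n (x ^ a)]).
Proof.
move=> cP; split=> [n|n x y Px Py] /=; last by rewrite conjMg conjVg; exact: cP.2.
have [I [c H]] := cP.1 n; exists I, (fun g => c (g ^ a)) => g h e.
by rewrite /= conjMg conjVg; exact: H.
Qed.

(** Conjugation invariance is reached by finitely many conditions: every g is x u with x from a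
    finite list and u in a small member of the chain, and w ^ g is the conjugate of w ^ x by u. *)
Lemma chain_core P : chain P -> chain (fun n => [set x | forall g, P n (x ^ g)]).
Proof.
move=> cP; split=> [n|n x y Px Py g] /=; last first.
 by rewrite conjMg conjVg; apply: cP.2; [exact: Px|exact: Py].
have [s Hs] := finitely_colored_reps (cP.1 n.+3).
have h x : x \in s -> finitely_colored [set w | P n.+3 (w ^ x)].
 by move=> _; have := (chain_conj x cP).1 n.+3.
apply: finitely_coloredS (finitely_colored_bigI h) => w Hw g.
have [x xs hx] := Hs g; have -> : w ^ g = (x^-1 * g)^-1 * (w ^ x * (x^-1 * g)) by free_group.
apply: cP.2; first exact: (chain_le cP (leqW (leqnSn n.+1)) hx).
by apply: chainM=> //; exact: Hw.
Qed.

Lemma chain_radicalM x y : chain_radical x -> chain_radical y -> chain_radical (x * y).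
Proof. by move=> Px Py P cP n; apply: chainM=> //; [exact: Px|exact: Py]. Qed.
Lemma chain_radicalV x : chain_radical x -> chain_radical x^-1.
Proof. by move=> Px P cP n; apply: chainV=> //; exact: Px. Qed.
Lemma chain_radical1 : chain_radical 1.
Proof. by move=> P cP n; exact: chain1. Qed.
Lemma chain_radicalJ x g : chain_radical x -> chain_radical (x ^ g).
Proof. by move=> Px P cP n; exact: Px _ (chain_conj g cP) n. Qed.
Lemma color_power P a : finitely_colored P -> exists2 m, (0 < m)%N & P (a ^+ m).
Proof.
move=> [I [c H]].
have : exists i j : 'I_#|I|.+1, (i < j)%N /\ c (a ^+ i) = c (a ^+ j).
 apply: contrapT => hn.
 have inj : injective (fun i : 'I_#|I|.+1 => c (a ^+ i)).
  move=> i j e; apply/eqP; rewrite -val_eqE /=; apply: contrapT => /negP; rewrite neq_ltn => /orP[ij|ji].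
   by apply: hn; exists i, j.
  by apply: hn; exists j, i.
 have := leq_card _ inj; by rewrite card_ord ltnn.
move=> [i [j [ij /H h]]]; exists (j - i)%N; first by rewrite subn_gt0.
by move: h; rewrite -{1}(subnKC (ltnW ij)) expgnDr mulKg.
Qed.
End Chains.

Lemma chain_preimage (G G' : groupType) (f : G -> G') P : {morph f : x y / x * y} ->
 chain P -> chain (fun n => [set x | P n (f x)]).
Proof.
move=> fM cP.
have f1 : f 1 = 1 by apply: (mulgI (f 1)); rewrite -fM !mulg1.
have fV x : f x^-1 = (f x)^-1 by apply/eqP; rewrite -mulg_eq1 -fM mulVg f1.
split=> [n|n x y Px Py] /=; last by rewrite fM fV; exact: cP.2.
have [I [c H]] := cP.1 n; exists I, (c \o f) => g h /H.
by rewrite /= fM fV.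
Qed.

Lemma chain_radical_morph (G G' : groupType) (f : G -> G') x : {morph f : x y / x * y} ->
 chain_radical x -> chain_radical (f x).
Proof. by move=> fM Nx P cP n; exact: Nx _ (chain_preimage fM cP) n. Qed.

(** * Elements inside and outside the chain radical *)

Section OneParameter.
Variables (R : realType) (G : groupType).

(* phi(s) is the commutator of a^m with phi(s/(lam^m-1)); choosing m with a^m in a conjugation
  invariant neighbourhood puts that commutator near 1. *)
Lemma dilated_one_parameter_chain_radical (phi : R -> G) (a : G) (lam : R) :
 (1 < lam)%R -> {morph phi : s t / (s + t)%R >-> s * t} -> (forall s, phi s ^ a = phi (lam * s)%R) ->
 forall s, chain_radical (phi s).
Proof.
move=> lam1 phiD phia s P cP n.
have phi0 : phi 0%R = 1 by apply: (mulgI (phi 0%R)); rewrite -phiD addr0 mulg1.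
have phiN t : phi (- t)%R = (phi t)^-1 by apply/eqP; rewrite -mulg_eq1 -phiD addNr phi0.
have phiX k t : phi t ^ (a ^+ k) = phi (lam ^+ k * t)%R.
 elim: k => [|k IH]; first by rewrite expg0 conjg1 expr0 mul1r.
 by rewrite expgSr conjgM IH phia exprS mulrA.
have cC := chain_core cP.
have [m m0 am] := color_power a (cC.1 n.+2).
have pm : (lam ^+ m - 1 != 0)%R by rewrite gt_eqF // subr_gt0 exprn_egt1 // -lt0n.
pose t := (s / (lam ^+ m - 1))%R.
have -> : phi s = (phi t)^-1 * phi t ^ (a ^+ m).
 by rewrite phiX -phiN -phiD; congr phi; rewrite -{1}(divfK pm s) -/t mulrBr mulr1 addrC mulrC.
have -> : (phi t)^-1 * phi t ^ (a ^+ m) = ((a ^+ m) ^ phi t)^-1 * a ^+ m by free_group.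
have am' g : P n.+2 (a ^+ m ^ g) by exact: am.
by apply: cP.2; apply: (chain_sub cP)=> //; rewrite -[a ^+ m]conjg1.
Qed.

Lemma norm_chain (N : G -> R) (r : R) : (forall x y, N (x^-1 * y)%g <= N x + N y)%R ->
 (forall e : R, (0 < e)%R -> finitely_colored [set x | (N x < e)%R]) ->
 (0 < r)%R -> chain (fun n => [set x | (N x < r * 2^-1 ^+ n)%R]).
Proof.
move=> Nle Nc r0; split=> [n|n x y /= Nx Ny].
 by apply: Nc; rewrite mulr_gt0 // exprn_gt0 // invr_gt0.
apply: (le_lt_trans (Nle x y)); move: Nx Ny; rewrite exprS; set u := (_ ^+ n)%R; lra.
Qed.

(** The tool for the converse directions: a subadditive function with finitely colored balls cannot
    be positive on the radical. It is applied to the displacement of a vector under a compact factor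
    and to the distance of a character from the integers. *)
Lemma chain_radical_norm (N : G -> R) : (forall x y, N (x^-1 * y)%g <= N x + N y)%R ->
 (forall e : R, (0 < e)%R -> finitely_colored [set x | (N x < e)%R]) ->
 forall g, chain_radical g -> (N g <= 0)%R.
Proof.
move=> Nle Nc g Ng; rewrite leNgt; apply/negP => r0.
by have := Ng _ (norm_chain Nle Nc r0) 0%N; rewrite /= expr0 mulr1 ltxx.
Qed.
End OneParameter.
Local Close Scope group_scope.

Local Open Scope card_scope.
Local Open Scope group_scope.

(** * Definable relations and saturation *)

Section Renaming.
Variables (L : language) (G : groupType) (E : expansion L G).

Fixpoint trename (r : nat -> nat) (t : term L) : term L :=
 match t with
 | TVar k => TVar L (r k)
 | TMul a b => TMul (trename r a) (trename r b)
 | TFun f a => TFun (fun i => trename r (a i))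
 end.

Fixpoint frename (r : nat -> nat) (p : formula L) : formula L :=
 match p with
 | FEq a b => FEq (trename r a) (trename r b)
 | FRel q a => FRel (fun i => trename r (a i))
 | FFalse => FFalse L
 | FImp a b => FImp (frename r a) (frename r b)
 | FAll k a => FAll (r k) (frename r a)
 end.

Lemma teval_trename v r t : teval E v (trename r t) = teval E (v \o r) t.
Proof.
elim: t => [k|a IHa b IHb|f a IH] //=; first by rewrite IHa IHb.
by congr fun_interp; apply/funext => i; exact: IH.
Qed.

Lemma sat_ext p (v w : nat -> G) : v =1 w -> sat E v p <-> sat E w p.
Proof. by move=> /funext ->. Qed.
Lemma sat_eq p (v w : nat -> G) : sat E v p -> v =1 w -> sat E w p.
Proof. by move=> h /funext <-. Qed.
Lemma sat_frename r p v : injective r -> sat E v (frename r p) <-> sat E (v \o r) p.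
Proof.
move=> ri; elim: p v => [a b|q a| |a IHa b IHb|k a IH] v //=.
- by rewrite !teval_trename.
- have -> : (fun i => teval E v (trename r (a i))) = (fun i => teval E (v \o r) (a i)) by
  apply/funext => i; rewrite teval_trename.
 by [].
- by rewrite IHa IHb.
have e x : (fun l => if l == r k then x else v l) \o r = (fun l => if l == k then x else v (r l)).
 by apply/funext => l /=; rewrite (inj_eq ri).
by split=> H x; [rewrite -e; apply/IH|apply/IH; rewrite e].
Qed.

Definition mix (T : Type) (v u : nat -> T) l := if odd l then u l./2 else v l./2.
Definition upd (v : nat -> G) k x := fun l => if l == k then x else v l.
Definition cons_val (x : G) (w : nat -> G) k := if k is k'.+1 then w k' else x.

(* In a definable relation the variables are evaluated at the even places and the parameters at the odd ones. *)
Definition def_rel (A : set G) (X : (nat -> G) -> Prop) :=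
 exists p u, (forall k, A (u k)) /\ forall v, X v <-> sat E (mix v u) p.

Lemma def_rel_ext A X Y : (forall v, X v <-> Y v) -> def_rel A X -> def_rel A Y.
Proof. by move=> XY [p [u [Au h]]]; exists p, u; split=> // v; rewrite -XY. Qed.
Lemma def_rel_sub A B X : A `<=` B -> def_rel A X -> def_rel B X.
Proof. by move=> AB [p [u [Au h]]]; exists p, u; split=> // k; exact: AB. Qed.
Lemma mix_even T (v u : nat -> T) k : mix v u k.*2 = v k.
Proof. by rewrite /mix odd_double doubleK. Qed.
Lemma mix_odd T (v u : nat -> T) k : mix v u k.*2.+1 = u k.
Proof. by rewrite /mix /= odd_double uphalf_double. Qed.
Lemma odd_half_case (P : nat -> Prop) : (forall k, P k.*2) -> (forall k, P k.*2.+1) -> forall l, P l.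
Proof. by move=> h0 h1 l; rewrite -(odd_double_half l); case: (odd l); rewrite ?add0n ?add1n. Qed.
Lemma double_inj' : injective double.
Proof. by move=> a b /(congr1 half); rewrite !doubleK. Qed.

Definition mix_rename (r s : nat -> nat) l := if odd l then (s l./2).*2.+1 else (r l./2).*2.

Lemma mix_rename_inj r s : injective r -> injective s -> injective (mix_rename r s).
Proof.
move=> ri si; apply: odd_half_case => a; apply: odd_half_case => b; rewrite /mix_rename /= ?odd_double ?uphalf_double ?doubleK //.
- by move=> /double_inj' /ri ->.
- by move=> /(congr1 odd) /=; rewrite !odd_double.
- by move=> /(congr1 odd) /=; rewrite !odd_double.
- by move=> [] /double_inj' /si ->.
Qed.

Lemma mix_rename_comp T (v u : nat -> T) r s : mix v u \o mix_rename r s = mix (v \o r) (u \o s).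
Proof.
apply/funext; apply: odd_half_case => k; rewrite /= /mix_rename /= ?odd_double ?uphalf_double ?doubleK ?mix_even ?mix_odd //.
Qed.

Lemma def_rel_rename A X r : injective r -> def_rel A X -> def_rel A (fun v => X (v \o r)).
Proof.
move=> ri [p [u [Au h]]]; exists (frename (mix_rename r id) p), u; split=> // v.
by rewrite sat_frename ?mix_rename_comp //; apply: mix_rename_inj.
Qed.

(** The two parameter sequences are interleaved into one, so the parameter variables of each formula
    are renamed injectively while the free variables remain shared. *)
Lemma def_rel_imp A X Y : def_rel A X -> def_rel A Y -> def_rel A (fun v => X v -> Y v).
Proof.
move=> [p [u [Au hu]]] [q [w [Aw hw]]].
have i1 : injective double := double_inj'.
have i2 : injective (fun k => k.*2.+1) by move=> a b [] /i1.
exists (FImp (frename (mix_rename id double) p) (frename (mix_rename id (fun k => k.*2.+1)) q)), (mix u w).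
split=> [|v /=]; first by rewrite /mix => k; case: (odd k).
rewrite !sat_frename ?mix_rename_comp ?hu ?hw; try exact: mix_rename_inj.
have -> : mix u w \o double = u by apply/funext => k /=; rewrite mix_even.
have -> // : mix u w \o (fun k => k.*2.+1) = w by apply/funext => k /=; rewrite mix_odd.
Qed.

Lemma def_rel_false A a : A a -> def_rel A (fun=> False).
Proof. by move=> Aa; exists (FFalse L), (fun=> a). Qed.
Lemma def_rel_all A X k : def_rel A X -> def_rel A (fun v => forall x, X (upd v k x)).
Proof.
move=> [p [u [Au h]]]; exists (FAll k.*2 p), u; split=> // v /=.
have e x : mix (upd v k x) u = (fun l => if l == k.*2 then x else mix v u l).
 apply/funext; apply: odd_half_case => l; rewrite ?mix_even ?mix_odd /upd.
  by rewrite (inj_eq double_inj').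
 by case: eqP=> // /(congr1 odd) /=; rewrite !odd_double.
by split=> H x; [rewrite -e -h|rewrite h e].
Qed.

Lemma def_rel_mul A a i j k : A a -> def_rel A (fun v => v i * v j = v k).
Proof.
move=> Aa; exists (FEq (TMul (TVar L i.*2) (TVar L j.*2)) (TVar L k.*2)), (fun=> a).
by split=> // v /=; rewrite !mix_even.
Qed.

Lemma def_rel_holds A p : pformulas_over A p -> def_rel A (fun v => holds_at E (v 0%N) p).
Proof.
case: p => p u /= Au; pose r k := if k is k'.+1 then k'.*2.+1 else 0%N.
have ri : injective r by case=> [|a] [|b] //= [] /double_inj' ->.
exists (frename r p), u; split=> // v; rewrite sat_frename // /holds_at /=.
apply: sat_ext => -[|k] /=; first by rewrite -[0%N]double0 mix_even.
by rewrite mix_odd.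
Qed.

Lemma def_rel_not A a X : A a -> def_rel A X -> def_rel A (fun v => ~ X v).
Proof. by move=> Aa dX; apply: def_rel_imp=> //; exact: def_rel_false Aa. Qed.
Lemma def_rel_and A a X Y : A a -> def_rel A X -> def_rel A Y -> def_rel A (fun v => X v /\ Y v).
Proof.
move=> Aa dX dY; have := def_rel_not Aa (def_rel_imp dX (def_rel_not Aa dY)).
apply: def_rel_ext => v; split=> [h|[h1 h2] h]; last exact: h h1 h2.
by apply: contrapT => h'; apply: h => h1 h2; apply: h'.
Qed.

Lemma def_rel_ex A a X k : A a -> def_rel A X -> def_rel A (fun v => exists x, X (upd v k x)).
Proof.
move=> Aa dX; have := def_rel_not Aa (def_rel_all k (def_rel_not Aa dX)).
apply: def_rel_ext => v; split=> [h|[x h] h']; last exact: h' h.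
by apply: contrapT => h'; apply: h => x h1; apply: h'; exists x.
Qed.

Lemma def_rel_quotient A a (D : set G) : A a -> def_rel A (fun v => D (v 0%N)) ->
 def_rel A (fun v => D ((v 0%N)^-1 * v 1%N)).
Proof.
move=> Aa dD.
have d1 : def_rel A (fun v => D (v 2%N)).
 have := def_rel_rename (r := addn 2) (@addnI 2) dD.
 by apply: def_rel_ext => v /=; rewrite addn0.
have := def_rel_ex 2 Aa (def_rel_and Aa (def_rel_mul 0 2 1 Aa) d1).
apply: def_rel_ext => v; rewrite /upd /=; split=> [[x [<- h]]|h]; first by rewrite mulgA mulVg mul1g.
by exists ((v 0%N)^-1 * v 1%N); rewrite mulgA mulgV mul1g.
Qed.

Definition def_set (A X : set G) :=
 exists2 p : pformula L G, pformulas_over A p & X = [set x | holds_at E x p].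

Lemma def_set_of_rel A X w : def_rel A X -> (forall k, A (w k)) ->
 def_set A [set x | X (cons_val x w)].
Proof.
move=> [p [u [Au h]]] Aw.
(* This exchanges 2j+1 and 2j+2. Turning all free variables but the first into parameters shifts
   places by one in [holds_at], so that w moves from even to odd places and u from odd to even
   ones. *)
pose r l := if l is l'.+1 then if odd l'.+1 then l'.+2 else l' else 0%N.
have rK : involutive r.
 case=> [//|l]; rewrite /r; case: (boolP (odd l.+1)) => [|] /= ol; first by rewrite negbK (negbTE ol).
 by case: l ol => [//|l] /=; rewrite !negbK => /negPf ->.
exists (frename r p, mix w u); first by move=> k; rewrite /mix /=; case: (odd k).
have e x : (fun k => if k is k'.+1 then mix w u k' else x) \o r = mix (cons_val x w) u.
 apply/funext; apply: odd_half_case => k /=; rewrite ?mix_even ?mix_odd.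
  by case: k => [//|k]; rewrite doubleS /r /= odd_double /= mix_even.
 by rewrite /r /= odd_double /= mix_odd.
by apply/seteqP; split=> x /=; rewrite h /holds_at /= sat_frename ?e //; exact: inv_inj.
Qed.

Lemma def_rel_of_set A X : def_set A X -> def_rel A (fun v => X (v 0%N)).
Proof. by move=> [p Ap ->]; exact: def_rel_holds. Qed.
Lemma def_set_countable A X : def_set A X ->
 exists u : nat -> G, def_set (range u) X.
Proof. by move=> [p Ap ->]; exists p.2; exists p=> // k; exists k. Qed.
Lemma def_setI A X Y a : A a -> def_set A X -> def_set A Y -> def_set A (X `&` Y).
Proof.
move=> Aa dX dY.
by have := def_set_of_rel (w := fun=> a)
 (def_rel_and Aa (def_rel_of_set dX) (def_rel_of_set dY)) (fun=> Aa).
Qed.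

Lemma def_setT A a : A a -> def_set A setT.
Proof.
move=> Aa; have := def_set_of_rel (w := fun=> a) (def_rel_not Aa (def_rel_false Aa)) (fun=> Aa).
by congr (def_set _ _); apply/seteqP; split=> // x _ [].
Qed.

Lemma def_set_bigI A a (I : eqType) (s : seq I) (X : I -> set G) : A a ->
 (forall i, def_set A (X i)) -> def_set A [set x | forall i, i \in s -> X i x].
Proof.
move=> Aa dX; elim: s => [|i s IH].
 by have := def_setT Aa; congr (def_set _ _); apply/seteqP; split.
have := def_setI Aa (dX i) IH; congr (def_set _ _); apply/seteqP; split=> x /=.
 by move=> [h1 h2] k; rewrite inE => /orP[/eqP ->|/h2].
by move=> h; split=> [|k ks]; apply: h; rewrite inE ?eqxx // ks orbT.
Qed.

Lemma saturated_family kappa A (I : eqType) (X : I -> set G) : saturated E kappa ->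
 ~~ ([set: kappa] #<= A) -> (forall i, def_set A (X i)) ->
 (forall s : seq I, exists x, forall i, i \in s -> X i x) -> exists x, forall i, X i x.
Proof.
move=> sE kA dX fip.
have /choice[p hp] : forall i, exists p : pformula L G, pformulas_over A p /\ X i = [set x | holds_at E x p].
 by move=> i; have [p ? ?] := dX i; exists p.
have [| |x hx] := sE A kA (range p).
- by move=> q [i _ <-]; have [] := hp i.
- move=> Psi /(@finite_seqP {classic pformula L G})[t ->] tp.
 have [s hs] : exists s : seq I, forall q, q \in t -> exists2 i, i \in s & q = p i.
  elim: t tp => [|q t IH] tp; first by exists [::].
  have [|s hs] := IH; first by move=> r rt; apply: tp; rewrite /= inE rt orbT.
  have [i _ iq] : range p q by apply: tp; rewrite /= inE eqxx.
  exists (i :: s) => r; rewrite inE => /orP[/eqP ->|/hs[k ks ->]]; first by exists i; rewrite ?inE ?eqxx.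
  by exists k=> //; rewrite inE ks orbT.
 have [x hx] := fip s; exists x => q /= /hs[i si ->].
 by have := hx i si; have [_ ->] := hp i.
exists x => i; have [_ ->] := hp i; apply: hx; by exists i.
Qed.
End Renaming.

Lemma card_le_inj (T U : Type) (A : set T) (B : set U) (f : T -> U) :
 (forall x, A x -> B (f x)) -> (forall x y, A x -> A y -> f x = f y -> x = y) -> A #<= B.
Proof.
move=> fB fi; apply: (@card_le_trans _ _ _ (f @` A)); last by apply: subset_card_le => _ [x Ax <-]; exact: fB.
have fi' : {in A &, injective f} by move=> x y; rewrite !inE; exact: fi.
by have := inj_card_eq fi'; rewrite card_eq_sym card_eq_le => /andP[].
Qed.

Lemma card_le_setT_inj (T U : Type) (A : set T) (f : T -> U) :
 (forall x y, A x -> A y -> f x = f y -> x = y) -> A #<= [set: U].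
Proof. by move=> fi; exact: (@card_le_inj _ _ A [set: U] f). Qed.
Lemma card_leP_inj (T U : Type) (u0 : U) (A : set T) (B : set U) : A #<= B ->
 exists f : T -> U, (forall x, A x -> B (f x)) /\ (forall x y, A x -> A y -> f x = f y -> x = y).
Proof.
move=> /card_leP[f]; exists (fun x => if pselect (A x) is left Ax then val (f (SigSub (mem_set Ax))) else u0).
split=> [x Ax|x y Ax Ay].
 by case: pselect=> // Ax'; exact: set_mem (valP _).
case: pselect=> // Ax'; case: pselect=> // Ay' /val_inj /(@inj _ _ _ f) h.
by have [] := h (mem_set I) (mem_set I).
Qed.

(** Hilbert's hotel: a copy e of the natural numbers inside A is moved to its even places, and the
    odd ones receive the new elements of B. *)
Lemma card_le_setU_countable (T : Type) (A B : set T) : infinite_set A -> countable B -> A `|` B #<= A.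
Proof.
move=> iA cB; have [a0 Aa0] := infinite_setN0 iA.
have [e [eA ei]] := card_leP_inj a0 ((infiniteP A).1 iA).
have [c [_ ci]] := card_leP_inj 0%N cB.
pose d x := xget 0%N [set n | x = e n].
have hd x : (exists n, x = e n) -> x = e (d x) by move=> h; have := xgetPex 0%N h.
pose f x := if pselect (exists n, x = e n) then e (d x).*2 else if pselect (A x) then x else e (c x).*2.+1.
have fA x : (A `|` B) x -> A (f x).
 by rewrite /f; case: pselect => hd'; [move=> _; exact: eA|case: pselect=> // Ax _; exact: eA].
apply: (@card_le_inj _ _ _ _ f)=> // x y Hx Hy; rewrite /f.
case: (pselect (exists n, x = e n)) => hx; case: (pselect (exists n, y = e n)) => hy /=.
- by move=> /(ei _ _ I I) /double_inj' e1; rewrite (hd x hx) (hd y hy) e1.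
- case: pselect => Ay e1; first by case: hy; exists (d x).*2.
 by have /(congr1 odd) := ei _ _ I I e1; rewrite /= !odd_double.
- case: pselect => Ax e1; first by case: hx; exists (d y).*2.
 by have /(congr1 odd) := ei _ _ I I e1; rewrite /= !odd_double.
case: pselect => Ax; case: pselect => Ay e1 //.
- by case: hx; exists (c y).*2.+1.
- by case: hy; exists (c x).*2.+1.
by have [/double_inj' e2] := ei _ _ I I e1; apply: ci=> //; [case: Hx|case: Hy].
Qed.

Lemma card_lt_setU_countable (kappa T : Type) (A B : set T) : ~~ ([set: kappa] #<= [set: nat]) ->
 ~~ ([set: kappa] #<= A) -> countable B -> ~~ ([set: kappa] #<= A `|` B).
Proof.
move=> kn kA cB; have [fA|iA] := pselect (finite_set A).
 apply: contra kn => h; apply: card_le_trans h _;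
 have [a [_ ai]] := card_leP_inj 0%N (finite_set_countable fA).
 have [c [_ ci]] := card_leP_inj 0%N cB.
 apply: (@card_le_setT_inj _ _ _ (fun x => if pselect (A x) then (a x).*2 else (c x).*2.+1)) => x y hx hy.
 case: pselect => Ax; case: pselect => Ay.
 - by move=> /double_inj'; exact: ai.
 - by move=> /(congr1 odd) /=; rewrite !odd_double.
 - by move=> /(congr1 odd) /=; rewrite !odd_double.
 - by move=> [] /double_inj' e2; apply: ci=> //; [case: hx|case: hy].
by apply: contra kA => h; apply: card_le_trans h _; exact: card_le_setU_countable.
Qed.

(** * Minimal almost periodicity implies type-absolute connectedness *)

Section MinapTAC.
Variables (L : language) (G Gs : groupType) (E : expansion L G) (Es : expansion L Gs) (j : G -> Gs) (kappa : Type).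
Hypothesis j_elem : elementary_embedding E Es j.
Hypothesis kappa_large : ~~ ([set: kappa] #<= [set: set (nat + G + lfun L + lrel L)]).
Hypothesis Es_sat : saturated Es kappa.

Lemma elementary_morph : {morph j : x y / x * y}.
Proof.
move=> x y; pose p := FEq (TMul (TVar L 0) (TVar L 1)) (TVar L 2).
pose v n := if n is n'.+1 then if n' is 0 then y else x * y else x.
by have /= [h _] := j_elem p v; rewrite -h.
Qed.

Let kappa_range a : ~~ ([set: kappa] #<= range j `|` [set a]).
Proof.
apply: contra kappa_large => h; apply: card_le_trans h _.
pose f (x : Gs) : set (nat + G + lfun L + lrel L) := [set s | exists2 g, s = inl (inl (inr g)) & j g = x].
have fj g s : f (j g) s -> exists2 g', s = inl (inl (inr g')) & j g' = j g by [].
have fg g : f (j g) (inl (inl (inr g))) by exists g.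
pose F x := if pselect (range j x) is left _ then f x else set0.
apply: (@card_le_setT_inj _ _ _ F) => x y hx hy; rewrite /F.
case: pselect => [[g _ <-]|nx]; case: pselect => [[g' _ <-]|ny] e.
- by have := fg g; rewrite e => -[g'' [<-]].
- by have := fg g; rewrite e.
- by have := fg g'; rewrite -e.
have -> : x = a by case: hx.
by case: hy=> // ->.
Qed.

Let kappa_nat : ~~ ([set: kappa] #<= [set: nat]).
Proof.
apply: contra kappa_large => h; apply: card_le_trans h _.
apply: (@card_le_setT_inj _ _ _ (fun n : nat => [set (inl (inl (inl n)) : nat + G + lfun L + lrel L)])) => m n _ _ e.
have : [set inl (inl (inl n))] (inl (inl (inl m)) : nat + G + lfun L + lrel L) by rewrite -e.
by case.
Qed.

Let kappaA : ~~ ([set: kappa] #<= range j).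
Proof. by apply: contra (kappa_range 1) => h; apply: card_le_trans h _; apply: subset_card_le; left. Qed.
(** Finite parts D s of the type defining K behave like a chain: compactness gives s' with (D s')^-1
    (D s') inside D s, and bounded index makes every D s finitely colored. The traces on G of the
    iterates form a chain, so D s contains G; being a condition with parameters from G that holds on
    all of G, it holds on the extension. *)
Lemma bounded_type_definable_total K : minap G ->
 tdef_bounded_subgroup Es kappa (range j) K -> K = setT.
Proof.
move=> Gmin [[K1 KM KV] [Phi PhiA KE] Kb].
pose I := {p : pformula L Gs | `[< Phi p >]}.
pose T : eqType := {classic I}.
have IP (i : T) : Phi (sval (i : I)) by apply/asboolP; exact: (svalP (i : I)).
pose D (s : seq T) := [set x | forall i, i \in s -> holds_at Es x (sval (i : I))].
have Aj : range j (j 1) by exists 1.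
have dD A s : range j `<=` A -> def_set Es A (D s).
 move=> jA; apply: (@def_set_bigI _ _ Es A (j 1) T s (fun i => [set x | holds_at Es x (sval (i : I))])); first exact: jA.
 by move=> i; exists (sval (i : I))=> // k; apply: jA; apply: PhiA (IP i) k.
have Dcat s t x : D (s ++ t) x -> D s x /\ D t x.
 by move=> h; split=> i hi; apply: h; rewrite mem_cat hi ?orbT.
have Dflat (t : seq (seq T)) x s : s \in t -> D (flatten t) x -> D s x.
 by move=> st h i ix; apply: h; apply/flattenP; exists s.
have DK x : (forall s, D s x) -> K x.
 rewrite KE => h p Pp.
 have Pp' : `[< Phi p >] by apply/asboolP.
 by have := h [:: (exist _ p Pp' : T)] (exist _ p Pp' : T); rewrite inE eqxx; apply.
have KD x s : K x -> D s x by rewrite KE => h i _; apply: h; exact: IP.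
have KT (x : Gs) s : exists y, D s y by exists 1; exact: KD.
have step s : exists s', forall x y, D s' x -> D s' y -> D s (x^-1 * y).
 apply: contrapT => hn.
 have hn' s' : exists x y, [/\ D s' x, D s' y & ~ D s (x^-1 * y)].
  apply: contrapT => h; apply: hn; exists s' => x y dx dy; apply: contrapT => nd.
  by apply: h; exists x, y.
 have dq A : range j `<=` A -> def_rel Es A (fun v => ~ D s ((v 0%N)^-1 * v 1%N)).
  move=> jA; have Aa := jA _ Aj; apply: (def_rel_not Aa).
  by apply: (def_rel_quotient Aa); exact: def_rel_of_set (dD A s jA).
 have dd1 A s' : range j `<=` A -> def_rel Es A (fun v => D s' (v 1%N)).
  move=> jA; have := def_rel_rename (r := S) (fun a b => @succn_inj a b) (def_rel_of_set (dD A s' jA)).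
  by [].
 (* Saturation realizes types in one variable, so the pair is found in two stages: a is chosen such
    that suitable b exist for each finite part, and then b over the additional parameter a. *)
 have [a ha] : exists a, forall s', D s' a /\ exists y, D s' y /\ ~ D s (a^-1 * y).
  apply: (@saturated_family _ _ Es kappa (range j) (seq T) (fun s' => [set a | D s' a /\ exists y, D s' y /\ ~ D s (a^-1 * y)]))=> //.
   move=> s'.
   have d1 : def_rel Es (range j) (fun v => exists y, D s' (upd v 1%N y 1%N) /\ ~ D s ((upd v 1%N y 0%N)^-1 * upd v 1%N y 1%N)).
    apply: (def_rel_ex (X := fun v => D s' (v 1%N) /\ ~ D s ((v 0%N)^-1 * v 1%N)) _ Aj).
    by apply: (def_rel_and Aj); [exact: dd1|exact: dq].
   have := def_set_of_rel (w := fun=> j 1) (def_rel_and Aj (def_rel_of_set (dD _ s' (@subset_refl _ _))) d1) (fun=> Aj).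
   by [].
  move=> t; have [x [y [dx dy nd]]] := hn' (flatten t); exists x => s' st; split; first exact: Dflat dx.
  by exists y; split=> //; exact: Dflat dy.
 have [b hb] : exists b, forall s', D s' b /\ ~ D s (a^-1 * b).
  pose A := range j `|` [set a].
  have jA : range j `<=` A by left.
  apply: (@saturated_family _ _ Es kappa A (seq T) (fun s' => [set b | D s' b /\ ~ D s (a^-1 * b)]))=> //; first exact: kappa_range.
   move=> s'; have Aa := jA _ Aj.
   have d2 : def_rel Es A (fun v => ~ D s ((v 1%N)^-1 * v 0%N)).
    pose r k := if k is k'.+1 then if k' is 0 then 0%N else k else 1%N.
    have ri : injective r by case=> [|[|x]] [|[|y]] //= [] ->.
    exact: (def_rel_rename (r := r) ri (dq A jA)).
   have := def_set_of_rel (w := fun=> a) (def_rel_and Aa (def_rel_of_set (dD _ s' jA)) d2).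
   by apply=> _; right.
  move=> t; have [_ [y [dy nd]]] := ha (flatten t); exists y => s' st; split=> //; exact: Dflat dy.
 have Ka : K a by apply: DK => s'; exact: (ha s').1.
 have Kb' : K b by apply: DK => s'; exact: (hb s').1.
 by apply: (hb s).2; apply: KD; apply: KM=> //; exact: KV.
have [next hnext] := choice step.
have col s : finitely_colored (D s).
 pose s' := next s; have [u hu] := def_set_countable (dD _ s' (@subset_refl _ _)).
 pose rep (C : set Gs) : Gs := if pselect (exists x, C x) is left h then projT1 (cid h) else 1.
 pose A0 := rep @` lcosets_of K.
 have kA0 : ~~ ([set: kappa] #<= A0).
  by apply: contra Kb => h; apply: card_le_trans h _; exact: card_image_le.
 pose A := A0 `|` range u.
 have kA : ~~ ([set: kappa] #<= A).
  by apply: card_lt_setU_countable=> //; exact: card_image_le.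
 have Au : A (u 0%N) by right; exists 0%N.
 (* Otherwise saturation, over representatives of the cosets of K and the countably many parameters
    of D s', yields a y outside all translates r D s'. The representative r of y K contradicts this,
    since r^-1 y is in K. *)
 have [t ht] : exists t : seq Gs, forall y, exists2 r, r \in t & D s' (r^-1 * y).
  apply: contrapT => hn.
  pose J := {r : Gs | `[< A0 r >]}.
  have [y hy] : exists y, forall r : J, ~ D s' ((sval r)^-1 * y).
   apply: (@saturated_family _ _ Es kappa A J (fun r => [set y | ~ D s' ((sval r)^-1 * y)]))=> //.
    move=> r; have Ar : A (sval r) by left; apply/asboolP; exact: (svalP r).
    have dq : def_rel Es A (fun v => ~ D s' ((v 0%N)^-1 * v 1%N)).
     apply: (def_rel_not Au); apply: (def_rel_quotient Au).
     by apply: def_rel_sub (def_rel_of_set hu); right.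
    pose r' k := if k is k'.+1 then if k' is 0 then 0%N else k else 1%N.
    have ri : injective r' by case=> [|[|x]] [|[|y]] //= [] ->.
    have := def_set_of_rel (w := fun=> sval r) (def_rel_rename (r := r') ri dq) (fun=> Ar).
    by [].
   move=> t; apply: contrapT => h; apply: hn; exists [seq sval r | r <- t] => y.
   apply: contrapT => h'; apply: h; exists y => r rt hr; apply: h'.
   by exists (sval r)=> //; exact: map_f.
  have Ar : A0 (rep [set y * h | h in K]) by exists [set y * h | h in K]=> //; exists y.
  have Ar' : `[< A0 (rep [set y * h | h in K]) >] by apply/asboolP.
  have := hy (exist (fun r => is_true `[< A0 r >]) _ Ar'); apply => /=; apply: KD.
  rewrite /rep; case: pselect => [h|[]]; last by exists (y * 1), 1.
  by case: cid => z /= [h' Kh' <-]; rewrite invgM mulgVK; exact: KV.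
 exact: finitely_colored_cover ht (hnext s).
apply/seteqP; split=> // x _; apply: DK => s.
pose P n := [set g | D (iter n next s) (j g)].
have j1 : j 1 = 1 by apply: (mulgI (j 1)); rewrite -elementary_morph !mulg1.
have jV g : j g^-1 = (j g)^-1 by apply/eqP; rewrite -mulg_eq1 -elementary_morph mulVg j1.
have cP : chain P.
 split=> [n|n g h dg dh]; last by rewrite /P /= elementary_morph jV; exact: hnext.
 by have [J [c H]] := col (iter n next s); exists J, (c \o j) => g h /H; rewrite /P /= elementary_morph jV.
move=> i si; have PA := PhiA _ (IP i).
have /choice[u' hu'] : forall k, exists g, j g = (sval (i : I)).2 k by move=> k; have [g _ <-] := PA k; exists g.
have hall g : sat E (fun k => if k is k'.+1 then u' k' else g) (sval (i : I)).1.
 have := Gmin g P cP 0%N i si; rewrite /holds_at => h; apply/j_elem.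
 by apply: sat_eq h _ => -[|k] //=; rewrite hu'.
have : sat E (fun k => if k is k'.+1 then u' k' else 1) (FAll 0 (sval (i : I)).1).
 by move=> /= g; apply: sat_eq (hall g) _ => -[|k].
by move=> /j_elem /= /(_ x) h; apply: sat_eq h _ => -[|k] //=; rewrite hu'.
Qed.
End MinapTAC.

Theorem minap_TAC (G : groupType) : minap G -> type_absolutely_connected G.
Proof.
move=> Gmin L E Gs Es j kappa je kl ks; split; last first.
 by move=> K KP; rewrite (bounded_type_definable_total je kl ks Gmin KP).
split; first by split.
 by exists set0=> //; apply/seteqP; split=> // x _ p [].
apply: contra kl => h; apply: card_le_trans h _.
apply: (@card_le_setT_inj _ _ _ (fun=> set0)) => C C' [g _ <-] [g' _ <-] _.
by apply/seteqP; split=> z _; [exists (g'^-1 * z)|exists (g^-1 * z)]=> //; rewrite mulVKg.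
Qed.
Lemma filter_setC_absurd (T : Type) (F : set_system T) (X : set T) : ProperFilter F ->
 F X -> F (~` X) -> False.
Proof.
by move=> FF FX FnX; apply: (@filter_not_empty _ F FF); rewrite -(setICr X); exact: filterI.
Qed.

(** * An ultrafilter realizing all finitely solvable systems *)

Section SaturatedUltrafilter.
Variables (G : Type) (lam : eqType).

(** Names for the elements of a saturated extension. [Node r f] is meant to solve all conditions
    [r i] with parameters named [f i]; well-foundedness puts parameters before solutions. Points p :
    label -> G are assignments, and the model will be the labels modulo equality almost
    everywhere. *)
Inductive label := Leaf | Node of lam -> set (nat -> G) & lam -> nat -> label.

HB.instance Definition _ := gen_eqMixin label.
HB.instance Definition _ := gen_choiceMixin label.

Definition vcons (T : Type) (x : T) (w : nat -> T) k := if k is k'.+1 then w k' else x.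

Definition finitary (r : set (nat -> G)) :=
 exists N, forall v v' : nat -> G, (forall k, (k < N)%N -> v k = v' k) -> r v -> r v'.

Definition supported (D : set label) (X : set (label -> G)) := exists s : seq label,
 (forall w, w \in s -> D w) /\ forall p p' : label -> G, (forall w, w \in s -> p w = p' w) -> X p -> X p'.

Lemma supportedC D X : supported D X -> supported D (~` X).
Proof.
move=> [s [sD h]]; exists s; split=> // p p' e nX Xp'; apply: nX.
by apply: h Xp' => w ws; rewrite e.
Qed.

Lemma supportedI D X Y : supported D X -> supported D Y -> supported D (X `&` Y).
Proof.
move=> [s [sD hs]] [t [tD ht]]; exists (s ++ t); split.
 by move=> w; rewrite mem_cat => /orP[/sD|/tD].
move=> p p' e [Xp Yp]; split; [apply: hs Xp|apply: ht Yp] => w h; apply: e; rewrite mem_cat h ?orbT //.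
Qed.

Lemma supportedS (D D' : set label) X : D `<=` D' -> supported D X -> supported D' X.
Proof. by move=> DD' [s [sD h]]; exists s; split=> // w /sD /DD'. Qed.
Lemma supportedT D : supported D setT.
Proof. by exists [::]. Qed.
Lemma supported_finitary (D : set label) r (f : nat -> label) : finitary r -> (forall k, D (f k)) ->
 supported D [set p : label -> G | r (p \o f)].
Proof.
move=> [N h] fD; exists [seq f k | k <- iota 0 N]; split; first by move=> w /mapP[k _ ->].
move=> p p' e; apply: h => k kN /=; apply: e; apply/mapP; exists k=> //.
by rewrite mem_iota.
Qed.

Variables (r : lam -> set (nat -> G)) (f : lam -> nat -> label).
Definition solved_by (w : label) i := [set p : label -> G | r i (vcons (p w) (p \o f i))].
Definition solvable_at (s : seq lam) := [set p : label -> G|exists x, forall i, i \in s -> r i (vcons x (p \o f i))].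
End SaturatedUltrafilter.

Arguments Leaf {G lam}.
Arguments Node {G lam}.

Section SaturatedUltrafilterExistence.
Variables (G : Type) (g0 : G) (lam : eqType).
Notation label := (label G lam).

Lemma supported_solved_by (D : set label) r f w i : finitary (r i) -> D w -> (forall i k, D (f i k)) ->
 supported D (solved_by r f w i).
Proof.
move=> ri Dw fD; have -> : solved_by r f w i = [set p : label -> G | r i (p \o vcons w (f i))].
 by apply/funext => p; congr (r i _); apply/funext => -[|k].
by apply: supported_finitary=> // -[|k] //=.
Qed.

Lemma supported_solvable_at (D : set label) r f s : (forall i, finitary (r i)) -> (forall i k, D (f i k)) ->
 supported D (solvable_at r f s).
Proof.
move=> rF fD; have /choice[N hN] := rF.
exists (flatten [seq [seq f i k | k <- iota 0 (N i)] | i <- s]); split.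
 by move=> w /flattenP[t /mapP[i _ ->] /mapP[k _ ->]].
move=> p p' e [x hx]; exists x => i si; apply: hN (hx i si) => -[|k] //= kN.
apply: e; apply/flattenP; exists [seq f i k | k <- iota 0 (N i)]; first exact: map_f.
by apply: map_f; rewrite mem_iota /= add0n ltnW.
Qed.

Definition honored (T : set (set (label -> G))) (w : label) := forall r f, w = Node r f -> (forall i, finitary (r i)) ->
 (forall s, T (solvable_at r f s)) -> forall i, T (solved_by r f w i).

(** An ultrafilter on the algebra of sets depending on finitely many labels of D, where D is closed
    under taking parameters and its labels already solve the systems they name. *)
Record partial_type (D : set label) (T : set (set (label -> G))) : Prop := {
 pt_closed : forall r f, D (Node r f) -> forall i k, D (f i k);
 pt_supp : forall X, T X -> supported D X;
 pt_T : T setT;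
 pt_I : forall X Y, T X -> T Y -> T (X `&` Y);
 pt_up : forall X Y, T X -> X `<=` Y -> supported D Y -> T Y;
 pt_proper : ~ T set0;
 pt_ultra : forall X, supported D X -> T X \/ T (~` X);
 pt_honor : forall w, D w -> honored T w }.

(** A set of T does not restrict the value at the new label w. If all finite parts of the system
    named by w are solvable on sets of T, the value at w can be changed to a solution, so the
    conditions on w generate a proper filter together with T. *)
Lemma partial_type_extend D T w : partial_type D T -> ~ D w ->
 (forall r f, w = Node r f -> forall i k, D (f i k)) ->
 exists2 T', partial_type (D `|` [set w]) T' & T `<=` T'.
Proof.
move=> PT nDw wD.
pose ok r f := w = Node r f /\ (forall i, finitary (r i)) /\ (forall s, T (solvable_at r f s)).
pose B (s : seq lam) : set (label -> G) := [set p | forall r f, ok r f -> forall i, i \in s -> solved_by r f w i p].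
pose F : set_system (label -> G) := [set Y|exists X s, T X /\ X `&` B s `<=` Y].
have TBn X s : T X -> exists p, X p /\ B s p.
 move=> TX; have [[r [f rf]]|nok] := pselect (exists r f, ok r f); last first.
  have [[p Xp]|nX] := pselect (exists p, X p); last first.
   case: (pt_proper PT); have := TX.
   by rewrite (_ : X = set0) //; apply/seteqP; split=> // p Xp'; case: nX; exists p.
  by exists p; split=> // r f rf; case: nok; exists r, f.
 have [wE [rF rS]] := rf.
 have TXs := pt_I PT TX (rS s).
 have [[p [Xp [x hx]]]|h] := pselect (exists p, (X `&` solvable_at r f s) p); last first.
  case: (pt_proper PT); have := TXs.
  by rewrite (_ : X `&` _ = set0) //; apply/seteqP; split=> // p Xp'; case: h; exists p.
 pose p' u := if u == w then x else p u.
 have p'D u : D u -> p' u = p u by rewrite /p'; case: eqP=> // -> /nDw.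
 exists p'; split.
  have [t [tD ht]] := pt_supp PT TX; apply: ht Xp => u /tD Du; by rewrite p'D.
 move=> r1 f1 [w1E _] i si; move: w1E; rewrite wE => -[<- <-]; rewrite /solved_by /= {1}/p' wE eqxx.
 have -> : p' \o f i = p \o f i by apply/funext => k /=; rewrite p'D //; exact: wD wE i k.
 exact: hx.
have FF : ProperFilter F.
 split.
  by move=> [X [s [TX h]]]; have [p Xp] := TBn X s TX; exact: h Xp.
 split.
 - by exists setT, [::]; split=> //; exact: pt_T PT.
 - move=> Y1 Y2 [X1 [s1 [T1 h1]]] [X2 [s2 [T2 h2]]]; exists (X1 `&` X2), (s1 ++ s2); split; first exact: (pt_I PT T1 T2).
  move=> p [[p1 p2] pB]; split; [apply: h1|apply: h2]; split=> // r f rf i si; apply: (pB r f rf i); rewrite mem_cat si ?orbT //.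
 - by move=> Y1 Y2 Y12 [X [s [TX h]]]; exists X, s; split=> // p /h /Y12.
have [U [UU FU]] := ultraFilterLemma FF.
pose T' : set (set (label -> G)) := [set X | supported (D `|` [set w]) X /\ U X].
have DD' : D `<=` D `|` [set w] by left.
have TU X : T X -> U X by move=> TX; apply: FU; exists X, [::]; split=> // p [].
have UT X : supported D X -> U X -> T X.
 move=> sX UX; have [//|TnX] := pt_ultra PT sX.
 by case: (filter_setC_absurd _ UX (TU _ TnX)).
exists T'; last by move=> X TX; split; [exact: supportedS DD' (pt_supp PT TX)|exact: TU].
split.
- move=> r f [h|h] i k; left; [exact: pt_closed PT _ _ h i k|exact: wD (esym h) i k].
- by move=> X [].
- by split; [exact: supportedT|exact: filterT].
- by move=> X Y [sX UX] [sY UY]; split; [exact: supportedI|exact: filterI].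
- by move=> X Y [sX UX] XY sY; split=> //; exact: filterS UX.
- by move=> [_ /filter_not_empty].
- move=> X sX; have [UX|UX] := in_ultra_setVsetC X UU; first by left.
 by right; split=> //; exact: supportedC.
move=> u [Du|->] r f uE rF hs i.
 have fD : forall i k, D (f i k) by apply: (pt_closed PT (r := r)); rewrite -uE.
 have Ts s : T (solvable_at r f s).
  by apply: UT; [exact: supported_solvable_at|exact: (hs s).2].
 have h := pt_honor PT Du uE rF Ts i.
 by split; [exact: supportedS DD' (pt_supp PT h)|exact: TU].
have fD := wD _ _ uE.
split; first by apply: supported_solved_by=> //; [right|move=> *; left].
have Ts s : T (solvable_at r f s).
 by apply: UT; [exact: supported_solvable_at|exact: (hs s).2].
apply: FU; exists setT, [:: i]; split; first exact: pt_T PT.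
by move=> p [_ Bp]; apply: Bp; rewrite ?inE.
Qed.

Lemma partial_type0 : exists T, partial_type set0 T.
Proof.
exists [set X | X = setT]; split=> //.
- by move=> X ->; exact: supportedT.
- by move=> X Y -> ->; rewrite setIT.
- by move=> X Y -> h _; apply/seteqP; split.
- by move=> e; have : [set: label -> G] (fun=> g0) by []; rewrite -e.
- move=> X [s [s0 h]].
 have hp (p p' : label -> G) : X p -> X p' by apply: h => w /s0.
 have [[p Xp]|nX] := pselect (exists p, X p); [left|right]; apply/seteqP; split=> // p' _.
  exact: hp Xp.
 by move=> Xp'; apply: nX; exists p'.
Qed.

(** Zorn's lemma on pairs (D, T), coded as one subset of a sum type so that inclusion orders both
    components. In a maximal pair D contains every label, by induction on labels. *)
Theorem saturated_ultrafilter : exists2 U : set_system (label -> G), UltraFilter U &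
 forall r f, (forall i, finitary (r i)) -> (forall s, U (solvable_at r f s)) ->
 forall i, U (solved_by r f (Node r f) i).
Proof.
pose DD (A : set (label + set (label -> G))) : set label := [set w | A (inl w)].
pose TT (A : set (label + set (label -> G))) := [set X | A (inr X)].
have [|A [PA Amax]] := @Zorn_bigcup _ [set A | A !=set0 -> partial_type (DD A) (TT A)].
- move=> F FP Ftot [z [A0 FA0 A0z]].
 have PA0 := FP _ FA0 (ex_intro _ z A0z).
 set C := \bigcup_(X in F) X.
 have C2 x y : C x -> C y -> exists2 A, F A & A x /\ A y.
  move=> [A FA Ax] [B FB By]; have [AB|BA] := Ftot A B FA FB; [exists B=> //|exists A=> //]; split=> //; [exact: AB|exact: BA].
 have PTA A x : F A -> A x -> partial_type (DD A) (TT A) by move=> FA Ax; apply: FP FA _; exists x.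
 have sub A : F A -> DD A `<=` DD C by move=> FA w Aw; exists A.
 have suppC X : supported (DD C) X -> forall x, C x -> exists A, [/\ F A, A x & supported (DD A) X].
  move=> [s [sD h]] x Cx.
  suff [A FA [Ax As]] : exists2 A, F A & A x /\ forall w, w \in s -> A (inl w).
   by exists A; split=> //; exists s.
  elim: s sD {h} => [|a s IH] sD; first by case: Cx => A FA Ax; exists A.
  have [A FA [Ax As]] := IH (fun w ws => sD w (mem_behead (s := a :: s) ws)).
  have [B FB Ba] := sD a (mem_head _ _).
  have [AB|BA] := Ftot A B FA FB.
   exists B=> //; split; first exact: AB.
   by move=> w; rewrite inE => /orP[/eqP ->//|/As /AB].
  exists A=> //; split=> // w; rewrite inE => /orP[/eqP ->|/As //]; exact: BA.
 have C0 : C z by exists A0.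
 split.
 + by move=> r f [B FB Bw] i k; exists B=> //; exact: pt_closed (PTA _ _ FB Bw) _ _ Bw i k.
 + by move=> X [B FB BX]; apply: supportedS (sub _ FB) _; exact: pt_supp (PTA _ _ FB BX) _ BX.
 + by exists A0=> //; exact: pt_T PA0.
 + move=> X Y CX CY; have [B FB [BX BY]] := C2 _ _ CX CY; exists B=> //.
  exact: pt_I (PTA _ _ FB BX) _ _ BX BY.
 + move=> X Y CX XY sY; have [B [FB BX sBY]] := suppC Y sY _ CX; exists B=> //.
  exact: pt_up (PTA _ _ FB BX) _ _ BX XY sBY.
 + by move=> [B FB B0]; exact: pt_proper (PTA _ _ FB B0) B0.
 + move=> X sX; have [B [FB Bz sB]] := suppC X sX _ C0.
  by have [h|h] := pt_ultra (PTA _ _ FB Bz) sB; [left|right]; exists B.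
 + move=> w [B FB Bw] r f wE rF hs i.
  have PB := PTA _ _ FB Bw.
  have fD : forall i k, DD B (f i k) by apply: (pt_closed PB (r := r)); rewrite -wE.
  exists B=> //; apply: (pt_honor PB Bw wE rF) => s.
  have [//|h] := pt_ultra PB (supported_solvable_at s rF fD).
  have [B' FB' [h1 h2]] := C2 _ _ (hs s) (ex_intro2 _ _ B FB h).
  have PB' := PTA _ _ FB' h1; case: (pt_proper PB').
  by have := pt_I PB' h1 h2; rewrite setICr.
have An0 : A !=set0.
 apply: contrapT => An0; have [T0 PT0] := partial_type0.
 pose B : set (label + set (label -> G)) := [set x | if x is inr X then T0 X else False].
 apply: (Amax B); last by move=> _; exact: PT0.
 split; first by move=> x Ax; case: An0; exists x.
 by move=> h; apply: An0; exists (inr setT); apply: h; exact: pt_T PT0.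
have PTA := PA An0.
have all w : DD A w.
 elim: w => [|r f IH]; apply: contrapT => nD.
  have [//|T' PT' TT'] := @partial_type_extend _ _ Leaf PTA nD.
  pose B : set (label + set (label -> G)) := [set x | match x with inl w => (DD A `|` [set Leaf]) w | inr X => T' X end].
  apply: (Amax B); last by move=> _; exact: PT'.
  split; first by move=> [u|X] h; [left|exact: TT'].
  by move=> /(_ (inl Leaf)) h; apply: nD; apply: h; right.
 have [|T' PT' TT'] := @partial_type_extend _ _ (Node r f) PTA nD; first by move=> r1 f1 [_ <-].
 pose B : set (label + set (label -> G)) := [set x | match x with inl w => (DD A `|` [set Node r f]) w | inr X => T' X end].
 apply: (Amax B); last by move=> _; exact: PT'.
 split; first by move=> [u|X] h; [left|exact: TT'].
 by move=> /(_ (inl (Node r f))) h; apply: nD; apply: h; right.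
pose F : set_system (label -> G) := [set Y | exists2 X, TT A X & X `<=` Y].
have FF : ProperFilter F.
 split.
  by move=> [X TX X0]; apply: (pt_proper PTA); move: TX; rewrite (_ : X = set0) //; apply/seteqP; split.
 split.
 - by exists setT=> //; exact: pt_T PTA.
 - by move=> X Y [X' TX' h] [Y' TY' h']; exists (X' `&` Y'); [exact: (pt_I PTA TX' TY')|move=> p [/h ? /h' ?]].
 - by move=> X Y XY [X' TX' h]; exists X' => // p /h /XY.
have [U [UU FU]] := ultraFilterLemma FF.
have TU X : TT A X -> U X by move=> TX; apply: FU; exists X.
exists U=> // r f rF hs i; apply: (TU _); apply: (pt_honor PTA (all _) erefl rF) => s.
have [//|h] := pt_ultra PTA (supported_solvable_at s rF (fun i k => all (f i k))).
by case: (filter_setC_absurd _ (hs s) (TU _ h)).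
Qed.
End SaturatedUltrafilterExistence.

(** * The successor of a cardinal *)

Section SuccessorCardinal.
Variable Y : Type.

(** The successor is the segment [Lev] of a well-ordered power set of Y, formed by the elements with
    at most |Y| predecessors. Were |Lev| <= |Y|, the least element outside [Lev] would belong to it,
    and if there is none Cantor's theorem is violated. A maximal injection from a segment of [Lev]
    to A is either total or onto A; in the latter case A injects into a proper segment. *)
Lemma successor_cardinal : exists2 kappa : Type, ~~ ([set: kappa] #<= [set: Y]) &
 forall (T : Type) (A : set T), ~~ ([set: kappa] #<= A) -> A #<= [set: Y].
Proof.
have [R Rwo] := wochoice.well_ordering_principle {classic (set Y)}.
have Rmin (P : set (set Y)) : P !=set0 -> exists2 z, P z & forall y, P y -> R z y.
 move=> [x Px]; have [|z [[zP zmin] _]] := Rwo [pred x | `[< P x >]]; first by exists x; apply/asboolP.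
 by exists z => [|y Py]; [exact/asboolP|apply: zmin; exact/asboolP].
have Rwc : wochoice.wo_chain R predT := fun A _ => Rwo A.
have Rxx x : R x x := wochoice.wo_chain_reflexive Rwc (isT : x \in predT).
have Ranti x y : R x y -> R y x -> x = y.
 by move=> xy yx; apply: (wochoice.wo_chain_antisymmetric Rwc); rewrite // xy.
have Rtot x y : R x y \/ R y x by apply/orP; exact: (wochoice.wo_chainW Rwc).
pose lt x y := R x y /\ x <> y.
have ltNR x y : ~ R x y -> lt y x.
 by move=> h; case: (Rtot x y)=> // h'; split=> // e; apply: h; rewrite e.
pose Lev := {x : set Y | `[< [set y | lt y x] #<= [set: Y] >]}.
have LevP x : [set y | lt y x] #<= [set: Y] -> exists l : Lev, sval l = x.
 by move=> h; have h' : `[< [set y | lt y x] #<= [set: Y] >] by [apply/asboolP]; exists (exist _ x h').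
have Levlt (l : Lev) : [set y | lt y (sval l)] #<= [set: Y] by case: l => x /= /asboolP.
have svi : injective (sval : Lev -> set Y).
 by move=> [x hx] [y hy] /= e; move: hx hy; rewrite e => hx hy; congr exist; exact: bool_irrelevance.
exists Lev.
 apply/negP => h; have [[x hx]|nx] := pselect (exists x, forall l : Lev, sval l <> x); last first.
  have : [set: set Y] #<= [set: Y].
   apply: card_le_trans _ h.
   have /choice[g hg] : forall x, exists l : Lev, sval l = x.
    by move=> x; apply: contrapT => h; apply: nx; exists x => l e; apply: h; exists l.
   by apply: (@card_le_setT_inj _ _ _ g) => a b _ _ e; rewrite -(hg a) -(hg b) e.
  have [y0|Y0] := pselect (exists y : Y, True).
   have [y1 _] := y0; move=> /(@card_leP_inj _ _ y1)[f [_ fi]].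
   pose D := [set y | exists2 S : set Y, f S = y & ~ S y].
   have [Dy|nDy] := pselect (D (f D)).
    by have [S /(fi _ _ I I) e nS] := Dy; apply: nS; rewrite e.
   by apply: (nDy); exists D.
  move=> /card_leP[f]; apply: Y0.
  by have := f (SigSub (mem_set (I : [set: set Y] set0))) => -[y _]; exists y.
 have [|z hz zmin] := Rmin [set x | forall l : Lev, sval l <> x]; first by exists x.
 have [|l /hz//] := LevP z.
 apply: card_le_trans _ h.
 have [[l0 _]|nl] := pselect (exists l : Lev, True); last first.
  have -> : [set y | lt y z] = set0; last exact: card_ge0.
  apply/seteqP; split=> // y [yz ynz] /=; apply: ynz; apply: Ranti=> //; apply: zmin => l _.
  by apply: nl; exists l.
 have /choice[g hg] : forall y, exists l : Lev, lt y z -> sval l = y.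
  move=> y; have [yz|nyz] := pselect (lt y z); last by exists l0.
  apply: contrapT => h; case: yz => yz; apply; apply: Ranti=> //; apply: zmin => l e.
  by apply: h; exists l.
 by apply: (@card_le_setT_inj _ _ _ g) => a b ha hb e; rewrite -(hg a ha) -(hg b hb) e.
move=> T A nA.
pose good (f : set (Lev * T)) := [/\ forall l t, f (l, t) -> A t, forall l t t', f (l, t) -> f (l, t') -> t = t',
 forall l l' t, f (l, t) -> f (l', t) -> l = l' & forall l l' t, f (l, t) -> R (sval l') (sval l) -> exists t', f (l', t')].
have [|f [[fA fun_f finj fdown] fmax]] := @Zorn_bigcup _ good.
 move=> F FP Ftot.
 have F2 x y : (\bigcup_(X in F) X) x -> (\bigcup_(X in F) X) y -> exists2 X, F X & X x /\ X y.
  move=> [X FX Xx] [Z FZ Zy]; have [XZ|ZX] := Ftot X Z FX FZ; [exists Z=> //|exists X=> //]; split=> //; [exact: XZ|exact: ZX].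
 split.
 - by move=> l t [X FX Xl]; have [h _ _ _] := FP X FX; exact: h Xl.
 - by move=> l t t' h1 h2; have [X FX [X1 X2]] := F2 _ _ h1 h2; have [_ h _ _] := FP X FX; exact: h X1 X2.
 - by move=> l l' t h1 h2; have [X FX [X1 X2]] := F2 _ _ h1 h2; have [_ _ h _] := FP X FX; exact: h X1 X2.
 - by move=> l l' t [X FX Xl] r; have [_ _ _ h] := FP X FX; have [t' ht'] := h _ _ _ Xl r; exists t', X.
have [[l0 hl0]|full] := pselect (exists l, forall t, ~ f (l, t)); last first.
 have /choice[g hg] : forall l, exists t, f (l, t).
  by move=> l; apply: contrapT => h; apply: full; exists l => t ft; apply: h; exists t.
 case/negP: nA; apply: (@card_le_inj _ _ _ _ g) => [l _|l l' _ _ e]; first exact: fA (hg l).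
 by apply: finj (hg l) _; rewrite e.
have [|z [l [lz hl]] zmin] := Rmin [set x|exists l, sval l = x /\ forall t, ~ f (l, t)].
 by exists (sval l0), l0.
have fl' l' t : f (l', t) -> lt (sval l') z.
 by move=> h; apply: ltNR => r; have [|t' ht'] := fdown l' l t h; [rewrite lz|exact: hl ht'].
have [Af|nAf] := pselect (forall t, A t -> exists l, f (l, t)).
 have [t0|T0] := pselect (exists t, A t); last first.
  by have -> : A = set0; [apply/seteqP; split=> // t At; case: T0; exists t|exact: card_ge0].
 have /choice[g hg] : forall t, exists l, A t -> f (l, t).
  by move=> t; have [/Af[l' h]|nAt] := pselect (A t); [exists l'|exists l0].
 apply: (@card_le_trans _ _ _ [set y | lt y z]); last by rewrite -lz; exact: Levlt.
 apply: (@card_le_inj _ _ _ _ (fun t => sval (g t))) => [t At|t t' At At' /svi e].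
  exact: fl' (hg t At).
 by apply: fun_f (hg t At) _; rewrite e; exact: hg.
have [a Aa ha] : exists2 a, A a & forall l, ~ f (l, a).
 by apply: contrapT => h; apply: nAf => t At; apply: contrapT => h'; apply: h; exists t=> // l' fl; apply: h'; exists l'.
case: (fmax (f `|` [set (l, a)])).
 by split=> [x fx|]; [left|move=> /(_ (l, a)) h; apply: (hl a); apply: h; right].
split.
- by move=> l' t [/fA//|[_ ->]].
- move=> l' t t' [h|h] [h'|h'].
 + exact: fun_f h h'.
 + by case: h' => e _; case: (hl t); rewrite -e.
 + by case: h => e _; case: (hl t'); rewrite -e.
 + by case: h => _ ->; case: h' => _ ->.
- move=> l1 l2 t [h|h] [h'|h'].
 + exact: finj h h'.
 + by case: h' => _ e; case: (ha l1); rewrite -e.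
 + by case: h => _ e; case: (ha l2); rewrite -e.
 + by case: h => -> _; case: h' => -> _.
move=> l1 l2 t [h|[-> e]] r; first by have [t' ht'] := fdown _ _ _ h r; exists t'; left.
have [e2|ne] := pselect (l2 = l); first by exists a; right; rewrite e2.
apply: contrapT => h; apply: ne; apply: svi; apply: Ranti=> //; rewrite lz; apply: zmin.
by exists l2; split=> // t' ft'; apply: h; exists t'; left.
Qed.
End SuccessorCardinal.

(** * The saturated extension; type-absolute connectedness implies minimal almost periodicity *)

Section FiniteSupport.
Variables (L : language) (G : groupType) (E : expansion L G).

Lemma teval_finite (t : term L) : exists N, forall v v' : nat -> G, (forall k, (k < N)%N -> v k = v' k) ->
 teval E v t = teval E v' t.
Proof.
elim: t => [k|a [N hN] b [N' hN']|f a IH].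
- by exists k.+1 => v v' h /=; exact: h.
- by exists (maxn N N') => v v' h /=; rewrite (hN v v') ?(hN' v v') // => k kN; apply: h; rewrite leq_max kN ?orbT.
have [N hN] := choice IH; exists (\max_i N i) => v v' h /=; congr fun_interp; apply/funext => i.
by apply: hN => k kN; apply: h; apply: leq_trans kN _; exact: leq_bigmax.
Qed.

Lemma sat_finite (p : formula L) : exists N, forall v v' : nat -> G, (forall k, (k < N)%N -> v k = v' k) ->
 sat E v p -> sat E v' p.
Proof.
elim: p => [a b|q a| |a [N hN] b [N' hN']|k a [N hN]].
- have [N hN] := teval_finite a; have [N' hN'] := teval_finite b.
 by exists (maxn N N') => v v' h /=; rewrite (hN v v') ?(hN' v v') // => k kN; apply: h; rewrite leq_max kN ?orbT.
- have [N hN] := choice (fun i => teval_finite (a i)).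
 exists (\max_i N i) => v v' h /=; have -> // : (fun i => teval E v (a i)) = (fun i => teval E v' (a i)).
 by apply/funext => i; apply: hN => k kN; apply: h; apply: leq_trans kN _; exact: leq_bigmax.
- by exists 0%N.
- exists (maxn N N') => v v' h /= H /hN H1; apply: (hN' v) => [k kN|]; first by apply: h; rewrite leq_max kN orbT.
 by apply: H; apply: H1 => k kN; rewrite h // leq_max kN.
exists N => v v' h /= H x; apply: hN (H x) => l lN; case: eqP=> // _; exact: h.
Qed.
End FiniteSupport.

Section SaturatedModel.
Variables (L : language) (G : groupType) (E : expansion L G) (Y : Type) (y0 : Y).
Let lam : eqType := {classic (formula L * (nat -> Y))}.
Notation label := (label G lam).
Variable U : set_system (label -> G).
Hypothesis UU : UltraFilter U.
Hypothesis Usat : forall r f, (forall i, finitary (r i)) -> (forall s, U (solvable_at r f s)) ->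
 forall i, U (solved_by r f (Node r f) i).

Let U_forall (I : finType) (P : I -> set (label -> G)) : (forall i, U (P i)) -> U [set p | forall i, P i p].
Proof. by move=> h; exact: filter_forall. Qed.

(** The chosen representative depends on the class of w only, so almost sure equality becomes
    equality in [carrier]. *)
Definition crep (w : label) : label := xget Leaf [set w' | U [set p | p w = p w']].

Lemma crepP w : U [set p | p w = p (crep w)].
Proof. by apply: (@xgetPex _ Leaf [set w' | U [set p | p w = p w']]); exists w; apply: filterS filterT. Qed.
Lemma crep_eq w w' : U [set p | p w = p w'] -> crep w = crep w'.
Proof.
move=> h; rewrite /crep; congr xget; apply/seteqP; split=> u /= hu; apply: filterS (filterI h hu) => p [/= h1 h2].
 by rewrite -h1 h2.
by rewrite h1 h2.
Qed.

Definition carrier := {w : label | crep w == w}.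
HB.instance Definition _ := Choice.on carrier.

Definition cls (w : label) : carrier := exist _ (crep w) (introT eqP (esym (crep_eq (crepP w)))).

Lemma clsP w : U [set p | p (val (cls w)) = p w].
Proof. by apply: filterS (crepP w) => p /= ->. Qed.
Lemma carrier_eq (m m' : carrier) : U [set p | p (val m) = p (val m')] -> m = m'.
Proof. by move=> /crep_eq; case: m m' => w hw [w' hw'] /= e; apply: val_inj => /=; rewrite -(eqP hw) -(eqP hw'). Qed.
Lemma solve_family (r : lam -> set (nat -> G)) (f : lam -> nat -> carrier) : (forall i, finitary (r i)) ->
 (forall s : seq lam, U [set p|exists x, forall i, i \in s -> r i (vcons x (fun k => p (val (f i k))))]) ->
 exists m : carrier, forall i, U [set p | r i (vcons (p (val m)) (fun k => p (val (f i k))))].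
Proof.
move=> rF h; have H := @Usat r (fun i k => val (f i k)) rF h.
exists (cls (Node r (fun i k => val (f i k)))) => i.
by apply: filterS (filterI (clsP (Node r (fun i k => val (f i k)))) (H i)) => p [/= -> ].
Qed.

Lemma solve_one (r : set (nat -> G)) (f : nat -> carrier) : finitary r ->
 U [set p|exists x, r (vcons x (fun k => p (val (f k))))] ->
 exists m : carrier, U [set p | r (vcons (p (val m)) (fun k => p (val (f k))))].
Proof.
move=> rF h; have [|m hm] := solve_family (r := fun=> r) (f := fun=> f) (fun=> rF); last by exists m; exact: hm (FFalse L, fun=> y0).
by move=> s; apply: filterS h => p [x hx]; exists x.
Qed.

Definition pair_seq (T : Type) (a b : T) k := if k is 0%N then a else b.

Lemma mul_exists (a b : carrier) : exists m : carrier, U [set p | p (val m) = p (val a) * p (val b)].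
Proof.
apply: (@solve_one [set v | v 0%N = v 1%N * v 2%N] (pair_seq a b)).
 by exists 3%N => v v' h /=; rewrite !h.
by apply: filterS filterT => p _; exists (p (val a) * p (val b)).
Qed.

Lemma inv_exists (a : carrier) : exists m : carrier, U [set p | p (val m) = (p (val a))^-1].
Proof.
apply: (@solve_one [set v | v 0%N = (v 1%N)^-1] (fun=> a)).
 by exists 2%N => v v' h /=; rewrite !h.
by apply: filterS filterT => p _; exists (p (val a))^-1.
Qed.

Lemma const_exists (g : G) : exists m : carrier, U [set p | p (val m) = g].
Proof.
apply: (@solve_one [set v | v 0%N = g] (fun=> cls Leaf)).
 by exists 1%N => v v' h /=; rewrite !h.
by apply: filterS filterT => p _; exists g.
Qed.

Definition cmul a b := projT1 (cid (mul_exists a b)).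
Definition cinv a := projT1 (cid (inv_exists a)).
Definition cconst g := projT1 (cid (const_exists g)).

Lemma cmulP a b : U [set p | p (val (cmul a b)) = p (val a) * p (val b)].
Proof. by rewrite /cmul; case: cid. Qed.
Lemma cinvP a : U [set p | p (val (cinv a)) = (p (val a))^-1].
Proof. by rewrite /cinv; case: cid. Qed.
Lemma cconstP g : U [set p | p (val (cconst g)) = g].
Proof. by rewrite /cconst; case: cid. Qed.
Lemma cmulA : associative cmul.
Proof.
move=> a b c; apply: carrier_eq.
by apply: filterS (filterI (filterI (cmulP a (cmul b c)) (cmulP b c)) (filterI (cmulP (cmul a b) c) (cmulP a b))) => p [[/= -> ->] [/= -> ->]]; rewrite mulgA.
Qed.

Lemma cmul1 : left_id (cconst 1) cmul.
Proof.
move=> a; apply: carrier_eq.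
by apply: filterS (filterI (cmulP (cconst 1) a) (cconstP 1)) => p [/= -> ->]; rewrite mul1g.
Qed.

Lemma c1mul : right_id (cconst 1) cmul.
Proof.
move=> a; apply: carrier_eq.
by apply: filterS (filterI (cmulP a (cconst 1)) (cconstP 1)) => p [/= -> ->]; rewrite mulg1.
Qed.

Lemma cmulV : left_inverse (cconst 1) cinv cmul.
Proof.
move=> a; apply: carrier_eq.
by apply: filterS (filterI (cmulP (cinv a) a) (filterI (cinvP a) (cconstP 1))) => p [/= -> [-> ->]]; rewrite mulVg.
Qed.

Lemma cmulVr : right_inverse (cconst 1) cinv cmul.
Proof.
move=> a; apply: carrier_eq.
by apply: filterS (filterI (cmulP a (cinv a)) (filterI (cinvP a) (cconstP 1))) => p [/= -> [-> ->]]; rewrite mulgV.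
Qed.

Definition saturated_model : groupType :=
 HB.pack_for groupType carrier (isGroup.Build carrier cmulA cmul1 c1mul cmulV cmulVr).

Lemma fun_exists (f : lfun L) (a : 'I_(lfun_arity f) -> carrier) :
 exists m : carrier, U [set p | p (val m) = fun_interp E (fun i => p (val (a i)))].
Proof.
pose a' k := if insub k is Some i then a i else cls Leaf.
have [| |m hm] := @solve_one [set v | v 0%N = fun_interp E (fun i : 'I_(lfun_arity f) => v i.+1)] a'.
- exists (lfun_arity f).+1 => v v' h /=; rewrite h // => ->; congr fun_interp; apply/funext => i.
 by apply: h; rewrite ltnS.
- by apply: filterS filterT => p _; exists (fun_interp E (fun i : 'I_(lfun_arity f) => p (val (a' i)))).
exists m; apply: filterS hm => p /= ->; congr fun_interp; apply/funext => i.
by rewrite /a' valK.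
Qed.

Definition saturated_expansion : expansion L saturated_model :=
 Expansion (fun f a => projT1 (cid (fun_exists a)) : saturated_model)
  (fun q (a : 'I_(lrel_arity q) -> saturated_model) => U [set p | rel_interp E (fun i => p (val (a i : carrier)))]).

Notation Es := saturated_expansion.

Lemma teval_los (v : nat -> saturated_model) (t : term L) :
 U [set p | p (val (teval Es v t : carrier)) = teval E (fun k => p (val (v k : carrier))) t].
Proof.
elim: t => [k|a IHa b IHb|f a IH] /=; first exact: filterS filterT.
 by apply: filterS (filterI (cmulP (teval Es v a) (teval Es v b)) (filterI IHa IHb)) => p [/= -> [-> ->]].
case: cid => m hm /=.
apply: filterS (filterI hm (U_forall IH)) => p [/= -> h]; congr fun_interp; apply/funext => i; exact: h.
Qed.

(** The theorem of Los. Elements are labels rather than arbitrary functions of p, so for the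
    universal quantifier the counterexample is a label obtained from [solve_one]; this is legitimate
    as a formula involves finitely many variables. *)
Lemma sat_los (p : formula L) (v : nat -> saturated_model) :
 sat Es v p <-> U [set f | sat E (fun k => f (val (v k : carrier))) p].
Proof.
elim: p v => [a b|q a| |a IHa b IHb|k a IH] v /=.
- split=> [e|h].
  by apply: filterS (filterI (teval_los v a) (teval_los v b)) => f [/= <- <-]; rewrite e.
 apply: carrier_eq; apply: filterS (filterI h (filterI (teval_los v a) (teval_los v b))) => f [/= e [-> ->]].
 exact: e.
- have h := U_forall (fun i => teval_los v (a i)).
 by split=> h'; apply: filterS (filterI h h') => f [/= e]; congr rel_interp; apply/funext => i; rewrite e.
- by split=> // /filter_not_empty.
- rewrite IHa IHb; split=> [h|h ha]; last by apply: filterS (filterI h ha) => f [/= h1 h2]; exact: h1.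
 have [/h hb|na] := in_ultra_setVsetC [set f | sat E (fun k => f (val (v k : carrier))) a] UU.
  by apply: filterS hb => f /= hb' _; exact: hb'.
 by apply: filterS na => f /= na /na.
split=> [h|h x]; last first.
 apply/IH; apply: filterS h => f /= h; apply: sat_eq (h (f (val (x : carrier)))) _ => l.
 by case: eqP.
apply: contrapT => nU.
have [//|nh] := in_ultra_setVsetC [set f | forall x, sat E (fun l => if l == k then x else f (val (v l : carrier))) a] UU.
pose r : set (nat -> G) := [set u | ~ sat E (fun l => if l == k then u 0%N else u l.+1) a].
have rF : finitary r.
 have [N hN] := sat_finite E a; exists N.+1 => u u' e nu su; apply: nu; apply: hN su => l lN.
 by case: eqP => _; rewrite e // ltnS ltnW.
have [|m hm] := @solve_one r v rF.
 by apply: filterS nh => f /= /existsNP[x hx]; exists x.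
have := h m => /IH hm'; apply: (filter_setC_absurd _ hm'); apply: filterS hm => f /= hf hs; apply: hf.
by apply: sat_eq hs _ => l /=; case: eqP.
Qed.

Lemma cconst_elementary : elementary_embedding E Es (cconst : G -> saturated_model).
Proof.
move=> p v; rewrite sat_los; have [N hN] := sat_finite E p.
have h : U [set f | forall k : 'I_N, f (val (cconst (v k))) = v k] := U_forall (fun k : 'I_N => cconstP (v k)).
split=> [s|s].
 by apply: filterS h => f /= hf; apply: hN s => k kN; have /= -> := hf (Ordinal kN).
have [f [/= hf s']] := filter_ex (filterI h s).
by apply: hN s' => k kN; have /= -> := hf (Ordinal kN).
Qed.

(** Parameters from A are coded by elements of Y through [dec], so that all formulas over A are
    indexed by [lam]. Indices of formulas outside Phi receive the trivial condition. *)
Lemma saturated_model_saturated (kappa : Type) :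
 (forall (T : Type) (A : set T), ~~ ([set: kappa] #<= A) -> A #<= [set: Y]) -> saturated Es kappa.
Proof.
move=> hk A /hk hA Phi PhiA fip.
have [dec hdec] : exists dec : Y -> saturated_model, forall a, A a -> exists y, dec y = a.
 have [f [_ fi]] := card_leP_inj y0 hA.
 exists (fun y => xget 1 [set a | A a /\ f a = y]) => a Aa; exists (f a).
 by have [|h1 h2] := @xgetPex _ 1 [set b | A b /\ f b = f a]; [exists a|exact: fi h1 Aa h2].
pose pf (i : lam) : pformula L saturated_model := ((i : formula L * (nat -> Y)).1, dec \o (i : formula L * (nat -> Y)).2).
pose r (i : lam) : set (nat -> G) := if pselect (Phi (pf i)) is left _ then [set u | sat E u (pf i).1] else setT.
pose f (i : lam) k : carrier := (pf i).2 k.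
have rF i : finitary (r i).
 by rewrite /r; case: pselect => _; [exact: sat_finite|exists 0%N].
have key (x : saturated_model) (q : pformula L saturated_model) :
  holds_at Es x q <-> U [set g | sat E (vcons (g (val (x : carrier))) (fun k => g (val (q.2 k : carrier)))) q.1].
 rewrite /holds_at sat_los; split=> h; apply: filterS h => g /= h; apply: sat_eq h _ => -[|k] //.
have [s|m hm] := solve_family (f := f) rF.
 have [||x hx] := fip [set q | exists2 i, i \in s & q = pf i /\ Phi q].
 - apply: (@sub_finite_set _ _ (pf @` [set` s])); first by move=> q [i si [-> _]]; exists i.
  exact: finite_image (finite_seq s).
 - by move=> q [i _ [_]].
 have h : forall i, i \in s -> U [set g | r i (vcons (g (val (x : carrier))) (fun k => g (val (f i k))))].
  move=> i si; rewrite /r; case: pselect => [Pi|_]; last exact: filterS filterT.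
  have := hx (pf i) (ex_intro2 _ _ i si (conj erefl Pi)).
  by move=> /key; apply: filterS.
 have {}h : U [set g | forall i, i \in s -> r i (vcons (g (val (x : carrier))) (fun k => g (val (f i k))))].
  elim: s h {hx} => [|i s IH] h; first exact: filterS filterT.
  have h2 := IH (fun k ks => h k (mem_behead (s := i :: s) ks)).
  apply: filterS (filterI (h i (mem_head _ _)) h2) => g [/= h3 h4] k; rewrite inE => /orP[/eqP ->//|]; exact: h4.
 by apply: filterS h => g hg; exists (g (val (x : carrier))).
exists m => q Pq; apply/key.
have /choice[c hc] : forall k, exists y, dec y = q.2 k by move=> k; apply: hdec; exact: PhiA Pq k.
have e : pf (q.1, c) = q by rewrite /pf /=; case: q {Pq} hc => q1 q2 /= hc; congr pair; apply/funext.
have := hm (q.1, c); rewrite /r; case: pselect => [_|]; last by rewrite e.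
by rewrite /f e.
Qed.
End SaturatedModel.

Theorem saturated_extension (L : language) (G : groupType) (E : expansion L G) (Y : Type) (y0 : Y) :
 exists (Gs : groupType) (Es : expansion L Gs) (j : G -> Gs) (kappa : Type),
 [/\ elementary_embedding E Es j, ~~ ([set: kappa] #<= [set: Y]) & saturated Es kappa].
Proof.
have [kappa k1 k2] := successor_cardinal Y.
have [U UU HU] := saturated_ultrafilter (1 : G) {classic (formula L * (nat -> Y))}.
exists (saturated_model y0 UU HU), (saturated_expansion E y0 UU HU), (cconst y0 UU HU), kappa; split=> //.
 exact: cconst_elementary.
exact: saturated_model_saturated.
Qed.

(** G is expanded by all its subsets as unary predicates. The intersection K of the predicates of a
    chain is then a type-definable subgroup of a saturated extension. Its index is bounded, so K is
    everything, and so is each member of the chain in G. *)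
Theorem TAC_minap (G : groupType) : type_absolutely_connected G -> minap G.
Proof.
move=> tac g P cP n.
pose L := @Language void (fun=> 0%N) (set G) (fun=> 1%N).
pose E : expansion L G := @Expansion L G (fun f => match f : void with end) (fun (r : set G) a => r (a ord0)).
pose Y := set (nat + G + lfun L + lrel L).
have [Gs [Es [j [kappa [jE kY ks]]]]] := saturated_extension E (set0 : Y).
pose S (r : set G) (x : Gs) := rel_interp Es (r := (r : lrel L)) (fun=> x).
pose A (r : set G) k : formula L := FRel (r := (r : lrel L)) (fun=> TVar L k).
have SA (r : set G) k (v : nat -> Gs) : sat Es v (A r k) <-> S r (v k) by [].
have SA' (r : set G) k (v : nat -> G) : sat E v (A r k) <-> r (v k) by [].
have Sj r x : S r (j x) <-> r x by rewrite -(SA r 0%N (j \o (fun=> x))) -jE SA'.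
have trans2 (r1 r2 r3 : set G) : (forall x y, r1 x -> r2 y -> r3 (x^-1 * y)) -> forall x y, S r1 x -> S r2 y -> S r3 (x^-1 * y).
 move=> H; pose F := FAll 0 (FAll 1 (FAll 2 (FImp (A r1 0%N) (FImp (A r2 1%N) (FImp (FEq (TMul (TVar L 0) (TVar L 2)) (TVar L 1)) (A r3 2%N)))))).
 have : sat E (fun=> 1) F.
  by move=> x y z /= h1 h2 e; rewrite -[z](mulKg x) e; exact: H.
 move=> /jE h x y h1 h2; have := h x y (x^-1 * y); apply=> //=.
 by rewrite mulVKg.
have transU (r1 r2 r3 : set G) : r3 `<=` r1 `|` r2 -> forall x, S r3 x -> S r1 x \/ S r2 x.
 move=> H; pose F := FAll 0 (FImp (A r3 0%N) (FImp (FImp (A r1 0%N) (FFalse L)) (A r2 0%N))).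
 have : sat E (fun=> 1) F by move=> x /= h3 h1; case: (H x h3)=> // /h1.
 move=> /jE h x h3; have := h x h3; have [?|n1] := pselect (S r1 x); [by left|by move=> h'; right; apply: h'].
have S0 x : ~ S set0 x.
 have : sat E (fun=> 1) (FAll 0 (FImp (A set0 0%N) (FFalse L))) by move=> y.
 by move=> /jE /(_ x).
have ST x : S setT x.
 have : sat E (fun=> 1) (FAll 0 (A setT 0%N)) by move=> y.
 by move=> /jE /(_ x).
pose K := [set x | forall n, S (P n) x].
have K1 : K 1.
 move=> m; have h0 : S (P m.+1) (j 1) by apply/Sj; exact: chain1.
 by have := trans2 _ _ _ (fun x y => @cP.2 m x y) _ _ h0 h0; rewrite mulVg.
have Kdiv x y : K x -> K y -> K (x^-1 * y).
 by move=> Kx Ky m; exact: trans2 _ _ _ (fun x y => @cP.2 m x y) _ _ (Kx m.+1) (Ky m.+1).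
have KV x : K x -> K x^-1 by move=> Kx; have := Kdiv _ _ Kx K1; rewrite mulg1.
have KM x y : K x -> K y -> K (x * y) by move=> /KV Kx Ky; have := Kdiv _ _ Kx Ky; rewrite invgK.
have /seteqP[_ /(_ (j g) I) h] : K = [set: Gs].
 have [_ tacK] := tac L E Gs Es j kappa jE kY ks.
 apply/seteqP; split=> //; apply: tacK; split=> //.
 - exists [set p|exists m, p = (A (P m) 0%N, fun=> j 1)]; first by move=> _ [m ->] k; exists 1.
  by apply/seteqP; split=> x /= h; [move=> _ [m ->]; exact: h|move=> m; exact: (h (A (P m) 0%N, fun=> j 1)) (ex_intro _ m erefl)].
 apply: contra kY => h; apply: card_le_trans h _.
 pose rp (C : set Gs) : Gs := xget 1 C.
 have rpP (C : set Gs) : lcosets_of K C -> exists2 x, C = [set x * h | h in K] & K (x^-1 * rp C).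
  move=> [x _ <-]; exists x=> //.
  have [|y hy] := @xgetPex _ 1 [set x * h | h in K]; first by exists (x * 1), 1.
  by rewrite /rp => <-; rewrite mulKg.
 apply: (@card_le_setT_inj _ _ _ (fun C => [set s | exists2 r : set G, s = inr r & S r (rp C)] : Y)) => C C' hC hC' e.
 have same r : S r (rp C) <-> S r (rp C').
  split=> h'; [have : [set s | exists2 r : set G, s = inr r & S r (rp C)] (inr r : nat + G + lfun L + lrel L) by exists r
        |have : [set s | exists2 r : set G, s = inr r & S r (rp C')] (inr r : nat + G + lfun L + lrel L) by exists r].
   by rewrite e => -[r' [->]].
  by rewrite -e => -[r' [->]].
 (* Elements satisfying the same predicates have the same color for every coloring of G, as finitely
    many color classes cover the extension. So a coset of K is determined by the predicates of its
    representative. *)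
 have near : K ((rp C)^-1 * rp C').
  move=> m; have [I [c hc]] := cP.1 m.
  have cover (s : seq I) x : S [set x | c x \in s] x -> exists i, S [set x | c x = i] x.
   elim: s => [|i s IH] hs.
    by case: (S0 x); case: (transU set0 set0 _ _ x hs).
   have [|h1|h2] := transU [set x | c x = i] [set x | c x \in s] _ _ x hs; [|by exists i|exact: IH].
   by move=> y /=; rewrite inE => /orP[/eqP ->|]; [left|right].
  have [i hi] : exists i : I, S [set x | c x = i] (rp C).
   apply: (cover (enum I)); have [|//|//] := transU [set x | c x \in enum I] [set x | c x \in enum I] setT _ (rp C) (ST _).
   by move=> y _; left; rewrite /= mem_enum.
  have hi' : S [set x | c x = i] (rp C') by apply/same.
  by apply: (trans2 _ _ _ _ _ _ hi hi') => x y /= <- /esym; exact: hc.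
 have [x Cx kx] := rpP C hC; have [x' Cx' kx'] := rpP C' hC'.
 have xx' : K (x^-1 * x').
  have -> : x^-1 * x' = (x^-1 * rp C) * ((rp C)^-1 * rp C') * (x'^-1 * rp C')^-1 by free_group.
  by apply: (KM); [apply: (KM)|exact: KV].
 rewrite Cx Cx'; apply/seteqP; split=> _ [k Kk <-].
  exists ((x^-1 * x')^-1 * k); first by apply: (KM)=> //; exact: KV.
  by free_group.
 by exists ((x^-1 * x') * k); [exact: KM | free_group].
exact/Sj.
Qed.
Local Close Scope group_scope.
Local Close Scope card_scope.

Local Open Scope group_scope.

(** * The Bohr compactification of a discrete group *)

Section BohrNeighborhoods.
Variable G : groupType.

(** The neighborhoods of 1 in the Bohr topology of the abstract group. *)
Definition bnb (N : set G) := exists P n, chain P /\ P n `<=` N.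

Lemma bnb_chain P n : chain P -> bnb (P n).
Proof. by move=> cP; exists P, n; split=> //; exact: subset_refl. Qed.
Lemma bnbI N M : bnb N -> bnb M -> bnb (N `&` M).
Proof.
move=> [P [n [cP PN]]] [Q [m [cQ QM]]]; exists (fun k => P (n + k)%N `&` Q (m + k)%N), 0%N; split.
 by apply: chainI; exact: chain_shift.
by move=> x; rewrite !addn0 => -[/PN ? /QM].
Qed.

Lemma bnbT : bnb setT.
Proof. by exists (fun=> setT), 0%N; do 2!split=> //; move=> n; exists unit, (fun=> tt). Qed.
Lemma bnb1 N : bnb N -> N 1.
Proof. by move=> [P [n [cP PN]]]; apply: PN; exact: chain1. Qed.
Lemma bnb_div N : bnb N -> exists2 M, bnb M & forall x y, M x -> M y -> N (x^-1 * y).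
Proof.
move=> [P [n [cP PN]]]; exists (P n.+1); first exact: bnb_chain.
by move=> x y Px Py; apply: PN; exact: cP.2.
Qed.

Lemma bnbV N : bnb N -> exists2 M, bnb M & forall x, M x -> N x^-1.
Proof. by move=> /bnb_div[M bM h]; exists M=> // x Mx; rewrite -[x^-1]mulg1; apply: h=> //; exact: bnb1. Qed.
Lemma bnbM N : bnb N -> exists2 M, bnb M & forall x y, M x -> M y -> N (x * y).
Proof.
move=> [P [n [cP PN]]]; exists (P n.+2); first exact: bnb_chain.
by move=> x y Px Py; apply: PN; exact: chainM.
Qed.

Lemma bnbJ N : bnb N -> exists2 M, bnb M & forall x g, M x -> N (x ^ g).
Proof.
move=> [P [n [cP PN]]]; exists [set x | forall g, P n (x ^ g)]; last by move=> x g h; apply: PN.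
by exists (fun n => [set x | forall g, P n (x ^ g)]), n; split=> //; exact: chain_core.
Qed.

Lemma bnb_colored N : bnb N -> finitely_colored N.
Proof. by move=> [P [n [cP PN]]]; exact: finitely_coloredS PN (cP.1 n). Qed.
Lemma minap_bnb : minap G <-> forall N, bnb N -> forall x, N x.
Proof.
split=> [Gm N [P [n [cP PN]]] x|h x P cP n]; first by apply: PN; exact: Gm.
by apply: h; exact: bnb_chain.
Qed.

Definition cauchy_filter (F : set (set G)) := forall N, bnb N -> exists2 A, F A & forall x y, A x -> A y -> N (x^-1 * y).

(** Round Cauchy filters are the minimal Cauchy filters, hence canonical names for the points of the
    completion: two of them whose members always meet are equal. *)
Definition round_filter (F : set (set G)) := forall A, F A -> exists B N, [/\ F B, bnb N & forall x y, B x -> N y -> A (x * y)].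

Definition round_cauchy (F : set (set G)) := [/\ ProperFilter (F : set_system G), cauchy_filter F & round_filter F].

Lemma round_cauchy_eq (F F' : set (set G)) : round_cauchy F -> round_cauchy F' ->
 (forall A A', F A -> F' A' -> exists x, A x /\ A' x) -> F = F'.
Proof.
have sub (H H' : set (set G)) : round_cauchy H -> round_cauchy H' ->
  (forall A A', H A -> H' A' -> exists x, A x /\ A' x) -> H `<=` H'.
 move=> [pH cH rH] [pH' cH' rH'] meet A /rH[B [N [HB bN BN]]].
 have [D H'D DN] := cH' N bN; have [x [Bx Dx]] := meet B D HB H'D.
 apply: filterS H'D => y Dy; rewrite -[y](mulVKg x); apply: BN=> //; exact: DN.
move=> rF rF' meet; apply/seteqP; split; first exact: sub.
by apply: sub=> // A A' FA FA'; have [x [? ?]] := meet A' A FA' FA; exists x.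
Qed.

Definition rounding (F : set (set G)) : set (set G) :=
 [set A|exists B N, [/\ F B, bnb N & forall x y, B x -> N y -> A (x * y)]].

Lemma round_cauchy_rounding (F : set (set G)) : ProperFilter (F : set_system G) -> cauchy_filter F -> round_cauchy (rounding F).
Proof.
move=> pF cF; split.
- split.
  by move=> [B [N [FB /bnb1 N1 h]]]; have [x Bx] := filter_ex FB; exact: h Bx N1.
 split.
 + by exists setT, setT; split=> //; [exact: filterT|exact: bnbT].
 + move=> A A' [B [N [FB bN h]]] [B' [N' [FB' bN' h']]]; exists (B `&` B'), (N `&` N').
  by split=> [||x y [? ?] [? ?]]; [exact: filterI|exact: bnbI|split; [exact: h|exact: h']].
 + by move=> A A' AA' [B [N [FB bN h]]]; exists B, N; split=> // x y Bx Ny; apply: AA'; exact: h.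
- move=> N bN; have [M1 bM1 h1] := bnb_div bN; have [M2 bM2 h2] := bnbM bM1.
 have bM := bnbI bM1 bM2.
 have [A FA hA] := cF _ bM2; exists [set z | exists2 x, A x & (M1 `&` M2) (x^-1 * z)].
  by exists A, (M1 `&` M2); split=> // x y Ax My; exists x=> //; rewrite mulKg.
 move=> z z' [x Ax [zx _]] [x' Ax' [_ zx']].
 have -> : z^-1 * z' = (x^-1 * z)^-1 * ((x^-1 * x') * (x'^-1 * z')) by free_group.
 by apply: h1=> //; apply: h2=> //; exact: hA.
- move=> A [B [N [FB bN h]]]; have [M bM hM] := bnbM bN.
 exists [set z | exists2 x, B x & M (x^-1 * z)], M; split=> //.
  by exists B, M; split=> // x y Bx My; exists x=> //; rewrite mulKg.
 move=> z y [x Bx zx] My; have -> : z * y = x * ((x^-1 * z) * y) by free_group.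
 by apply: h=> //; exact: hM.
Qed.

(** Total boundedness: an ultrafilter contains one of the finitely many color classes. *)
Lemma cauchy_ultra (F : set (set G)) : UltraFilter (F : set_system G) -> cauchy_filter F.
Proof.
move=> UF N /bnb_colored[I [c hc]].
suff [i Fi] : exists i, F [set x | c x = i].
 by exists [set x | c x = i]=> // x y <- /esym; exact: hc.
apply: contrapT => hn.
have : F [set x | forall i, c x <> i].
 apply: filter_forall => i; have [h|//] := in_ultra_setVsetC [set x | c x = i] UF.
 by case: hn; exists i.
by move=> /filter_ex[x /(_ (c x))].
Qed.

(** In (x y)^-1 (x' y') the quotient x^-1 x' appears conjugated by y. This is harmless because Bohr
    neighborhoods contain conjugation invariant ones, by [bnbJ]. *)
Lemma round_cauchy_mul F F' : round_cauchy F -> round_cauchy F' ->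
 round_cauchy [set A|exists B B', [/\ F B, F' B' & forall x y, B x -> B' y -> A (x * y)]].
Proof.
move=> [pF cF rF] [pF' cF' rF']; split.
- split.
  move=> [B [B' [FB FB' h]]]; have [x Bx] := filter_ex FB; have [y By] := filter_ex FB'.
  exact: h Bx By.
 split.
 + by exists setT, setT; split=> //; exact: filterT.
 + move=> A1 A2 [B1 [B1' [? ? h]]] [B2 [B2' [? ? h']]]; exists (B1 `&` B2), (B1' `&` B2').
  by split=> [||x y [? ?] [? ?]]; [exact: filterI|exact: filterI|split; [exact: h|exact: h']].
 + by move=> A A' AA' [B [B' [? ? h]]]; exists B, B'; split=> // x y Bx Ny; apply: AA'; exact: h.
- move=> N bN; have [M bM hM] := bnbM bN; have [M1 bM1 hM1] := bnbJ bM.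
 have [B FB hB] := cF _ bM1; have [B' FB' hB'] := cF' _ bM.
 exists [set z|exists x y, [/\ B x, B' y & z = x * y]].
  by exists B, B'; split=> // x y Bx By; exists x, y.
 move=> z z' [x [y [Bx By ->]]] [x' [y' [Bx' By' ->]]].
 have -> : (x * y)^-1 * (x' * y') = (x^-1 * x') ^ y * (y^-1 * y') by free_group.
 by apply: hM; [apply: hM1; exact: hB|exact: hB'].
- move=> A [B [B' [FB FB' h]]]; have [C [N [FC bN hC]]] := rF' _ FB'.
 exists [set z|exists x y, [/\ B x, C y & z = x * y]], N; split=> //.
  by exists B, C; split=> // x y Bx Cy; exists x, y.
 by move=> _ y [x [u [Bx Cu ->]]] Ny; rewrite -mulgA; apply: h=> //; exact: hC.
Qed.

Lemma round_cauchy_inv F : round_cauchy F -> round_cauchy [set A | F [set x | A x^-1]].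
Proof.
move=> [pF cF rF]; split.
- split; first by move=> /filter_ex[x].
 split.
 + exact: filterT.
 + by move=> A A' FA FA'; exact: filterI FA FA'.
 + by move=> A A' AA' FA; apply: filterS FA => x /AA'.
- move=> N bN; have [M bM hM] := bnbJ bN; have [M' bM' hM'] := bnbV bM.
 have [B FB hB] := cF _ bM'; exists [set x | B x^-1].
  by apply: (filterS (F := F) _ FB) => x Bx; rewrite /= invgK.
 move=> x y Bx By; have -> : x^-1 * y = ((x^-1^-1 * y^-1)^-1) ^ x by free_group.
 by apply: hM; apply: hM'; exact: hB.
- move=> A /rF[B [N [FB bN hB]]]; have [M bM hM] := bnbJ bN; have [M' bM' hM'] := bnbV bM.
 exists [set x | B x^-1], M'; split=> //; first by apply: (filterS (F := F) _ FB) => x Bx; rewrite /= invgK.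
 move=> x y Bx My; rewrite -[x * y]invgK.
 have -> : (x * y)^-1 = x^-1 * (y^-1) ^ x^-1 by free_group.
 by apply: hB=> //; apply: hM; exact: hM'.
Qed.

Lemma round_cauchy_point g : round_cauchy [set A | exists2 N, bnb N & forall x, N x -> A (g * x)].
Proof.
have -> : [set A | exists2 N, bnb N & forall x, N x -> A (g * x)] = rounding (principal_filter g).
 apply/seteqP; split=> A; first by move=> [N bN h]; exists [set g], N; split=> // _ y ->; exact: h.
 by move=> [B [N [FB bN h]]]; exists N=> // x Nx; apply: h=> //; exact: FB.
have U := principal_filter_ultra g; exact: (round_cauchy_rounding (@ultra_proper _ _ U) (cauchy_ultra U)).
Qed.
End BohrNeighborhoods.

Section BohrCompactification.
Variable G : groupType.

Definition bohr := {F : set (set G) | round_cauchy F}.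

HB.instance Definition _ := gen_eqMixin bohr.
HB.instance Definition _ := gen_choiceMixin bohr.

Lemma bohr_eq (F F' : bohr) : (forall A A', sval F A -> sval F' A' -> exists x, A x /\ A' x) -> F = F'.
Proof.
case: F F' => F hF [F' hF'] /= h; have e := round_cauchy_eq hF hF' h.
by move: hF hF' {h}; rewrite e => hF hF'; congr exist; exact: Prop_irrelevance.
Qed.

Definition bohr_mul (F F' : bohr) : bohr := exist _ _ (round_cauchy_mul (svalP F) (svalP F')).
Definition bohr_inv (F : bohr) : bohr := exist _ _ (round_cauchy_inv (svalP F)).
Definition bohr_of (g : G) : bohr := exist _ _ (round_cauchy_point g).

Lemma bohr_ex (F : bohr) A : sval F A -> exists x, A x.
Proof. by case: (svalP F) => pF _ _ /filter_ex. Qed.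
Lemma bohrI (F : bohr) A B : sval F A -> sval F B -> sval F (A `&` B).
Proof. by case: (svalP F) => pF _ _; exact: filterI. Qed.
Lemma bohrS (F : bohr) A B : sval F A -> A `<=` B -> sval F B.
Proof. by case: (svalP F) => pF _ _ FA AB; exact: filterS FA. Qed.
Lemma bohr_ofP g A : sval (bohr_of g) A -> A g.
Proof. by move=> [N /bnb1 N1 h]; rewrite -[g]mulg1; exact: h. Qed.
Lemma bohr_mulA : associative bohr_mul.
Proof.
move=> F1 F2 F3; apply: bohr_eq => A A' [B1 [C [f1 [B2 [B3 [f2 f3 h1]]] h2]]] [C' [B3' [[B1' [B2' [f1' f2' h1']]] f3' h2']]].
have [x [x1 x2]] := bohr_ex (bohrI f1 f1'); have [y [y1 y2]] := bohr_ex (bohrI f2 f2').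
have [z [z1 z2]] := bohr_ex (bohrI f3 f3').
by exists (x * (y * z)); split; [apply: h2=> //; exact: h1|rewrite mulgA; apply: h2' => //; exact: h1'].
Qed.

Lemma bohr_mul1 : left_id (bohr_of 1) bohr_mul.
Proof.
move=> F; apply: bohr_eq => A A' [B [C [/bohr_ofP B1 FC h]]] FA'.
have [x [x1 x2]] := bohr_ex (bohrI FC FA'); exists x; split=> //.
by rewrite -[x]mul1g; exact: h.
Qed.

Lemma bohr_1mul : right_id (bohr_of 1) bohr_mul.
Proof.
move=> F; apply: bohr_eq => A A' [B [C [FB /bohr_ofP C1 h]]] FA'.
have [x [x1 x2]] := bohr_ex (bohrI FB FA'); exists x; split=> //.
by rewrite -[x]mulg1; exact: h.
Qed.

Lemma bohr_mulV : left_inverse (bohr_of 1) bohr_inv bohr_mul.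
Proof.
move=> F; apply: bohr_eq => A A' [B [C [/= FB FC h]]] /bohr_ofP A1; exists 1; split=> //.
have [x [x1 x2]] := bohr_ex (bohrI FB FC); rewrite -(mulVg x); exact: h.
Qed.

Lemma bohr_mulVr : right_inverse (bohr_of 1) bohr_inv bohr_mul.
Proof.
move=> F; apply: bohr_eq => A A' [B [C [/= FB FC h]]] /bohr_ofP A1; exists 1; split=> //.
have [x [x1 x2]] := bohr_ex (bohrI FB FC); rewrite -(mulgV x); exact: h.
Qed.

HB.instance Definition _ := isGroup.Build bohr bohr_mulA bohr_mul1 bohr_1mul bohr_mulV bohr_mulVr.

Definition bohr_nbhs (F : bohr) : set_system bohr :=
 [set O | exists2 A, sval F A & forall F' : bohr, sval F' A -> O F'].

HB.instance Definition _ := hasNbhs.Build bohr bohr_nbhs.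

Lemma bohr_nbhs_filter (F : bohr) : ProperFilter (nbhs F).
Proof.
split; first by move=> [A FA h]; exact: h FA.
split.
- by exists setT=> //; case: (svalP F) => pF _ _; exact: filterT.
- move=> O O' [A FA h] [A' FA' h']; exists (A `&` A'); first exact: bohrI.
 by move=> F' FA''; split; [apply: h|apply: h']; apply: (bohrS FA'') => x [].
- by move=> O O' OO' [A FA h]; exists A=> // F' /h /OO'.
Qed.

Lemma bohr_nbhs_singleton (F : bohr) (O : set bohr) : nbhs F O -> O F.
Proof. by move=> [A FA h]; exact: h. Qed.
Lemma bohr_nbhs_nbhs (F : bohr) (O : set bohr) : nbhs F O -> nbhs F (nbhs^~ O).
Proof. by move=> [A FA h]; exists A=> // F' F'A; exists A. Qed.

HB.instance Definition _ := Nbhs_isNbhsTopological.Build bohr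
 bohr_nbhs_filter bohr_nbhs_singleton bohr_nbhs_nbhs.

Lemma bohr_mulg_continuous : continuous (fun x : bohr * bohr => (x.1 * x.2 : bohr)).
Proof.
move=> [F F'] O [A [B [B' [FB FB' h]]] hO].
exists ([set H : bohr | sval H B], [set H : bohr | sval H B']); first by split; [exists B|exists B'].
by move=> [H H'] /= [HB HB']; apply: hO; exists B, B'.
Qed.

Lemma bohr_invg_continuous : continuous (fun x : bohr => x^-1).
Proof. by move=> F O [A FA hO]; exists [set x | A x^-1]=> // H HA; apply: hO. Qed.

HB.instance Definition _ := Group_isTopGroup.Build bohr bohr_mulg_continuous bohr_invg_continuous.

(** An ultrafilter on the completion induces a filter on G of the sets belonging to almost every
    point. Any ultrafilter of G above it is Cauchy, and its rounding is the limit. *)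
Lemma bohr_compact : compact [set: bohr].
Proof.
rewrite compact_ultra => UU UUU _.
pose Phi : set_system G := [set A | UU [set F : bohr | sval F A]].
have pPhi : ProperFilter Phi.
 split; first by move=> h; have {}h : UU [set F : bohr | sval F set0] := h; apply: (@filter_not_empty _ UU _); apply: filterS h => F /= /bohr_ex[x []].
 split.
 - apply: (filterS (F := UU) _ filterT) => F _; case: (svalP F) => pF _ _; exact: filterT.
 - move=> A B FA FB; apply: (filterS (F := UU) _ (filterI (F := UU) FA FB)) => F [/= ? ?]; exact: bohrI.
 - by move=> A B AB FA; apply: (filterS (F := UU) _ FA) => F /= FA'; exact: bohrS AB.
have [V [UV PV]] := ultraFilterLemma pPhi.
pose p : bohr := exist _ _ (round_cauchy_rounding (@ultra_proper _ V UV) (cauchy_ultra UV)).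
exists p; split=> // O [A [A' [N [VA' bN hA]]] hO].
apply: (filterS (P := [set F : bohr | sval F A]))=> //.
have [//|nA] := in_ultra_setVsetC [set F : bohr | sval F A] UUU.
have [M bM hM] := bnbV bN.
(* If almost no F contains A, almost every F contains the points M-close to the complement of A. In
   the limit such a point lies in A', while A' N is inside A: a contradiction. *)
have : Phi [set z | exists2 x, ~ A x & M (x^-1 * z)].
 apply: filterS nA => F /= nFA; have [pF cF rF] := svalP F.
 have [D FD hD] := cF _ bM.
 have [d0 [Dd0 nAd0]] : exists d, D d /\ ~ A d.
  apply: contrapT => h; apply: nFA; apply: (bohrS FD) => d Dd; apply: contrapT => nAd.
  by apply: h; exists d.
 by apply: (bohrS FD) => d Dd; exists d0=> //; exact: hD.
move=> /PV VC; have [a [A'a [x nAx Ma]]] := filter_ex (filterI VA' VC).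
by case: nAx; rewrite (_ : x = a * (x^-1 * a)^-1); [apply: hA=> //; exact: hM | free_group].
Qed.

Lemma bohr_hausdorff : hausdorff_space bohr.
Proof.
move=> F F' cl; apply: bohr_eq => A A' FA FA'.
have [H [HA HA']] := cl [set H : bohr | sval H A] [set H : bohr | sval H A'] (ex_intro2 _ _ A FA (fun _ h => h)) (ex_intro2 _ _ A' FA' (fun _ h => h)).
exact: bohr_ex (bohrI HA HA').
Qed.

Lemma bohr_ofM : {morph bohr_of : x y / x * y}.
Proof.
move=> x y; apply: bohr_eq => A A' /bohr_ofP Axy [B [B' [/bohr_ofP Bx /bohr_ofP By h]]].
by exists (x * y); split=> //; exact: h.
Qed.

Lemma bohr_of_round (F : bohr) A : sval F A -> exists2 B, sval F B & forall x, B x -> sval (bohr_of x) A.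
Proof.
by case: (svalP F) => pF cF rF /rF[B [N [FB bN h]]]; exists B=> // x Bx; exists N=> // y; exact: h.
Qed.

Lemma bohr_of_dense : dense (range bohr_of).
Proof.
move=> O [F OF] oO; have [A FA hO] : nbhs F O by exact: open_nbhs_nbhs.
have [B FB hB] := bohr_of_round FA; have [x Bx] := bohr_ex FB.
by exists (bohr_of x); split; [apply: hO; exact: hB|exists x].
Qed.
End BohrCompactification.

Lemma compact_nbhs_cover (T : topologicalType) (K : set T) (U : T -> set T) : compact K ->
 (forall x, nbhs x (U x)) -> exists s : seq T, (forall x, x \in s -> K x) /\
  forall y, K y -> exists2 x, x \in s & U x y.
Proof.
move=> Kc hU; apply: contrapT => hn.
pose C (s : seq T) := [set y | K y /\ forall x, x \in s -> K x -> ~ U x y].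
have Cn s : exists y, C s y.
 apply: contrapT => h; apply: hn; exists [seq x <- s | `[< K x >]]; split.
  by move=> x; rewrite mem_filter => /andP[/asboolP].
 move=> y Ky; apply: contrapT => h'; apply: h; exists y; split=> // x xs Kx Ux; apply: h'; exists x=> //.
 by rewrite mem_filter xs andbT; apply/asboolP.
pose F : set_system T := [set A|exists s, C s `<=` A].
have pF : ProperFilter F.
 split; first by move=> [s h]; have [y /h] := Cn s.
 split.
 - by exists [::].
 - move=> A B [s hs] [t ht]; exists (s ++ t) => y [Ky Uy].
  by split; [apply: hs|apply: ht]; split=> // x xs; apply: Uy; rewrite mem_cat xs ?orbT.
 - by move=> A B AB [s hs]; exists s => y /hs /AB.
have [|p [Kp clp]] := Kc F pF; first by exists [::] => y [].
have hp : F (C [:: p]) by exists [:: p].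
have [y [[_ h1] h2]] := clp _ _ hp (hU p).
by apply: (h1 p) h2; rewrite ?inE.
Qed.

Section CompactGroups.
Variable K : topGroupType.

Lemma nbhs1_div (W : set K) : nbhs 1 W -> exists2 V, nbhs 1 V & forall x y, V x -> V y -> W (x^-1 * y).
Proof.
move=> nW.
have c : (fun xy : K * K => xy.1^-1 * xy.2) @ ((1 : K), (1 : K)) --> (1^-1 * 1 : K).
 by apply: cvgMg; [apply: cvgVg; exact: cvg_fst|exact: cvg_snd].
rewrite invg1 mulg1 in c.
have [[A B] [nA nB] AB] := c W nW; exists (A `&` B); first exact: filterI.
by move=> x y [Ax _] [_ By]; exact: (AB (x, y)).
Qed.

Hypothesis K_compact : compact [set: K].

Lemma compact_nbhs1_colored (W : set K) : nbhs 1 W -> finitely_colored W.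
Proof.
move=> /nbhs1_div[V nV VW]; have [s [_ hs]] := compact_nbhs_cover K_compact (fun x => nbhs_translate1 x nV).
by apply: (finitely_colored_cover (s := s)) VW => y; exact: hs.
Qed.

Lemma compact_bnb (G : groupType) (f : G -> K) (W : set K) : {morph f : x y / x * y} ->
 nbhs 1 W -> bnb [set x | W (f x)].
Proof.
move=> fM nW.
have next (V : set K) : exists V', nbhs 1 V -> nbhs 1 V' /\ forall x y, V' x -> V' y -> V (x^-1 * y).
 by have [/nbhs1_div[V' ? ?]|nV] := pselect (nbhs 1 V); [exists V'|exists V].
have [nx hnx] := choice next; pose V n := iter n nx W.
have nV n : nbhs 1 (V n) by elim: n => [//|n IH]; exact: (hnx _ IH).1.
have cV : chain V.
 by split=> [n|n x y]; [exact: compact_nbhs1_colored|exact: (hnx _ (nV n)).2].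
by exists (fun n => [set x | V n (f x)]), 0%N; split=> //; exact: chain_preimage.
Qed.
End CompactGroups.

(** * Universal property of the Bohr compactification *)

Section Universality.
Variables (G : groupType) (K : topGroupType) (f : G -> K).
Hypotheses (K_compact : compact [set: K]) (K_hausdorff : hausdorff_space K) (fM : {morph f : x y / x * y}).

Let f1 : f 1 = 1.
Proof. by apply: (mulgI (f 1)); rewrite -fM !mulg1. Qed.
Let fV x : f x^-1 = (f x)^-1.
Proof. by apply/eqP; rewrite -mulg_eq1 -fM mulVg f1. Qed.
Lemma nbhs_div_translate (p : K) (O : set K) : nbhs p O -> exists2 W, nbhs (1 : K) W &
 forall x y, W (p^-1 * x) -> W (y^-1 * x) -> O y.
Proof.
move=> nO; have [V nV hV] := nbhs1_div (nbhs1_translate nO).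
have [W nW hW] := nbhs1_div nV.
exists W=> // x y h1 h2.
have W1 : W 1 by exact: nbhs_singleton nW.
have -> : y = p * ((p^-1 * x)^-1^-1 * (y^-1 * x)^-1) by free_group.
apply: (hV ((p^-1 * x)^-1)); first by rewrite -[_^-1]mulg1; exact: hW.
by rewrite -[_^-1]mulg1; exact: hW.
Qed.

(** The extension of f to the completion. It exists because the image of F is Cauchy, by
    [compact_bnb], and has a cluster point in the compact K. *)
Definition bohr_lim (F : bohr G) : K := xget 1 [set p | forall O, nbhs p O -> sval F [set x | O (f x)]].

Lemma bohr_limP (F : bohr G) (O : set K) : nbhs (bohr_lim F) O -> sval F [set x | O (f x)].
Proof.
move: O.
suff : [set p | forall O, nbhs p O -> sval F [set x | O (f x)]] (bohr_lim F) by [].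
apply: xgetPex; have [pF cF rF] := svalP F.
have pfF : ProperFilter (fun O : set K => sval F [set x | O (f x)]).
 split; first by move=> h; have [x []] := filter_ex h.
 split; [exact: filterT|by move=> A B; exact: filterI|by move=> A B AB; apply: filterS => x /AB].
have [|p [_ clp]] := K_compact pfF; first exact: filterT.
exists p => O nO; have [W nW hW] := nbhs_div_translate nO.
have [V nV hV] := nbhs1_div nW.
have [A FA hA] := cF _ (compact_bnb K_compact fM nV).
have [_ [/= [a Aa <-] h]] := clp (f @` A) _ (filterS (fun x Ax => ex_intro2 _ _ x Ax erefl) FA) (nbhs_translate1 p nV).
have V1 : V 1 by exact: nbhs_singleton nV.
apply: filterS FA => x Ax; apply: (hW (f a)); first by rewrite -[_ * _]mul1g -{1}invg1; exact: hV.
by rewrite -fV -fM -[f _]mul1g -{1}invg1; apply: hV=> //; exact: hA.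
Qed.

Lemma bohr_lim_unique (F : bohr G) p : (forall O, nbhs p O -> sval F [set x | O (f x)]) -> bohr_lim F = p.
Proof.
move=> h; apply: K_hausdorff => A B nA nB.
have [x [? ?]] := bohr_ex (bohrI (bohr_limP nA) (h B nB)).
by exists (f x).
Qed.

Lemma bohr_lim_of g : bohr_lim (bohr_of g) = f g.
Proof.
apply: bohr_lim_unique => O nO.
exists [set x | O (f g * f x)]; first exact: (@compact_bnb K K_compact G f [set h | O (f g * h)] fM (nbhs1_translate nO)).
by move=> x /=; rewrite fM.
Qed.

Lemma bohr_limM : {morph bohr_lim : x y / x * y}.
Proof.
move=> F F'; apply: bohr_lim_unique => O nO.
have c : (fun xy : K * K => xy.1 * xy.2) @ (bohr_lim F, bohr_lim F') --> bohr_lim F * bohr_lim F'.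
 by apply: cvgMg; [exact: cvg_fst|exact: cvg_snd].
have [[A B] [/= nA nB] AB] := c O nO.
exists [set x | A (f x)], [set x | B (f x)]; split; [exact: bohr_limP|exact: bohr_limP |].
by move=> x y Ax By /=; rewrite fM; exact: (AB (f x, f y)).
Qed.

Lemma bohr_lim_continuous : continuous bohr_lim.
Proof.
move=> F O nO; have [W nW hW] := nbhs_div_translate nO.
exists [set x | W ((bohr_lim F)^-1 * f x)]; first exact: (bohr_limP (nbhs_translate1 _ nW)).
move=> F' F'A; have [x [/= h1 h2]] := bohr_ex (bohrI F'A (bohr_limP (nbhs_translate1 (bohr_lim F') nW))).
exact: hW h1 h2.
Qed.

Lemma bohr_lim_universal (g : bohr G -> K) : continuous g -> (forall x, g (bohr_of x) = f x) -> g = bohr_lim.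
Proof.
move=> cg gf; apply/funext => F; apply/esym; apply: bohr_lim_unique => O nO.
have [A FA hO] := cg F O nO; have [B FB hB] := bohr_of_round FA.
by apply: (bohrS FB) => x Bx; rewrite /= -gf; apply: hO; exact: hB.
Qed.
End Universality.

Lemma bohr_of_compactification (G : groupType) :
 is_bohr_compactification (@bohr_of G : discrete_topology G -> bohr G).
Proof.
split.
- exact: bohr_compact.
- exact: bohr_hausdorff.
- split; first by move=> x y; exact: (@bohr_ofM G x y).
 by move=> x O /nbhs_singleton Ox; apply: (filterS _ (discrete_set1 (x : discrete_topology G))) => _ ->.
- exact: bohr_of_dense.
move=> K f Kc Kh [fM _]; exists (bohr_lim f); split.
 split; first by split; [exact: bohr_limM|exact: bohr_lim_continuous].
 by apply/funext => x; apply/esym; exact: (@bohr_lim_of G K f Kc Kh fM x).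
move=> g [[_ cg] gf]; apply/esym; apply: bohr_lim_universal=> // x.
by rewrite gf.
Qed.

Theorem von_neumann_minap (G : groupType) :
 von_neumann_radical (discrete_topology G) = [set: discrete_topology G] <-> minap G.
Proof.
split=> [h|Gm].
 apply/minap_bnb => N bN x.
 have : von_neumann_radical (discrete_topology G) (x : discrete_topology G) by rewrite h.
 move=> /(_ _ _ (bohr_of_compactification G)) e.
 have : sval (bohr_of (1 : G)) N by exists N=> // y; rewrite mul1g.
 rewrite (_ : bohr_of 1 = bohr_of x); last by rewrite e.
 by move=> /bohr_ofP.
apply/seteqP; split=> // x _ B b [Bc Bh [bM _] _ _].
apply: Bh => U V nU nV.
exists (b x); split; first exact: nbhs_singleton nU.
exact: ((minap_bnb G).1 Gm _ (@compact_bnb B Bc G b V bM nV) x).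
Qed.
Local Close Scope group_scope.

(** * The adjoint action of exponentials *)

Lemma norm_mulmx3_le (R : realType) m p q r (A : 'M[R]_(m, p)) (B : 'M[R]_(p, q)) (C : 'M[R]_(q, r)) (e : R) :
 `|B| <= e -> `|A *m B *m C| <= p%:R * `|A| * (q%:R * `|C|) * e.
Proof.
move=> Be; rewrite -mulmxA; apply: mulmx_le_trans.
rewrite -[X in _ <= X]mulrA; apply: ler_wpM2l; first by rewrite mulr_ge0.
apply: mulmx_le_trans; rewrite -!mulrA; apply: ler_wpM2l=> //.
by rewrite mulrC; apply: ler_wpM2l.
Qed.

Section AdjointExponential.
Variables (R : realType) (n : nat) (G : topGroupType) (hG : hausdorff_space G).
Variable c : lie_chart R n.+1 G.
Notation V := 'rV[R]_n.+1.
Notation Exp := (Exp c).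
Notation Ad := (Ad hG c).
Notation ad := (ad hG c).

Definition ad_basis (i : 'I_n.+1) : 'M[R]_n.+1 := ad (delta_mx 0 i).
Notation a := ad_basis.

Lemma ad0 : ad 0 = 0.
Proof. by have := adZ hG c 0 0; rewrite !scale0r. Qed.
Lemma adN X : ad (- X) = - ad X.
Proof. by rewrite -scaleN1r adZ scaleN1r. Qed.
Lemma adm_ad X : adm a X = ad X.
Proof.
rewrite /adm [in RHS](row_sum_delta X).
elim/big_rec2: _ => [|i x y _ ->]; first by rewrite ad0.
by rewrite adD adZ.
Qed.

Lemma lie_alg_ad : lie_alg a.
Proof. by split=> [x|x y]; rewrite !adm_ad; [exact: ad_self|exact: ad_jacobi]. Qed.
Lemma killing_Ad g x y : killing a (x *m Ad g) (y *m Ad g) = killing a x y.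
Proof.
rewrite /killing !adm_ad !ad_conj.
have -> : Ad g^-1%g *m ad x *m Ad g *m (Ad g^-1%g *m ad y *m Ad g) = Ad g^-1%g *m (ad x *m ad y *m Ad g).
 by rewrite !mulmxA -[Ad g^-1%g *m ad x *m Ad g *m Ad g^-1%g]mulmxA AdV mulmx1.
by rewrite mxtrace_mulC -!mulmxA AdV mulmx1.
Qed.

Lemma norm_row_mulmx_near (v : V) (E : 'M[R]_n.+1) (e : R) : `|E| <= e -> `|v *m (1%:M + E)| <= (1 + n.+1%:R * e) * `|v|.
Proof.
move=> hE; rewrite mulmxDr mulmx1; apply: normD_le_trans; rewrite mulrDl mul1r lerD2l.
apply: mulmx_le_trans; rewrite -!mulrA ler_wpM2l // mulrC.
by apply: ler_wpM2r.
Qed.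

(** Euler's formula. With h = 2^-k, the matrices A = Ad (Exp (h X)) and B = 1 + h ad X differ by
    O(h^2), and A^(2^k) = Ad (Exp X). A telescoping sum over 2^k factors leaves an error O(h),
    provided the intermediate powers stay bounded. *)
Lemma AdExp_limit X : exists2 M : R, 0 <= M & exists K, forall k, (K <= k)%N ->
 `|Ad (Exp X) - (1%:M + 2^-1 ^+ k *: ad X) ^+ (2 ^ k)| <= M * 2^-1 ^+ k.
Proof.
have [d d0 [C C0 [hC1 hC2]]] := ad_bounds hG c.
have [d' d0' [C' C0' hA]] := Ad_near1 hG c.
pose N := n.+1%:R : R.
have N0 : 0 <= N by [].
(* Both A and B multiply norms by at most 1 + h b, so all powers up to 2^k are bounded by
   [expR b]. *)
pose b := N * ((C + C') * `|X|).
have b0 : 0 <= b by rewrite !mulr_ge0 // addr_ge0.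
pose M := expR b * (expR b * (N * (C * `|X| ^+ 2))).
have M0 : 0 <= M by rewrite !mulr_ge0 // ?expR_ge0 // exprn_ge0.
exists M=> //.
have [K hK] := half_small X d0; have [K' hK'] := half_small X d0'.
exists (maxn K K') => k; rewrite geq_max => /andP[/hK kK /hK' kK'].
set h := 2^-1 ^+ k; have h0 : 0 < h := halfX_gt0 R k.
set A := Ad (Exp (h *: X)); set B : 'M[R]_n.+1 := 1%:M + h *: ad X.
have nX : `|h *: X| = h * `|X| by rewrite normrZ gtr0_norm.
have powA j : A ^+ j = Ad (Exp ((j%:R * h) *: X)).
 elim: j => [|j IH]; first by rewrite expr0 mul0r scale0r Exp0 Ad1.
 by rewrite exprSr IH -natr1 mulrDl mul1r (ExpD hG) AdM.
have e2 : A ^+ (2 ^ k) = Ad (Exp X).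
 by rewrite powA natrX exp2_halfX scale1r.
have step (u : V) : `|u *m A| <= (1 + h * b) * `|u|.
 have -> : A = 1%:M + (A - 1%:M) by rewrite addrC subrK.
 have -> : 1 + h * b = 1 + N * ((C + C') * (h * `|X|)) by rewrite /b; ring.
 apply: norm_row_mulmx_near; apply: (le_trans (hA _ kK')); rewrite nX.
 by apply: ler_wpM2r; [rewrite mulr_ge0 // ltW|rewrite lerDr].
have stepB (u : V) : `|u *m B| <= (1 + h * b) * `|u|.
 have -> : 1 + h * b = 1 + N * ((C + C') * (h * `|X|)) by rewrite /b; ring.
 apply: norm_row_mulmx_near; rewrite normrZ gtr0_norm // mulrCA; apply: ler_wpM2l; first exact: ltW.
 by apply: (le_trans (hC1 X)); apply: ler_wpM2r=> //; rewrite lerDl.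
have q1 : 1 <= 1 + h * b by rewrite lerDl mulr_ge0 // ltW.
have q0 : 0 <= 1 + h * b by apply: le_trans q1.
have powB j (u : V) : `|u *m B ^+ j| <= (1 + h * b) ^+ j * `|u|.
 elim: j => [|j IH]; first by rewrite !expr0 mulmx1 mul1r.
 rewrite exprSr [B ^+ j * B]/(_ *m _) mulmxA; apply: (le_trans (stepB _)).
 by rewrite exprS -mulrA ler_wpM2l.
have pj j : (j <= 2 ^ k)%N -> (1 + h * b) ^+ j <= expR b.
 move=> jk; apply: (@le_trans _ _ (expR (h * b) ^+ j)).
  by apply: lerXn2r; rewrite ?nnegrE ?expR_ge0 // expR_ge1Dx.
 have jh : j%:R * h <= 1.
  by have := ler_wpM2r (ltW h0) (_ : j%:R <= 2 ^+ k); rewrite exp2_halfX; apply; rewrite -natrX ler_nat.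
 by rewrite -expRM_natl ler_expR mulrA; have := ler_wpM2r b0 jh; rewrite mul1r.
have AB : `|A - B| <= C * (h * `|X|) ^+ 2.
 have := hC2 (h *: X) kK; rewrite nX adZ; congr (`|_| <= _).
 by rewrite /B opprD addrA.
rewrite -e2; apply: mx_norm_le_op => [|u]; first by rewrite mulr_ge0 // ltW.
pose kap := expR b * `|u| * (N * (C * (h * `|X|) ^+ 2)).
have kap0 : 0 <= kap by rewrite !mulr_ge0 ?expR_ge0 ?exprn_ge0 // mulr_ge0 // ltW.
have main j : (j <= 2 ^ k)%N -> `|u *m A ^+ j - u *m B ^+ j| <= j%:R * (1 + h * b) ^+ j * kap.
 elim: j => [|j IH] jk; first by rewrite !expr0 subrr normr0 !mul0r.
 have -> : u *m A ^+ j.+1 - u *m B ^+ j.+1 = (u *m A ^+ j - u *m B ^+ j) *m A + u *m B ^+ j *m (A - B).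
  by rewrite !exprSr [A ^+ j * A]/(_ *m _) [B ^+ j * B]/(_ *m _) !mulmxA mulmxBl mulmxBr addrA subrK.
 apply: normD_le_trans.
 have i1 : `|(u *m A ^+ j - u *m B ^+ j) *m A| <= (1 + h * b) * (j%:R * (1 + h * b) ^+ j * kap).
  by apply: (le_trans (step _)); apply: ler_wpM2l=> //; apply: IH; exact: ltnW.
 have i2 : `|u *m B ^+ j *m (A - B)| <= kap.
  apply: mulmx_le_trans; rewrite /kap -/N -mulrA mulrCA.
  apply: ler_pM=> //; first by rewrite mulr_ge0.
   by apply: (le_trans (powB j u)); apply: ler_wpM2r=> //; apply: pj; exact: ltnW.
  by apply: ler_wpM2l.
 apply: (le_trans (lerD i1 i2)).
 have e1 : j.+1%:R * (1 + h * b) ^+ j.+1 * kap = (1 + h * b) * (j%:R * (1 + h * b) ^+ j * kap) + (1 + h * b) ^+ j.+1 * kap.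
  by rewrite -natr1 exprS; ring.
 rewrite e1 lerD2l; rewrite -{1}[kap]mul1r; apply: ler_wpM2r=> //; exact: exprn_ege1.
rewrite mulmxBr; apply: (le_trans (main _ (leqnn _))).
have -> : M * h * `|u| = 2 ^+ k * expR b * kap.
 transitivity (2 ^+ k * h * (M * h * `|u|)); first by rewrite exp2_halfX mul1r.
 by rewrite /M /kap; ring.
rewrite natrX; apply: ler_wpM2r=> //; apply: ler_wpM2l; first exact: exprn_ge0.
exact: pj.
Qed.

(* Multiplicatively closed linear conditions pass from ad X to Ad (Exp X), as the latter is a limit of powers of 1 + 2^-k ad X. *)
Lemma AdExp_stable m (W : 'M[R]_(m, n.+1)) X : (W *m ad X <= W)%MS -> (W *m Ad (Exp X) <= W)%MS.
Proof.
move=> hW; have [M M0 [K hK]] := AdExp_limit X.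
have stab (t : R) j : (W *m (1%:M + t *: ad X) ^+ j <= W)%MS.
 elim: j => [|j IH]; first by rewrite expr0 mulmx1.
 rewrite exprS [_ * _]/(_ *m _) mulmxA mulmxDr mulmx1 mulmxDl addmx_sub // -scalemxAr -scalemxAl scalemx_sub //.
 by apply: submx_trans IH; exact: submxMr.
rewrite submxE -normr_le0.
apply: (le_of_halfX (M := n.+1%:R * `|W| * (n.+1%:R * `|cokermx W|) * M)); exists K => k kK; rewrite add0r.
have /eqP h0 : W *m (1%:M + 2^-1 ^+ k *: ad X) ^+ (2 ^ k) *m cokermx W == 0 by rewrite -submxE.
rewrite -[W *m _ *m _]subr0 -h0 -mulmxBl -mulmxBr -[X in _ <= X]mulrA; apply: norm_mulmx3_le; exact: hK.
Qed.

Lemma AdExp_vec_limit X (v l : V) (f : nat -> V) (M : R) : (forall k, v *m (1%:M + 2^-1 ^+ k *: ad X) ^+ (2 ^ k) = f k) ->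
 (exists K, forall k, (K <= k)%N -> `|f k - l| <= M * 2^-1 ^+ k) -> v *m Ad (Exp X) = l.
Proof.
move=> hf [K hK]; have [M' M'0 [K' hK']] := AdExp_limit X.
apply/eqP; rewrite -subr_eq0 -normr_le0.
apply: (le_of_halfX (M := n.+1%:R * `|v| * M' + M)); exists (maxn K K') => k; rewrite geq_max => /andP[k1 k2].
rewrite add0r; have -> : v *m Ad (Exp X) - l = v *m (Ad (Exp X) - (1%:M + 2^-1 ^+ k *: ad X) ^+ (2 ^ k)) + (f k - l).
 by rewrite mulmxBr hf addrA subrK.
apply: normD_le_trans; rewrite mulrDl; apply: lerD; last exact: hK.
apply: mulmx_le_trans; rewrite -mulrA; rewrite -[X in _ <= X]mulrA -mulrA.
by do 2! apply: ler_wpM2l=> //; exact: hK'.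
Qed.

Lemma AdExp_fix X (v : V) : v *m ad X = 0 -> v *m Ad (Exp X) = v.
Proof.
move=> h; apply: (AdExp_vec_limit (f := fun=> v) (M := 0)) => [k|].
 elim: (2 ^ k)%N => [|j IH]; first by rewrite expr0 mulmx1.
 by rewrite exprS [_ * _]/(_ *m _) mulmxA mulmxDr mulmx1 -scalemxAr h scaler0 addr0.
by exists 0%N => k _; rewrite subrr normr0 mul0r.
Qed.

Lemma mulmx_eigen_pow (v : V) (A : 'M[R]_n.+1) (s : R) j : v *m A = s *: v -> v *m A ^+ j = s ^+ j *: v.
Proof.
move=> h; elim: j => [|j IH]; first by rewrite !expr0 mulmx1 scale1r.
by rewrite exprS [_ * _]/(_ *m _) mulmxA h -scalemxAl IH scalerA -exprS.
Qed.

Lemma bernoulli (x : R) j : 0 <= x -> 1 + j%:R * x <= (1 + x) ^+ j.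
Proof.
move=> x0; elim: j => [|j IH]; first by rewrite mul0r addr0 expr0.
rewrite exprS -natr1; have := ler_wpM2l (_ : 0 <= 1 + x) IH => h.
apply: le_trans (h _); last by rewrite addr_ge0.
have : 0 <= j%:R * x * x by rewrite !mulr_ge0.
lra.
Qed.

(** The new eigenvalue is the limit of (1 + 2^-k s)^(2^k), each term of which is at least 1 + s by
    Bernoulli's inequality. *)
Lemma AdExp_eigen X (v : V) (s : R) : 0 < s -> v *m ad X = s *: v ->
 exists2 lam : R, 1 < lam & v *m Ad (Exp X) = lam *: v.
Proof.
move=> s0 h; have [->|v0] := eqVneq v 0; first by exists 2; [lra|rewrite mul0mx scaler0].
have [i vi] : exists i, v 0 i != 0.
 apply: contrapT => hn; case/eqP: v0; apply/rowP => i; rewrite mxE.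
 by apply: contrapT => /eqP vi; apply: hn; exists i.
pose mu k := (1 + 2^-1 ^+ k * s) ^+ (2 ^ k).
have hmu k : v *m (1%:M + 2^-1 ^+ k *: ad X) ^+ (2 ^ k) = mu k *: v.
 by apply: mulmx_eigen_pow; rewrite mulmxDr mulmx1 -scalemxAr h scalerA scalerDl scale1r.
have mu1 k : 1 + s <= mu k.
 have h0 : 0 <= 2^-1 ^+ k * s by rewrite mulr_ge0 ?ltW // halfX_gt0.
 by have := bernoulli (2 ^ k) h0; rewrite mulrA natrX exp2_halfX mul1r.
have [M M0 [K hK]] := AdExp_limit X.
have nvi : 0 < `|v 0 i| by rewrite normr_gt0.
pose lam := (v *m Ad (Exp X)) 0 i / v 0 i.
have hv k : (K <= k)%N -> `|v *m Ad (Exp X) - mu k *: v| <= n.+1%:R * `|v| * M * 2^-1 ^+ k.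
 move=> kK; rewrite -hmu -mulmxBr; apply: mulmx_le_trans; rewrite -mulrA.
 by rewrite -[X in _ <= X]mulrA -mulrA; do 2! apply: ler_wpM2l=> //; exact: hK.
have hl k : (K <= k)%N -> `|lam - mu k| <= n.+1%:R * `|v| * M / `|v 0 i| * 2^-1 ^+ k.
 move=> kK; have -> : lam - mu k = (v *m Ad (Exp X) - mu k *: v) 0 i / v 0 i.
  have -> : (v *m Ad (Exp X) - mu k *: v) 0 i = (v *m Ad (Exp X)) 0 i - mu k * v 0 i.
   by set w := v *m Ad _; rewrite !mxE.
  by rewrite mulrBl mulfK.
 rewrite normrM normfV; have := le_trans (norm_coord_le _ i) (hv k kK).
 move=> h1; have := ler_wpM2r (_ : 0 <= `|v 0 i|^-1) h1; rewrite invr_ge0 normr_ge0 => /(_ isT).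
 by congr (_ <= _); ring.
exists lam.
 apply: (@lt_le_trans _ _ (1 + s)); first by lra.
 apply: (le_of_halfX (M := n.+1%:R * `|v| * M / `|v 0 i|)); exists K => k kK.
 have := hl k kK; rewrite ler_norml => /andP[h1 _]; have := mu1 k.
 by move: h1; set e := _ * 2^-1 ^+ k => h1 h2; lra.
apply: (AdExp_vec_limit (f := fun k => mu k *: v) (M := n.+1%:R * `|v| * M / `|v 0 i| * `|v|))=> //.
exists K => k kK; rewrite -scalerBl normrZ distrC; have := ler_wpM2r (normr_ge0 v) (hl k kK).
by congr (_ <= _); ring.
Qed.

Lemma Ad_stable_ad m (W : 'M[R]_(m, n.+1)) X : (forall t : R, (W *m Ad (Exp (t *: X)) <= W)%MS) -> (W *m ad X <= W)%MS.
Proof.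
move=> hW; have [M [K hK]] := adP hG c X.
rewrite submxE -normr_le0.
apply: (le_of_halfX (M := n.+1%:R * `|W| * (n.+1%:R * `|cokermx W|) * M)); exists K => k kK; rewrite add0r.
have /eqP h0 : W *m (2 ^+ k *: (Ad (Exp (2^-1 ^+ k *: X)) - 1%:M)) *m cokermx W == 0.
 rewrite -submxE -scalemxAr; apply: scalemx_sub; rewrite mulmxBr mulmx1; apply: addmx_sub; first exact: hW.
 by rewrite eqmx_opp.
rewrite -[W *m _ *m _]subr0 -h0 -mulmxBl -mulmxBr -[X in _ <= X]mulrA; apply: norm_mulmx3_le; rewrite distrC; exact: hK.
Qed.

Lemma Ad_stable_ideal m (W : 'M[R]_(m, n.+1)) : (forall X, (W *m Ad (Exp X) <= W)%MS) -> ideal a W.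
Proof. by move=> h X; rewrite adm_ad; apply: Ad_stable_ad => t; exact: h. Qed.
Lemma Exp_commute (u v : V) : u *m ad v = 0 -> (Exp u * Exp v = Exp v * Exp u)%g.
Proof.
move=> h; have := AdE hG c (Exp v) u; rewrite (AdExp_fix h) => e.
by rewrite conjgC -e.
Qed.

Lemma Exp_add_commute (u v : V) : u *m ad v = 0 -> Exp (u + v) = (Exp u * Exp v)%g.
Proof.
move=> h; have hk k : Exp u = (Exp (2^-1 ^+ k *: u) ^+ (2 ^ k))%g := Exp_half c u k.
have T := @Trotter R n.+1 G c u v.
apply: (cvg_unique_G hG T).
rewrite (_ : (fun k => _) = fun=> (Exp u * Exp v)%g); first exact: cvg_cst.
apply/funext => k; rewrite expgMn; first by rewrite -!Exp_half.
by apply: Exp_commute; rewrite adZ -scalemxAl -scalemxAr h !scaler0.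
Qed.

Notation C := R[i].
Notation VC := 'rV[C]_n.+1.
Notation cx := (map_mx (real_complex R)).

Let csq (z : C) : R := complex.Re z ^+ 2 + complex.Im z ^+ 2.

Let csqM (x y : C) : csq (x * y) = csq x * csq y.
Proof. by case: x => x1 x2; case: y => y1 y2; rewrite /csq /=; ring. Qed.
(** If Re s > 0, the squared modulus of 1 + 2^-k t s is at least 1 + 2 (2^-k t Re s), and by
    Bernoulli its 2^k-th power is at least 1 + 2 t Re s. This unbounded growth in t contradicts the
    bound on the orbit of the eigenvector. *)
Lemma bounded_orbit_spectrum_le0 X (M : R) : (forall t : R, `|Ad (Exp (t *: X))| <= M) ->
 forall (s : C) (z : VC), z != 0 -> z *m cx (adm a X) = s *: z -> complex.Re s <= 0.
Proof.
move=> hM s z z0 hz; rewrite leNgt; apply/negP => s0.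
have [i zi] : exists i, z 0 i != 0.
 apply: contrapT => hn; case/eqP: z0; apply/rowP => i; rewrite mxE.
 by apply: contrapT => /eqP zi; apply: hn; exists i.
pose q := csq (z 0 i).
have q0 : 0 < q.
 rewrite lt_neqAle addr_ge0 ?sqr_ge0 // andbT eq_sym /q /csq paddr_eq0 ?sqr_ge0 // !sqrf_eq0.
 by move: zi; case: (z 0 i) => x y /=; rewrite eq_complex.
pose u := cxRe z; pose w := cxIm z.
pose D := (n.+1%:R * `|u| * M + 1) ^+ 2 + (n.+1%:R * `|w| * M + 1) ^+ 2.
have D0 : 0 <= D by rewrite addr_ge0 // sqr_ge0.
(* D bounds the squared modulus of the i-th coordinate along the orbit. At this t the lower bound
   for it is q + 2 D. *)
pose t := D / (q * complex.Re s).
have qs : 0 < q * complex.Re s by rewrite mulr_gt0.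
have t0 : 0 <= t by rewrite divr_ge0 // ltW.
have [M' M'0 [K hK]] := AdExp_limit (t *: X).
have e0 : 0 < (n.+1%:R * (`|u| + `|w|) * M' + 1)^-1.
 by rewrite invr_gt0 ltr_pwDr // !mulr_ge0 // addr_ge0.
have [k0 hk0] := halfX_lt e0.
pose k := maxn K k0; have kK := hK k (leq_maxl _ _); have kk0 := hk0 k (leq_maxr _ _).
set B := 1%:M + _ *: _ in kK.
have B1 (v : V) : `|v| <= `|u| + `|w| -> `|(v *m B ^+ (2 ^ k)) 0 i| <= n.+1%:R * `|v| * M + 1.
 move=> hv; apply: (le_trans (norm_coord_le _ i)).
 have -> : v *m B ^+ (2 ^ k) = v *m Ad (Exp (t *: X)) - v *m (Ad (Exp (t *: X)) - B ^+ (2 ^ k)).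
  by rewrite mulmxBr opprB addrC subrK.
 apply: (le_trans (ler_normB _ _)); apply: lerD.
  by apply: mulmx_le_trans; apply: ler_wpM2l; rewrite ?mulr_ge0.
 apply: mulmx_le_trans.
 apply: (@le_trans _ _ (n.+1%:R * (`|u| + `|w|) * (M' * 2^-1 ^+ k))).
  by apply: ler_pM=> //; apply: ler_wpM2l.
 have h1 : 0 < n.+1%:R * (`|u| + `|w|) * M' + 1 by rewrite ltr_pwDr // !mulr_ge0 // addr_ge0.
 have := ltW kk0; rewrite -(ler_pM2r h1) mulVf ?gt_eqF // => h2.
 have h3 := halfX_gt0 R k.
 move: h2 h3; set A := n.+1%:R * (`|u| + `|w|); set e := 2^-1 ^+ k => h2 h3.
 have -> : A * (M' * e) = e * (A * M' + 1) - e by ring.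
 by move: h2 h3; clear; lra.
have zB : z *m cx (B ^+ (2 ^ k)) = (1 + real_complex R (2^-1 ^+ k * t) * s) ^+ (2 ^ k) *: z.
 have e1 : z *m cx B = (1 + real_complex R (2^-1 ^+ k * t) * s) *: z.
  rewrite /B adZ scalerA map_mxD map_scalar_mx rmorph1 mulmxDr mulmx1 map_mxZ -scalemxAr -adm_ad hz.
  by rewrite scalerA scalerDl scale1r.
 elim: (2 ^ k)%N => [|j IH]; first by rewrite !expr0 map_mx1 mulmx1 scale1r.
 by rewrite exprSr [B ^+ j * B]/(_ *m _) map_mxM mulmxA IH -scalemxAl e1 scalerA -exprSr.
have e2 : csq ((z *m cx (B ^+ (2 ^ k))) 0 i) = (u *m B ^+ (2 ^ k)) 0 i ^+ 2 + (w *m B ^+ (2 ^ k)) 0 i ^+ 2.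
 by rewrite -cxRe_mul -cxIm_mul /csq /cxRe /cxIm !mxE.
have e3 : csq ((z *m cx (B ^+ (2 ^ k))) 0 i) = csq (1 + real_complex R (2^-1 ^+ k * t) * s) ^+ (2 ^ k) * q.
 rewrite zB mxE csqM; congr (_ * _).
 by elim: (2 ^ k)%N => [|j IH]; rewrite ?expr0 ?exprS ?csqM ?IH // /csq /= expr1n expr0n addr0.
have h4 : 1 + 2 * (2^-1 ^+ k * t) * complex.Re s <= csq (1 + real_complex R (2^-1 ^+ k * t) * s).
 case: (s) => x y; rewrite /csq /= !mul0r subr0 add0r addr0.
 set e := _ * t; have := sqr_ge0 (e * x); have := sqr_ge0 (e * y).
 by rewrite !expr2; lra.
have h5 : 1 + 2 * t * complex.Re s <= csq (1 + real_complex R (2^-1 ^+ k * t) * s) ^+ (2 ^ k).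
 have h0 : 0 <= 2 * (2^-1 ^+ k * t) * complex.Re s by apply: mulr_ge0 (ltW s0); apply: mulr_ge0; [exact: ler0n|exact: mulr_ge0 (ltW (halfX_gt0 R k)) t0].
 apply: (@le_trans _ _ ((1 + 2 * (2^-1 ^+ k * t) * complex.Re s) ^+ (2 ^ k))).
  apply: le_trans (bernoulli (2 ^ k) h0); rewrite lerD2l natrX.
  have -> : 2 ^+ k * (2 * (2^-1 ^+ k * t) * complex.Re s) = (2 ^+ k * 2^-1 ^+ k) * (2 * t * complex.Re s) by ring.
  by rewrite exp2_halfX mul1r.
 by apply: lerXn2r; rewrite ?nnegrE ?addr_ge0 ?sqr_ge0.
have h6 : (1 + 2 * t * complex.Re s) * q <= D.
 apply: (@le_trans _ _ (csq ((z *m cx (B ^+ (2 ^ k))) 0 i))); first by rewrite e3 ler_wpM2r // ltW.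
 have nM : 0 <= M by apply: le_trans (hM 0).
 have b0 (v : V) : 0 <= n.+1%:R * `|v| * M + 1 by rewrite addr_ge0 // !mulr_ge0.
 rewrite e2; apply: lerD; rewrite -[X in X <= _]real_normK ?num_real //; apply: lerXn2r; rewrite ?nnegrE //; apply: B1.
  by rewrite lerDl.
 by rewrite lerDr.
have : (1 + 2 * t * complex.Re s) * q = q + 2 * D.
 have -> : (1 + 2 * t * complex.Re s) * q = q + 2 * (t * (q * complex.Re s)) by ring.
 by rewrite /t divfK // gt_eqF.
lra.
Qed.

Lemma bounded_orbit_spectrum X (M : R) : (forall t : R, `|Ad (Exp (t *: X))| <= M) ->
 forall (s : C) (z : VC), z != 0 -> z *m cx (adm a X) = s *: z -> complex.Re s = 0.
Proof.
move=> hM s z z0 hz; apply/eqP; rewrite eq_le (bounded_orbit_spectrum_le0 hM z0 hz) /=.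
have hN t : `|Ad (Exp (t *: - X))| <= M by rewrite scalerN -scaleNr.
have := @bounded_orbit_spectrum_le0 (- X) M hN (- s) z z0.
rewrite admN map_mxN mulmxN hz scaleNr => /(_ erefl).
by case: (s) => x y /=; rewrite oppr_le0.
Qed.

Lemma bounded_orbit_killing X (M : R) : (forall t : R, `|Ad (Exp (t *: X))| <= M) -> killing a X X <= 0.
Proof. by move=> hM; apply: spectrum_imaginary_killing => s z z0 hz; exact: (bounded_orbit_spectrum hM z0 hz). Qed.
End AdjointExponential.

(** * Products of exponentials as local coordinates *)

Section ProductsOfExponentials.
Variables (R : realType) (n : nat) (G : topGroupType).
Variable c : lie_chart R n G.
Notation V := 'rV[R]_n.
Notation Exp := (Exp c).
Let muP := lc_law c.

Definition exp_product (s : seq 'M[R]_n) (t : V) : G := (\prod_(L <- s) Exp (t *m L))%g.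

(** In coordinates the product of the curves has differential the sum of the L at 0, in the strong
    sense of a small Lipschitz constant for the difference. This is what the fixed point argument of
    [near_id_surj] consumes. *)
Lemma exp_product_coord (s : seq 'M[R]_n) (eta : R) : 0 < eta -> exists2 r : R, 0 < r & exists2 F : V -> V, F 0 = 0 &
 (forall t, `|t| <= r -> `|F t| <= 1 /\ lc_psi c (F t) = exp_product s t) /\
 (forall t t', `|t| <= r -> `|t'| <= r ->
  `|F t - F t' - (t - t') *m (\sum_(L <- s) L)| <= eta * `|t - t'|).
Proof.
elim: s eta => [|L s IH] eta eta0.
 exists 1=> //; exists (fun=> 0)=> //; split => [t _|t t' _ _].
  by rewrite normr0 ler01 /exp_product big_nil lc_psi0.
 by rewrite big_nil mulmx0 !subr0 normr0 mulr_ge0 // ltW.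
pose eta1 := Num.min 1 (eta / 2).
have eta10 : 0 < eta1 by rewrite lt_min ltr01 divr_gt0.
have [r0 r00 [F F0 [F1 F2]]] := IH eta1 eta10.
set Y := \sum_(L <- s) L in F2.
pose A : R := n%:R * `|L|; pose B : R := n%:R * `|Y| + 1.
have A0 : 0 <= A by rewrite mulr_ge0.
have B0 : 0 < B by rewrite ltr_pwDr // mulr_ge0.
(* D gathers all the coefficients by which the errors grow with the radius, so that the single
   condition r D <= m controls each of them. *)
pose D := 2 * A ^+ 2 + A * B + A + B.
have AB0 : 0 <= A * B by apply: mulr_ge0=> //; apply: ltW.
have A20 : 0 <= A ^+ 2 by apply: sqr_ge0.
have D0 : 0 < D by rewrite ltr_wpDl // !addr_ge0 // mulr_ge0.
pose m := Num.min 4^-1 (eta / 2).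
have m0 : 0 < m by rewrite lt_min invr_gt0 ltr0n divr_gt0.
pose r := Num.min r0 (m / D).
have rm : r * D <= m by rewrite -ler_pdivlMr // ge_min lexx orbT.
have r_gt0 : 0 < r by rewrite lt_min r00 divr_gt0.
have rr0 : r <= r0 by rewrite ge_min lexx.
have m1 : m <= 4^-1 by rewrite ge_min lexx.
have m2 : m <= eta / 2 by rewrite ge_min lexx orbT.
have e1 : eta1 <= 1 by rewrite ge_min lexx.
have e2 : eta1 <= eta / 2 by rewrite ge_min lexx orbT.
have DE : r * D = 2 * (r * A ^+ 2) + r * (A * B) + r * A + r * B by rewrite /D; ring.
have rA2 : 0 <= r * A ^+ 2 by apply: mulr_ge0=> //; apply: ltW.
have rAB : 0 <= r * (A * B) by apply: mulr_ge0=> //; apply: ltW.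
have rA : 0 <= r * A by apply: mulr_ge0=> //; apply: ltW.
have rB : 0 <= r * B by apply: mulr_ge0=> //; apply: ltW.
have L1 (t : V) : `|t *m L| <= A * `|t| by rewrite (le_trans (norm_mulmx_le _ _)) // /A mulrAC.
have FL (t t' : V) : `|t| <= r -> `|t'| <= r -> `|F t - F t'| <= B * `|t - t'|.
 move=> tr t'r; have h := F2 t t' (le_trans tr rr0) (le_trans t'r rr0).
 have -> : F t - F t' = (F t - F t' - (t - t') *m Y) + (t - t') *m Y by rewrite subrK.
 apply: normD_le_trans; apply: (le_trans (lerD h (norm_mulmx_le _ _))).
 have -> : n%:R * `|t - t'| * `|Y| = (n%:R * `|Y|) * `|t - t'| by ring.
 by rewrite -mulrDl ler_wpM2r // addrC /B lerD2l.
have LA (t : V) : `|t| <= r -> `|t *m L| <= r * A.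
 by move=> tr; apply: (le_trans (L1 t)); rewrite mulrC ler_wpM2r.
have LA4 (t : V) : `|t| <= r -> `|t *m L| <= 4^-1.
 by move=> tr; apply: (le_trans (LA t tr)); move: rm m1 DE rA2 rAB rA rB; clear; lra.
have ex2 (t : V) : `|t| <= r -> `|lexp muP (t *m L)| <= 2 * (r * A).
 by move=> tr; apply: (le_trans (norm_lexp_le _ (LA4 t tr))); rewrite ler_wpM2l // LA.
have ex1 (t : V) : `|t| <= r -> `|lexp muP (t *m L)| <= 1.
 by move=> tr; apply: (le_trans (ex2 t tr)); move: rm m1 DE rA2 rAB rA rB; clear; lra.
have FB (t : V) : `|t| <= r -> `|F t| <= r * B.
 move=> tr; have := FL t 0 tr; rewrite normr0 F0 !subr0 => h; apply: (le_trans (h (ltW r_gt0))).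
 by rewrite mulrC ler_wpM2r // ltW.
have F_1 (t : V) : `|t| <= r -> `|F t| <= 1 by move=> tr; apply: (F1 t (le_trans tr rr0)).1.
exists r=> //; exists (fun t => lc_mu c (lexp muP (t *m L)) (F t)).
 by rewrite mul0mx lexp0 F0 mux0 // normr0.
split=> [t tr|t t' tr t'r].
 split; last first.
  by rewrite lc_psiM ?ex1 ?F_1 // (F1 t (le_trans tr rr0)).2 /exp_product big_cons Exp_small // LA4.
 have h := mu_sum_le muP (ex1 _ tr) (F_1 _ tr).
 have h1 := ex2 _ tr; have h2 := FB _ tr.
 set x := lexp _ _ in h h1 *; set y := F t in h h2 *.
 have h3 : `|lc_mu c x y| <= `|lc_mu c x y - (x + y)| + (`|x| + `|y|).
  have := ler_normD (lc_mu c x y - (x + y)) (x + y); rewrite subrK => hh.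
  by apply: (le_trans hh); rewrite lerD2l ler_normD.
 have h4 : `|x| * `|y| <= 1 * `|y| by rewrite ler_wpM2r // ex1.
 have yr : `|y| <= 1 by apply: F_1.
 move: h h1 h2 h3 h4 rm m1 DE rA2 rAB rA rB; rewrite mul1r; clear; lra.
rewrite big_cons -/Y.
have h1 := mu_lip muP (ex1 _ tr) (F_1 _ tr) (ex1 _ t'r) (F_1 _ t'r).
have h2 := lexp_lip muP (LA _ tr) (LA _ t'r).
have h2' : `|lexp muP (t *m L) - lexp muP (t' *m L) - (t *m L - t' *m L)| <= 2 * (r * A) * `|t *m L - t' *m L|.
 by apply: h2; move: rm m1 DE rA2 rAB rA rB; clear; lra.
have [h3 _] := lexp_dist muP (LA4 _ tr) (LA4 _ t'r).
have h4 := F2 _ _ (le_trans tr rr0) (le_trans t'r rr0).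
have h5 := L1 (t - t'); rewrite mulmxBl in h5.
have h6 := FL _ _ tr t'r; have h7 := FB _ tr; have h8 := ex2 _ t'r.
set x := lexp _ (t *m L) in h1 h2' h3 *; set x' := lexp _ (t' *m L) in h1 h2' h3 h8 *.
set u := t *m L - t' *m L in h2' h3 h5; set d := `|t - t'| in h4 h5 h6 *.
have d0 : 0 <= d by apply: normr_ge0.
have -> : lc_mu c x (F t) - lc_mu c x' (F t') - (t - t') *m (L + Y) =
  (lc_mu c x (F t) - lc_mu c x' (F t') - (x + F t - (x' + F t'))) + (x - x' - u) + (F t - F t' - (t - t') *m Y).
 have -> : (t - t') *m (L + Y) = u + (t - t') *m Y by rewrite mulmxDr mulmxBl.
 set q := _ *m Y; move: (lc_mu c x _) (lc_mu c x' _) => p p'.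
 by mx_ring.
apply: normD_le_trans; apply: (le_trans (lerD (ler_normD _ _) h4)).
have k1 : `|x - x'| * `|F t| <= 2 * (A * d) * (r * B).
 by apply: ler_pM=> //; apply: (le_trans h3); rewrite ler_wpM2l.
have k2 : `|x'| * `|F t - F t'| <= 2 * (r * A) * (B * d) by apply: ler_pM.
have k3 : 2 * (r * A) * `|u| <= 2 * (r * A) * (A * d) by rewrite ler_wpM2l // mulr_ge0.
have k4 : eta1 * d <= eta / 2 * d by rewrite ler_wpM2r.
have k5 : r * D * d <= eta / 2 * d by rewrite ler_wpM2r // (le_trans rm).
have E1 : 2 * (A * d) * (r * B) = 2 * (r * (A * B) * d) by ring.
have E2 : 2 * (r * A) * (B * d) = 2 * (r * (A * B) * d) by ring.
have E3 : 2 * (r * A) * (A * d) = 2 * (r * A ^+ 2) * d by ring.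
have E4 : r * D * d = 2 * (r * A ^+ 2) * d + r * (A * B) * d + r * A * d + r * B * d by rewrite DE; ring.
have p1 : 0 <= r * A * d by apply: mulr_ge0.
have p2 : 0 <= r * B * d by apply: mulr_ge0.
have p3 : 0 <= r * (A * B) * d by apply: mulr_ge0.
move: h1 h2' k1 k2 k3 k4 k5 E1 E2 E3 E4 p1 p2 p3.
rewrite -!/d; move: (`|x - x' - u|) (`|lc_mu c x _ - _ - _|) => q1 q2; clear; lra.
Qed.

(** Precomposition with the inverse of the differential makes the coordinate map close to the
    identity; the ball of radius r / A is what this inverse maps into the ball of radius r. *)
Lemma exp_product_nbhs (s : seq 'M[R]_n) (e : R) : \sum_(L <- s) L \in unitmx -> 0 < e ->
 nbhs (1%g : G) [set g | exists2 t, `|t| < e & g = exp_product s t].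
Proof.
set Y := \sum_(L <- s) L => Yu e0.
pose A : R := n%:R * `|invmx Y| + 1.
have A0 : 0 < A by rewrite ltr_pwDr // mulr_ge0.
have LA (t : V) : `|t *m invmx Y| <= A * `|t|.
 apply: mulmx_le_trans; have -> : n%:R * `|t| * `|invmx Y| = (n%:R * `|invmx Y|) * `|t| by ring.
 by rewrite ler_wpM2r // /A lerDl.
have eta0 : 0 < (2 * A)^-1 by rewrite invr_gt0 mulr_gt0.
have [r r0 [F F0 [F1 F2]]] := exp_product_coord s eta0.
have rA0 : 0 <= r / A by rewrite divr_ge0 // ltW.
have LAr (t : V) : `|t| <= r / A -> `|t *m invmx Y| <= r.
 by move=> h; apply: (le_trans (LA t)); rewrite mulrC -ler_pdivlMr.
have surj := @near_id_surj R n (fun x => F (x *m invmx Y)) (r / A) rA0.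
have {}surj : forall z, `|z| <= r / A / 2 -> exists2 x, `|x| <= 2 * `|z| & F (x *m invmx Y) = z.
 apply: surj => [|x y hx hy]; first by rewrite mul0mx.
 have := F2 _ _ (LAr _ hx) (LAr _ hy); rewrite -mulmxBl -/Y mulmxKV // => h; apply: (le_trans h).
 have := LA (x - y); rewrite -(ler_pM2l eta0) => h'; apply: (le_trans h').
 by rewrite invfM mulrA mulfVK // gt_eqF.
have m0 : 0 < Num.min (r / A / 2) (e / (2 * A)) by rewrite lt_min !divr_gt0 // mulr_gt0.
apply: filterS (lc_nbhs c m0) => g [z zm ->].
move: zm; rewrite lt_min => /andP[z1 z2].
have [x x1 x2] := surj z (ltW z1).
exists (x *m invmx Y).
 apply: (le_lt_trans (LA x)); apply: (@le_lt_trans _ _ (A * (2 * `|z|))); first by rewrite ler_wpM2l // ltW.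
 by move: z2; rewrite ltr_pdivlMr ?mulr_gt0 //; move: (`|z|) => q; have -> : A * (2 * q) = q * (2 * A) by ring.
have xr : `|x *m invmx Y| <= r.
 by apply: LAr; apply: (le_trans x1); rewrite mulrC -ler_pdivlMr // ltW.
by rewrite -(F1 _ xr).2 x2.
Qed.
End ProductsOfExponentials.

(** * Subgroups and connectedness *)

Lemma connected_locally_constant (T : topologicalType) (U : Type) (K : set T) (f : T -> U) :
 connected K -> (forall x, K x -> nbhs x [set y | K y -> f y = f x]) ->
 forall x y, K x -> K y -> f x = f y.
Proof.
move=> Kc floc x y Kx Ky.
have := Kc [set z | K z /\ f z = f x]; suff h : K = [set z | K z /\ f z = f x] by rewrite h in Ky; case: Ky.
apply/esym/Kc; first by exists x.
 exists ([set z | K z -> f z = f x]°); first exact: open_interior.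
 apply/seteqP; split=> z [Kz h]; split=> //.
  by have := floc z Kz; rewrite h.
 exact: (interior_subset h).
exists (~` ([set z | K z -> f z <> f x]°)); first exact/open_closedC/open_interior.
apply/seteqP; split=> z [Kz h]; split=> //.
 by move=> /interior_subset /(_ Kz).
apply: contrapT => hz; apply: h; apply: filterS (floc z Kz) => w hw Kw.
by rewrite hw.
Qed.

Section Subgroups.
Variable G : groupType.
Implicit Types A B H : set G.
Local Open Scope group_scope.

Lemma subgroup1 H : is_subgroup H -> H 1. Proof. by case. Qed.
Lemma subgroupM H x y : is_subgroup H -> H x -> H y -> H (x * y). Proof. by case=> _ h _; apply: h. Qed.
Lemma subgroupV H x : is_subgroup H -> H x -> H x^-1. Proof. by case=> _ _ h; apply: h. Qed.
Lemma subgroupVE H x : is_subgroup H -> H x^-1 = H x.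
Proof.
move=> hH; apply/propext; split => h; last exact: subgroupV.
by rewrite -[x]invgK; apply: subgroupV.
Qed.
Lemma subgroupMlE H x y : is_subgroup H -> H x -> H (x * y) = H y.
Proof.
move=> hH Hx; apply/propext; split => h; last exact: subgroupM.
by rewrite -[y](mulKg x); apply: subgroupM=> //; apply: subgroupV.
Qed.
Lemma subgroupMrE H x y : is_subgroup H -> H y -> H (x * y) = H x.
Proof.
move=> hH Hy; apply/propext; split => h; last exact: subgroupM.
by rewrite -[x](mulgK y); apply: subgroupM=> //; apply: subgroupV.
Qed.
Lemma subgroupJ H x y : is_subgroup H -> H x -> H y -> H (x ^ y).
Proof. by move=> hH Hx Hy; rewrite conjgE; do 2?apply: subgroupM=> //; apply: subgroupV. Qed.
Lemma subgroup_prod H (I : Type) (s : seq I) (f : I -> G) :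
 is_subgroup H -> (forall i, H (f i)) -> H (\prod_(i <- s) f i).
Proof.
move=> hH Hf; elim: s => [|i s IH]; first by rewrite big_nil; apply: subgroup1.
by rewrite big_cons; apply: subgroupM.
Qed.

Lemma generatedG A : is_subgroup (generated A).
Proof.
split=> [H [hH _]|x y hx hy H hAH|x hx H hAH]; first exact: subgroup1.
 by apply: subgroupM; [exact: hAH.1|exact: hx|exact: hy].
by apply: subgroupV; [exact: hAH.1|exact: hx].
Qed.

Lemma sub_generated A : A `<=` generated A. Proof. by move=> x Ax H [_]; exact. Qed.

Lemma generated_sub A H : is_subgroup H -> A `<=` H -> generated A `<=` H.
Proof. by move=> hH AH x; apply. Qed.
Lemma generated_ind A (P : set G) : (forall x, A x -> A x^-1) -> P 1 ->
 (forall x y, A x -> P y -> P (x * y)) -> generated A `<=` P.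
Proof.
move=> AV P1 PM x hx.
pose Q := [set g | (forall y, P y -> P (g * y)) /\ (forall y, P y -> P (g^-1 * y))].
suff [h _] : Q x by rewrite -[x]mulg1; apply: h.
apply: hx; split; last by move=> g Ag; split=> y; apply: PM=> //; apply: AV.
split; first by split=> y; rewrite ?invg1 mul1g.
 move=> g h [g1 g2] [h1 h2]; split=> y Py; first by rewrite -mulgA; apply/g1/h1.
 by rewrite invgM -mulgA; apply/h2/g2.
by move=> g [g1 g2]; split=> y Py; rewrite ?invgK; [apply: g2|apply: g1].
Qed.

Lemma subgroup_centralizer A : is_subgroup [set x | forall a, A a -> x * a = a * x].
Proof.
split=> [a _|x y hx hy a Aa|x hx a Aa]; first by rewrite mul1g mulg1.
 by rewrite -mulgA hy // !mulgA hx.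
by apply: (mulgI x); rewrite mulVKg mulgA hx // mulgK.
Qed.

Lemma generated_commute A B : (forall a b, A a -> B b -> a * b = b * a) ->
 forall x y, generated A x -> generated B y -> x * y = y * x.
Proof.
move=> h x y hx hy.
have h1 : forall b, B b -> x * b = b * x.
 apply: (generated_sub (subgroup_centralizer B)) hx => a Aa b; exact: h.
apply/esym; refine (generated_sub (subgroup_centralizer [set x]) _ hy _ erefl) => b Bb z ->.
by rewrite h1.
Qed.

Lemma generated_normalized A K : (forall g x, K g -> A x -> A (x ^ g)) -> normalized_by K (generated A).
Proof.
move=> h g x Kg Ax H [hH AH].
suff : generated A `<=` [set x | H (x ^ g)] by apply.
apply: generated_sub; last by move=> y Ay; apply/AH/h.
split=> [|u v hu hv|u hu] /=; rewrite ?conj1g ?conjMg ?conjVg; first exact: subgroup1.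
 exact: subgroupM.
exact: subgroupV.
Qed.
End Subgroups.

Section ConnectedGroups.
Variable G : topGroupType.
Local Open Scope group_scope.

Lemma connected_subgroup_open (H N : set G) (U : set G) : is_subgroup H -> is_subgroup N ->
 connected H -> nbhs (1 : G) U -> U `&` H `<=` N -> H `<=` N.
Proof.
move=> hH hN Hc U1 UN x Hx.
have h : N 1 = N x.
 apply: (connected_locally_constant Hc (f := N))=> // [y Hy|]; last exact: subgroup1.
 apply: filterS (nbhs_translate1 y U1) => z Uz Hz.
 have N1 : N (y^-1 * z) by apply: UN; split=> //; apply: subgroupM=> //; apply: subgroupV.
 by rewrite -{1}[z](mulVKg y) subgroupMrE.
by rewrite -h; apply: subgroup1.
Qed.

Lemma connected_subgroup_full (H : set G) : connected [set: G] -> is_subgroup H -> nbhs (1 : G) H -> H = setT.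
Proof.
move=> Gc hH H1; apply/seteqP; split=> // x _.
by apply: (@connected_subgroup_open setT H H)=> // [g [] //|]; exact: hH.
Qed.

(** The quotient of z ^ g and z ^ h lies in D and tends to 1 as h tends to g. As D has no element
    near 1 other than 1, the map g |-> z ^ g is locally constant on K. *)
Lemma connected_discrete_orbit (K D : set G) (z k : G) : connected K -> K 1 -> K k ->
 (forall g h, K g -> K h -> D ((z ^ g)^-1 * z ^ h)) -> nbhs (1 : G) [set s | D s -> s = 1] -> z ^ k = z.
Proof.
move=> Kc K1 Kk DK D1.
rewrite -[RHS](conjg1 z); apply: (connected_locally_constant Kc (f := fun k => z ^ k))=> // g Kg.
have : (fun h => (z ^ g)^-1 * z ^ h) @ g --> (1 : G).
 rewrite -[X in _ --> X](mulVg (z ^ g)); apply: cvgMg; first exact: cvg_cst.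
 by apply: cvgJg; [exact: cvg_cst|exact: cvg_id].
move=> hc; have hn : nbhs g [set h | D ((z ^ g)^-1 * z ^ h) -> (z ^ g)^-1 * z ^ h = 1] := hc _ D1.
apply: filterS hn => h /= hh Kh.
by apply: (mulgI (z ^ g)^-1); rewrite mulVg; apply/hh/DK.
Qed.

Lemma connected_discrete_centralizer (K D : set G) (z k : G) : connected K -> K 1 -> K k ->
 (forall x g, K g -> D x -> D (x ^ g)) -> is_subgroup D -> nbhs (1 : G) [set s | D s -> s = 1] ->
 D z -> z ^ k = z.
Proof.
move=> Kc K1 Kk DK hD D1 Dz; apply: (connected_discrete_orbit Kc K1 Kk _ D1) => g h Kg Kh.
by apply: (subgroupM hD); [apply: (subgroupV hD)|]; apply: DK.
Qed.

Lemma connected_paths (R : realType) (N : set G) :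
 (forall g, N g -> exists c : R -> G, [/\ continuous c, c 0%R = 1, c 1%R = g & forall t, N (c t)]) -> connected N.
Proof.
move=> h.
have -> : N = \bigcup_(K in [set K | [/\ connected K, K 1 & K `<=` N]]) K.
 apply/seteqP; split=> [g Ng|g [K [_ _ KN] Kg]]; last exact: KN.
 have [c [cc c0 c1 cN]] := h g Ng; exists (range c); last by exists 1%R.
 split; [|by exists 0%R|by move=> _ [t _ <-]].
 by apply: connected_continuous_connected; [by apply/connected_intervalP|exact: continuous_subspaceT].
by apply: bigcup_connected; [exists 1 => K []|move=> K []].
Qed.
End ConnectedGroups.

Section Rows.
Variables (R : realFieldType) (n : nat).
Lemma pred_span (P : 'rV[R]_n -> Prop) : exists m, exists W : 'M[R]_(m, n),
 (forall i, P (row i W)) /\ forall v, P v -> (v <= W)%MS.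
Proof.
pose Q r := `[< exists m, exists2 W : 'M[R]_(m, n), forall i, P (row i W) & \rank W = r >].
have Q0 : exists r, Q r by exists 0%N; apply/asboolP; exists 0%N; exists 0; [case|rewrite mxrank0].
have Qn r : Q r -> (r <= n)%N by move=> /asboolP[m [W _ <-]]; exact: rank_leq_col.
have [r /asboolP[m [W hW Wr]] rmax] := ex_maxnP Q0 Qn.
exists m, W; split=> // v Pv; apply: contrapT => /negP vW.
have : Q (\rank (col_mx W v)).
 apply/asboolP; exists (m + 1)%N; exists (col_mx W v)=> // i.
 rewrite -(splitK i); case: (fintype.split i) => j /=; first by rewrite rowKu.
 by rewrite rowKd row_id.
move/rmax; rewrite -Wr leqNgt; case/negP.
rewrite -addsmxE; apply: rank_ltmx; rewrite ltmxE addsmxSl /=; apply: contra vW => h.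
exact: submx_trans (addsmxSr W v) h.
Qed.
End Rows.

(** * Analytic subgroups of a connected Lie group *)

Section ConnectedLieGroup.
Variables (R : realType) (n : nat) (G : topGroupType) (hG : hausdorff_space G).
Variable c : lie_chart R n.+1 G.
Hypothesis Gc : connected [set: G].
Notation V := 'rV[R]_n.+1.
Notation Exp := (Exp c).
Notation Ad := (Ad hG c).
Notation ad := (ad hG c).
Notation a := (ad_basis hG c).

(** The analytic subgroup attached to the subspace W; it carries the topology induced by G and need
    not be closed. *)
Definition exp_group m (W : 'M[R]_(m, n.+1)) : set G :=
 generated [set g | exists2 v : V, (v <= W)%MS & g = Exp v].

Lemma ExpV X : (Exp X)^-1%g = Exp (- X). Proof. by rewrite ExpN. Qed.

Lemma exp_group_Exp m (W : 'M[R]_(m, n.+1)) v : (v <= W)%MS -> exp_group W (Exp v).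
Proof. by move=> vW; apply: sub_generated; exists v. Qed.
Lemma exp_group_ind m (W : 'M[R]_(m, n.+1)) (P : set G) : P 1%g ->
 (forall v x, (v <= W)%MS -> P x -> P (Exp v * x)%g) -> exp_group W `<=` P.
Proof.
move=> P1 PM; apply: generated_ind=> // [_ [v vW ->]|_ x [v vW ->] Px]; last exact: PM.
by exists (- v); rewrite ?eqmx_opp // ExpV.
Qed.

Lemma exp_group_full : exp_group (1%:M : 'M[R]_n.+1) = setT.
Proof.
apply: connected_subgroup_full=> //; first exact: generatedG.
have h := lexp_image_nbhs c (@ltr01 R).
by apply: filterS h => g [X _ ->]; apply: exp_group_Exp; exact: submx1.
Qed.

Lemma ideal_Ad m (W : 'M[R]_(m, n.+1)) g : ideal a W -> (W *m Ad g <= W)%MS.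
Proof.
move=> hW; suff h : [set: G] `<=` [set g | (W *m Ad g <= W)%MS] by exact: (h g I).
rewrite -exp_group_full; apply: exp_group_ind => [|v x _ hx] /=; first by rewrite Ad1 mulmx1.
rewrite AdM mulmxA; apply: submx_trans hx; apply: submxMr.
by apply: AdExp_stable; rewrite -adm_ad; exact: hW.
Qed.

Lemma exp_group_connected m (W : 'M[R]_(m, n.+1)) : connected (exp_group W).
Proof.
apply: (connected_paths (R := R)); apply: exp_group_ind => [|v x vW [p [pc p0 p1 pW]]].
 exists (fun=> 1%g); split=> // [|t]; first by move=> t; exact: cvg_cst.
 exact: (subgroup1 (generatedG _)).
exists (fun t => Exp (t *: v) * p t)%g; split; rewrite ?scale0r ?scale1r ?Exp0 ?p0 ?p1 ?mulg1 //.
 move=> t; apply: cvgMg; last exact: pc.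
 exact: (@Exp_scale_cvg _ _ _ c _ _ _ _ v _ cvg_id).
move=> t; apply: (subgroupM (generatedG _)); last exact: pW.
by apply: exp_group_Exp; apply: scalemx_sub.
Qed.

Lemma exp_group_normal m (W : 'M[R]_(m, n.+1)) : ideal a W -> normalized_by [set: G] (exp_group W).
Proof.
move=> hW; apply: generated_normalized => g _ _ [v vW ->].
exists (v *m Ad g); last by rewrite AdE.
by apply: submx_trans (ideal_Ad g hW); apply: submxMr.
Qed.

Lemma exp_group_eq1 m (W : 'M[R]_(m, n.+1)) : exp_group W `<=` [set 1%g] -> W = 0.
Proof.
move=> h; apply/row_matrixP => i; rewrite row0; apply: (@Exp_line_inj _ _ _ c) => t.
rewrite scaler0 Exp0; apply: h; apply: exp_group_Exp; apply: scalemx_sub; exact: row_sub.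
Qed.

(** The analytic subgroup of an abelian ideal is connected, normal and abelian, hence inside the
    trivial solvable radical. *)
Lemma semisimple_no_abelian_ideals : is_solvable_radical [set 1%g : G] -> no_abelian_ideals a.
Proof.
move=> [_ rad] W hW Wab; apply: exp_group_eq1; apply: rad; split.
- exact: generatedG.
- exact: exp_group_normal.
- exact: exp_group_connected.
exists 1%N; apply: generated_sub => [|_ [x [y [Wx Wy ->]]]].
 by split=> [|x y -> ->|x ->]; rewrite /= ?mulg1 ?invg1.
have : (x * y = y * x)%g.
 apply: (generated_commute _ Wx Wy) => _ _ [u uW ->] [v vW ->]; apply: (@Exp_commute _ _ _ hG).
 by rewrite -adm_ad Wab.
by move=> xy; apply/eqP/commgP.
Qed.

Lemma hyperbolic_chain_radical y t : hyperbolic a y -> chain_radical (Exp (t *: y)).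
Proof.
move=> [h [s [s0]]]; rewrite adm_ad => hs.
wlog sp : h s s0 hs / 0 < s.
 move=> W; have [sp|] := ltP 0 s; first exact: (W h s).
 rewrite le_eqVlt (negPf s0) /= -oppr_gt0 => sp.
 by apply: (W (- h) (- s)); rewrite ?oppr_eq0 // adN mulmxN hs scaleNr.
have [lam lam1 hl] := AdExp_eigen sp hs.
apply: (@dilated_one_parameter_chain_radical _ _ (fun t => Exp (t *: y)) (Exp h) lam)=> // [u v|u].
 exact: ExpD.
by rewrite -AdE -scalemxAl hl scalerA mulrC.
Qed.

Lemma hyperbolic_minap m (W : 'M[R]_(m, n.+1)) : (forall i, hyperbolic a (row i W)) -> (1%:M <= W)%MS -> minap G.
Proof.
move=> hW /submxP[D DW] g.
have srad : is_subgroup (@chain_radical G).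
 by split; [exact: chain_radical1|exact: chain_radicalM|exact: chain_radicalV].
suff -> : @chain_radical G = setT by [].
apply: connected_subgroup_full=> //.
(* As D W = 1, the differential of this product is the identity, although each factor only runs
   through the hyperbolic one-parameter group of a row of W. *)
pose s := [seq col i D *m row i W | i <- enum 'I_m].
have su : \sum_(L <- s) L \in unitmx.
 rewrite big_map big_enum /=; suff -> : \sum_i col i D *m row i W = 1%:M by rewrite unitmx1.
 rewrite DW; apply/matrixP => i j; rewrite summxE mxE; apply: eq_bigr => k _.
 by rewrite mxE big_ord1 !mxE.
apply: filterS (exp_product_nbhs c su (@ltr01 R)) => _ [t _ ->].
rewrite /exp_product big_map; apply: (subgroup_prod _ srad) => i.
rewrite mulmxA; have -> : t *m col i D = ((t *m col i D) 0 0)%:M by apply: mx11_scalar.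
by rewrite mul_scalar_mx; apply: hyperbolic_chain_radical.
Qed.
End ConnectedLieGroup.

(** * Central characters of perfect groups by averaging *)

Section QuasiMorphism.
Variables (R : realType) (G : groupType) (H Z : set G) (chi phi0 : G -> R).
Hypotheses (hH : is_subgroup H) (Z1 : Z 1%g) (ZH : Z `<=` H) (Zc : forall z h, Z z -> H h -> (z * h = h * z)%g).

Definition equivariant_on (phi : G -> R) := forall z h, Z z -> H h -> phi (z * h)%g = chi z + phi h.
(** Conjugates of u are included because left translation by [gs i] moves u to a conjugate. *)
Definition almost_period (e : R) (u : G) := forall k h, H k -> H h -> `|phi0 (u ^ k * h)%g - phi0 h| <= e.
Hypothesis phi0Z : equivariant_on phi0.
Hypothesis net : forall e : R, 0 < e -> exists n, exists gs : 'I_n.+1 -> G, (forall i, H (gs i)) /\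
 forall h, H h -> exists z u i, [/\ Z z, H u, almost_period e u & h = (z * u * gs i)%g].

Definition admissible (phi : G -> R) := equivariant_on phi /\
 forall e u h, H u -> almost_period e u -> H h -> `|phi (u * h)%g - phi h| <= e.
(** Defect 0 would mean that phi minus phi 1 is a homomorphism on H. *)
Definition defect_le (phi : G -> R) (w : R) := forall g h h', H g -> H h -> H h' ->
 `|phi (g * h)%g - phi h - (phi (g * h')%g - phi h')| <= w.

Lemma almost_periodJ e u g : H g -> almost_period e u -> almost_period e (u ^ g)%g.
Proof. by move=> Hg hu k h Hk Hh; rewrite -conjgM; apply: hu=> //; apply: subgroupM. Qed.
Lemma admissible_phi0 : admissible phi0.
Proof.
split=> // e u h Hu hu Hh.
by have := hu 1%g h (subgroup1 hH) Hh; rewrite conjg1.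
Qed.

Lemma defect_phi0 : exists w, defect_le phi0 w.
Proof.
have [n [gs [Hgs hgs]]] := net ltr01.
pose M := \sum_i \sum_j (`|phi0 (gs i * gs j)%g| + `|phi0 (gs j)|).
have hM i j : `|phi0 (gs i * gs j)%g| + `|phi0 (gs j)| <= M.
 have nn i' j' : 0 <= `|phi0 (gs i' * gs j')%g| + `|phi0 (gs j')| by rewrite addr_ge0.
 rewrite /M (bigD1 i) //= (bigD1 j) //= -addrA lerDl addr_ge0 // ?sumr_ge0 // => i' _.
 by rewrite sumr_ge0.
suff key g : H g -> exists C, forall h, H h -> `|phi0 (g * h)%g - phi0 h - C| <= 3 + M.
 exists (2 * (3 + M)) => g h h' Hg Hh Hh'; have [C hC] := key g Hg.
 have := hC h Hh; have := hC h' Hh'; rewrite !ler_norml => /andP[a1 a2] /andP[b1 b2].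
 by apply/andP; split; lra.
move=> Hg; have [z [u [i [Zz Hu gu ->]]]] := hgs g Hg; exists (chi z) => h Hh.
have [z' [u' [j [Zz' Hu' gu' ->]]]] := hgs h Hh.
have [_ adm] := admissible_phi0.
have E1 : (z * u * gs i * (z' * u' * gs j) = z * (z' * (u * (u' ^ (gs i)^-1 * (gs i * gs j)))))%g.
 rewrite conjgE invgK !mulgA; congr (_ * _)%g; rewrite mulgVK.
 by congr (_ * _)%g; rewrite -!mulgA; congr (_ * _)%g; rewrite !mulgA (Zc Zz' Hu) -!mulgA (Zc Zz' (Hgs i)).
have Hv : H (u' ^ (gs i)^-1)%g by apply: subgroupJ=> //; apply: subgroupV.
have Hij : H (gs i * gs j)%g by apply: subgroupM.
have Hw : H (u * (u' ^ (gs i)^-1 * (gs i * gs j)))%g by do 2?apply: subgroupM.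
rewrite E1 (phi0Z Zz (subgroupM hH (ZH Zz') Hw)) (phi0Z Zz' Hw) -[(z' * u' * gs j)%g]mulgA.
rewrite (phi0Z Zz' (subgroupM hH Hu' (Hgs j))).
have k1 : `|phi0 (u * (u' ^ (gs i)^-1 * (gs i * gs j)))%g - phi0 (u' ^ (gs i)^-1 * (gs i * gs j))%g| <= 1.
 by apply: adm=> //; apply: subgroupM.
have k2 : `|phi0 (u' ^ (gs i)^-1 * (gs i * gs j))%g - phi0 (gs i * gs j)%g| <= 1.
 by apply: adm=> //; apply: almost_periodJ=> //; apply: subgroupV.
have k3 : `|phi0 (u' * gs j)%g - phi0 (gs j)| <= 1 by apply: adm.
have := hM i j; have := ler_norm (phi0 (gs i * gs j)%g); have := ler_norm (phi0 (gs j)).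
have := lerNnormlW (lexx `|phi0 (gs i * gs j)%g|); have := lerNnormlW (lexx `|phi0 (gs j)|).
move: k1 k2 k3; rewrite !ler_norml => /andP[p1 p2] /andP[p3 p4] /andP[p5 p6] q1 q2 q3 q4 q5.
by apply/andP; split; lra.
Qed.

(* Averaging the translates of phi over a net of H/Z: in phi'(gh) - phi'(h) one pair of terms,
  matched by the net, nearly cancels, so that the defect drops by a definite factor. *)
Lemma admissible_average phi w e n (gs : 'I_n.+1 -> G) : admissible phi -> defect_le phi w ->
 (forall i, H (gs i)) ->
 (forall h, H h -> exists z u i, [/\ Z z, H u, almost_period e u & h = (z * u * gs i)%g]) ->
 exists2 phi', admissible phi' & defect_le phi' ((n%:R * w + 2 * e) / n.+1%:R).
Proof.
move=> [phiZ phiU] hw Hgs hgs.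
have n0 : (n.+1%:R : R) != 0 by rewrite pnatr_eq0.
exists (fun h => (\sum_i phi (gs i * h)%g) / n.+1%:R).
 split=> [z h Zz Hh|e' u h Hu hu Hh].
  under eq_bigr => i _.
   rewrite mulgA -(Zc Zz (Hgs i)) -mulgA phiZ //; last exact: subgroupM.
   over.
  by rewrite big_split /= sumr_const card_ord mulrDl -[chi z *+ _]mulr_natr mulfK.
 rewrite -mulrBl normrM normfV [X in _ / X]ger0_norm ?ler0n // ler_pdivrMr ?ltr0n // -sumrB.
 apply: (le_trans (ler_norm_sum _ _ _)).
 apply: (@le_trans _ _ (\sum_(i < n.+1) e')); last by rewrite sumr_const card_ord mulr_natr.
 apply: ler_sum => i _.
 have -> : (gs i * (u * h) = u ^ (gs i)^-1 * (gs i * h))%g by rewrite conjgE invgK !mulgA mulgVK.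
 have Hgi : H (gs i)^-1%g by apply: subgroupV.
 by apply: phiU; [exact: subgroupJ|exact: almost_periodJ|exact: subgroupM].
move=> g h h' Hg Hh Hh'.
have [z [u [j [Zz Hu gu hg]]]] := hgs (gs ord0 * g)%g (subgroupM hH (Hgs _) Hg).
pose s := tperm ord0 j.
pose d i x := phi (gs i * (g * x))%g - phi (gs (s i) * x)%g.
have dE x : \sum_i phi (gs i * (g * x))%g - \sum_i phi (gs i * x)%g = \sum_i d i x.
 by rewrite [X in _ - X](reindex_inj (perm_inj (s := s))) -sumrB.
rewrite -!mulrBl !dE -sumrB normrM normfV [X in _ / X]ger0_norm ?ler0n //.
rewrite ler_pM2r ?invr_gt0 ?ltr0n //.
apply: (le_trans (ler_norm_sum _ _ _)); rewrite big_ord_recl addrC; apply: lerD.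
 apply: (@le_trans _ _ (\sum_(i < n) w)); last by rewrite sumr_const card_ord mulr_natl.
 apply: ler_sum => i _; set i' := lift ord0 i; rewrite /d.
 have E x : (gs i' * (g * x) = (gs i' * g * (gs (s i'))^-1) * (gs (s i') * x))%g by rewrite !mulgA mulgVK.
 rewrite !E; apply: hw; do 2?apply: subgroupM=> //; exact: subgroupV.
have hd x : H x -> `|d ord0 x - chi z| <= e.
 move=> Hx; have Hjx := subgroupM hH (Hgs j) Hx.
 rewrite /d /s tpermL mulgA hg -!mulgA (phiZ _ _ Zz (subgroupM hH Hu Hjx)).
 by rewrite addrAC [chi z + _]addrC addrK; apply: phiU.
have := hd h Hh; have := hd h' Hh'; rewrite !ler_norml => /andP[a1 a2] /andP[b1 b2].
by apply/andP; split; lra.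
Qed.

(** The infimum of the defects cannot be positive, since averaging lowers a defect close to it below
    it. *)
Lemma small_defect (d : R) : 0 < d -> exists2 phi, admissible phi & defect_le phi d.
Proof.
move=> d0; pose A := [set w : R | exists2 phi, admissible phi & defect_le phi w].
have An : A !=set0 by have [w hw] := defect_phi0; exists w, phi0=> //; exact: admissible_phi0.
have Alb : has_lbound A.
 exists 0 => w [phi _ hw]; apply: le_trans (hw 1%g 1%g 1%g _ _ _); rewrite ?normr_ge0 //; exact: subgroup1.
have hA : has_inf A by split.
have [h|h] := ltP (inf A) d.
 have [|w [phi phiA hw] wd] := @inf_adherent _ A (d - inf A) _ hA; first by rewrite subr_gt0.
 exists phi=> // g x y Hg Hx Hy; apply: (le_trans (hw _ _ _ Hg Hx Hy)); apply: ltW.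
 by move: wd; rewrite subrKC.
have W0 : 0 < inf A by apply: lt_le_trans h.
(* With e a quarter of the infimum, a defect w averages to (n w + inf / 2) / (n + 1). This is below
   the infimum as soon as w exceeds it by less than inf / (2 (n + 1)). *)
have [n [gs [Hgs hgs]]] := net (divr_gt0 W0 (ltr0Sn R 3)).
have n2 : 0 < (2 * n.+1%:R : R) by rewrite mulr_gt0.
have [w [phi phiA hw] wd] := inf_adherent (divr_gt0 W0 n2) hA.
have [phi' phi'A hw'] := admissible_average phiA hw Hgs hgs.
have : inf A <= (n%:R * w + 2 * (inf A / 4)) / n.+1%:R by apply: ge_inf=> //; exists phi'.
rewrite ler_pdivlMr ?ltr0n // => hi.
have e1 : inf A / (2 * n.+1%:R) * (2 * n.+1%:R) = inf A by rewrite divfK // gt_eqF.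
have n0 : (0 : R) <= n%:R by [].
have wlt : n%:R * w <= n%:R * (inf A + inf A / (2 * n.+1%:R)) by rewrite ler_wpM2l // ltW.
have q0 : 0 < inf A / (2 * n.+1%:R) by rewrite divr_gt0.
move: hi e1 wlt; rewrite -natr1; move: (inf A / _) q0 W0 n0 => q; clear; nra.
Qed.

(** A function of defect w is additive up to w after subtracting phi 1, so on a product of
    commutators it is at most C w, where C depends on the word but not on phi. At z the same
    quantity is chi z, and w is arbitrarily small. *)
Theorem perfect_central_character z : Z z -> commutator_subgroup H H z -> chi z = 0.
Proof.
move=> Zz hz.
pose P := [set g | H g /\ exists2 C : R, 0 <= C & forall phi w, admissible phi -> defect_le phi w ->
 `|phi g - phi 1%g| <= C * w].
have defM phi w g g' : defect_le phi w -> H g -> H g' ->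
  `|(phi (g * g')%g - phi 1%g) - (phi g - phi 1%g) - (phi g' - phi 1%g)| <= w.
 move=> hw Hg Hg'; have := hw g g' 1%g Hg Hg' (subgroup1 hH); rewrite mulg1.
 suff -> : phi (g * g')%g - phi 1%g - (phi g - phi 1%g) - (phi g' - phi 1%g) = phi (g * g')%g - phi g' - (phi g - phi 1%g) by [].
 by ring.
have sP : is_subgroup P.
 split=> [|g g' [Hg [C C0 hC]] [Hg' [C' C'0 hC']]|g [Hg [C C0 hC]]].
 - split; first exact: subgroup1.
  by exists 0=> // phi w _ _; rewrite subrr normr0 mul0r.
 - split; first exact: subgroupM.
  exists (C + C' + 1) => [|phi w ha hw]; first by rewrite !addr_ge0.
  have := defM _ _ _ _ hw Hg Hg'; have := hC _ _ ha hw; have := hC' _ _ ha hw.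
  rewrite !mulrDl mul1r !ler_norml => /andP[p1 p2] /andP[p3 p4] /andP[p5 p6].
  by apply/andP; split; lra.
 - split; first exact: subgroupV.
  exists (C + 1) => [|phi w ha hw]; first by rewrite addr_ge0.
  have := defM _ _ _ _ hw Hg (subgroupV hH Hg); have := hC _ _ ha hw; rewrite mulgV.
  rewrite !mulrDl mul1r !ler_norml => /andP[p1 p2] /andP[p3 p4].
  by apply/andP; split; lra.
have [_ [C C0 hC]] : P z.
 apply: (generated_sub sP) hz => _ [x [y [Hx Hy ->]]].
 have Hx' := subgroupV hH Hx; have Hy' := subgroupV hH Hy.
 have -> : [~ x, y]%g = (x^-1 * (y^-1 * (x * y)))%g by rewrite commgEl conjgE.
 have Hxy : H (x * y)%g by apply: subgroupM.
 split; first by do 2?apply: subgroupM=> //.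
 exists 5=> // phi w ha hw.
 have := defM _ _ _ _ hw Hx' (subgroupM hH Hy' Hxy); have := defM _ _ _ _ hw Hy' Hxy.
 have := defM _ _ _ _ hw Hx Hy; have := defM _ _ _ _ hw Hx Hx'; have := defM _ _ _ _ hw Hy Hy'.
 rewrite !mulgV !ler_norml => /andP[p1 p2] /andP[p3 p4] /andP[p5 p6] /andP[p7 p8] /andP[p9 p10].
 by apply/andP; split; lra.
apply/eqP; rewrite -normr_le0; apply/ler_addgt0Pr => e e0; rewrite add0r.
have [|phi ha hw] := @small_defect (e / (C + 1)); first by rewrite divr_gt0 // ltr_wpDl.
have := hC _ _ ha hw; rewrite -{1}[z]mulg1 ha.1 ?addrK //; last exact: subgroup1.
move=> h; apply: (le_trans h); have C1 : 0 < C + 1 by rewrite ltr_wpDl.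
by rewrite mulrA ler_pdivrMr // mulrDr mulr1 mulrC lerDl ltW.
Qed.
End QuasiMorphism.

(** * Extension of characters with values in R/L *)

Section CharacterExtension.
Variables (R : realType) (G : groupType) (K : set G) (L : set R).
Hypotheses (hK : is_subgroup K) (L0 : L 0) (LB : forall s t, L s -> L t -> L (s - t)).
Local Open Scope group_scope.

(* The graph of a homomorphism to R/L, defined on a subgroup of K containing the commutators. *)
Definition partial_character (C : set (G * R)) : Prop :=
 [/\ forall x s, C (x, s) -> K x,
   forall x y s t, C (x, s) -> C (y, t) -> C (x * y, (s + t)%R),
   forall x s, C (x, s) -> C (x^-1, (- s)%R),
   forall x y, K x -> K y -> C ([~ x, y], 0%R)
  & forall s, C (1, s) -> L s].

Lemma partial_characterX C x s k : partial_character C -> C (x, s) -> C (x ^+ k, (k%:R * s)%R).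
Proof.
move=> [CK CM _ CR _] Cx; elim: k => [|k IH].
 by rewrite expg0 mul0r -(commg1 x); apply: CR; [exact: CK Cx|exact: subgroup1].
by rewrite expgS -natr1 mulrDl mul1r addrC; apply: CM.
Qed.

Lemma partial_character_adjoin C g (t : R) : partial_character C -> K g ->
 (forall k s, C (g ^+ k, s) -> L (s - k%:R * t)%R) -> exists C', [/\ C `<=` C', partial_character C' & C' (g, t)].
Proof.
move=> hC Kg ht; case: (hC) => CK CM CV CR C1.
(* The pair (a, b) stands for the integer exponent a - b, to which the value (a - b) t is
   attached. *)
pose p a b := g ^+ a * (g ^+ b)^-1.
have KX k : K (g ^+ k) by elim: k => [|k IH]; rewrite ?expg0 ?expgS; [exact: subgroup1|exact: subgroupM].
have Kp a b : K (p a b) by apply: subgroupM=> //; exact: subgroupV.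
have pV a b : (p a b)^-1 = p b a by rewrite /p invgM invgK.
have pM a b k l : p (a + k)%N (b + l)%N = p a b * p k l.
 have cg i j : g ^+ i * g ^+ j = g ^+ j * g ^+ i by rewrite -!expgnDr addnC.
 have cV i j : g ^+ i * (g ^+ j)^-1 = (g ^+ j)^-1 * g ^+ i.
  by apply: (mulIg (g ^+ j)); rewrite mulgVK -mulgA cg mulKg.
 by rewrite /p addnC [(b + l)%N]addnC !expgnDr invgM !mulgA; congr (_ * _); rewrite cg -!mulgA cV.
exists [set xs|exists a b, C (xs.1 * p a b, (xs.2 + (a%:R - b%:R) * t)%R)]; split.
- by move=> [x s] Cx; exists 0%N, 0%N; rewrite /p expg0 invg1 !mulg1 subrr mul0r addr0.
- split.
 + move=> x s [a [b /= h]]; have := CK _ _ h; rewrite (subgroupMrE _ hK) //.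
 + move=> x y s u [a [b /= h]] [k [l /= h']]; exists (a + k)%N, (b + l)%N => /=; rewrite pM.
  have Ky : K y by have := CK _ _ h'; rewrite (subgroupMrE _ hK).
  have -> : x * y * (p a b * p k l) = (x * p a b) * (y * p k l) * [~ y ^ p k l, p a b ^ p k l].
   by rewrite commgEl !conjgE; free_group.
  have -> : (s + u + ((a + k)%:R - (b + l)%:R) * t = (s + (a%:R - b%:R) * t) + (u + (k%:R - l%:R) * t) + 0)%R.
   by rewrite !natrD; ring.
  by apply: (CM); [exact: CM|apply: CR; apply: subgroupJ].
 + move=> x s [a [b /= h]]; exists b, a => /=.
  have Kx : K x by have := CK _ _ h; rewrite (subgroupMrE _ hK).
  have -> : x^-1 * p b a = (x * p a b)^-1 * [~ x^-1, (p a b)^-1].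
   by rewrite -pV commgEl conjgE; free_group.
  have -> : (- s + (b%:R - a%:R) * t = - (s + (a%:R - b%:R) * t) + 0)%R by ring.
  by apply: CM; [exact: CV|apply: CR; apply: subgroupV].
 + by move=> x y Kx Ky; exists 0%N, 0%N; rewrite /p expg0 invg1 !mulg1 subrr mul0r addr0; apply: CR.
 + move=> s [a [b /=]]; rewrite mul1g => h.
  have LN u : L u -> L (- u)%R by move=> Lu; rewrite -[(- u)%R]add0r; exact: LB.
  have [ab|/ltnW ba] := leqP b a.
   have := ht (a - b)%N _; rewrite natrB // => /(_ (s + (a%:R - b%:R) * t)%R); rewrite addrK; apply.
   by move: h; rewrite /p -{1}(subnK ab) expgnDr mulgK.
  rewrite -[s]opprK; apply: LN; have := ht (b - a)%N _; rewrite natrB // => /(_ (- (s + (a%:R - b%:R) * t))%R).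
  have -> : (- (s + (a%:R - b%:R) * t) - (b%:R - a%:R) * t = - s)%R by ring.
  by apply; have := CV _ _ h; rewrite pV /p -{1}(subnK ba) expgnDr mulgK.
exists 0%N, 1%N => /=; rewrite /p expg0 mul1g expg1 mulgV.
have -> : (t + (0%:R - 1%:R) * t = 0)%R by ring.
by rewrite -(commg1 g); apply: CR=> //; exact: subgroup1.
Qed.

(** Divisibility of R: if m is the least positive exponent with g^m in the domain, the value at g is
    the m-th part of the value at g^m; if there is none, the value 0 will do. *)
Lemma partial_character_extend C g : partial_character C -> K g ->
 exists C', [/\ C `<=` C', partial_character C' & exists t, C' (g, t)].
Proof.
move=> hC Kg; suff [t ht] : exists t, forall k s, C (g ^+ k, s) -> L (s - k%:R * t)%R.
 by have [C' [? ? ?]] := partial_character_adjoin hC Kg ht; exists C'; split=> //; exists t.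
case: (hC) => CK CM CV CR C1.
have [hm|hm] := pselect (exists m, (0 < m)%N && `[< exists s, C (g ^+ m, s) >]); last first.
 exists 0%R => -[|k] s hs; first by rewrite mul0r subr0; apply: C1; rewrite -(expg0 g).
 by case: hm; exists k.+1; apply/asboolP; exists s.
have [m /andP[m0 /asboolP[s0 hs0]] mmin] := ex_minnP hm.
exists (s0 / m%:R)%R => k s hs.
have [q [r [kE rm]]] : exists q r, k = (q * m + r)%N /\ (r < m)%N.
 by exists (k %/ m)%N, (k %% m)%N; rewrite -divn_eq ltn_pmod.
have hr : C (g ^+ r, (s - q%:R * s0)%R).
 have -> : g ^+ r = g ^+ k * (g ^+ m ^+ q)^-1.
  by rewrite kE addnC mulnC expgnDr expgnA mulgK.
 by apply: CM=> //; apply: CV; exact: partial_characterX.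
have r0 : r = 0%N.
 case: r kE rm hr=> // r kE rm hr; suff : (m <= r.+1)%N by rewrite leqNgt rm.
 by apply: mmin; apply/asboolP; exists (s - q%:R * s0)%R.
rewrite r0 expg0 in hr; rewrite kE r0 addn0 natrM.
have -> : (q%:R * m%:R * (s0 / m%:R) = q%:R * s0)%R by rewrite -mulrA [X in (_ * X)%R]mulrC divfK ?pnatr_eq0 -?lt0n.
exact: C1.
Qed.

(** Applied with L = 0 to the center of a group and with L the integers to a group modulo its
    commutators. *)
Lemma character_extension C0 : partial_character C0 -> exists f : G -> R,
 (forall x y, K x -> K y -> L (f (x * y)%g - f x - f y)%R) /\ forall x s, C0 (x, s) -> L (f x - s)%R.
Proof.
move=> hC0; have C01 : C0 (1, 0%R).
 case: hC0 => _ _ _ CR _; rewrite -(commg1 1); apply: CR; exact: subgroup1.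
have [|A [hA Amax]] := @Zorn_bigcup _ [set A : set (G * R) | partial_character (C0 `|` A)].
 move=> F FP Ftot; set U := \bigcup_(X in F) X.
 have [F0|Fn] := pselect (F = set0).
  by rewrite /= /U F0 bigcup_set0 setU0.
 have [X0 FX0] : exists X, F X by apply: contrapT => h; apply: Fn; apply/seteqP; split=> // X FX; case: h; exists X.
 have inX q : (C0 `|` U) q -> exists2 X, F X & (C0 `|` X) q.
  by case=> [h|[X FX h]]; [exists X0=> //; left|exists X=> //; right].
 have XU X q : F X -> (C0 `|` X) q -> (C0 `|` U) q.
  by move=> FX [h|h]; [left|right; exists X].
 split.
 - by move=> x s /inX[X /FP[CK _ _ _ _]]; exact: CK.
 - move=> x y s t /inX[X FX hx] /inX[Y FY hy].
  have [XY|YX] := Ftot X Y FX FY.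
   apply: (XU Y)=> //; have [_ CM _ _ _] := FP Y FY; apply: CM=> //.
   by case: hx => h; [left|right; apply: XY].
  apply: (XU X)=> //; have [_ CM _ _ _] := FP X FX; apply: CM=> //.
  by case: hy => h; [left|right; apply: YX].
 - by move=> x s /inX[X FX hx]; apply: (XU X)=> //; have [_ _ CV _ _] := FP X FX; exact: CV.
 - by move=> x y Kx Ky; left; case: hC0 => _ _ _ CR _; exact: CR.
 - by move=> s /inX[X /FP[_ _ _ _ C1]]; exact: C1.
pose D := C0 `|` A.
have Dtot x : K x -> exists s, D (x, s).
 move=> Kx; have [C' [DC' pC' [t ht]]] := partial_character_extend hA Kx.
 apply: contrapT => hn; apply: (Amax C').
  split; first by move=> q Aq; apply: DC'; right.
  by move=> h; apply: hn; exists t; right; apply: h.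
 by rewrite /= (_ : C0 `|` C' = C') //; apply/setUidr => q h; apply: DC'; left.
pose f x := xget 0%R [set s | D (x, s)].
have Df x : K x -> D (x, f x).
 by move=> Kx; rewrite /f; case: xgetP => [s _ //|hn]; have [s hs] := Dtot x Kx; case: (hn s).
case: hA => CK CM CV CR C1.
have key x s t : D (x, s) -> D (x, t) -> L (s - t)%R.
 by move=> h h'; apply: C1; rewrite -(mulgV x); apply: CM=> //; exact: CV.
exists f; split=> [x y Kx Ky|x s hx].
 rewrite -addrA -opprD; apply: (key (x * y)); first by apply: Df; exact: subgroupM.
 by apply: CM; apply: Df.
by apply: (key x); [apply: Df; apply: CK; left; exact: hx|left].
Qed.
End CharacterExtension.

(** * Total boundedness of matrices and compact subsets of groups *)

Lemma bounded_matrix_coloring (R : realType) m n (M e : R) : 0 < e -> exists (I : finType) (col : 'M[R]_(m, n) -> I),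
 forall A B, `|A| <= M -> `|B| <= M -> col A = col B -> `|A - B| <= e.
Proof.
move=> e0; pose N := Num.truncn (2 * M / e).
exists {ffun 'I_m * 'I_n -> 'I_N.+1}, (fun A => [ffun ij => inord (Num.truncn ((A ij.1 ij.2 + M) / e))]).
move=> A B hA hB /ffunP hc; apply: mx_norm_le => [|i j]; first exact: ltW.
have bd (A' : 'M[R]_(m, n)) : `|A'| <= M -> 0 <= (A' i j + M) / e /\ (A' i j + M) / e <= 2 * M / e.
 move=> h; have := le_trans (mx_coord_le A' i j) h; rewrite ler_norml => /andP[h1 h2]; split.
  by apply: divr_ge0; [rewrite -lerBlDr sub0r|exact: ltW].
 by rewrite ler_pM2r ?invr_gt0 // mulrDl mul1r lerD2r.
have [a1 a2] := bd A hA; have [b1 b2] := bd B hB.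
have := hc (i, j); rewrite !ffunE /= => /(congr1 val) /=.
have tr x : 0 <= x -> x <= 2 * M / e -> (Num.truncn x < N.+1)%N.
 by move=> x0 xM; rewrite ltnS; apply: le_truncn.
rewrite !inordK ?tr // => E.
have /andP[p1 p2] := truncn_itv a1; have /andP[q1 q2] := truncn_itv b1.
rewrite E in p1 p2; rewrite !mxE.
have -> : A i j - B i j = ((A i j + M) / e - (B i j + M) / e) * e.
 by rewrite -mulrBl divfK ?gt_eqF //; ring.
rewrite normrM (gtr0_norm e0); apply: ler_piMl; [exact: ltW|rewrite ler_norml].
move: p1 p2 q1 q2; rewrite -natr1; move: (_ / e) (_ / e) (Num.truncn _) => x y k h1 h2 h3 h4.
by apply/andP; split; lra.
Qed.

Section CompactSubsets.
Variable G : topGroupType.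
Local Open Scope group_scope.

Lemma compact_mulg (A B : set G) : compact A -> compact B -> compact [set z|exists x y, [/\ A x, B y & z = x * y]].
Proof.
move=> Ac Bc; have -> : [set z|exists x y, [/\ A x, B y & z = x * y]] = (fun p => p.1 * p.2) @` (A `*` B).
 apply/seteqP; split=> [z [x [y [Ax By ->]]]|_ [[x y] [/= Ax By] <-]]; first by exists (x, y).
 by exists x, y.
apply: continuous_compact; last exact: compact_setX.
by apply: continuous_subspaceT; exact: mulg_continuous.
Qed.

Lemma compact_invg (A : set G) : compact A -> compact [set z | A z^-1].
Proof.
move=> Ac; have -> : [set z | A z^-1] = (fun x => x^-1) @` A.
 by apply/seteqP; split=> [z Az|_ [x Ax <-]] /=; [exists z^-1=> //|]; rewrite invgK.
by apply: continuous_compact Ac; apply: continuous_subspaceT; exact: invg_continuous.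
Qed.

(** Commuting torsion elements generate a finite group; T is built by adjoining the finitely many
    powers of one element at a time. *)
Lemma torsion_products (s : seq G) : (forall x, x \in s -> exists2 k, (0 < k)%N & x ^+ k = 1) ->
 (forall x y, x \in s -> y \in s -> x * y = y * x) ->
 exists T : seq G, 1 \in T /\ forall t x, t \in T -> x \in s -> t * x \in T.
Proof.
elim: s => [|q s IH] tor com; first by exists [:: 1]; rewrite mem_head.
have [T [T1 hT]] : exists T : seq G, 1 \in T /\ forall t x, t \in T -> x \in s -> t * x \in T.
 by apply: IH => [x xs|x y xs ys]; [apply: tor|apply: com]; rewrite inE ?xs ?ys orbT.
have [m m0 qm] := tor q (mem_head _ _).
exists [seq t * q ^+ e | t <- T, e <- iota 0 m]; split.
 by apply/allpairsP; exists (1, 0%N); rewrite /= mem_iota expg0 mulg1.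
move=> t' x /allpairsP[[t e] [/= tT em ->]]; rewrite mem_iota /= in em.
rewrite inE => /predU1P[->|xs]; last first.
 have qx : q ^+ e * x = x * q ^+ e.
  elim: e {em} => [|e IHe]; first by rewrite expg0 mul1g mulg1.
  by rewrite expgS -mulgA IHe !mulgA (com q x) ?mem_head // inE xs orbT.
 apply/allpairsP; exists (t * x, e); rewrite /= mem_iota em -mulgA qx mulgA; split=> //; exact: hT.
rewrite -mulgA -expgSr; have [em'|] := ltnP e.+1 m.
 by apply/allpairsP; exists (t, e.+1); rewrite /= mem_iota.
move=> me; have -> : e.+1 = m by apply/eqP; rewrite eqn_leq em.
by apply/allpairsP; exists (t, 0%N); rewrite /= mem_iota expg0 qm.
Qed.
End CompactSubsets.

(** * Compactness of the analytic subgroup of a minimal negative definite ideal *)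

Section Semisimple.
Variables (R : realType) (n : nat) (G : topGroupType) (hG : hausdorff_space G).
Variable c : lie_chart R n.+1 G.
Hypothesis Gc : connected [set: G].
Notation V := 'rV[R]_n.+1.
Notation Exp := (Exp c).
Notation Ad := (Ad hG c).
Notation ad := (ad hG c).
Notation a := (ad_basis hG c).
Hypothesis nab : no_abelian_ideals a.
Notation B := (killing a).
Let aP := lie_alg_ad hG c.
Let Bu := killing_nondegenerate aP nab.

Lemma norm_mulmx_op m p q (A : 'M[R]_(m, p)) (D : 'M[R]_(p, q)) : `|A *m D| <= p%:R * `|D| * `|A|.
Proof. by rewrite mulrAC; exact: norm_mulmx_le. Qed.
Lemma mxtrace_norm_le (A : 'M[R]_n.+1) : `|\tr A| <= n.+1%:R * `|A|.
Proof.
rewrite /mxtrace; apply: (le_trans (ler_norm_sum _ _ _)).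
apply: (@le_trans _ _ (\sum_(i < n.+1) `|A|)); first by apply: ler_sum => i _; exact: mx_coord_le.
by rewrite sumr_const card_ord mulr_natl lexx.
Qed.

(** The vector representing x |-> tr (T ad x) for the Killing form. It is a left inverse of [ad] on
    all matrices, and serves as first order logarithm of Ad u at T = Ad u - 1. *)
Definition killing_dual (T : 'M[R]_n.+1) : V := (\row_j \tr (T *m a j)) *m invmx (killing_mx a).

Lemma killing_dualP T x : B (killing_dual T) x = \tr (T *m ad x).
Proof.
rewrite killingE /killing_dual mulmxKV // -adm_ad /adm mulmx_sumr raddf_sum /= mxE.
by apply: eq_bigr => j _; rewrite !mxE -scalemxAr mxtraceZ mulrC.
Qed.

Lemma killing_dual_ad X : killing_dual (ad X) = X.
Proof.
apply/eqP; rewrite -subr_eq0; apply/eqP/(killing_radical_eq0 aP nab) => y.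
by rewrite killingDl killingNl killing_dualP /killing !adm_ad subrr.
Qed.

Lemma killing_dual_bound : exists2 K : R, 0 < K & forall T, `|killing_dual T| <= K * `|T|.
Proof.
pose M : R := \sum_j `|a j|.
exists (n.+1%:R * `|invmx (killing_mx a)| * (n.+1%:R * n.+1%:R * M) + 1).
 by rewrite ltr_pwDr // !mulr_ge0 // sumr_ge0.
move=> T; apply: (le_trans (norm_mulmx_op _ _)).
have h : `|\row_j \tr (T *m a j)| <= n.+1%:R * n.+1%:R * M * `|T|.
 apply: norm_rV_le => [|j]; first by rewrite !mulr_ge0 // sumr_ge0.
 rewrite mxE; apply: (le_trans (mxtrace_norm_le _)); rewrite -!mulrA ler_wpM2l //.
 apply: (le_trans (norm_mulmx_op _ _)); rewrite -mulrA ler_wpM2l // ler_wpM2r //.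
 by rewrite /M (bigD1 j) //= lerDl sumr_ge0.
apply: (@le_trans _ _ (n.+1%:R * `|invmx (killing_mx a)| * (n.+1%:R * n.+1%:R * M * `|T|))).
 by rewrite ler_wpM2l // mulr_ge0.
by rewrite mulrDl mul1r !mulrA lerDl.
Qed.

Lemma ad_inj_bound : exists2 K : R, 0 < K & forall X, `|X| <= K * `|ad X|.
Proof.
have [K K0 hK] := killing_dual_bound; exists K=> // X.
by rewrite -{1}(killing_dual_ad X).
Qed.

Lemma Ad_eq1_central g : Ad g = 1%:M -> forall x, (g * x = x * g)%g.
Proof.
move=> hg x; suff : [set: G] `<=` [set x | forall z, [set g] z -> x * z = z * x]%g by move=> /(_ x I g erefl).
rewrite -(exp_group_full c Gc); apply: generated_sub; first exact: subgroup_centralizer.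
move=> _ [v _ ->] _ -> /=; apply: (mulgI g^-1%g).
by rewrite mulKg -conjgE -(AdE hG c) hg mulmx1.
Qed.

Lemma central_Ad_eq1 g : (forall x, g * x = x * g)%g -> Ad g = 1%:M.
Proof. by move=> hg; apply/esym/Ad_unique => v; rewrite mulmx1 conjgE -hg mulKg. Qed.
Lemma Ad_Exp_eq1 : exists2 r : R, 0 < r & forall X, `|X| <= r -> Ad (Exp X) = 1%:M -> X = 0.
Proof.
have [K K0 hK] := ad_inj_bound; have [d d0 [C C0 [_ hC]]] := ad_bounds hG c.
pose e := (K * C + 1)^-1.
have e0 : 0 < e by rewrite invr_gt0 ltr_pwDr // mulr_ge0 // ltW.
exists (Num.min d (e / 2)) => [|X]; first by rewrite lt_min d0 divr_gt0.
rewrite le_min => /andP[Xd Xe] X1.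
have := hC _ Xd; rewrite X1 subrr sub0r normrN => h.
have {}h : `|X| <= K * (C * `|X| ^+ 2).
 by apply: (le_trans (hK X)); rewrite ler_wpM2l // ltW.
apply/eqP; rewrite -normr_le0 leNgt; apply/negP => X0.
have : 1 <= K * C * `|X| by rewrite -(ler_pM2r X0) mul1r -[leRHS]mulrA -expr2 -mulrA.
have : K * C * `|X| <= K * C * (e / 2) by rewrite ler_wpM2l // mulr_ge0 // ltW.
have : (K * C + 1) * e = 1 by rewrite /e divff // gt_eqF // -invr_gt0.
rewrite mulrDl mul1r; lra.
Qed.

(* Ad u - 1 is a derivation up to a quadratic error, and derivations are inner. *)
Lemma Ad_near_inner : exists2 C : R, 0 <= C & forall u, `|Ad u - 1%:M - ad (killing_dual (Ad u - 1%:M))| <= C * `|Ad u - 1%:M| ^+ 2.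
Proof.
have [K K0 hK] := killing_dual_bound; have [d d0 [C [C0 [hC _]]]] := ad_bounds hG c.
pose M := K * (n.+1%:R * (C * n.+1%:R)).
have M0 : 0 <= M by rewrite !mulr_ge0 // ltW.
exists M=> // u.
set T := Ad u - 1%:M; set Y := killing_dual T.
have AT : Ad u = 1%:M + T by rewrite /T addrC subrK.
clearbody T.
apply: mx_norm_le_op => [|y]; first by rewrite mulr_ge0 // sqr_ge0.
set E := T *m ad (y *m T).
have eq1 : ad (y *m T) = ad y *m T - T *m ad y - E.
 have := congr1 (fun X => Ad u *m X) (ad_conj hG c u y).
 rewrite /= !mulmxA AdV mul1mx AT mulmxDr mulmx1 adD mulmxDl mul1mx !mulmxDr mulmx1 => h.
 rewrite /E; move: h; move: (ad (y *m T)) (ad y) => P Q h.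
 have -> : Q *m T = P + (T *m Q + T *m P) by apply: (addrI Q); rewrite -h -addrA.
 by move: (T *m Q) (T *m P) => U W; mx_ring.
have eq2 : y *m (T - ad Y) = - killing_dual E.
 apply/eqP; rewrite -subr_eq0; apply/eqP/(killing_radical_eq0 aP nab) => z.
 rewrite opprK killingDl killing_dualP /killing !adm_ad mulmxBr adD.
 have -> : ad (- (y *m ad Y)) = - (ad y *m ad Y - ad Y *m ad y) by rewrite (adN hG c) ad_jacobi.
 rewrite eq1.
 have : \tr ((T - ad Y) *m ad (z *m ad y)) = 0.
  by rewrite mulmxBl raddfB /= -killing_dualP -/Y /killing !adm_ad subrr.
 set S := T - ad Y; rewrite ad_jacobi mulmxBr raddfB /= => hS.
 have -> : ad y *m T - T *m ad y - E - (ad y *m ad Y - ad Y *m ad y) = ad y *m S - S *m ad y - E.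
  rewrite /S mulmxBr mulmxBl; move: (ad y *m _) (ad y *m _) (T *m _) (ad Y *m _) => P1 P2 P3 P4.
  by mx_ring.
 have -> : (ad y *m S - S *m ad y - E) *m ad z = ad y *m (S *m ad z) - S *m (ad y *m ad z) - E *m ad z.
  by clearbody S; rewrite !mulmxBl !mulmxA.
 by rewrite !raddfB /= subrK mxtrace_mulC -mulmxA.
rewrite eq2 normrN; apply: (le_trans (hK E)).
have h1 : `|E| <= n.+1%:R * `|T| * (C * (n.+1%:R * `|T| * `|y|)).
 apply: mulmx_le_trans; rewrite ler_wpM2l ?mulr_ge0 //.
 by apply: (le_trans (hC _)); rewrite ler_wpM2l // norm_mulmx_op.
have -> : M * `|T| ^+ 2 * `|y| = K * (n.+1%:R * `|T| * (C * (n.+1%:R * `|T| * `|y|))) by rewrite /M; ring.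
by rewrite ler_wpM2l // ltW.
Qed.

Lemma Exp_mul_small X Y : `|X| <= 64^-1 -> `|Y| <= 64^-1 ->
 exists2 Z, `|Z| <= 8 * (`|X| + `|Y|) & Exp Z = (Exp X * Exp Y)%g.
Proof.
move=> hX hY; pose muP := lc_law c.
have q1 : (64^-1 : R) <= 4^-1 by rewrite lef_pV2 ?posrE // ler_nat.
have X4 := le_trans hX q1; have Y4 := le_trans hY q1.
have x2 := norm_lexp_le muP X4; have y2 := norm_lexp_le muP Y4.
rewrite !Exp_small //.
set x := lexp _ X in x2 *; set y := lexp _ Y in y2 *.
have x1 : `|x| <= 1 by move: x2 X4; clear -Gc Bu; lra.
have y1 : `|y| <= 1 by move: y2 Y4; clear -Gc Bu; lra.
have h := mu_sum_le muP x1 y1.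
have hm : `|lc_mu c x y| <= 2 * (`|x| + `|y|).
 have := ler_normD (lc_mu c x y - (x + y)) (x + y); rewrite subrK => h3.
 have h4 := ler_normD x y; have h5 : `|x| * `|y| <= 1 * `|y| by rewrite ler_wpM2r.
 have := normr_ge0 x; move: h h3 h4 h5; clear -Gc Bu; rewrite mul1r; have := normr_ge0 y; lra.
have m8 : `|lc_mu c x y| <= 8^-1.
 by move: hm x2 y2 hX hY; clear -Gc Bu; lra.
have [Z Z1 Z2] := lexp_surj muP m8.
exists Z; first by move: Z1 hm x2 y2; clear -Gc Bu; lra.
rewrite Exp_small; first by rewrite Z2 lc_psiM.
by move: Z1 m8; clear -Gc Bu; lra.
Qed.

Lemma Ad_continuous g (e : R) : 0 < e -> nbhs g [set h | `|Ad h - Ad g| <= e].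
Proof.
move=> e0; have [d d0 [C C0 hC]] := Ad_near1 hG c.
pose r := Num.min d (e / (n.+1%:R * `|Ad g| * C + 1)).
have q0 : 0 < n.+1%:R * `|Ad g| * C + 1 by rewrite ltr_pwDr // !mulr_ge0.
have r0 : 0 < r by rewrite lt_min d0 divr_gt0.
apply: filterS (nbhs_translate1 g (lexp_image_nbhs c r0)) => h [X Xr hX] /=.
have -> : h = (g * Exp X)%g by rewrite -hX mulVKg.
have -> : Ad (g * Exp X)%g - Ad g = Ad g *m (Ad (Exp X) - 1%:M) by rewrite AdM mulmxBr mulmx1.
move: Xr; rewrite lt_min => /andP[/ltW Xd]; rewrite ltr_pdivlMr // => Xe.
apply: mulmx_le_trans; apply: (@le_trans _ _ (n.+1%:R * `|Ad g| * (C * `|X|))).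
 by rewrite ler_wpM2l ?hC // mulr_ge0.
have -> : n.+1%:R * `|Ad g| * (C * `|X|) = `|X| * (n.+1%:R * `|Ad g| * C) by ring.
by have := normr_ge0 X; move: Xe; rewrite mulrDr mulr1; clear -Gc Bu; lra.
Qed.

Lemma ball_compact m (r : R) : compact [set x : 'rV[R]_m | `|x| <= r].
Proof.
apply: bounded_closed_compact.
 by exists r; split=> [|M rM x /= xr]; [exact: num_real|exact: le_trans (ltW rM)].
have -> : [set x : 'rV[R]_m | `|x| <= r] = (fun x => `|x|) @^-1` [set x | x <= r] by [].
by apply: closed_comp; [move=> x _; exact: norm_continuous|exact: closed_le].
Qed.

(** By compactness some X0 in the ball minimizes the distance of Ad (u Exp X) to 1. If the minimum
    were positive, a Newton step would decrease it while remaining in the ball. Hence u is central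
    up to the small factor Exp X0. *)
Lemma Ad_near1_central (r : R) : 0 < r -> exists2 e : R, 0 < e & forall u, `|Ad u - 1%:M| <= e ->
 exists2 X, `|X| <= r & Ad (u * Exp X)%g = 1%:M.
Proof.
move=> r0; have [K K0 hK] := killing_dual_bound; have [d d0 [C C0 [_ hC]]] := ad_bounds hG c.
have hK' X : `|X| <= K * `|ad X| by rewrite -{1}(killing_dual_ad X).
have [C' C'0 hC'] := Ad_near_inner; have [d1 d10 [C1 C10 hC1]] := Ad_near1 hG c.
wlog rs : r r0 / [/\ r <= 128^-1, r <= d & K * C * r <= 2^-1].
 move=> W; pose r' := Num.min (Num.min r 128^-1) (Num.min d (2 * (K * C + 1))^-1).
 have q0 : 0 < 2 * (K * C + 1) by rewrite mulr_gt0 // ltr_pwDr // mulr_ge0 // ltW.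
 have r'0 : 0 < r' by rewrite !lt_min r0 d0 !invr_gt0 q0 ltr0n.
 have [||e e0 he] := W r'.
 - by [].
 - split; [by rewrite !ge_min lexx orbT|by rewrite !ge_min lexx !orbT|].
  have : r' <= (2 * (K * C + 1))^-1 by rewrite !ge_min lexx !orbT.
  rewrite -[X in _ <= X]mul1r ler_pdivlMr //; move: (K * C) r'0 => q; clear -Gc Bu; nra.
 by exists e=> // u /he[X X1 X2]; exists X=> //; apply: le_trans X1 _; rewrite !ge_min lexx.
case: rs => r128 rd KCr.
(* The Newton correction -Y turns the distance m into at most Q m^2. *)
pose Q := C' + C * K ^+ 2 + n.+1%:R * (C1 * K).
have Q0 : 0 <= Q by rewrite !addr_ge0 // !mulr_ge0 // ?sqr_ge0 // ltW.
pose e := Num.min (Num.min (2 * n.+1%:R)^-1 (2 * (Q + 1))^-1)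
 (Num.min (r / (128 * (K + 1))) (Num.min (d1 / (K + 1)) (d / (K + 1)))).
have K1 : 0 < K + 1 by rewrite addr_gt0.
have Q1 : 0 < 2 * (Q + 1) by rewrite mulr_gt0 // ltr_pwDr.
have n1 : 0 < 2 * n.+1%:R :> R by rewrite mulr_gt0.
have e0 : 0 < e by rewrite !lt_min !invr_gt0 n1 Q1 !divr_gt0 // mulr_gt0.
have e1 : e * (2 * n.+1%:R) <= 1 by rewrite -ler_pdivlMr // mul1r !ge_min lexx.
have e2 : e * (2 * (Q + 1)) <= 1 by rewrite -ler_pdivlMr // mul1r !ge_min lexx orbT.
have e3 : e * (128 * (K + 1)) <= r by rewrite -ler_pdivlMr ?mulr_gt0 // !ge_min lexx !orbT.
have e4 : e * (K + 1) <= d1 by rewrite -ler_pdivlMr // !ge_min lexx !orbT.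
have e5 : e * (K + 1) <= d by rewrite -ler_pdivlMr // !ge_min lexx !orbT.
clearbody e; exists e=> // u hu.
pose f X := - `|Ad (u * Exp X)%g - 1%:M|.
have [X0] : exists2 X0, `|X0| <= r & forall X, `|X| <= r -> `|Ad (u * Exp X0)%g - 1%:M| <= `|Ad (u * Exp X)%g - 1%:M|.
 have [|||X0 h1 h2] := @EVT_max_rV R n.+1 f [set X | `|X| <= r].
 - by exists 0; rewrite /= normr0 ltW.
 - exact: ball_compact.
 - apply: continuous_subspaceT => X; apply/(@cvgrPdist_le _ _ _ (nbhs X) (nbhs_filter X)) => eps eps0.
  have hc : nbhs X [set Y | `|Ad (u * Exp Y)%g - Ad (u * Exp X)%g| <= eps].
   have nb : nbhs (Exp X) [set h | `|Ad (u * h)%g - Ad (u * Exp X)%g| <= eps].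
    have hE : (fun h => u * h)%g @ Exp X --> (u * Exp X)%g by apply: cvgMg; [exact: cvg_cst|exact: cvg_id].
    exact: hE _ (Ad_continuous _ eps0).
   exact: (@Exp_continuous _ _ _ c X _ nb).
  apply: filterS hc => Y /= hY; rewrite /f opprK addrC.
  apply: le_trans hY; apply: le_trans (ler_dist_dist _ _) _.
  by rewrite opprB addrA subrK.
 exists X0; first by move: h1; rewrite inE.
 by move=> X hX; have := h2 X; rewrite inE /f lerN2; apply.
move=> X0r Xmin; exists X0=> //.
set g := (u * Exp X0)%g in Xmin *; set T := Ad g - 1%:M in Xmin.
have me : `|T| <= e by have := Xmin 0; rewrite normr0 Exp0 mulg1 => /(_ (ltW r0)) h; exact: le_trans hu.
(* The minimizer is well inside the ball of radius r, which leaves room for the correction. *)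
have small_X0 : `|X0| <= 8 * (K * e).
 set S := Ad (Exp X0) - 1%:M.
 have hS : S = (T - (Ad u - 1%:M)) - (Ad u - 1%:M) *m S.
  rewrite /T /g AdM /S mulmxBl mul1mx mulmxBr mulmx1.
  by move: (Ad u *m Ad (Exp X0)) (Ad u) (Ad (Exp X0)) => P P' P''; mx_ring.
 have S1 : `|S| <= 2 * e + n.+1%:R * e * `|S|.
  rewrite {1}hS; apply: (le_trans (ler_normB _ _)); apply: lerD.
   apply: (le_trans (ler_normB _ _)); rewrite mulr2n mulrDl mul1r; exact: lerD.
  by apply: mulmx_le_trans; rewrite ler_wpM2r // ler_wpM2l.
 have S2 : `|S| <= 4 * e.
  have : n.+1%:R * e * `|S| <= 2^-1 * `|S| by rewrite ler_wpM2r //; move: e1; clear -Gc Bu; lra.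
  by move: S1; clear -Gc Bu; lra.
 have h1 : `|ad X0| <= `|S| + C * `|X0| ^+ 2.
  have -> : ad X0 = S - (S - ad X0) by rewrite subKr.
  by apply: (le_trans (ler_normB _ _)); rewrite lerD2l hC // (le_trans X0r).
 have h2 : `|X0| <= K * (4 * e) + K * C * r * `|X0|.
  apply: (le_trans (hK' X0)).
  have -> : K * (4 * e) + K * C * r * `|X0| = K * (4 * e + C * (r * `|X0|)) by ring.
  apply: ler_wpM2l; [exact: ltW|]; apply: (le_trans h1); apply: lerD=> //.
  by rewrite ler_wpM2l // expr2 ler_wpM2r.
 have : K * C * r * `|X0| <= 2^-1 * `|X0| by rewrite ler_wpM2r.
 by move: h2; clear -Gc Bu; lra.
apply/eqP; rewrite -subr_eq0 -normr_le0 -/T leNgt; apply/negP => T0.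
set Y := killing_dual T.
have Ym : `|Y| <= K * `|T| by exact: hK.
have Ye : `|Y| <= K * e by apply: (le_trans Ym); rewrite ler_wpM2l // ltW.
have Ke : K * e <= r / 128.
 by move: e3 e0 K0; clear -Gc Bu; nra.
have [X' X'1 X'2] : exists2 Z, `|Z| <= 8 * (`|X0| + `|- Y|) & Exp Z = (Exp X0 * Exp (- Y))%g.
 apply: Exp_mul_small; rewrite ?normrN; move: small_X0 Ye Ke r128; clear -Gc Bu; lra.
have X'r : `|X'| <= r.
 by apply: (le_trans X'1); rewrite normrN; move: small_X0 Ye Ke r0; clear -Gc Bu; lra.
have := Xmin X' X'r; rewrite X'2 mulgA -/g AdM leNgt; apply/negP/negPn.
set S := Ad (Exp (- Y)) - 1%:M.
have -> : Ad g *m Ad (Exp (- Y)) - 1%:M = (T - ad Y) + (S - ad (- Y)) + T *m S.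
 rewrite (adN hG c) /S /T mulmxBr mulmx1 mulmxBl mul1mx.
 by move: (Ad g *m Ad (Exp (- Y))) (Ad g) (Ad (Exp (- Y))) (ad Y) => P P' P'' P3; mx_ring.
have Yd : `|- Y| <= d by rewrite normrN; move: Ye e5 e0; clear -Gc Bu; lra.
have Yd1 : `|- Y| <= d1 by rewrite normrN; move: Ye e4 e0; clear -Gc Bu; lra.
have k1 := hC' g; rewrite -/T -/Y in k1.
have k2 := hC _ Yd; rewrite -/S normrN in k2.
have k3 := hC1 _ Yd1; rewrite -/S normrN in k3.
have k4 : `|T *m S| <= n.+1%:R * (C1 * K) * `|T| ^+ 2.
 apply: mulmx_le_trans.
 have -> : n.+1%:R * (C1 * K) * `|T| ^+ 2 = n.+1%:R * `|T| * (C1 * (K * `|T|)) by ring.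
 by rewrite ler_wpM2l ?mulr_ge0 //; apply: (le_trans k3); rewrite ler_wpM2l.
have k5 : C * `|Y| ^+ 2 <= C * K ^+ 2 * `|T| ^+ 2.
 rewrite -mulrA -exprMn; apply: ler_wpM2l=> //; apply: lerXn2r=> //; rewrite nnegrE ?normr_ge0 //; exact: le_trans Ym.
have k6 : Q * `|T| ^+ 2 < `|T|.
 rewrite expr2 mulrA -[X in _ < X]mul1r ltr_pM2r //.
 apply: (@le_lt_trans _ _ (Q * e)); first by rewrite ler_wpM2l.
 by move: e2 e0; clear -Gc Bu; lra.
apply: le_lt_trans k6; apply: normD_le_trans.
have := ler_normD (T - ad Y) (S - ad (- Y)).
rewrite /Q !mulrDl; move: k1 k2 k4 k5; clear.
move: (`|_ - _|) (`|_ - _|) (`|_ + _|) (`|_ *m _|) => *; lra.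
Qed.
Variable W : 'M[R]_n.+1.
Hypothesis Wi : ideal a W.
Hypothesis Wdef : forall x : V, (x <= W)%MS -> B x x <= 0 /\ (B x x = 0 -> x = 0).
Notation O := (orth a W).
Notation H := (exp_group c W).
Let sH : is_subgroup H := generatedG _.

Lemma ideal_orth_bracket (x y : V) : (x <= W)%MS -> (y <= O)%MS -> x *m ad y = 0 /\ y *m ad x = 0.
Proof.
move=> xW yO; have h : x *m ad y = - (y *m ad x) by rewrite -!adm_ad (adm_anti aP).
suff : x *m ad y = 0 by move=> E; split=> //; apply/eqP; rewrite -oppr_eq0 -h E.
apply/eqP; rewrite -submx0 -(ideal_cap_orth aP nab Wi) sub_capmx -adm_ad (ideal_sub _ Wi xW) /=.
by rewrite adm_ad h eqmx_opp -adm_ad; apply: ideal_sub yO; exact: ideal_orth.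
Qed.

Lemma ideal_projection : exists P : 'M[R]_n.+1, forall v : V, (v *m P <= W)%MS /\ (v - v *m P <= O)%MS.
Proof.
have /sub_addsmxP[[u1 u2] /= E] := ideal_add_orth aP nab Wi.
exists (u1 *m W) => v; split; first by rewrite mulmxA submxMl.
have -> : v - v *m (u1 *m W) = v *m u2 *m O; last exact: submxMl.
by rewrite -{1}[v]mulmx1 E mulmxDr addrC addKr mulmxA.
Qed.

Lemma exp_group_fix_orth h (y : V) : H h -> (y <= O)%MS -> y *m Ad h = y.
Proof.
move=> Hh yO; suff : H `<=` [set h | y *m Ad h = y] by apply.
apply: (exp_group_ind hG (P := [set h | y *m Ad h = y])) => [|v x vW hx]; first by rewrite /= Ad1 mulmx1.
by rewrite /= AdM mulmxA AdExp_fix // (ideal_orth_bracket vW yO).2.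
Qed.

Lemma Exp_orth_fix (x y : V) : (x <= W)%MS -> (y <= O)%MS -> x *m Ad (Exp y) = x.
Proof. by move=> xW yO; apply: AdExp_fix; rewrite (ideal_orth_bracket xW yO).1. Qed.
Lemma Ad_eq1_split g : (forall x : V, (x <= W)%MS -> x *m Ad g = x) ->
 (forall y : V, (y <= O)%MS -> y *m Ad g = y) -> Ad g = 1%:M.
Proof.
move=> h1 h2; have [P hP] := ideal_projection.
apply/row_matrixP => i; rewrite !rowE mulmx1; have [p1 p2] := hP (delta_mx 0 i).
by rewrite -[X in X *m _](subrK (delta_mx 0 i *m P)) mulmxDl (h1 _ p1) (h2 _ p2) subrK.
Qed.

(** X splits into commuting components X1 in W and X2 in the orthogonal. If Exp X fixes the
    orthogonal, Exp X2 acts trivially on both summands, and X2 = 0 by local injectivity of Ad (Exp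
    X). *)
Lemma near_orth_fix_sub : exists2 r : R, 0 < r & forall X : V, `|X| <= r ->
 (forall y : V, (y <= O)%MS -> y *m Ad (Exp X) = y) -> (X <= W)%MS.
Proof.
have [r1 r10 hr] := Ad_Exp_eq1; have [P hP] := ideal_projection.
pose K : R := 1 + n.+1%:R * `|P|.
have K0 : 0 < K by rewrite ltr_pwDl // mulr_ge0.
exists (r1 / K) => [|X Xr hX]; first by rewrite divr_gt0.
have [p1 p2] := hP X; set X1 := X *m P in p1 p2; pose X2 := X - X1.
have E : Exp X = (Exp X1 * Exp X2)%g.
 by rewrite -(Exp_add_commute (hG := hG)) ?(ideal_orth_bracket p1 p2).1 // /X2 subrKC.
suff : X2 = 0 by move/eqP; rewrite subr_eq0 => /eqP ->.
apply: hr.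
 apply: (le_trans (ler_normB _ _)).
 have h : `|X1| <= n.+1%:R * `|P| * `|X| by exact: norm_mulmx_op.
 apply: (@le_trans _ _ (K * `|X|)); first by rewrite /K mulrDl mul1r lerD2l.
 by rewrite mulrC -ler_pdivlMr.
apply: Ad_eq1_split => [x xW|y yO]; first exact: Exp_orth_fix.
by have := hX y yO; rewrite E AdM mulmxA (AdExp_fix (ideal_orth_bracket p1 yO).2).
Qed.

Lemma killing_CauchySchwarz (x w : V) : (x <= W)%MS -> (w <= W)%MS -> B x w ^+ 2 <= B x x * B w w.
Proof.
move=> xW wW; have [w0 w1] := Wdef wW.
have [->|wn] := eqVneq w 0; first by rewrite killingC killing0l killing0l expr0n mulr0.
have bw : B w w < 0 by rewrite lt_neqAle w0 andbT; apply: contra wn => /eqP /w1 ->.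
have yW : ((B w w *: x + (- B x w) *: w)%R <= W)%MS by apply: addmx_sub; exact: scalemx_sub.
have [] := Wdef yW; rewrite !killingDl !killingZl !killingDr !killingZr (killingC _ w x) => h _.
have {}h : B w w * (B w w * B x x - B x w ^+ 2) <= 0.
 by apply: le_trans h; apply: le_of_eq; ring.
by move: h; rewrite nmulr_rle0 // subr_ge0 mulrC.
Qed.

(** On W each coordinate is the Killing product with a vector of W, so the Cauchy-Schwarz inequality
    bounds it by the definite form. *)
Lemma definite_norm : exists2 q : R, 0 <= q & forall x : V, (x <= W)%MS -> `|x| <= Num.sqrt (q * - B x x).
Proof.
have [P hP] := ideal_projection.
pose w i : V := ((delta_mx 0 i : V) *m invmx (killing_mx a)) *m P.
have ww i : B (w i) (w i) <= 0 by apply: (Wdef _).1; exact: (hP _).1.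
exists (\sum_i - B (w i) (w i)) => [|x xW]; first by apply: sumr_ge0 => i _; rewrite oppr_ge0.
have [x0 _] := Wdef xW.
apply: norm_rV_le => [|i]; first exact: sqrtr_ge0.
have -> : x 0 i = B x (w i).
 have /orthP h := (hP ((delta_mx 0 i : V) *m invmx (killing_mx a))).2.
 rewrite killingC; have := h x xW; rewrite killingDl killingNl => /eqP; rewrite subr_eq0 => /eqP <-.
 rewrite killingE mulmxKV // mxE (bigD1 i) //= big1 ?addr0 => [|j ji].
  by rewrite !mxE !eqxx mul1r.
 by rewrite !mxE eqxx (negPf ji) mul0r.
rewrite -sqrtr_sqr; apply: ler_wsqrtr.
apply: (le_trans (killing_CauchySchwarz xW (hP _).1)); rewrite -mulrNN mulrC.
rewrite ler_wpM2r ?oppr_ge0 // (bigD1 i) //= lerDl; apply: sumr_ge0 => j _; by rewrite oppr_ge0.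
Qed.

Lemma killing_bound : exists2 C : R, 0 <= C & forall x, - B x x <= C * `|x| ^+ 2.
Proof.
have [_ _ [C [C0 [hC _]]]] := ad_bounds hG c.
exists (n.+1%:R * (n.+1%:R * C * C)) => [|x]; first by rewrite !mulr_ge0.
apply: (le_trans (ler_norm _)); rewrite normrN /killing !adm_ad.
apply: (le_trans (mxtrace_norm_le _)); rewrite -!mulrA ler_wpM2l //.
apply: mulmx_le_trans; rewrite -!mulrA ler_wpM2l //.
have -> : C * (C * `|x| ^+ 2) = (C * `|x|) * (C * `|x|) by ring.
exact: ler_pM.
Qed.

Lemma Ad_bounded : exists2 M : R, 0 <= M & forall h, H h -> `|Ad h| <= M.
Proof.
have [P hP] := ideal_projection; have [q q0 hq] := definite_norm.
have [C' C'0 BC] := killing_bound.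
have xH (x : V) h : (x <= W)%MS -> `|x *m Ad h| <= Num.sqrt (q * C') * `|x|.
 move=> xW; have xhW : (x *m Ad h <= W)%MS by apply: submx_trans (ideal_Ad Gc h Wi); exact: submxMr.
 apply: (le_trans (hq _ xhW)); rewrite killing_Ad.
 have e : `|x| = Num.sqrt (`|x| ^+ 2) by rewrite sqrtr_sqr ger0_norm.
 rewrite [X in _ <= _ * X]e -sqrtrM ?mulr_ge0 //; apply: ler_wsqrtr.
 by rewrite -mulrA ler_wpM2l.
pose M : R := Num.sqrt (q * C') * (n.+1%:R * `|P|) + (1 + n.+1%:R * `|P|).
have M0 : 0 <= M by rewrite !addr_ge0 // mulr_ge0 // ?sqrtr_ge0 // mulr_ge0.
exists M=> // h Hh; apply: mx_norm_le_op=> // v; have [p1 p2] := hP v.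
have hv : `|v *m P| <= n.+1%:R * `|P| * `|v| by exact: norm_mulmx_op.
rewrite -[X in `|X *m _|](subrK (v *m P)) mulmxDl (exp_group_fix_orth Hh p2).
apply: normD_le_trans; rewrite addrC /M mulrDl; apply: lerD.
 by apply: (le_trans (xH _ h p1)); rewrite -mulrA ler_wpM2l ?sqrtr_ge0.
by apply: (le_trans (ler_normB _ _)); rewrite mulrDl mul1r lerD2l.
Qed.

(** H is compact modulo its center: the bounded set Ad H falls into finitely many small pieces, and
    if Ad h and Ad g are in one piece, [Ad_near1_central] makes h g^-1 central up to a small
    exponential, whose exponent lies in W. *)
Lemma exp_group_cover (r : R) : 0 < r -> exists s : seq G, (forall g, g \in s -> H g) /\
 forall h, H h -> exists z X g, [/\ [/\ H z & Ad z = 1%:M], (X <= W)%MS, `|X| <= r, g \in s & h = (z * Exp X * g)%g].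
Proof.
move=> r0; have [r2 r20 hr2] := near_orth_fix_sub.
have m0 : 0 < Num.min r r2 by rewrite lt_min r0.
have [e e0 he] := Ad_near1_central m0.
have [M M0 hM] := Ad_bounded.
have q0 : 0 < e / (n.+1%:R * M + 1) by rewrite divr_gt0 // ltr_pwDr // mulr_ge0.
have [I [col hcol]] := bounded_matrix_coloring n.+1 n.+1 M q0.
pose rep i := xget 1%g [set h | H h /\ col (Ad h) = i].
have Hrep i : H (rep i) by rewrite /rep; case: xgetP => [h _ []|_] //; exact: (subgroup1 sH).
exists [seq rep i | i <- enum I]; split; first by move=> _ /mapP[i _ ->].
move=> h Hh; pose g := rep (col (Ad h)); have Hg : H g := Hrep _.
have cg : col (Ad g) = col (Ad h).
 by rewrite /g /rep; case: xgetP => [? _ [] //|/(_ h)]; case.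
have hu : `|Ad (h * g^-1)%g - 1%:M| <= e.
 rewrite AdM -(AdV hG c g) -mulmxBl; apply: (le_trans (norm_mulmx_op _ _)).
 apply: (@le_trans _ _ (n.+1%:R * M * (e / (n.+1%:R * M + 1)))).
  apply: ler_pM=> //; rewrite ?mulr_ge0 //; last by apply: hcol; rewrite ?hM.
  by rewrite ler_wpM2l // hM //; apply: (subgroupV sH).
 by rewrite mulrA ler_pdivrMr ?ltr_pwDr ?mulr_ge0 // mulrDr mulr1 mulrC lerDl ltW.
have [X] := he _ hu; rewrite le_min => /andP[Xr Xr2] hX.
have Hu : H (h * g^-1)%g by apply: (subgroupM sH)=> //; exact: (subgroupV sH).
have XW : (X <= W)%MS.
 apply: hr2=> // y yO; rewrite -{1}(exp_group_fix_orth Hu yO) -mulmxA -AdM hX mulmx1 //.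
exists (h * g^-1 * Exp X)%g, (- X), g; split; rewrite ?normrN ?eqmx_opp //.
- by split=> //; apply: (subgroupM sH)=> //; exact: exp_group_Exp.
- by apply/mapP; exists (col (Ad h))=> //; rewrite mem_enum.
by rewrite ExpN // mulgK mulgVK.
Qed.

Lemma center_discrete : nbhs (1%g : G) [set s | Ad s = 1%:M -> s = 1%g].
Proof.
have [r r0 hr] := Ad_Exp_eq1.
by apply: filterS (lexp_image_nbhs c r0) => _ [X Xr ->] /= h; rewrite (hr X (ltW Xr) h) Exp0.
Qed.

Lemma compact_center_finite (K : set G) : compact K -> exists s : seq G, forall z, K z -> Ad z = 1%:M -> z \in s.
Proof.
move=> Kc; have [D D1 hD] := nbhs1_div center_discrete.
have [s [_ hs]] := compact_nbhs_cover Kc (fun x => nbhs_translate1 x D1).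
pose f x := xget 1%g [set z | D (x^-1 * z)%g /\ Ad z = 1%:M].
exists [seq f x | x <- s] => z Kz z1; have [x xs Dx] := hs z Kz.
apply/mapP; exists x=> //; rewrite /f; case: xgetP => [z' _ [Dz' z'1]|/(_ z)]; last by case.
have E : ((x^-1 * z')^-1 * (x^-1 * z) = z'^-1 * z)%g by free_group.
have := hD _ _ Dz' Dx; rewrite E /= AdM z1 mulmx1 => h.
have : Ad z'^-1%g = 1%:M by rewrite -[LHS]mul1mx -z'1 AdV.
by move/h => e; rewrite -[z](mulVKg z') e mulg1.
Qed.
Hypothesis W0 : W != 0.
Hypothesis Wmin : forall m (U : 'M[R]_(m, n.+1)), ideal a U -> (U <= W)%MS -> U != 0 -> (W <= U)%MS.
Let Hconn : connected H. Proof. exact: exp_group_connected. Qed.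

Lemma exp_group_nonabelian : exists x y, [/\ H x, H y & (x * y <> y * x)%g].
Proof.
apply: contrapT => hn; have com x y : H x -> H y -> (x * y = y * x)%g.
 by move=> Hx Hy; apply: contrapT => h; apply: hn; exists x, y.
have [r r0 hr] := Ad_Exp_eq1.
case/eqP: W0; apply/row_matrixP => i; rewrite row0; set v : V := row i W.
have vW : (v <= W)%MS by exact: row_sub.
pose t := r / (`|v| + 1); have v1 : 0 < `|v| + 1 by rewrite ltr_pwDr.
have t0 : 0 < t by rewrite divr_gt0.
suff : t *: v = 0 by move/eqP; rewrite scaler_eq0 gt_eqF //= => /eqP.
apply: hr; first by rewrite normrZ gtr0_norm // /t mulrAC ler_pdivrMr // mulrDr mulr1 lerDl ltW.
have Htv : H (Exp (t *: v)) by apply: exp_group_Exp; exact: scalemx_sub.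
apply: (Ad_eq1_split) => [x xW|y yO]; last exact: exp_group_fix_orth.
apply: (@Exp_line_inj _ _ _ c) => u; have Hu : H (Exp (u *: x)) by apply: exp_group_Exp; exact: scalemx_sub.
by rewrite scalemxAl (AdE hG c) conjgE (com _ _ Hu Htv) mulKg.
Qed.

(* The curves t |-> (Exp(tX)^g Exp(-tX))^h stay in N, and their velocities span an ideal. *)
Lemma exp_group_normal_sub (N : set G) g : is_subgroup N -> N `<=` H -> normalized_by H N ->
 N g -> Ad g <> 1%:M -> H `<=` N.
Proof.
move=> sN NH nN Ng g1.
have [X XW Xg] : exists2 X : V, (X <= W)%MS & X *m Ad g <> X.
 apply: contrapT => hn; apply: g1; apply: (Ad_eq1_split) => [x xW|y yO].
  by apply: contrapT => h; apply: hn; exists x.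
 by apply: (exp_group_fix_orth (NH _ Ng)).
pose Y0 := X *m Ad g - X.
have WAd (v : V) h : (v <= W)%MS -> (v *m Ad h <= W)%MS.
 by move=> vW; apply: submx_trans (ideal_Ad Gc h Wi); exact: submxMr.
have Y0W : (Y0 <= W)%MS by rewrite addmx_sub ?eqmx_opp ?WAd.
have Y00 : Y0 != 0 by rewrite subr_eq0; apply/eqP.
have [m [U [hU Umax]]] := pred_span (fun v => exists h, H h /\ v = Y0 *m Ad h).
have /choice[hh hhP] := hU.
have UW : (U <= W)%MS by apply/row_subP => i; have [h [_ ->]] := hU i; exact: WAd.
have [P hP] := ideal_projection.
have Ui : ideal a U.
 apply: Ad_stable_ideal => x; apply/row_subP => i; rewrite row_mul; have [h [Hh ->]] := hU i.
 have [p1 p2] := hP x.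
 have -> : Exp x = (Exp (x *m P) * Exp (x - x *m P))%g.
  by rewrite -(Exp_add_commute (hG := hG)) ?(ideal_orth_bracket p1 p2).1 // subrKC.
 rewrite AdM !mulmxA -(mulmxA Y0) -AdM (Exp_orth_fix) ?WAd //; apply: Umax; eexists; split; last by [].
 by apply: (subgroupM sH)=> //; exact: exp_group_Exp.
have Un0 : U != 0.
 have : (Y0 <= U)%MS by apply: Umax; exists 1%g; rewrite Ad1 mulmx1; split=> //; exact: (subgroup1 sH).
 by move=> h; apply/eqP => U0; case/submxP: h => D E; case/eqP: Y00; rewrite E U0 mulmx0.
have /submxP[D WD] := Wmin Ui UW Un0.
(* The identity is decomposed into the ideal U of velocities and the orthogonal of W. The resulting
   products fill a neighborhood of 1 in G, and their factors of the first kind lie in N. *)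
have /sub_addsmxP[[u1 u2] /= E1] := ideal_add_orth aP nab Wi.
pose A := u1 *m D.
pose L1 i := col i A *m (X *m Ad g *m Ad (hh i)); pose L2 i := - (col i A *m (X *m Ad (hh i))).
pose s := flatten [seq [:: L1 i; L2 i] | i <- enum 'I_m] ++ [:: u2 *m O].
have su : \sum_(L <- s) L \in unitmx.
 suff -> : \sum_(L <- s) L = 1%:M by exact: unitmx1.
 rewrite big_cat big_seq1 big_flatten big_map big_enum /= E1; congr (_ + _).
 rewrite {1}WD mulmxA -/A; apply/matrixP => j k; rewrite summxE mxE; apply: eq_bigr => i _.
 rewrite big_cons big_seq1 /L1 /L2 -mulmxBr -mulmxBl -/Y0 -(hhP i).2.
 by rewrite mxE big_ord1 !mxE.
have [r r0 hr] := near_orth_fix_sub.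
pose K : R := n.+1%:R * `|u2 *m O| + 1.
have K0 : 0 < K by rewrite ltr_pwDr // mulr_ge0.
apply: (connected_subgroup_open sH sN Hconn (exp_product_nbhs c su (divr_gt0 r0 K0))).
move=> _ [[t tr ->] Ht].
have N1 : N (\prod_(L <- flatten [seq [:: L1 i; L2 i] | i <- enum 'I_m]) Exp (t *m L))%g.
 rewrite big_flatten big_map; apply: (subgroup_prod _ sN) => i.
 rewrite big_cons big_seq1 /L1 /L2 mulmxN !mulmxA.
 have -> : t *m col i A = ((t *m col i A) 0 0)%:M by apply: mx11_scalar.
 rewrite !mul_scalar_mx; set q := _ 0 0; set x := Exp (q *: X).
 rewrite /=; have -> : (Exp (q *: X *m Ad g *m Ad (hh i)) * Exp (- (q *: X *m Ad (hh i))) = (g^-1 * g ^ x^-1) ^ hh i)%g.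
  by rewrite ExpN // !(AdE hG c) -/x !conjgE; free_group.
 have Hx : H x by apply: exp_group_Exp; exact: scalemx_sub.
 apply: (nN _ _ (hhP i).1).
 apply: (subgroupM sN); first exact: (subgroupV sN).
 by apply: (nN)=> //; apply: (subgroupV sH).
(* For a product in H the remaining factor, the exponential of a vector of the orthogonal, lies in H
   too. It therefore fixes the orthogonal, its exponent is in W as well, and it is 1. *)
move: Ht; rewrite /exp_product big_cat /= big_seq1 mulmxA => Ht.
have Hy : H (Exp (t *m u2 *m O)) by move: Ht; rewrite (subgroupMlE _ sH) //; exact: NH.
have yO : (t *m u2 *m O <= O)%MS by exact: submxMl.
have : (t *m u2 *m O <= W)%MS.
 apply: hr => [|y yO']; last exact: (exp_group_fix_orth Hy).
 rewrite -mulmxA; apply: (le_trans (norm_mulmx_op _ _)).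
 apply: (@le_trans _ _ (K * `|t|)); first by rewrite ler_wpM2r // lerDl.
 by rewrite mulrC -ler_pdivlMr // ltW.
move=> yW; have : (t *m u2 *m O <= W :&: O)%MS by rewrite sub_capmx yW.
by rewrite (ideal_cap_orth aP nab Wi) submx0 => /eqP ->; rewrite Exp0 mulg1.
Qed.

(** A noncentral commutator generates everything by [exp_group_normal_sub]. If all commutators were
    central, conjugates of x would differ by elements of a discrete set, and connectedness would
    make H abelian. *)
Lemma exp_group_perfect : H `<=` commutator_subgroup H H.
Proof.
set N := commutator_subgroup H H; have sN : is_subgroup N by exact: generatedG.
have NH : N `<=` H.
 apply: generated_sub=> // _ [x [y [Hx Hy ->]]]; rewrite commgEl.
 by apply: (subgroupM sH); [exact: (subgroupV sH)|exact: (subgroupJ sH)].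
have nN : normalized_by H N.
 apply: generated_normalized => g _ Hg [x [y [Hx Hy ->]]]; exists (x ^ g)%g, (y ^ g)%g.
 by split; rewrite ?conjRg //; exact: (subgroupJ sH).
have [[g Ng g1]|hn] := pselect (exists2 g, N g & Ad g <> 1%:M); first exact: (exp_group_normal_sub sN NH nN Ng g1).
have N1 g : N g -> Ad g = 1%:M by move=> Ng; apply: contrapT => h; apply: hn; exists g.
exfalso; have [x [y [Hx Hy]]] := exp_group_nonabelian; apply.
have : (x ^ y = x)%g.
 apply: (connected_discrete_orbit Hconn (subgroup1 sH) Hy _ (center_discrete)) => g h Hg Hh.
 apply: N1; have -> : ((x ^ g)^-1 * x ^ h = [~ x, g]^-1 * [~ x, h])%g by rewrite !commgEl !conjgE; free_group.
 apply: (subgroupM sN); first apply: (subgroupV sN).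
  by apply: sub_generated; exists x, g.
 by apply: sub_generated; exists x, h.
by move=> e; rewrite -{2}e conjgE mulgA mulgV mul1g.
Qed.
Lemma mulmx_continuous m p (A : 'M[R]_(m, p)) : continuous (fun v : 'rV[R]_m => v *m A).
Proof.
move=> X; apply/(@cvgrPdist_le _ _ _ (nbhs X) (nbhs_filter X)) => e e0; apply/nbhs_ballP.
pose K : R := m%:R * `|A| + 1; have K0 : 0 < K by rewrite ltr_pwDr // mulr_ge0.
exists (e / K) => [|Y]; first by rewrite /= divr_gt0.
rewrite -ball_normE /= -mulmxBl ltr_pdivlMr // => h.
apply: (le_trans (norm_mulmx_op _ _)); apply: le_trans (ltW h); rewrite mulrC ler_wpM2l //.
by rewrite /K lerDl.
Qed.

Notation psi := (lc_psi c).
Let Z : set G := [set z | H z /\ Ad z = 1%:M].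

Let sZ : is_subgroup Z.
Proof.
split=> [|x y [Hx x1] [Hy y1]|x [Hx x1]]; split.
- exact: (subgroup1 sH).
- exact: Ad1.
- exact: (subgroupM sH).
- by rewrite AdM x1 y1 mulmx1.
- exact: (subgroupV sH).
by rewrite -[LHS]mul1mx -x1 AdV.
Qed.

Let Zc z h : Z z -> (z * h = h * z)%g.
Proof. by case=> _ z1; exact: (Ad_eq1_central z1). Qed.

(* A central character, extended to H by the choice of coset representatives in a compact set,
  jumps by a bounded amount; an inf-convolution in the chart makes it continuous. *)
Section Smoothing.
Variables (chi : G -> R) (F : set G).
Hypotheses (chiM : forall x y, Z x -> Z y -> chi (x * y)%g = chi x + chi y).
Hypotheses (Fc : compact F) (FH : forall h, H h -> exists2 f, F f & H f /\ Z (h * f^-1)%g).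

Ltac forget := clear -Gc nab aP Wi Wdef W0 Wmin sH Hconn sZ Zc chiM Fc FH.

Definition coset_rep (h : G) : G := xget 1%g [set f | F f /\ H f /\ Z (h * f^-1)%g].
Definition rough (h : G) : R := chi (h * (coset_rep h)^-1)%g.

Lemma coset_repP h : H h -> [/\ F (coset_rep h), H (coset_rep h) & Z (h * (coset_rep h)^-1)%g].
Proof.
move=> Hh; rewrite /coset_rep; case: xgetP => [f _ [? []] //|hn].
by have [f Ff [Hf Zf]] := FH Hh; case: (hn f).
Qed.

Lemma rough_equivariant z h : Z z -> H h -> rough (z * h)%g = chi z + rough h.
Proof.
move=> Zz Hh; have -> : rough (z * h)%g = chi (z * (h * (coset_rep h)^-1))%g.
 rewrite /rough mulgA; congr (chi (_ * _^-1)%g); rewrite /coset_rep; congr (xget _ _).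
 apply/seteqP; split=> f /= [Ff [Hf hf]]; split=> //; split=> //.
  by move: hf; rewrite -mulgA (subgroupMlE _ sZ).
 by rewrite -mulgA (subgroupMlE _ sZ).
by rewrite chiM //; case: (coset_repP Hh).
Qed.

(** A jump is chi z with z central and in a fixed compact set; there are finitely many such z since
    the center is discrete. *)
Lemma rough_jump : exists2 K : R, 0 <= K & forall (x : V) h, `|x| <= 4^-1 -> H (psi x) -> H h ->
 `|rough (psi x * h)%g - rough h| <= K.
Proof.
pose E1 : set G := psi @` [set x : V | `|x| <= 4^-1].
have E1c : compact E1.
 apply: continuous_compact (@ball_compact _ _); apply: continuous_in_subspaceT => x; rewrite inE /= => hx.
 by apply: lc_cont; apply: (le_trans hx); rewrite invf_le1 ?ler1n.
have [s hs] := compact_center_finite (compact_mulg E1c (compact_mulg Fc (compact_invg Fc))).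
exists (\sum_(z <- s) `|chi z|) => [|x h xr Hx Hh]; first exact: sumr_ge0.
have Hxh := subgroupM sH Hx Hh.
have [F1 H1 Z1] := coset_repP Hh; have [F2 H2 Z2] := coset_repP Hxh.
set f := coset_rep h in F1 H1 Z1; set f' := coset_rep _ in F2 H2 Z2.
pose z := (psi x * (f * f'^-1))%g.
have E : (psi x * h * f'^-1 = h * f^-1 * z)%g.
 by rewrite /z (mulgA (h * f^-1)%g) (Zc (psi x) Z1); free_group.
have Zz : Z z by move: Z2; rewrite E (subgroupMlE _ sZ).
have -> : rough (psi x * h)%g - rough h = chi z.
 by rewrite /rough -/f -/f' E chiM // addrC addKr.
have zs : z \in s.
 apply: hs; last by case: Zz.
 exists (psi x), (f * f'^-1)%g; split=> //; first by exists x.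
 by exists f, f'^-1%g; split=> //=; rewrite invgK.
by rewrite (big_rem _ zs) /= lerDl sumr_ge0.
Qed.

Lemma smooth_extension : exists2 phi : G -> R, (forall z h, Z z -> H h -> phi (z * h)%g = chi z + phi h) &
 forall e : R, 0 < e -> exists2 U, nbhs (1%g : G) U & forall u h, U u -> H u -> H h -> `|phi (u * h)%g - phi h| <= e.
Proof.
(* The slope 8 (K + 1) exceeds the jumps of [rough] so much that near-minimizers satisfy |x| <= 1/8;
   a small translation then keeps them in the ball of radius 1/4 over which the infimum is taken. *)
have [K K0 hK] := rough_jump; pose C := 8 * (K + 1).
have C0 : 0 < C by rewrite mulr_gt0 // ltr_pwDr.
pose S h := [set t : R|exists x : V, [/\ `|x| <= 4^-1, H (psi x) & t = rough (psi x * h)%g + C * `|x|]].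
pose phi h := inf (S h).
have H1 : H (psi 0) by rewrite lc_psi0; exact: (subgroup1 sH).
have S0 h : S h (rough h) by exists 0; rewrite normr0 mulr0 addr0 lc_psi0 mul1g -(lc_psi0 c); split=> //.
have Slb h : H h -> lbound (S h) (rough h - K).
 move=> Hh _ [x [xr Hx ->]]; have := hK x h xr Hx Hh; rewrite ler_norml => /andP[h1 _].
 have : 0 <= C * `|x| by rewrite mulr_ge0 // ltW.
 by move: h1; forget; lra.
have hinf h : H h -> has_inf (S h) by move=> Hh; split; [exists (rough h)|exists (rough h - K); exact: Slb].
have phi_le h : H h -> phi h <= rough h by move=> Hh; apply: ge_inf=> //; exists (rough h - K); exact: Slb.
have key z (v : V) h : Z z -> `|v| <= 64^-1 -> H (psi v) -> H h -> phi (z * h)%g <= chi z + phi (psi v * h)%g + 2 * C * `|v|.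
 move=> Zz v64 Hv Hh; apply/ler_addgt0Pr => e e0.
 pose e' := Num.min e 1; have e'0 : 0 < e' by rewrite lt_min e0 ltr01.
 have e'e : e' <= e by rewrite ge_min lexx.
 have e'1 : e' <= 1 by rewrite ge_min lexx orbT.
 have Hvh := subgroupM sH Hv Hh.
 have [_ [x [xr Hx ->]]] := inf_adherent e'0 (hinf _ Hvh); rewrite -/(phi _) => hx.
 have x8 : `|x| <= 8^-1.
  have := hK x _ xr Hx Hvh; rewrite ler_norml => /andP[h1 _]; have h2 := phi_le _ Hvh.
  have : C * `|x| <= K + 1 by move: hx h1 h2 e'1; forget; lra.
  have := normr_ge0 x; rewrite /C; move: K0; move: (`|x|) => q; forget; nra.
 have q1 : (8^-1 : R) <= 1 by rewrite invf_le1 ?ler1n.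
 have q2 : (64^-1 : R) <= 1 by rewrite invf_le1 ?ler1n.
 have x1 := le_trans x8 q1; have v1 := le_trans v64 q2.
 have hm := mu_sum_le (lc_law c) x1 v1.
 have hxv : `|x| * `|v| <= 1 * `|v| by rewrite ler_wpM2r.
 have mx : `|lc_mu c x v| <= `|x| + 2 * `|v|.
  have := ler_normD (lc_mu c x v - (x + v)) (x + v); rewrite subrK => h1.
  have h2 := ler_normD x v; have := normr_ge0 v; move: hm hxv h1 h2; forget; lra.
 have Hm : H (psi (lc_mu c x v)) by rewrite lc_psiM //; exact: (subgroupM sH).
 have m4 : `|lc_mu c x v| <= 4^-1 by move: mx x8 v64; forget; lra.
 have Hzh : H (z * h)%g by apply: (subgroupM sH)=> //; case: Zz.
 have : phi (z * h)%g <= rough (psi (lc_mu c x v) * (z * h))%g + C * `|lc_mu c x v|.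
  by apply: ge_inf; [exists (rough (z * h)%g - K); exact: Slb|exists (lc_mu c x v)].
 have -> : (psi (lc_mu c x v) * (z * h) = z * (psi x * (psi v * h)))%g.
  by rewrite lc_psiM // mulgA -(Zc _ Zz) -!mulgA.
 rewrite rough_equivariant //; last exact: (subgroupM sH).
 have : C * `|lc_mu c x v| <= C * (`|x| + 2 * `|v|) by rewrite ler_wpM2l // ltW.
 by move: hx e'e; forget; lra.
have v00 : `|0 : V| <= 64^-1 by rewrite normr0.
exists phi => [z h Zz Hh|e e0].
 have k1 := key z 0 h Zz v00 H1 Hh.
 have k2 := key z^-1%g 0 (z * h)%g (subgroupV sZ Zz) v00 H1 (subgroupM sH (proj1 Zz) Hh).
 rewrite lc_psi0 mul1g normr0 mulr0 addr0 in k1; rewrite lc_psi0 mul1g mulKg normr0 mulr0 addr0 in k2.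
 have : chi 1%g = chi 1%g + chi 1%g by rewrite -chiM ?mulg1 //; exact: (subgroup1 sZ).
 have : chi (z * z^-1)%g = chi z + chi z^-1%g by rewrite chiM //; exact: (subgroupV sZ).
 by rewrite mulgV => e1 e2; apply/eqP; rewrite eq_le k1 /=; move: k2 e1 e2; forget; lra.
pose d := Num.min 64^-1 (e / (2 * C)).
have d0 : 0 < d by rewrite lt_min invr_gt0 ltr0n divr_gt0 // mulr_gt0.
pose U0 := [set g | exists2 x : V, `|x| < d & g = psi x].
have U01 : nbhs (1%g : G) U0 by exact: (lc_nbhs c d0).
have dP (v : V) : `|v| < d -> `|v| <= 64^-1 /\ 2 * C * `|v| <= e.
 rewrite lt_min => /andP[h1 h2]; split; first exact: ltW.
 have C20 : 0 < 2 * C by rewrite mulr_gt0.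
 by move: (ltW h2); rewrite (ler_pdivlMr _ _ C20) mulrC.
have chi1 : chi 1%g = 0.
 have : chi 1%g = chi 1%g + chi 1%g by rewrite -chiM ?mulg1 //; exact: (subgroup1 sZ).
 by forget; lra.
exists (U0 `&` [set g | U0 g^-1%g]).
 apply: filterI=> //; have h : (fun x : G => x^-1)%g @ (1%g : G) --> (1%g : G).
  by rewrite -[X in _ --> X]invg1; apply: cvgVg; exact: cvg_id.
 exact: h _ U01.
move=> u h [[v vd uE] [w wd wE]] Hu Hh; have [v1 v2] := dP v vd; have [w1 w2] := dP w wd.
have k1 : phi h <= phi (u * h)%g + e.
 have := key 1%g v h (subgroup1 sZ) v1; rewrite -uE mul1g chi1 add0r => /(_ Hu Hh).
 by move: v2; forget; lra.
have k2 : phi (u * h)%g <= phi h + e.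
 have := key 1%g w (u * h)%g (subgroup1 sZ) w1; rewrite -wE mul1g chi1 add0r mulKg => /(_ (subgroupV sH Hu) (subgroupM sH Hu Hh)).
 by move: w2; forget; lra.
by rewrite ler_norml; apply/andP; split; move: k1 k2; forget; lra.
Qed.
End Smoothing.

Lemma exp_group_conj_small (U : set G) : nbhs (1%g : G) U ->
 exists2 r : R, 0 < r & forall X k, (X <= W)%MS -> `|X| <= r -> H k -> U (Exp X ^ k)%g.
Proof.
move=> U1; have [M M0 hM] := Ad_bounded.
have : nbhs (Exp 0) U by rewrite Exp0.
move/Exp_continuous => /nbhs_ballP[d d0 hd].
have q0 : 0 < n.+1%:R * M + 1 by rewrite ltr_pwDr // mulr_ge0.
exists (d / 2 / (n.+1%:R * M + 1)) => [|X k XW Xr Hk]; first by rewrite !divr_gt0.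
rewrite -(AdE hG c); apply: hd; rewrite -ball_normE /= sub0r normrN.
apply: (le_lt_trans (norm_mulmx_op _ _)); apply: (@le_lt_trans _ _ ((n.+1%:R * M + 1) * `|X|)).
 rewrite ler_wpM2r //; apply: (@le_trans _ _ (n.+1%:R * M)); last by rewrite lerDl.
 by rewrite ler_wpM2l // hM.
by move: Xr; rewrite ler_pdivlMr // mulrC => h; apply: (le_lt_trans h); rewrite ltr_pdivrMr // ltr_pMr // ltr1n.
Qed.

Lemma exp_group_net : exists2 F : set G, compact F & (forall h, H h -> exists2 f, F f & H f /\ Z (h * f^-1)%g) /\ F `<=` H.
Proof.
have [s [sHs hs]] := exp_group_cover ltr01.
pose E1 : set G := Exp @` ([set X : V | `|X| <= 1] `&` [set X : V | (X <= W)%MS]).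
have E1c : compact E1.
 apply: continuous_compact; first by apply: continuous_subspaceT; exact: Exp_continuous.
 apply: compact_closedI; first exact: ball_compact.
 have -> : [set X : V | (X <= W)%MS] = (fun X : V => `|X *m cokermx W|) @^-1` [set x | x <= 0].
  by apply/seteqP; split=> X /=; rewrite submxE normr_le0.
 apply: closed_comp; last exact: closed_le.
 move=> X _; exact: (continuous_comp (@mulmx_continuous _ _ (cokermx W) X) (@norm_continuous _ _ _)).
have sc : compact [set g | g \in s] by apply: finite_compact; exact: finite_seq.
have E1H : E1 `<=` H by move=> _ [X [_ XW] <-]; exact: exp_group_Exp.
exists [set z|exists x y, [/\ E1 x, [set g | g \in s] y & z = (x * y)%g]]; first exact: compact_mulg.
split=> [h Hh|_ [x [y [Ex ys ->]]]]; last by apply: (subgroupM sH); [exact: E1H|exact: sHs].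
have [z [X [g [Zz XW X1 gs ->]]]] := hs h Hh.
have HX : H (Exp X) by apply: exp_group_Exp.
exists (Exp X * g)%g; first by exists (Exp X), g; split=> //; exists X.
split; first by apply: (subgroupM sH)=> //; exact: sHs.
by have -> : (z * Exp X * g * (Exp X * g)^-1 = z)%g by free_group.
Qed.

Lemma center_torsion z : Z z -> exists2 k, (0 < k)%N & (z ^+ k = 1)%g.
Proof.
move=> Zz; apply: contrapT => hn.
have tor k l : (z ^+ k = z ^+ l)%g -> k = l.
 wlog kl : k l / (k <= l)%N.
  by move=> W1 e; case/orP: (leq_total k l) => h; [exact: W1|apply/esym/W1].
 move=> e; apply/eqP; rewrite eqn_leq kl leqNgt; apply/negP => lk; apply: hn; exists (l - k)%N; first by rewrite subn_gt0.
 by apply: (mulIg (z ^+ k)%g); rewrite -expgnDr subnK // mul1g.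
(* The graph of z^k |-> k, with integer exponents written as differences of natural numbers. It is
   the graph of a map because z is assumed to have infinite order. *)
pose C0 := [set xs : G * R|exists i j : nat, (xs.1 * z ^+ i = z ^+ j)%g /\ xs.2 = j%:R - i%:R].
have ZX k : Z (z ^+ k)%g by elim: k => [|k IH]; rewrite ?expg0 ?expgS; [exact: (subgroup1 sZ)|exact: (subgroupM sZ)].
have pC0 : partial_character Z [set 0] C0.
 split.
 - by move=> x s [i [j [/= e _]]]; move: (ZX j); rewrite -e (subgroupMrE _ sZ).
 - move=> x y s t [i [j [/= e ->]]] [k [l [/= e' ->]]]; exists (k + i)%N, (l + j)%N => /=; split.
   by rewrite !expgnDr -mulgA (mulgA y) e' (Zc (z ^+ i)%g (ZX l)) mulgA e (Zc _ (ZX l)).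
  by rewrite !natrD; ring.
 - move=> x s [i [j [/= e ->]]]; exists j, i => /=; split; last by rewrite opprB.
  by rewrite -e mulKg.
 - move=> x y Zx Zy; exists 0%N, 0%N => /=; rewrite expg0 mulg1 subrr; split=> //.
  by apply/eqP/commgP; exact: Zc.
 - by move=> s [i [j [/=]]]; rewrite mul1g => /tor ->; rewrite subrr.
have [||chi [chiM chiz]] := character_extension sZ _ _ pC0; rewrite ?subr0 //.
 by move=> _ _ -> ->; rewrite /= subr0.
have {}chiM x y : Z x -> Z y -> chi (x * y)%g = chi x + chi y.
 by move=> Zx Zy; have /eqP := chiM x y Zx Zy; rewrite -addrA -opprD subr_eq0 => /eqP.
have {chiz} : chi z = 1.
 have : C0 (z, 1) by exists 0%N, 1%N; rewrite /= expg0 mulg1 subr0.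
 by move/chiz/eqP; rewrite subr_eq0 => /eqP.
suff -> : chi z = 0 by move/eqP; rewrite eq_sym oner_eq0.
have [F Fc [FH _]] := exp_group_net.
have [phi phiZ phiU] := smooth_extension chiM Fc FH.
apply: (perfect_central_character (H := H) (Z := Z) (phi0 := phi) sH)=> //.
- by move=> x [].
- by move=> x y Zx _; exact: Zc.
- move=> e e0; have [U U1 hU] := phiU e e0; have [r r0 hr] := exp_group_conj_small U1.
 have [s [sHs hs]] := exp_group_cover r0.
 have s0 : (0 < size s)%N.
  by case: s hs {sHs} => // /(_ 1%g (subgroup1 sH)) [? [? [? [_ _ _]]]].
 exists (size s).-1, (fun i => nth 1%g s i); split.
  move=> i; have hi : (i < size s)%N by rewrite -[X in (_ < X)%N](prednK s0) ltn_ord.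
  exact: (sHs _ (mem_nth _ hi)).
 move=> h /hs[z' [X [g [Zz' XW Xr gs ->]]]].
 have gi : (index g s < (size s).-1.+1)%N by rewrite prednK // index_mem.
 have HX : H (Exp X) by exact: exp_group_Exp.
 exists z', (Exp X), (Ordinal gi); split=> //=; last by rewrite nth_index.
 by move=> k l Hk Hl; apply: hU=> //; [exact: hr|exact: (subgroupJ sH)].
- by apply: (exp_group_perfect); case: Zz.
Qed.

(** Multiplying an element f of the compact set F by a small exponential gives an element f' of F
    times a central element of a finite list. These central elements commute and are torsion, so
    they multiply within a finite set, and H is a finite union of translates of F. The factor z0
    accounts for 1 being represented in F by f1. *)
Lemma exp_group_compact : compact H.
Proof.
have [F Fc [FH FsH]] := exp_group_net.
pose E1 : set G := Exp @` [set X : V | `|X| <= 1].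
have E1c : compact E1.
 by apply: continuous_compact (@ball_compact _ _); apply: continuous_subspaceT; exact: Exp_continuous.
have [s hs] := compact_center_finite (compact_mulg E1c (compact_mulg Fc (compact_invg Fc))).
pose q := [seq z <- s | `[< Z z >]].
have qZ z : z \in q -> Z z by rewrite mem_filter => /andP[/asboolP].
have [T0 [T1 hT]] : exists T : seq G, 1%g \in T /\ forall t x, t \in T -> x \in q -> (t * x)%g \in T.
 by apply: torsion_products => [x /qZ|x y /qZ Zx _]; [exact: center_torsion|exact: Zc].
have [f1 Ff1 [Hf1 Zf1]] := FH _ (subgroup1 sH).
set z0 := (1 * f1^-1)%g in Zf1.
pose P := [set h|exists t f, [/\ t \in T0, Z t, F f & h = (t * (z0 * f))%g]].
have step v h : (v <= W)%MS -> `|v| <= 1 -> P h -> P (Exp v * h)%g.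
 move=> vW v1 [t [f [tT Zt Ff ->]]]; have Hv : H (Exp v) by exact: exp_group_Exp.
 have [f' Ff' [Hf' Zf']] := FH _ (subgroupM sH Hv (FsH _ Ff)).
 have E : (Exp v * (f * f'^-1) = Exp v * f * f'^-1)%g by rewrite mulgA.
 have zq : (Exp v * (f * f'^-1))%g \in q.
  rewrite mem_filter; apply/andP; split; first by apply/asboolP; rewrite E.
  apply: hs; last by rewrite E; case: Zf'.
  exists (Exp v), (f * f'^-1)%g; split=> //; first by exists v.
  by exists f, f'^-1%g; split=> //=; rewrite invgK.
 exists (t * (Exp v * (f * f'^-1)))%g, f'; split=> //; first exact: hT.
  by apply: (subgroupM sZ)=> //; rewrite E.
 rewrite mulgA -(Zc _ Zt) -mulgA -[RHS]mulgA; congr (_ * _)%g.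
 rewrite mulgA -(Zc (Exp v) Zf1) [RHS]mulgA -(Zc (Exp v * (f * f'^-1))%g Zf1); clearbody z0.
 by free_group.
have HP : H `<=` P.
 apply: (exp_group_ind hG) => [|v x vW Px].
  by exists 1%g, f1; split=> //; [exact: (subgroup1 sZ)|rewrite /z0 !mul1g mulVg].
 have [k hk] := half_small v (@ltr01 R); rewrite (Exp_half c v k).
 have vk : (2^-1 ^+ k *: v <= W)%MS by exact: scalemx_sub.
 elim: (2 ^ k)%N => [|j IH]; first by rewrite expg0 mul1g.
 by rewrite expgS -mulgA; apply: step=> //; exact: (hk k (leqnn _)).
have -> : H = [set h|exists x y, [/\ [set t | t \in [seq t <- T0 | `[< Z t >]]] x,
  [set y|exists u f, [/\ [set z0] u, F f & y = (u * f)%g]] y & h = (x * y)%g]].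
 apply/seteqP; split=> [h /HP[t [f [tT Zt Ff ->]]]|_ [t [_ [tT [_ [f [-> Ff ->]]] ->]]]].
  exists t, (z0 * f)%g; split=> //; last by exists z0, f.
  by rewrite /= mem_filter tT andbT; apply/asboolP.
 move: tT; rewrite /= mem_filter => /andP[/asboolP[Ht _] _].
 by apply: (subgroupM sH)=> //; apply: (subgroupM sH); [case: Zf1|exact: FsH].
apply: compact_mulg; first by apply: finite_compact; exact: finite_seq.
by apply: compact_mulg=> //; exact: compact_set1.
Qed.

Theorem exp_group_simple_factor : simple_factor H.
Proof.
split; last by apply: compact_closed=> //; exact: exp_group_compact.
- split=> //; first exact: (exp_group_nonabelian).
 move=> N NH sN nN Nc.
 have [[g Ng g1]|hn] := pselect (exists2 g, N g & Ad g <> 1%:M).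
  by right; apply/seteqP; split=> //; exact: (exp_group_normal_sub sN NH nN Ng g1).
 left; have N1 g : N g -> Ad g = 1%:M by move=> Ng; apply: contrapT => h; apply: hn; exists g.
 apply/seteqP; split=> [g Ng|_ ->]; last exact: (subgroup1 sN).
 apply: (connected_locally_constant Nc (f := id))=> //; last exact: (subgroup1 sN).
 move=> x Nx; apply: filterS (nbhs_translate1 x (center_discrete)) => y h Ny.
 have := h (N1 _ (subgroupM sN (subgroupV sN Nx) Ny)) => /(congr1 (fun z => x * z)%g).
 by rewrite mulVKg mulg1.
- exact: exp_group_normal.
Qed.
End Semisimple.

(** * Semisimple Lie groups with and without compact factors *)

Section SemisimpleLieGroup.
Variables (R : realType) (n : nat) (G : topGroupType) (hG : hausdorff_space G).
Variable c : lie_chart R n.+1 G.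
Hypotheses (Gc : connected [set: G]) (Grad : is_solvable_radical [set 1%g : G]).
Notation V := 'rV[R]_n.+1.
Notation Exp := (Exp c).
Notation Ad := (Ad hG c).
Notation ad := (ad hG c).
Notation a := (ad_basis hG c).
Notation B := (killing a).
Let aP := lie_alg_ad hG c.
Let nab : no_abelian_ideals a := semisimple_no_abelian_ideals Gc Grad.

Lemma ideal_genmx m (U : 'M[R]_(m, n.+1)) : ideal a U -> ideal a <<U>>%MS.
Proof. by move=> h x; rewrite genmxE (eqmxMr _ (genmxE U)). Qed.
Lemma Ad_orbit_ideal (P : V -> Prop) m (U : 'M[R]_(m, n.+1)) : (forall v g, P v -> P (v *m Ad g)) ->
 (forall i, P (row i U)) -> (forall v, P v -> (v <= U)%MS) -> ideal a U.
Proof.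
by move=> hP h1 h2; apply: Ad_stable_ideal => X; apply/row_subP => i; rewrite row_mul; apply/h2/hP.
Qed.

Lemma chart_minap : no_compact_simple_factors G -> minap G.
Proof.
move=> ncf; have [m [N [hN Nmax]]] := pred_span (hyperbolic a).
have Ni : ideal a N.
 apply: (@Ad_orbit_ideal (hyperbolic a))=> // v g [h [s [s0 hs]]]; exists (h *m Ad g), s; split=> //.
 rewrite adm_ad in hs; rewrite adm_ad ad_conj !mulmxA -[v *m _ *m _]mulmxA AdV mulmx1 hs.
 by rewrite -scalemxAl.
have [N1|N1] := boolP (1%:M <= N)%MS; first exact: hyperbolic_minap hN N1.
pose P r := `[< exists2 U : 'M[R]_n.+1, ideal a U & [/\ (U <= orth a N)%MS, U != 0 & \rank U = r] >].
have [r /asboolP[W Wi [WO W0 Wr]] rmin] : exists2 r, P r & forall k, P k -> (r <= k)%N.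
 have Pex : exists r, P r.
  exists (\rank (orth a N)); apply/asboolP; exists (orth a N); first exact: ideal_orth.
  split=> //; apply: contra N1 => /eqP O0; have := rank_orth aP nab N; rewrite O0 mxrank0 => /esym/eqP.
  by rewrite subn_eq0 sub1mx /row_full => h; rewrite eqn_leq rank_leq_col.
 by have [r Pr rm] := ex_minnP Pex; exists r.
have Wdef (x : V) : (x <= W)%MS -> B x x <= 0 /\ (B x x = 0 -> x = 0).
 move=> xW; apply: (orth_hyperbolic_definite aP nab Ni Nmax); exact: submx_trans WO.
have Wmin k (U : 'M[R]_(k, n.+1)) : ideal a U -> (U <= W)%MS -> U != 0 -> (W <= U)%MS.
 move=> Ui UW U0; rewrite -(mxrank_leqif_sup UW).2 eqn_leq (mxrankS UW) /= Wr.
 apply: rmin; apply/asboolP; exists <<U>>%MS; first exact: ideal_genmx.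
 by rewrite !genmxE (submx_trans UW WO) -mxrank_eq0 genmxE mxrank_eq0 U0.
by case: (ncf _ (exp_group_simple_factor Gc nab Wi Wdef W0 Wmin)); exact: (exp_group_compact Gc nab Wi Wdef W0 Wmin).
Qed.

Lemma Ad_bounded_compact (K : set G) : compact K -> exists2 M : R, 0 <= M & forall h, K h -> `|Ad h| <= M.
Proof.
move=> Kc; have [s [_ hs]] := compact_nbhs_cover Kc (fun x => Ad_continuous hG c x (@ltr01 R)).
exists (\sum_(x <- s) (`|Ad x| + 1)) => [|h Kh]; first by apply: sumr_ge0 => x _; rewrite addr_ge0.
have [x xs hx] := hs h Kh; rewrite (big_rem _ xs) /=.
apply: (@le_trans _ _ (`|Ad x| + 1)); last by rewrite lerDl sumr_ge0 // => y _; rewrite addr_ge0.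
rewrite -[Ad h](subrK (Ad x)); apply: normD_le_trans; rewrite addrC; exact: lerD.
Qed.

(* The ideal contains the velocities of the curves t |-> Exp(tY)^x Exp(-tY). *)
Lemma closed_normal_ideal (H : set G) x y : is_subgroup H -> normalized_by [set: G] H -> closed H ->
 H x -> (x * y <> y * x)%g -> exists W : 'M[R]_n.+1, [/\ ideal a W, W != 0 & forall v : V, (v <= W)%MS -> H (Exp v)].
Proof.
move=> sH nH Hc Hx xy.
have [Y YX] : exists Y : V, Y *m Ad x <> Y.
 apply: contrapT => hn; apply: xy; apply: (@Ad_eq1_central R n G hG c Gc x).
 apply/row_matrixP => i; rewrite rowE rowE mulmx1; apply: contrapT => h; apply: hn; by exists (delta_mx 0 i).
pose D := [set v : V | forall t : R, H (Exp (t *: v))].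
have DD u v : D u -> D v -> D (u + v).
 move=> Du Dv t; rewrite scalerDr.
 apply: (closed_cvg H Hc _ _ (@Trotter R n.+1 G c (t *: u) (t *: v))); near=> k.
 elim: (2 ^ k)%N => [|j IH]; rewrite ?expg0 ?expgS; first exact: (subgroup1 sH).
 by apply: (subgroupM sH)=> //; apply: (subgroupM sH); rewrite scalerA; [exact: Du|exact: Dv].
have DZ r v : D v -> D (r *: v) by move=> Dv t; rewrite scalerA; exact: Dv.
have D0 : D (Y *m Ad x - Y).
 move=> t; rewrite scalerBr scalemxAl.
 apply: (closed_cvg H Hc _ _ (@Trotter R n.+1 G c (t *: Y *m Ad x) (- (t *: Y)))); near=> k.
 elim: (2 ^ k)%N => [|j IH]; rewrite ?expg0 ?expgS; first exact: (subgroup1 sH).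
 apply: (subgroupM sH)=> //; rewrite scalemxAl scalerN (AdE hG c) ExpN //; set g := Exp _.
 have -> : (g ^ x * g^-1 = x^-1 * x ^ g^-1)%g by rewrite !conjgE; free_group.
 by apply: (subgroupM sH); [exact: (subgroupV sH)|exact: nH].
pose P v := exists g, v = (Y *m Ad x - Y) *m Ad g.
have DP v : P v -> D v by move=> [g ->] t; rewrite scalemxAl (AdE hG c); apply: nH.
have [m [U [hU Umax]]] := pred_span P.
exists <<U>>%MS; split.
- apply/ideal_genmx/(@Ad_orbit_ideal P)=> // v g [h ->]; exists (h * g)%g; by rewrite AdM mulmxA.
- rewrite -mxrank_eq0 genmxE mxrank_eq0; apply/eqP => U0.
 have : P (Y *m Ad x - Y) by exists 1%g; rewrite Ad1 mulmx1.
 by move/Umax/submxP => [E]; rewrite U0 mulmx0 => /eqP; rewrite subr_eq0 => /eqP.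
move=> v; rewrite genmxE => /submxP[E ->].
suff : D (E *m U) by move/(_ 1); rewrite scale1r.
rewrite mulmx_sum_row; elim/big_rec: _ => [t|i w _ Dw]; first by rewrite scaler0 Exp0; exact: (subgroup1 sH).
by apply: DD=> //; apply/DZ/DP.
Unshelve. all: by end_near.
Qed.

(** The factor contains exponentials of an ideal W; the bounded adjoint action of a compact set
    makes the Killing form negative definite there. N is the length of X Ad g - X for a fixed X in
    W: the cocycle rule gives subadditivity, central elements act trivially, and N = 0 would make
    the line of X an abelian ideal. *)
Lemma compact_factor_chart_norm (H : set G) : simple_factor H -> compact H ->
 exists N : G -> R, [/\ forall x y, N (x^-1 * y)%g <= N x + N y,
  forall e, 0 < e -> finitely_colored [set x | N x < e],
  forall x z, (forall y, z * y = y * z)%g -> N (x * z)%g = N x & exists g, 0 < N g].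
Proof.
move=> [[sH _ [x [y [Hx _ xy]]] _] nH Hcl] Hc.
have [W [Wi W0 hW]] := closed_normal_ideal sH nH Hcl Hx xy.
have [M M0 hM] := Ad_bounded_compact Hc.
have Wle (v : V) : (v <= W)%MS -> B v v <= 0.
 by move=> vW; apply: (bounded_orbit_killing (M := M)) => t; apply/hM/hW; exact: scalemx_sub.
have Wdef (v : V) : (v <= W)%MS -> B v v <= 0 /\ (B v v = 0 -> v = 0).
 move=> vW; split=> [|v0]; first exact: Wle.
 suff : (v <= W :&: orth a W)%MS by rewrite (ideal_cap_orth aP nab Wi) submx0 => /eqP.
 rewrite sub_capmx vW /=; apply/orthP => w wW; apply: contrapT => /eqP vw.
 have key (t : R) : 2 * t * B v w + B w w <= 0.
  have : ((t *: v + w)%R <= W)%MS by rewrite addmx_sub ?scalemx_sub.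
  move/Wle; rewrite !killingDl !killingDr !killingZl !killingZr v0 (killingC _ w v).
  by rewrite !mulr0 add0r addrA -!mulrA -mulrDr -mulr2n -[B v w *+ 2]mulr_natl mulrCA mulrA.
 have := key ((1 - B w w) / (2 * B v w)).
 have -> : 2 * ((1 - B w w) / (2 * B v w)) * B v w = 1 - B w w by field.
 by rewrite subrK ler10.
have [q q0 hq] := definite_norm nab Wi Wdef.
have [C C0 hC] := killing_bound hG c.
have [i Wi0] : exists i, row i W != 0.
 apply: contrapT => h; case/eqP: W0; apply/row_matrixP => i; rewrite row0; apply/eqP.
 by apply: contrapT => hi; apply: h; exists i; apply/negP.
pose X : V := row i W; have XW : (X <= W)%MS by exact: row_sub.
have WAd (v : V) g : (v <= W)%MS -> (v *m Ad g <= W)%MS.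
 by move=> vW; apply: submx_trans (ideal_Ad Gc g Wi); exact: submxMr.
have WD (u v : V) : (u <= W)%MS -> (v <= W)%MS -> ((u + v)%R <= W)%MS by move=> uW vW; exact: addmx_sub.
pose d g : V := X *m Ad g - X.
have dW g : (d g <= W)%MS by apply: WD; rewrite ?eqmx_opp ?WAd.
pose nq (v : V) := Num.sqrt (- B v v).
have nqAd v g : nq (v *m Ad g) = nq v by rewrite /nq killing_Ad.
have nqN v : nq (- v) = nq v by rewrite /nq killingNl killingC killingNl opprK.
have nqD (u v : V) : (u <= W)%MS -> (v <= W)%MS -> nq (u + v) <= nq u + nq v.
 move=> uW vW; rewrite -(ler_pXn2r (ltn0Sn 1)) ?nnegrE ?addr_ge0 ?sqrtr_ge0 //.
 have [u0 v0 uv0] := And3 (Wle _ uW) (Wle _ vW) (Wle _ (WD _ _ uW vW)).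
 rewrite sqrrD !sqr_sqrtr ?oppr_ge0 // killingDl !killingDr (killingC _ v u).
 have : - B u v <= nq u * nq v.
  rewrite /nq -sqrtrM ?oppr_ge0 // mulrNN; apply: (le_trans (ler_norm _)).
  rewrite normrN -sqrtr_sqr; apply: ler_wsqrtr; exact: (killing_CauchySchwarz Wdef).
 by rewrite /nq mulr2n; move: (Num.sqrt _ * _) => p; lra.
have dV g : nq (d g^-1%g) = nq (d g).
 rewrite -(nqAd _ g) /d mulmxBl -mulmxA AdVl mulmx1 -nqN opprB //.
have dM g h : d (g * h)%g = d g *m Ad h + d h by rewrite /d AdM mulmxBl mulmxA addrA subrK.
exists (fun g => nq (d g)); split.
- move=> g h; rewrite dM; apply: (le_trans (nqD _ _ (WAd _ _ (dW _)) (dW _))).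
 by rewrite nqAd dV.
- move=> e e0.
 have e'0 : 0 < e / (C + 1) by rewrite divr_gt0 // ltr_wpDl.
 pose e' := Num.min (e / (C + 1)) (e / 2).
 have e'00 : 0 < e' by rewrite lt_min e'0 divr_gt0.
 have [I [col hcol]] := bounded_matrix_coloring 1 n.+1 (Num.sqrt (q * - B X X)) e'00.
 (* The displacement of X under g^-1 h is the difference of X Ad g^-1 and X Ad h^-1, transported by
    the isometry Ad h. *)
 exists I, (fun g => col (X *m Ad g^-1%g)) => g h /= gh.
 have bd k : `|X *m Ad k| <= Num.sqrt (q * - B X X).
  by apply: (le_trans (hq _ (WAd _ k XW))); rewrite killing_Ad.
 have := hcol _ _ (bd _) (bd _) gh.
 have -> : d (g^-1 * h)%g = (X *m Ad g^-1%g - X *m Ad h^-1%g) *m Ad h.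
  by rewrite /d AdM mulmxBl -[X *m Ad h^-1%g *m _]mulmxA AdVl mulmx1 mulmxA.
 rewrite nqAd; set v := _ - _ => hv.
 apply: (@le_lt_trans _ _ (Num.sqrt (C * e' ^+ 2))).
  by apply: ler_wsqrtr; apply: (le_trans (hC _)); rewrite ler_wpM2l // lerXn2r // nnegrE // ltW.
 rewrite -(ltr_pXn2r (ltn0Sn 1)) ?nnegrE ?sqrtr_ge0 ?(ltW e0) // sqr_sqrtr; last by rewrite mulr_ge0 // sqr_ge0.
 have h1 : e' * (C + 1) <= e by rewrite -ler_pdivlMr ?ltr_wpDl // ge_min lexx.
 have h2 : e' * 2 <= e by rewrite -ler_pdivlMr // ge_min lexx orbT.
 by move: h1 h2 e'00 e0 C0; clear -Gc Grad aP nab; nra.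
- by move=> g z hz; rewrite dM (central_Ad_eq1 hG c hz) mulmx1 /d (central_Ad_eq1 hG c hz) mulmx1 subrr addr0.
apply: contrapT => hn; have Xfix g : X *m Ad g = X.
 apply/eqP; rewrite -subr_eq0; apply/eqP; have [d0 d1] := Wdef _ (dW g); apply: d1.
 apply/eqP; rewrite eq_le d0 /= leNgt; apply/negP => h; apply: hn; exists g.
 by rewrite sqrtr_gt0 oppr_gt0.
have XI : ideal a <<X>>%MS.
 by apply: ideal_genmx; apply: Ad_stable_ideal => Y; rewrite Xfix.
case/eqP: Wi0; apply/eqP; rewrite -mxrank_eq0 -genmxE mxrank_eq0; apply/eqP/nab=> // u v.
rewrite !genmxE => /sub_rVP[s ->] /sub_rVP[t ->].
by rewrite admZ -scalemxAl -scalemxAr (adm_self aP) !scaler0.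
Qed.
End SemisimpleLieGroup.

Lemma lie_dim0_trivial (R : realType) (G : topGroupType) (c : lie_chart R 0 G) : connected [set: G] -> forall g : G, g = 1%g.
Proof.
move=> Gc g; suff : [set 1%g] = [set: G] by move/seteqP => [_ /(_ g I)].
apply: connected_subgroup_full=> //; first by split=> [|x y -> ->|x ->]; rewrite /= ?mulg1 ?invg1.
by apply: filterS (lc_nbhs c (@ltr01 R)) => _ [x _ ->] /=; rewrite -(lc_psi0 c); congr lc_psi; apply/rowP; case.
Qed.

Section SemisimpleAtlas.
Variables (R : realType) (n : nat) (S : topGroupType) (A : set (chart R n S)).
Hypotheses (hA : is_lie_group A) (ss : connected_semisimple S).

Theorem semisimple_minap : no_compact_simple_factors S -> minap S.
Proof.
have hS : hausdorff_space S by case: hA.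
case: n A hA => [|m] A' hA'; have [c] := lie_chart_of_atlas hA'; last exact: (chart_minap hS c ss.1 ss.2).
move=> _ g; rewrite (lie_dim0_trivial c ss.1 g); exact: chain_radical1.
Qed.

Theorem compact_factor_norm (H : set S) : simple_factor H -> compact H ->
 exists N : S -> R, [/\ forall x y, N (x^-1 * y)%g <= N x + N y,
  forall e, 0 < e -> finitely_colored [set x | N x < e],
  forall x z, (forall y, z * y = y * z)%g -> N (x * z)%g = N x & exists g, 0 < N g].
Proof.
have hS : hausdorff_space S by case: hA.
case: n A hA => [|m] A' hA'; have [c] := lie_chart_of_atlas hA'; last exact: (compact_factor_chart_norm hS c ss.1 ss.2).
by move=> [[_ _ [x [y [_ _ xy]]] _] _ _]; case: xy; rewrite (lie_dim0_trivial c ss.1 x) mul1g mulg1.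
Qed.
End SemisimpleAtlas.

(** * Perfectness, and inclusions modulo a normal subgroup *)

Section PerfectMinap.
Variables (R : realType) (G : groupType).

Lemma generatedS (A B : set G) : A `<=` B -> generated A `<=` generated B.
Proof. by move=> AB; apply: generated_sub; [exact: generatedG|move=> x /AB; exact: sub_generated]. Qed.
Lemma commutator_subgroup_intro (A B : set G) x y : A x -> B y -> commutator_subgroup A B [~ x, y]%g.
Proof. by move=> Ax By; apply: sub_generated; exists x, y. Qed.
Lemma commutator_subgroupS (A B C D : set G) : A `<=` C -> B `<=` D -> commutator_subgroup A B `<=` commutator_subgroup C D.
Proof. by move=> sAC sBD; apply: generatedS => _ [x [y [Ax By ->]]]; exists x, y; split=> //; [exact: sAC|exact: sBD]. Qed.
Lemma commutator_subgroup_normal (A B K : set G) : normalized_by K A -> normalized_by K B ->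
 normalized_by K (commutator_subgroup A B).
Proof.
move=> nA nB; apply: generated_normalized => g _ Kg [x [y [Ax By ->]]].
by exists (x ^ g)%g, (y ^ g)%g; rewrite conjRg; split=> //; [exact: nA|exact: nB].
Qed.

Lemma normal_commutator_sub (A B D : set G) : is_subgroup D -> B `<=` D -> normalized_by A D -> commutator_subgroup A B `<=` D.
Proof.
move=> sD BD nD; apply: generated_sub=> // _ [x [y [Ax By ->]]].
have -> : [~ x, y]%g = ((y^-1) ^ x * y)%g by rewrite commgEr.
by apply: (subgroupM sD); [apply: (nD)=> //; apply/(subgroupV sD)/BD|exact: BD].
Qed.

Section ModuloNormal.
Variable N : set G.
Hypotheses (sN : is_subgroup N) (nN : normalized_by [set: G] N).
(** The set N D, which expresses inclusions in the quotient by N without forming it. *)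
Definition cosets_meet (D : set G) : set G := [set x | exists2 d, D d & N (x * d^-1)%g].

Lemma cosets_meet_sub (D E : set G) : D `<=` cosets_meet E -> cosets_meet D `<=` cosets_meet E.
Proof.
move=> DE x [d Dd Nx]; have [e Ee Ne] := DE d Dd; exists e=> //.
have -> : (x * e^-1 = x * d^-1 * (d * e^-1))%g by free_group.
exact: (subgroupM sN).
Qed.

Lemma commutator_cosets_meet (A B D E : set G) : A `<=` cosets_meet D -> B `<=` cosets_meet E ->
 commutator_subgroup A B `<=` cosets_meet (commutator_subgroup D E).
Proof.
move=> AD BE; set C := commutator_subgroup D E; have sC : is_subgroup C := generatedG _.
have cM x y d e : N (x * d^-1)%g -> N (y * e^-1)%g -> N (x * y * (d * e)^-1)%g.
 move=> h1 h2; have -> : (x * y * (d * e)^-1 = (y * e^-1) ^ x^-1 * (x * d^-1))%g by rewrite conjgE; free_group.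
 by apply: (subgroupM sN)=> //; exact: nN.
have cV x d : N (x * d^-1)%g -> N (x^-1 * d^-1^-1)%g.
 move=> h; have -> : (x^-1 * d^-1^-1 = ((x * d^-1)^-1) ^ x)%g by rewrite conjgE; free_group.
 by apply: nN=> //; exact: (subgroupV sN).
apply: generated_sub => [|_ [x [y [Ax By ->]]]].
 split=> [|x y [d Cd Nx] [e Ce Ny]|x [d Cd Nx]].
 - by exists 1%g; [exact: (subgroup1 sC)|rewrite mulgV; exact: (subgroup1 sN)].
 - by exists (d * e)%g; [exact: (subgroupM sC)|exact: cM].
 - by exists d^-1%g; [exact: (subgroupV sC)|exact: cV].
have [d Dd Nd] := AD x Ax; have [e Ee Ne] := BE y By.
exists [~ d, e]%g; first exact: commutator_subgroup_intro.
by rewrite !commgEl !conjgE; apply: (cM); [exact: cV|apply: (cM); [exact: cV|exact: cM]].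
Qed.
End ModuloNormal.

(** The distance of t to the nearest integer, that is, the length function of the circle R/Z. *)
Definition int_dist (t : R) : R := Num.min (t - (Num.floor t)%:~R) ((Num.floor t)%:~R + 1 - t).

Lemma int_dist_le t (m : int) : int_dist t <= `|t - m%:~R|.
Proof.
rewrite ge_min; have [mf|fm] := leP m (Num.floor t); apply/orP; [left|right; rewrite distrC];
 apply: le_trans (ler_norm _); first by rewrite lerD2l lerN2 ler_int.
by rewrite lerD2r -intrD1 ler_int lezD1.
Qed.

Lemma int_dist_attained t : exists m : int, `|t - m%:~R| = int_dist t.
Proof.
have /andP[h1 h2] := Num.Theory.floor_itv t; rewrite intrD1 in h2; rewrite /int_dist minEle.
case: ifP => _; first by exists (Num.floor t); rewrite ger0_norm // subr_ge0.
by exists (Num.floor t + 1); rewrite distrC intrD1 ger0_norm // subr_ge0 ltW.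
Qed.

(** Outside the commutator subgroup there would be g0 with a character to R/Z, trivial on
    commutators and nontrivial at g0. Its distance to 0 is a subadditive function with finitely
    colored balls, so it must vanish on the chain radical. *)
Lemma minap_perfect : minap G -> commutator_subgroup [set: G] [set: G] = setT.
Proof.
move=> Gm; apply/seteqP; split=> // g0 _; apply: contrapT => hg.
pose D := commutator_subgroup [set: G] [set: G]; have sD : is_subgroup D := generatedG _.
pose L := range (fun m : int => m%:~R : R).
have L0 : L 0 by exists 0.
have LB s t : L s -> L t -> L (s - t) by move=> [k _ <-] [l _ <-]; exists (k - l)=> //; rewrite intrB.
have sT : is_subgroup [set: G] by [].
pose C := [set xs : G * R | D xs.1 /\ xs.2 = 0].
have pC : partial_character [set: G] L C.
 split=> //.
 - by move=> x y s t [/= Dx ->] [/= Dy ->]; split; rewrite ?addr0 //; exact: (subgroupM sD).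
 - by move=> x s [/= Dx ->]; split; rewrite ?oppr0 //; exact: (subgroupV sD).
 - by move=> x y _ _; split=> //; exact: commutator_subgroup_intro.
 - by move=> s [_ /= ->].
(* The value at g0 is 1/m, where m is the order of g0 modulo commutators, or 1/2 if that order is
   infinite. *)
have [t Lt ht] : exists2 t : R, ~ L t & forall k s, C (g0 ^+ k, s)%g -> L (s - k%:R * t).
 have frac (t : R) : 0 < t -> t < 1 -> ~ L t.
  by move=> t0 t1 [m _ mE]; move: t0 t1; rewrite -mE ltr0z ltrz1 => h; rewrite ltNge -gtz0_ge1 h.
 have [hm|hm] := pselect (exists m, (0 < m)%N && `[< D (g0 ^+ m)%g >]); last first.
  exists 2^-1; first by apply: frac; rewrite ?invr_gt0 // invf_lt1 // ltr1n.
  move=> [|k] s [/= Ds ->]; first by rewrite mul0r subrr.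
  by case: hm; exists k.+1; apply/asboolP.
 have [m /andP[m0 /asboolP Dm] mmin] := ex_minnP hm.
 have m1 : (1 < m)%N.
  by rewrite ltn_neqAle m0 andbT eq_sym; apply/eqP => m1; apply: hg; move: Dm; rewrite m1 expg1.
 exists m%:R^-1; first by apply: frac; rewrite ?invr_gt0 ?ltr0n // invf_lt1 ?ltr0n // ltr1n.
 move=> k s [/= Dk ->]; rewrite sub0r.
 have r0 : (k %% m = 0)%N.
  apply/eqP; rewrite -leqn0 leqNgt; apply/negP => r0.
  suff : (m <= k %% m)%N by rewrite leqNgt ltn_pmod.
  apply: mmin; rewrite r0; apply/asboolP.
  have -> : (g0 ^+ (k %% m) = g0 ^+ k * (g0 ^+ m ^+ (k %/ m))^-1)%g.
   by rewrite {2}(divn_eq k m) addnC mulnC expgnDr expgnA mulgK.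
  apply: (subgroupM sD)=> //; apply: (subgroupV sD); elim: (k %/ m)%N => [|j IH].
   by rewrite expg0; exact: (subgroup1 sD).
  by rewrite expgS; exact: (subgroupM sD).
 exists (- (k %/ m)%N%:Z)=> //; rewrite {2}(divn_eq k m) r0 addn0 natrM mulfK ?pnatr_eq0 -?lt0n //.
 by rewrite mulrNz.
have [C' [_ pC' C't]] := partial_character_adjoin sT L0 LB pC I ht.
have [f [fM fC']] := character_extension sT L0 LB pC'.
have fV x : L (f x^-1%g + f x).
 have := LB _ _ (fM x x^-1%g I I) (LB _ _ L0 (fM 1%g 1%g I I)).
 rewrite mulgV mulg1 => h; have := LB _ _ L0 h; congr L; ring.
have h : int_dist (f g0) <= 0.
 apply: (@chain_radical_norm R G (fun g => int_dist (f g))); last exact: Gm.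
  move=> x y; have [k kE] := int_dist_attained (f x); have [l lE] := int_dist_attained (f y).
  have [p _ pE] := fM x^-1%g y I I; have [q _ qE] := fV x.
  apply: (le_trans (int_dist_le _ (p + q - k + l))); rewrite -kE -lE -normrN.
  have -> : - (f (x^-1 * y)%g - (p + q - k + l)%:~R) = (f x - k%:~R) - (f y - l%:~R).
   by rewrite !intrD mulrNz pE qE; ring.
  by apply: (le_trans (ler_normB _ _)).
 move=> e e0; pose fr g : R := f g - (Num.floor (f g))%:~R.
 have fr01 g : 0 <= fr g < 1.
  by have /andP[h1 h2] := Num.Theory.floor_itv (f g); rewrite subr_ge0 h1 ltrBlDl -intrD1.
 pose M := Num.truncn e^-1.
 exists 'I_M.+2, (fun g => inord (Num.truncn (fr g * M.+1%:R))) => g h.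
 have tr x : 0 <= fr x * M.+1%:R by rewrite mulr_ge0 //; case/andP: (fr01 x).
 have trM x : (Num.truncn (fr x * M.+1%:R) < M.+2)%N.
  rewrite ltnS -(@ler_nat R); have /andP[h1 _] := Num.Theory.truncn_itv (tr x); apply: (le_trans h1).
  by rewrite ler_piMl // ltW //; case/andP: (fr01 x).
 move/(congr1 val) => /=; rewrite !inordK //= => E.
 have /andP[a1 a2] := Num.Theory.truncn_itv (tr g); have /andP[b1 b2] := Num.Theory.truncn_itv (tr h).
 rewrite E in a1 a2; have [p _ pE] := fM g^-1%g h I I; have [q _ qE] := fV g.
 apply: (le_lt_trans (int_dist_le _ (p + q + Num.floor (f h) - Num.floor (f g)))).
 have -> : f (g^-1 * h)%g - (p + q + Num.floor (f h) - Num.floor (f g))%:~R = fr h - fr g.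
  by rewrite /fr !intrD mulrNz pE qE; ring.
 have eM : 1 < e * M.+1%:R.
  have ei : 0 < e^-1 by rewrite invr_gt0.
  have /andP[_] := Num.Theory.truncn_itv (ltW ei).
  by rewrite -/M => hM; rewrite -[X in X < _](mulfV (lt0r_neq0 e0)) ltr_pM2l.
 rewrite -(ltr_pM2r (_ : 0 < M.+1%:R)) // -{1}[M.+1%:R]ger0_norm // -normrM mulrBl.
 apply: le_lt_trans eM; rewrite ler_norml; move: a1 a2 b1 b2; set k := Num.truncn _; rewrite -[k.+1%:R]natr1.
 by move: (k%:R) (fr g * _) (fr h * _) => a u v a1 a2 b1 b2; apply/andP; split; lra.
have [m mE] := int_dist_attained (f g0); have [k _ kE] := fC' _ _ C't.
apply: Lt; exists (m - k)=> //; rewrite intrB kE.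
have : `|f g0 - m%:~R| <= 0 by rewrite mE.
by rewrite normr_le0 subr_eq0 => /eqP ->; ring.
Qed.
End PerfectMinap.

(** * Sigma-compact subgroups and Baire's theorem *)

Section SigmaCompact.
Variable G : topGroupType.
Implicit Types A B : set G.

Lemma subgroup_closure A : is_subgroup A -> is_subgroup (closure A).
Proof.
move=> sA; split=> [|x y cx cy U xyU|x cx U xU].
- by apply: subset_closure; exact: (subgroup1 sA).
- have [[P Q] [/= Px Qy] PQ] : nbhs (x, y) [set p : G * G | U (p.1 * p.2)%g] := @mulg_continuous G (x, y) U xyU.
 have [a [Aa Pa]] := cx P Px; have [b [Ab Qb]] := cy Q Qy; exists (a * b)%g; split; first exact: (subgroupM sA).
 exact: (PQ (a, b)).
have [a [Aa Ua]] := cx _ (@invg_continuous G x U xU).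
by exists a^-1%g; split=> //; exact: (subgroupV sA).
Qed.

Lemma commutator_continuous : continuous (fun p : G * G => [~ p.1, p.2]%g).
Proof.
have -> : (fun p : G * G => [~ p.1, p.2]%g) = (fun p => p.1^-1 * p.1 ^ p.2)%g by apply/funext => p; rewrite commgEl.
by move=> [x y]; apply: cvgMg; [apply: cvgVg|apply: cvgJg]; [exact: cvg_fst|exact: cvg_fst|exact: cvg_snd].
Qed.

Lemma commutator_closure A B : commutator_subgroup (closure A) (closure B) `<=` closure (commutator_subgroup A B).
Proof.
apply: generated_sub => [|_ [x [y [cx cy ->]]] U hU]; first exact/subgroup_closure/generatedG.
have [[P Q] [/= Px Qy] PQ] := @commutator_continuous (x, y) U hU.
have [a [Aa Pa]] := cx P Px; have [b [Ab Qb]] := cy Q Qy; exists [~ a, b]%g.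
by split; [exact: commutator_subgroup_intro|exact: (PQ (a, b))].
Qed.

(** The closure of the radical is again connected, normal and solvable, because commutators of
    closures lie in the closure of commutators; maximality concludes. *)
Lemma solvable_radical_closed (Rad : set G) : hausdorff_space G -> is_solvable_radical Rad -> closed Rad.
Proof.
move=> hG [[sR nR cR [k hk]] Rmax]; rewrite closure_id; apply/seteqP; split; first exact: subset_closure.
apply: Rmax; split; [exact: subgroup_closure| |exact: connected_closure|exists k].
 move=> g x _ cx U xgU.
 have h : (fun y => y ^ g)%g @ x --> (x ^ g)%g by apply: cvgJg; [exact: cvg_id|exact: cvg_cst].
 by have [y [Ry Uy]] := cx _ (h U xgU); exists (y ^ g)%g; split=> //; exact: nR.
have h j : iter j (fun K => commutator_subgroup K K) (closure Rad) `<=` closure (iter j (fun K => commutator_subgroup K K) Rad).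
 by elim: j=> // j IH /=; apply: subset_trans (@commutator_closure _ _); exact: (commutator_subgroupS IH).
apply: (subset_trans (h k)); apply: (subset_trans (closure_subset hk)).
by rewrite -(closure_id _).1 //; apply: accessible_closed_set1; exact: hausdorff_accessible.
Qed.

Definition sigma_compact A := exists (I : countType) (K : I -> set G), (forall i, compact (K i)) /\ A = \bigcup_i K i.

Lemma sigma_compact_closedI A B : sigma_compact A -> closed B -> sigma_compact (A `&` B).
Proof.
move=> [I [K [Kc ->]]] Bc; exists I, (fun i => K i `&` B); split; first by move=> i; exact: compact_closedI.
by rewrite setI_bigcupl.
Qed.

Lemma sigma_compact_generated A : sigma_compact A -> sigma_compact (generated A).
Proof.
move=> [I [K [Kc AE]]].
pose F (bi : bool * I) : set G := if bi.1 then K bi.2 else [set x | K bi.2 x^-1%g].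
pose W := fix W (s : seq (bool * I)) : set G :=
 if s is bi :: s' then [set z|exists x y, [/\ F bi x, W s' y & z = (x * y)%g]] else [set 1%g].
exists (seq (bool * I)), W; split.
 elim=> [|[b i] s IH]; first exact: compact_set1.
 by apply: compact_mulg=> //; case: b => /=; [exact: Kc|exact: compact_invg].
have FG bi x : F bi x -> generated A x.
 case: bi => -[] i /= Kx; first by apply: sub_generated; rewrite AE; exists i.
 by rewrite -[x]invgK; apply: (subgroupV (generatedG A)); apply: sub_generated; rewrite AE; exists i.
apply/seteqP; split=> [g|g [s _]]; last first.
 elim: s g => [|bi s IH] g /=; first by move->; exact: (subgroup1 (generatedG _)).
 by move=> [x [y [Fx Wy ->]]]; apply: (subgroupM (generatedG _)); [exact: FG Fx|exact: IH].
have -> : generated A = generated (A `|` [set x | A x^-1%g]).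
 apply/seteqP; split; first by apply: generatedS; exact: subsetUl.
 apply: generated_sub => [|x [Ax|Ax]]; [exact: generatedG|exact: sub_generated|].
 by rewrite -[x]invgK; apply: (subgroupV (generatedG A)); exact: sub_generated.
suff h : generated (A `|` [set x | A x^-1%g]) `<=` \bigcup_s W s by exact: h.
apply: generated_ind => [x [Ax|Ax]||x y Ax [s _ Ws]].
- by right; rewrite /= invgK.
- by left.
- by exists [::].
have [bi Fx] : exists bi, F bi x.
 by case: Ax; rewrite AE => -[i _ Ki]; [exists (true, i)|exists (false, i)].
by exists (bi :: s)=> //; exists x, y.
Qed.

Lemma sigma_compact_commutator A B : sigma_compact A -> sigma_compact B -> sigma_compact (commutator_subgroup A B).
Proof.
move=> [I [K [Kc AE]]] [J [M [Mc BE]]]; apply: sigma_compact_generated.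
exists (I * J)%type, (fun ij => [set z|exists x y, [/\ K ij.1 x, M ij.2 y & z = [~ x, y]%g]]); split.
 move=> [i j] /=; have -> : [set z|exists x y, [/\ K i x, M j y & z = [~ x, y]%g]] = (fun p => [~ p.1, p.2]%g) @` (K i `*` M j).
  apply/seteqP; split=> [z [x [y [Kx My ->]]]|_ [[x y] [/= Kx My] <-]]; first by exists (x, y).
  by exists x, y.
 apply: continuous_compact; last exact: compact_setX.
 by apply: continuous_subspaceT; exact: commutator_continuous.
apply/seteqP; split=> [z [x [y [Ax By ->]]]|z [[i j] _ [x [y [/= Kx My ->]]]]].
 by move: Ax By; rewrite AE BE => -[i _ Ki] [j _ Mj]; exists (i, j)=> //; exists x, y.
by exists x, y; rewrite AE BE; split=> //; [exists i|exists j].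
Qed.

Hypothesis hG : hausdorff_space G.
Hypothesis locally_compact1 : forall U, nbhs (1%g : G) U -> exists C, [/\ compact C, nbhs (1%g : G) C & C `<=` U].

Lemma locally_compact_at (x : G) (U : set G) : nbhs x U -> exists C, [/\ compact C, nbhs x C & C `<=` U].
Proof.
move=> xU; have [C [Cc C1 CU]] := locally_compact1 (nbhs1_translate xU).
exists [set y | C (x^-1 * y)%g]; split; [|exact: nbhs_translate1|by move=> y /CU /=; rewrite mulVKg].
have -> : [set y | C (x^-1 * y)%g] = (fun y => x * y)%g @` C.
 by apply/seteqP; split=> [y Cy|_ [y Cy <-]] /=; [exists (x^-1 * y)%g=> //; rewrite mulVKg|rewrite mulKg].
apply: continuous_compact Cc; apply: continuous_subspaceT => y.
by apply: cvgMg; [exact: cvg_cst|exact: cvg_id].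
Qed.

(** Were no K i to contain a relatively open piece of D, there would be nested compact neighborhoods
    of points of D avoiding the K i one after the other; a point of D in all of them is not
    covered. *)
Lemma baire_closed_cover (D : set G) (I : countType) (K : I -> set G) : closed D -> D !=set0 ->
 (forall i, compact (K i)) -> D `<=` \bigcup_i K i ->
 exists i x U, [/\ D x, nbhs x U & U `&` D `<=` K i].
Proof.
move=> Dc [x0 Dx0] Kc DK; apply: contrapT => hn.
pose Q k : set G := if unpickle k is Some i then K i else set0.
have Qc k : compact (Q k) by rewrite /Q; case: unpickle => [i|]; [exact: Kc|exact: compact0].
pose ok (p : G * set G) := [/\ D p.1, compact p.2 & nbhs p.1 p.2].
have step (p : {p | ok p}) k : exists q : {p | ok p}, (sval q).2 `<=` (sval p).2 `&` ~` Q k.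
 case: p => -[x C] /= [/= Dx Cc xC].
 have [y [Cy Dy Qy]] : exists y, [/\ (C°)%classic y, D y & ~ Q k y].
  apply: contrapT => h.
  have hQ : C° `&` D `<=` Q k by move=> y [Cy Dy]; apply: contrapT => Qy; apply: h; exists y.
  have CD : (C° `&` D) x by split.
  move: hQ; rewrite /Q; case: unpickle => [i|] hQ; last by have := hQ x CD.
  by apply: hn; exists i, x, C°; split=> //; apply: open_nbhs_nbhs; split=> //; exact: open_interior.
 have yU : nbhs y (C `&` ~` Q k).
  apply: filterI; first exact: Cy.
  by apply: open_nbhs_nbhs; split=> //; apply: closed_openC; exact: compact_closed.
 have [C' [C'c yC' C'U]] := locally_compact_at yU.
 by exists (exist _ (y, C') (And3 (Dy : D (y, C').1) C'c yC')).
have [C0 [C0c xC0 _]] := locally_compact_at (@filterT _ (nbhs x0) _).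
pose nx p k := projT1 (cid (step p k)).
pose s := fix s k : {p | ok p} := if k is k'.+1 then nx (s k') k' else exist _ (x0, C0) (And3 (Dx0 : D (x0, C0).1) C0c xC0).
pose E k := (sval (s k)).2.
have sE k : E k.+1 `<=` E k `&` ~` Q k by exact: (projT2 (cid (step (s k) k))).
have Emono k l : (k <= l)%N -> E l `<=` E k.
 by move/subnK => <-; elim: (l - k)%N=> // j IH; rewrite addSn => z /sE [] /IH.
have En k : (E k `&` D) (sval (s k)).1.
 by rewrite /E; case: (s k) => -[x C] /= [Dx _ xC]; split=> //; exact: nbhs_singleton.
pose F : set_system G := [set A|exists k, E k `&` D `<=` A].
have pF : ProperFilter F.
 split; first by move=> [k h]; have := h _ (En k).
 split; first by exists 0%N.
  move=> A B [k hk] [l hl]; exists (maxn k l) => z [Ez Dz].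
  by split; [apply: hk|apply: hl]; split=> //; apply: Emono Ez; rewrite ?leq_maxl ?leq_maxr.
 by move=> A B AB [k hk]; exists k => z /hk /AB.
have [|p [_ clp]] := C0c F pF; first by exists 0%N => z [].
have Ek k : (E k `&` D) p.
 have cl : closed (E k `&` D).
  by apply: closedI=> //; apply: compact_closed=> //; rewrite /E; case: (s k) => -[x C] /= [].
 rewrite ((closure_id _).1 cl) => U pU; have [z [h1 h2]] := clp (E k `&` D) U (ex_intro _ k (fun _ h => h)) pU.
 by exists z.
have [i _ Kp] := DK p (Ek 0%N).2.
have [/sE[_ hp] _] := Ek (pickle i).+1; apply: hp.
by rewrite /Q pickleK.
Qed.
End SigmaCompact.

Lemma discrete_countable (S : topGroupType) (D : set S) : @second_countable S -> is_subgroup D ->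
 nbhs (1%g : S) [set s | D s -> s = 1%g] -> exists f : nat -> S, (forall k, D (f k)) /\ forall s, D s -> exists k, f k = s.
Proof.
move=> [B /countable_injP[f finj] [Bo Bb]] sD D1.
pose P k := [set s | D s /\ exists2 b, B b /\ f b = k & b `&` D = [set s]].
exists (fun k => xget 1%g (P k)); split=> [k|s Ds].
 by case: xgetP => [s _ [] //|_]; exact: (subgroup1 sD).
have hs : nbhs s [set t | D (s^-1 * t)%g -> (s^-1 * t)%g = 1%g] := nbhs_translate1 s D1.
have [b [Bb' bs] hb] := Bb s _ hs.
have bD : b `&` D = [set s].
 apply/seteqP; split=> [t [bt Dt]|_ -> //].
 have := hb t bt (subgroupM sD (subgroupV sD Ds) Dt) => /(congr1 (fun z => s * z)%g).
 by rewrite mulVKg mulg1.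
exists (f b); have Ps : P (f b) s by split=> //; exists b.
case: xgetP => [t _ [Dt [b' [Bb'' fb'] b'D]]|/(_ s) //].
have e : b' = b by apply: finj; rewrite ?inE.
by have : [set t] s by rewrite -b'D e bD.
Qed.

Lemma chart_locally_compact (R : realType) n (G : topGroupType) (c : lie_chart R n G) U : nbhs (1%g : G) U ->
 exists C, [/\ compact C, nbhs (1%g : G) C & C `<=` U].
Proof.
move=> U1; have h0 : {for 0, continuous (lc_psi c)} by apply: lc_cont; rewrite normr0.
have : nbhs (0 : 'rV[R]_n) (lc_psi c @^-1` U) by apply: h0; rewrite lc_psi0.
move/nbhs_ballP => [d d0 hd]; pose r := Num.min (d / 2) 1.
have r0 : 0 < r by rewrite lt_min ltr01 divr_gt0.
exists (lc_psi c @` [set x | `|x| <= r]); split.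
- apply: continuous_compact (@ball_compact _ _ _); apply: continuous_in_subspaceT => x; rewrite inE /= => xr.
 by apply: lc_cont; apply: le_trans xr _; rewrite ge_min lexx orbT.
- by apply: filterS (lc_nbhs c r0) => _ [x xr ->]; exists x=> //; exact: ltW.
move=> _ [x /= xr <-]; apply: hd; rewrite -ball_normE /= sub0r normrN; apply: (le_lt_trans xr).
by rewrite gt_min ltr_pdivrMr // ltr_pMr // ltr1n.
Qed.

(** * The criterion for a Levi decomposition *)

Section LeviDecomposition.
Variables (R : realType) (n m : nat) (G S : topGroupType) (A : set (chart R n G)) (B : set (chart R m S)).
Variables (Rad : set G) (iota : S -> G).
Hypotheses (hA : is_lie_group A) (Gc : connected [set: G]) (hR : is_solvable_radical Rad).
Hypothesis hL : is_levi_subgroup A B Rad iota.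
Let hG : hausdorff_space G. Proof. by case: hA. Qed.
Let sR : is_subgroup Rad. Proof. by case: hR => -[]. Qed.
Let nR : normalized_by [set: G] Rad. Proof. by case: hR => -[]. Qed.
Let hB : is_lie_group B. Proof. by case: hL. Qed.
Let ss : connected_semisimple S. Proof. by case: hL. Qed.
Let iM : {morph iota : x y / x * y}%g. Proof. by case: hL => _ _ []. Qed.
Let dec g : exists s r, Rad r /\ g = (iota s * r)%g. Proof. by case: hL. Qed.
Let i1 : iota 1%g = 1%g. Proof. by apply: (mulgI (iota 1%g)); rewrite -iM !mulg1. Qed.
Let iV x : iota x^-1%g = (iota x)^-1%g. Proof. by apply: (mulgI (iota x)); rewrite -iM !mulgV i1. Qed.
Let D : set S := [set s | Rad (iota s)].
Let sD : is_subgroup D.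
Proof.
split=> [|x y Dx Dy|x Dx]; rewrite /D /= ?i1 ?iM ?iV; first exact: (subgroup1 sR).
 exact: (subgroupM sR).
exact: (subgroupV sR).
Qed.
Let D1 : nbhs (1%g : S) [set s | D s -> s = 1%g]. Proof. by case: hL. Qed.

(** A discrete normal subgroup of a connected group is central. *)
Lemma levi_radical_central s : D s -> forall x, (s * x = x * s)%g.
Proof.
move=> Ds x; suff e : (s ^ x = s)%g by rewrite -{2}e conjgE mulVKg.
apply: (connected_discrete_centralizer ss.1 _ _ _ sD D1 Ds)=> // z g _ Dz.
by rewrite /D /= conjgE !iM iV -conjgE; exact: nR.
Qed.

Lemma levi_minap : no_compact_simple_factors S -> Rad = commutator_subgroup [set: G] Rad -> minap G.
Proof.
move=> ncf RE; have Sm := semisimple_minap hB ss ncf.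
pose N : set G := @chain_radical G.
have sN : is_subgroup N by split; [exact: chain_radical1|exact: chain_radicalM|exact: chain_radicalV].
have nN : normalized_by [set: G] N by move=> g x _; exact: chain_radicalJ.
have iN s : N (iota s) by exact: (chain_radical_morph iM (Sm s)).
have self E : E `<=` cosets_meet N E by move=> x Ex; exists x=> //; rewrite mulgV; exact: (subgroup1 sN).
have GR : [set: G] `<=` cosets_meet N Rad.
 by move=> g _; have [s [r [Rr ->]]] := dec g; exists r=> //; rewrite mulgK.
have R1 : Rad `<=` cosets_meet N (commutator_subgroup Rad Rad).
 rewrite {1}RE; exact: commutator_cosets_meet.
case: hR => -[_ _ _ [k hk]] _.
have Rk : Rad `<=` cosets_meet N (iter k (fun K => commutator_subgroup K K) Rad).
 elim: k {hk} => [|k IH]; first exact: self.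
 apply: (subset_trans R1); apply: cosets_meet_sub=> //.
 exact: (commutator_cosets_meet sN nN IH IH).
move=> g; have [s [r [Rr ->]]] := dec g; apply: chain_radicalM; first exact: iN.
by have [d /hk ->] := Rk r Rr; rewrite invg1 mulg1.
Qed.

(** The function N of a compact factor of S is transported to G by a choice of the component in S.
    Two choices differ by an element mapped into the radical, which is central in S and does not
    affect N. *)
Lemma levi_no_compact_factors : minap G -> no_compact_simple_factors S.
Proof.
move=> Gm H sf Hc; have [N [ND Ncol Nz [g0 Ng0]]] := compact_factor_norm hB ss sf Hc.
have /choice[sg hsg] : forall g, exists s, Rad ((iota s)^-1 * g)%g.
 by move=> g; have [s [r [Rr ->]]] := dec g; exists s; rewrite mulKg.
have key g s : Rad ((iota s)^-1 * g)%g -> N (sg g) = N s.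
 move=> h; pose z := (s^-1 * sg g)%g.
 have Dz : D z.
  rewrite /D /= /z iM iV -[(_ * iota (sg g))%g](mulgVK (((iota s)^-1 * g))%g).
  have -> : ((iota s)^-1 * iota (sg g) * ((iota s)^-1 * g)^-1 * ((iota s)^-1 * g) =
   ((iota s)^-1 * g) * ((iota (sg g))^-1 * g)^-1)%g by free_group.
  by apply: (subgroupM sR)=> //; exact: (subgroupV sR).
 by rewrite -[sg g](mulVKg s) -/z Nz //; exact: levi_radical_central.
have sgM x y : N (sg (x^-1 * y)%g) = N ((sg x)^-1 * sg y)%g.
 apply: key; rewrite iM iV.
 have -> : (((iota (sg x))^-1 * iota (sg y))^-1 * (x^-1 * y) =
  (((iota (sg x))^-1 * x)^-1) ^ ((iota (sg x))^-1 * iota (sg y)) * ((iota (sg y))^-1 * y))%g.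
  by rewrite conjgE; free_group.
 by apply: (subgroupM sR)=> //; apply: nR=> //; exact: (subgroupV sR).
have : N (sg (iota g0)) <= 0.
 apply: (@chain_radical_norm R G (fun g => N (sg g))); last exact: Gm.
  by move=> x y; rewrite sgM.
 move=> e e0; have [I [col hcol]] := Ncol e e0; exists I, (col \o sg) => g h /= /hcol.
 by rewrite sgM.
by rewrite (key _ g0) ?mulVg; [rewrite leNgt Ng0|exact: (subgroup1 sR)].
Qed.

Lemma levi_radical_commutator : minap G -> Rad = commutator_subgroup [set: G] Rad.
Proof.
move=> Gm; set T := commutator_subgroup [set: G] Rad; have sT : is_subgroup T by exact: generatedG.
have nG : normalized_by [set: G] [set: G] by [].
have nT : normalized_by [set: G] T by exact: commutator_subgroup_normal.
have TR : T `<=` Rad by exact: normal_commutator_sub.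
have self E : E `<=` cosets_meet T E by move=> x Ex; exists x=> //; rewrite mulgV; exact: (subgroup1 sT).
(* G is perfect, and modulo T every commutator is a commutator of elements of S. So S covers G
   modulo T, and an element of Rad is, modulo T, in the image of D. *)
have RD r : Rad r -> exists2 s, D s & T ((iota s)^-1 * r)%g.
 move=> Rr; have : [set: G] `<=` cosets_meet T (range iota).
  rewrite -(minap_perfect R Gm); apply: generated_sub => [|_ [x [y [_ _ ->]]]].
   split=> [|x y [_ [s _ <-] Nx] [_ [t _ <-] Ny]|x [_ [s _ <-] Nx]].
   - by exists 1%g; [exists 1%g|rewrite mulgV; exact: (subgroup1 sT)].
   - exists (iota (s * t)%g); first by exists (s * t)%g.
    have -> : (x * y * (iota (s * t))^-1 = (y * (iota t)^-1) ^ x^-1 * (x * (iota s)^-1))%g.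
     by rewrite iM conjgE; free_group.
    by apply: (subgroupM sT)=> //; exact: nT.
   - exists (iota s^-1%g); first by exists s^-1%g.
    have -> : (x^-1 * (iota s^-1)^-1 = ((x * (iota s)^-1)^-1) ^ x)%g by rewrite iV conjgE; free_group.
    by apply: nT=> //; exact: (subgroupV sT).
  have [s [r1 [R1 ->]]] := dec x; have [t [r2 [R2 ->]]] := dec y.
  have T1 g r' : Rad r' -> T [~ g, r']%g by move=> ?; exact: commutator_subgroup_intro.
  exists (iota [~ s, t]%g); first by exists [~ s, t]%g.
  have -> : iota [~ s, t]%g = [~ iota s, iota t]%g by rewrite !commgEl !conjgE !iM !iV.
  set y' := (iota t * r2)%g; set q := [~ iota s, iota t]%g; set p := [~ iota s, r2]%g.
  have -> : [~ iota s * r1, y']%g = ((p * q ^ r2) ^ r1 * [~ y', r1]^-1)%g.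
   by rewrite /p /q /y' !commgEl !conjgE; free_group.
  (* Apart from the conjugation by q^-1, every factor on the right is a commutator with r1 or r2, or
     the inverse of one, hence in the normal subgroup T. *)
  have -> : ((p * q ^ r2) ^ r1 * [~ y', r1]^-1 * q^-1 =
    p * ([~ q, r2] * [~ p * q ^ r2, r1] * [~ y', r1]^-1) ^ q^-1)%g.
   by rewrite [[~ q, r2]%g]commgEl [[~ p * _, r1]%g]commgEl [(_ ^ q^-1)%g]conjgE; free_group.
  apply: (subgroupM sT); first exact: T1.
  by apply: nT=> //; apply: (subgroupM sT); [apply: (subgroupM sT)|apply: (subgroupV sT)]; exact: T1.
 move=> /(_ r I)[_ [s _ <-] Tr]; have Ts : T ((iota s)^-1 * r)%g.
  by have -> : ((iota s)^-1 * r = (r * (iota s)^-1) ^ iota s)%g; [rewrite conjgE; free_group|exact: nT].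
 exists s=> //; have : Rad (r * (iota s)^-1)%g by exact: TR.
 by rewrite (subgroupMlE _ sR) // (subgroupVE _ sR).
have [c] := lie_chart_of_atlas hA; have lc := chart_locally_compact c.
have Rcl : closed Rad by exact: solvable_radical_closed.
have Gs : sigma_compact [set: G].
 have [C [Cc C1 _]] := lc setT filterT.
 have -> : [set: G] = generated C.
  apply/esym/connected_subgroup_full=> //; first exact: generatedG.
  by apply: filterS C1; exact: sub_generated.
 by apply: sigma_compact_generated; exists unit, (fun=> C); split=> //; apply/seteqP; split=> [x Cx|x [_ _]]; first exists tt.
have Rs : sigma_compact Rad by rewrite -(setTI Rad); exact: sigma_compact_closedI.
have [I [K [Kc TE]]] := sigma_compact_commutator Gs Rs.
have [f [fD fs]] : exists f : nat -> S, (forall k, D (f k)) /\ forall s, D s -> exists k, f k = s.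
 by apply: discrete_countable=> //; case: hB.
pose M (ki : nat * I) := [set x | K ki.2 ((iota (f ki.1))^-1 * x)%g].
(* Rad is covered by the countably many compact translates of the pieces of T by elements of D. One
   of them contains a relatively open set, so T contains a neighborhood of 1 in the connected group
   Rad. *)
have [ki [x [U [Rx xU UM]]]] : exists ki x U, [/\ Rad x, nbhs x U & U `&` Rad `<=` M ki].
 apply: (baire_closed_cover hG lc Rcl); first by exists 1%g; exact: (subgroup1 sR).
  move=> [k i]; have -> : M (k, i) = (fun y => iota (f k) * y)%g @` K i.
   apply/seteqP; split=> [y /= h|_ [y Ky <-]]; last by rewrite /M /= mulKg.
   by exists ((iota (f k))^-1 * y)%g=> //; rewrite mulVKg.
  apply: continuous_compact (Kc i); apply: continuous_subspaceT => y.
  by apply: cvgMg; [exact: cvg_cst|exact: cvg_id].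
 move=> r Rr; have [s Ds] := RD r Rr; rewrite /T TE => -[i _ Ki].
 by have [k fk] := fs s Ds; exists (k, i)=> //; rewrite /M /= fk.
apply/seteqP; split=> //; apply: (connected_subgroup_open sR sT _ (nbhs1_translate xU)); first by case: hR => -[].
move=> y [Uxy Ry].
have MT z : M ki z -> T ((iota (f ki.1))^-1 * z)%g by move=> h; rewrite /T TE; exists ki.2.
have Tx : T ((iota (f ki.1))^-1 * x)%g by apply: MT; apply: UM; split=> //; exact: nbhs_singleton.
have : T ((iota (f ki.1))^-1 * (x * y))%g by apply: MT; apply: UM; split=> //; exact: (subgroupM sR).
by rewrite mulgA (subgroupMlE _ sT).
Qed.

Theorem levi_minap_iff : minap G <-> no_compact_simple_factors S /\ Rad = commutator_subgroup [set: G] Rad.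
Proof.
split=> [Gm|[ncf RE]]; last exact: levi_minap.
by split; [exact: levi_no_compact_factors|exact: levi_radical_commutator].
Qed.
End LeviDecomposition.

(** * Normal subgroups of groups mapping onto SL2 *)

Section TwoByTwo.
Variable R : realType.
Definition mx2 (a b c d : R) : 'M[R]_2 :=
 \matrix_(i, j) (if i == 0 then if j == 0 then a else b else if j == 0 then c else d).

Lemma mx2P (M : 'M[R]_2) : M = mx2 (M 0 0) (M 0 1) (M 1 0) (M 1 1).
Proof. by apply/matrixP => -[[|[]] // i1] [[|[]] // j1]; rewrite mxE /=; congr (M _ _); apply: val_inj. Qed.
Lemma mx2M a b c d a' b' c' d' : mx2 a b c d *m mx2 a' b' c' d' =
 mx2 (a * a' + b * c') (a * b' + b * d') (c * a' + d * c') (c * b' + d * d').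
Proof. by apply/matrixP => -[[|[]] // i1] [[|[]] // j1]; rewrite !mxE !big_ord_recl big_ord0 !mxE /= addr0. Qed.
Lemma det_mx2 a b c d : \det (mx2 a b c d) = a * d - b * c.
Proof.
rewrite (expand_det_row _ 0) !big_ord_recl big_ord0 /cofactor !det_mx11 !mxE /= expr0 expr1; ring.
Qed.

Lemma mx2_1 : 1%:M = mx2 1 0 0 1.
Proof. by rewrite [LHS]mx2P !mxE /=. Qed.
Lemma SL2P (M : 'M[R]_2) : SL2 M -> M 0 0 * M 1 1 - M 0 1 * M 1 0 = 1.
Proof. by rewrite /SL2 /= {1}[M]mx2P det_mx2. Qed.

Variables (G : topGroupType) (p : G -> 'M[R]_2).
Hypotheses (pM : {morph p : x y / (x * y)%g >-> x *m y}) (pR : range p = @SL2 R).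

Lemma cover_SL2 x : SL2 (p x). Proof. by rewrite -pR; exists x. Qed.
Lemma cover_lift (M : 'M[R]_2) : SL2 M -> exists x, p x = M. Proof. by rewrite -pR => -[x _ <-]; exists x. Qed.

Lemma cover1 : p 1%g = 1%:M.
Proof.
have h : p 1%g \in unitmx by rewrite unitmxE (cover_SL2 1%g) unitr1.
by rewrite -[LHS](mulKmx h) -pM mulg1 mulVmx.
Qed.

Lemma coverV x a b c d : p x = mx2 a b c d -> p x^-1%g = mx2 d (- b) (- c) a.
Proof.
move=> px; have := cover_SL2 x; rewrite /SL2 /= px det_mx2 => e.
have h : mx2 d (- b) (- c) a *m p x = 1%:M by rewrite px mx2M mx2_1; congr mx2; lra.
by rewrite -[LHS]mul1mx -h -mulmxA -pM mulgV cover1 mulmx1.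
Qed.

Variable N : set G.
Hypotheses (sN : is_subgroup N) (nN : normalized_by [set: G] N).
Let P := [set M | exists2 x, N x & p x = M].

Let PM M M' : P M -> P M' -> P (M *m M').
Proof. by move=> [x Nx <-] [y Ny <-]; exists (x * y)%g; rewrite ?pM //; exact: (subgroupM sN). Qed.
Let PJ a b c d k1 k2 k3 k4 : k1 * k4 - k2 * k3 = 1 -> P (mx2 a b c d) ->
 P (mx2 k1 k2 k3 k4 *m mx2 a b c d *m mx2 k4 (- k2) (- k3) k1).
Proof.
move=> k [x Nx px]; have [y py] : exists y, p y = mx2 k1 k2 k3 k4 by apply: cover_lift; rewrite /SL2 /= det_mx2.
exists (x ^ y^-1)%g; first exact: nN.
by rewrite conjgE invgK !pM py px (coverV py) mulmxA.
Qed.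

Let PV a b c d : P (mx2 a b c d) -> P (mx2 d (- b) (- c) a).
Proof. by move=> [x Nx px]; exists x^-1%g; [exact: (subgroupV sN)|exact: coverV]. Qed.
Let Pdet a b c d : P (mx2 a b c d) -> a * d - b * c = 1.
Proof. by move=> [x _ px]; have := cover_SL2 x; rewrite /SL2 /= px det_mx2. Qed.
(** Conjugation turns a nonscalar element into one with nonzero lower left entry, then into one with
    vanishing upper left entry. From it come a lower triangular element with distinct diagonal
    entries, all unipotents, and finally all matrices by elimination. *)
Lemma SL2_normal_full x : N x -> (p x 0 1 != 0) || (p x 1 0 != 0) || (p x 0 0 != p x 1 1) ->
 forall M, SL2 M -> exists2 y, N y & p y = M.
Proof.
move=> Nx; set a := p x 0 0; set b := p x 0 1; set c := p x 1 0; set d := p x 1 1 => hx.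
have P0 : P (mx2 a b c d) by exists x=> //; rewrite [p x]mx2P.
have [a1 [b1 [c1 [d1 [P1 c10]]]]] : exists a' b' c' d', P (mx2 a' b' c' d') /\ c' != 0.
 have [c0|c0] := eqVneq c 0; last by exists a, b, c, d.
 have [b0|b0] := eqVneq b 0.
  have k : 1 * 1 - 0 * 1 = 1 :> R by ring.
  have := PJ k P0; rewrite !mx2M => h; do 4!eexists; split; first exact: h.
  move: hx; rewrite c0 b0 !eqxx /= => ad; rewrite -subr_eq0 in ad.
  by have -> : (1 * a + 1 * 0) * 1 + (1 * 0 + 1 * d) * -1 = a - d by ring.
 have k : 0 * 0 - 1 * -1 = 1 :> R by ring.
 have := PJ k P0; rewrite !mx2M => h; do 4!eexists; split; first exact: h.
 have -> : (-1 * a + 0 * c) * 0 + (-1 * b + 0 * d) * - -1 = - b by ring.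
 by rewrite oppr_eq0.
have [e P2] : exists e, P (mx2 0 (- c1^-1) c1 e).
 pose t := - a1 / c1; have k : 1 * 1 - t * 0 = 1 by ring.
 have := PJ k P1; rewrite !mx2M => h; have hd := Pdet h; exists (c1 * - t + d1 * 1).
 move: h hd; have -> : (1 * a1 + t * c1) * 1 + (1 * b1 + t * d1) * - 0 = 0 by rewrite /t; field.
 have -> : (0 * a1 + 1 * c1) * 1 + (0 * b1 + 1 * d1) * - 0 = c1 by ring.
 have -> : (0 * a1 + 1 * c1) * - t + (0 * b1 + 1 * d1) * 1 = c1 * - t + d1 * 1 by ring.
 set q := (1 * a1 + _) * _ + _; rewrite mul0r sub0r => h hd.
 by have -> : - c1^-1 = q; [apply: (mulIf c10); rewrite mulNr mulVf // -hd opprK|].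
(* The commutator with diag(2, 1/2) of an element with upper left entry 0 is lower triangular with
   diagonal 1/4, 4. *)
have [be P3] : exists be, P (mx2 4^-1 0 be 4).
 have k : 2 * 2^-1 - 0 * 0 = 1 :> R by field.
 have := PM P2 (PJ k (PV P2)); rewrite !mx2M opprK => h; exists (c1 * (2 * e * 2^-1 + 0) * 1 + e * (2^-1 * - c1 * 2^-1)).
 move: h; congr P; congr mx2; field; exact: c10.
(* The commutator of the previous element with the unipotent of parameter t / 15 has parameter t,
   since 4^2 - 1 = 15. *)
have P4 t : P (mx2 1 0 t 1).
 have k : 1 * 1 - 0 * (t / 15) = 1 by ring.
 have := PM P3 (PJ k (PV P3)); rewrite !mx2M => h; move: h; congr P; congr mx2; by field.
have P5 t : P (mx2 1 t 0 1).
 have k : 0 * 0 - 1 * -1 = 1 :> R by ring.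
 have := PJ k (P4 (- t)); rewrite !mx2M => h; move: h; congr P; congr mx2; by ring.
have P6 a' b' c' d' : a' * d' - b' * c' = 1 -> c' != 0 -> P (mx2 a' b' c' d').
 move=> hd c'0; have := PM (PM (P5 ((a' - 1) / c')) (P4 c')) (P5 ((d' - 1) / c')); rewrite !mx2M => h.
 move: h; congr P; have e1 : b' = (a' * d' - 1) / c' by rewrite -hd subKr mulfK.
 by rewrite e1; congr mx2; field.
move=> M /SL2P hM; rewrite [M]mx2P; move: (M 0 0) (M 0 1) (M 1 0) (M 1 1) hM => a' b' c' d' hM.
have [c'0|] := eqVneq c' 0; last exact: P6.
have d'0 : d' != 0 by apply: contra_eq_neq hM => ->; rewrite c'0 !mulr0 subrr eq_sym oner_eq0.
have hd : (a' + b') * d' - b' * (c' + d') = 1 by rewrite -hM; ring.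
have := PM (P6 _ _ _ _ hd _) (P4 (-1)); rewrite c'0 add0r => /(_ d'0); rewrite mx2M.
by congr P; congr mx2; ring.
Qed.
End TwoByTwo.

(** * Smoothness of rational functions *)

Section RationalFunctions.
Variable R : realType.

Lemma cvg_mx_coord (T : Type) (F : set_system T) m n (u : T -> 'M[R]_(m, n)) (M : 'M[R]_(m, n)) : Filter F ->
 (forall i j, (fun t => u t i j) @ F --> M i j) -> u @ F --> M.
Proof.
move=> FF h; apply/cvg_ballP => e e0.
have k i j : \forall t \near F, ball (M i j) e (u t i j) by move/cvg_ballP: (h i j); exact.
have : \forall t \near F, forall ij : 'I_m * 'I_n, ball (M ij.1 ij.2) e (u t ij.1 ij.2).
 by apply: filter_forall => -[i j]; exact: k.
by apply: filterS => t ht; split=> // i j; exact: (ht (i, j)).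
Qed.

(** The class is closed under partial derivatives, so smoothness follows by induction on the order.
    The constructor [ratfun_ext] allows a coordinate function to be replaced by an expression valid
    on O only. *)
Inductive ratfun m (O : set 'rV[R]_m) : ('rV[R]_m -> R) -> Prop :=
| ratfun_cst a : ratfun O (fun=> a)
| ratfun_coord i : ratfun O (fun v => v 0 i)
| ratfun_add f g : ratfun O f -> ratfun O g -> ratfun O (f + g)
| ratfun_mul f g : ratfun O f -> ratfun O g -> ratfun O (f * g)
| ratfun_inv f : ratfun O f -> (forall v, O v -> f v != 0) -> ratfun O (fun v => (f v)^-1)
| ratfun_ext f g : ratfun O f -> (forall v, O v -> f v = g v) -> ratfun O g.

Variables (m : nat) (O : set 'rV[R]_m).
Notation e_ i := (delta_mx 0 i : 'rV[R]_m).
Hypothesis oO : open O.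

Let nearO (f g : 'rV[R]_m -> R) v : O v -> (forall v, O v -> f v = g v) -> \forall w \near v, f w = g w.
Proof. by move=> Ov e; apply: filterS (open_nbhs_nbhs (conj oO Ov)). Qed.
Lemma ratfun_continuous f v : ratfun O f -> O v -> {for v, continuous f}.
Proof.
move=> hf Ov; elim: hf => {f} [a|i|f g _ IHf _ IHg|f g _ IHf _ IHg|f _ IHf nz|f g _ IHf e].
- exact: cst_continuous.
- exact: coord_continuous.
- exact: continuousD.
- exact: continuousM.
- by apply: continuousV; [exact: nz|exact: IHf].
- rewrite /prop_for /continuous_at -(e _ Ov); apply: cvg_trans IHf.
 exact: (near_eq_cvg (nearO Ov e)).
Qed.

Lemma ratfun_derive f i : ratfun O f -> exists2 f', ratfun O f' &
 forall v, O v -> is_derive v (e_ i) f (f' v).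
Proof.
elim=> {f} [a|j|f g hf [f' hf' IHf] hg [g' hg' IHg]|f g hf [f' hf' IHf] hg [g' hg' IHg]|f hf [f' hf' IHf] nz|f g _ [f' hf' IHf] e].
- by exists (fun=> 0); [exact: ratfun_cst|move=> v _; exact: is_derive_cst].
- exists (fun=> e_ i 0 j); first exact: ratfun_cst.
 move=> v _; have h : (fun h : R => h^-1 *: ((h *: e_ i + v) 0 j - v 0 j)) @ 0^' -->
   e_ i 0 j.
  apply: (@cvg_trans _ ((fun=> (e_ i) 0 j) @ (0 : R)^')); last exact: cvg_cst.
  apply: near_eq_cvg; near=> t.
  rewrite !mxE addrK /= -[_ *: _]/(_ * _) mulrA mulVf ?mul1r //; near: t; exact: nbhs_dnbhs_neq.
 by apply: DeriveDef; [apply/cvg_ex; eexists; exact: h|exact: cvg_lim h].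
- by exists (f' + g'); [exact: ratfun_add|move=> v Ov; apply: is_deriveD; [exact: IHf|exact: IHg]].
- exists (f * g' + g * f'); first by apply: ratfun_add; exact: ratfun_mul.
 by move=> v Ov; apply: is_deriveM; [exact: IHf|exact: IHg].
- exists ((fun=> -1) * ((fun v => (f v)^-1) * (fun v => (f v)^-1)) * f').
  apply: ratfun_mul=> //; apply: ratfun_mul; first exact: ratfun_cst.
  by apply: ratfun_mul; exact: ratfun_inv.
 move=> v Ov; have [d1 d2] := IHf v Ov; have fv := nz v Ov.
 apply: DeriveDef; first exact: derivableV.
 by rewrite deriveV // d2 /= -[_ *: _]/(_ * _) /GRing.mul /= mulN1r -invfM -expr2.
- exists f' => // v Ov; apply: near_eq_is_derive (IHf v Ov); exact: nearO.
Unshelve. all: by end_near. Qed.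

Lemma ratfun_smooth n U (f : 'rV[R]_m -> 'rV[R]_n) : U `<=` O ->
 (forall j, ratfun O (fun v => f v 0 j)) -> smooth_on U f.
Proof.
move=> UO + k; elim: k f => [|k IH] f hf.
 by split=> // v /set_mem /UO Ov; apply: (@cvg_mx_coord _ (nbhs v)) => i j; rewrite ord1; exact: ratfun_continuous.
split; first by move=> v /set_mem /UO Ov; apply: (@cvg_mx_coord _ (nbhs v)) => i j; rewrite ord1; exact: ratfun_continuous.
move=> i; have /choice[f' hf'] : forall j, exists f', ratfun O f' /\ forall v, O v ->
  is_derive v (e_ i) (fun v => f v 0 j) (f' v).
 by move=> j; have [f' h1 h2] := ratfun_derive i (hf j); exists f'.
have key v : O v -> is_derive v (e_ i) f (\row_j f' j v).
 move=> Ov; have h : (fun h : R => h^-1 *: (f (h *: e_ i + v) - f v)) @ 0^' --> \row_j f' j v.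
  apply: cvg_mx_coord => a b; rewrite ord1 [X in _ --> X]mxE; have [_ /(_ _ Ov)[d1 d2]] := hf' b.
  rewrite -d2; apply: cvg_trans d1; apply: near_eq_cvg; near=> t; by rewrite !mxE.
 by apply: DeriveDef; [apply/cvg_ex; eexists; exact: h|exact: cvg_lim h].
split; first by move=> v /set_mem /UO /key[].
apply: IH => j; have [h _] := hf' j; apply: ratfun_ext h _ => v /key[_ ->]; by rewrite mxE.
Unshelve. all: by end_near. Qed.

Definition ratmx (F : 'rV[R]_m -> 'M[R]_2) := forall i j, ratfun O (fun v => F v i j).

Lemma ratmx_cst N : ratmx (fun=> N). Proof. by move=> i j; exact: ratfun_cst. Qed.

Lemma ratmx_mul F1 F2 : ratmx F1 -> ratmx F2 -> ratmx (fun v => F1 v *m F2 v).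
Proof.
move=> h1 h2 i j; apply: ratfun_ext (ratfun_add (ratfun_mul (h1 i 0) (h2 0 j)) (ratfun_mul (h1 i 1) (h2 1 j))) _.
by move=> v _; rewrite mxE !big_ord_recl big_ord0 addr0; have -> : lift ord0 ord0 = 1 :> 'I_2 by apply: val_inj.
Qed.

Lemma ratmx_mx2 a b c d : ratfun O a -> ratfun O b -> ratfun O c -> ratfun O d ->
 ratmx (fun v => mx2 (a v) (b v) (c v) (d v)).
Proof.
move=> ha hb hc hd -[[|[]] // i1] [[|[]] // j1];
 [apply: ratfun_ext ha _|apply: ratfun_ext hb _|apply: ratfun_ext hc _|apply: ratfun_ext hd _] => v _; by rewrite mxE.
Qed.
End RationalFunctions.

(** * The universal cover of SL2 as a semisimple Lie group *)

Section SL2Cover.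
Variables (R : realType) (G : topGroupType) (p : G -> 'M[R]_2).
Hypothesis hp : is_universal_cover_SL2 p.
Let pM : {morph p : x y / (x * y)%g >-> x *m y}. Proof. by case: hp. Qed.
Let pR : range p = @SL2 R. Proof. by case: hp => _ _ []. Qed.
Let pc : continuous p. Proof. by case: hp => _ _ []. Qed.
Let p1 : p 1%g = 1%:M := cover1 pM pR.

(** The sheet through 1 above an evenly covered neighborhood V of the identity matrix. Continuity of
    the section is stated through neighborhoods restricted to SL2, as s is a function on all
    matrices. *)
Lemma cover_section : exists V U s, [/\ open V, V (1%:M : 'M[R]_2), open U & U (1%g : G)] /\
 [/\ forall x, U x -> V (p x), forall x, U x -> s (p x) = x, forall M, SL2 M -> V M -> U (s M) /\ p (s M) = M
  & forall M O, SL2 M -> V M -> nbhs (s M) O -> nbhs M [set M' | SL2 M' -> V M' -> O (s M')]].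
Proof.
case: hp => _ _ [_ _ hcov]; have S1 : SL2 (1%:M : 'M[R]_2) by rewrite /SL2 /= det1.
have [V [Vo V1] [F [_ FE hF]]] := hcov _ S1.
have [U FU U1] : exists2 U, F U & U 1%g.
 have : (p @^-1` V) 1%g by rewrite /preimage /= p1.
 by rewrite -FE => -[U FU U1]; exists U.
have [Uo [s [sc sU sK]]] := hF U FU; exists V, U, s; split=> //.
have key x : U x -> exists2 M, V M /\ SL2 M & s M = x by rewrite -sU => -[M h <-]; exists M.
have sK' M : V M -> SL2 M -> p (s M) = M by move=> VM SM; apply: sK; rewrite inE.
split=> [x /key[M [VM SM] <-]|x /key[M [VM SM] <-]|M SM VM|M O SM VM hO].
- by rewrite sK'.
- by rewrite sK'.
- by split; [rewrite -sU; exists M|exact: sK'].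
move/subspace_continuousP: sc => /(_ M (conj VM SM) O hO).
move=> h; have {h} h : nbhs M [set M' | (V `&` @SL2 R) M' -> O (s M')] by exact: h.
by apply: filterS h => M' /= h SM' VM'; apply: h.
Qed.

Lemma cover_entry_continuous i j : continuous (fun x => p x i j).
Proof. by move=> x; apply: (@cvg_comp _ _ _ p (fun M : 'M[R]_2 => M i j)); [exact: pc|exact: coord_continuous]. Qed.
Lemma cover_pos : nbhs (1%g : G) [set x | 0 < p x 0 0].
Proof.
have : 0 < p 1%g 0 0 by rewrite p1 !mxE eqxx ltr01.
by move/lt_nbhsr => h; exact: (@cover_entry_continuous 0 0 1%g _ h).
Qed.

(** A scalar matrix in SL2 is 1 or -1; near the unit the upper left entry is positive, and the sheet
    U contains a single point above the identity matrix. *)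
Lemma cover_small_scalar : nbhs (1%g : G)
 [set x | ~~ ((p x 0 1 != 0) || (p x 1 0 != 0) || (p x 0 0 != p x 1 1)) -> x = 1%g].
Proof.
have [V [U [s [[Vo V1 Uo U1] [UV sK _ _]]]]] := cover_section.
have h0 := cover_pos.

apply: filterS (filterI h0 (open_nbhs_nbhs (conj Uo U1))) => x /= [x0 Ux].
rewrite !negb_or !negbK => /andP[/andP[/eqP b0 /eqP c0] /eqP ad].
have := SL2P (cover_SL2 pR x); rewrite b0 mul0r subr0 -ad -expr2 => /eqP.
rewrite sqrf_eq1 => /orP[/eqP a1|/eqP a1]; last by move: x0; rewrite a1 oppr_gt0 ltr10.
rewrite -(sK _ Ux) -(sK _ U1) p1 mx2_1; congr s.
by rewrite [p x]mx2P -ad b0 c0 a1.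
Qed.

Lemma cover_hausdorff : hausdorff_space G.
Proof.
move=> x y xy.
have pxy : p x = p y.
 apply: (@norm_hausdorff _ 'M[R]_2) => A B hA hB.
 by have [z [Az Bz]] := xy _ _ (pc hA) (pc hB); exists (p z).
have [W W1 hW] := nbhs1_div cover_small_scalar.
have hV g : nbhs g [set z | W (z^-1 * g)%g].
 have h : (fun z => z^-1 * g)%g @ g --> (g^-1 * g)%g.
  by apply: cvgMg; [apply: cvgVg; exact: cvg_id|exact: cvg_cst].
 by apply: h; rewrite mulVg.
have [z [/= zx zy]] := xy _ _ (hV x) (hV y).
have := hW _ _ zx zy; have -> : ((z^-1 * x)^-1 * (z^-1 * y) = x^-1 * y)%g by rewrite invgM invgK -!mulgA mulVKg.
have pe : p (x^-1 * y)%g = mx2 1 0 0 1 by rewrite pM -pxy -pM mulVg p1 mx2_1.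
by rewrite /= pe !mxE /= !eqxx => /(_ isT) e; rewrite -[y](mulVKg x) e mulg1.
Qed.

Lemma cover_connected : connected [set: G].
Proof.
case: hp => -[hpath _] _ _.
have -> : [set: G] = \bigcup_(K in [set K | connected K /\ K 1%g]) K.
 apply/seteqP; split=> // g _; have [q [qc q0 q1]] := hpath 1%g g.
 exists (q @` `[0, 1]%classic); last by exists 1=> //=; rewrite in_itv /= ler01 lexx.
 split; last by exists 0=> //=; rewrite in_itv /= lexx ler01.
 by apply: connected_continuous_connected=> //; exact: segment_connected.
by apply: bigcup_connected; [exists 1%g => K []|move=> K []].
Qed.

Lemma cover_normal_dichotomy (N : set G) : is_subgroup N -> normalized_by [set: G] N -> connected N ->
 N = [set 1%g] \/ exists2 x, N x & (p x 0 1 != 0) || (p x 1 0 != 0) || (p x 0 0 != p x 1 1).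
Proof.
move=> sN nN Nc.
have [h|hn] := pselect (exists2 x, N x & (p x 0 1 != 0) || (p x 1 0 != 0) || (p x 0 0 != p x 1 1)); first by right.
left; apply/seteqP; split=> [g Ng|_ ->]; last exact: (subgroup1 sN).
apply: (connected_locally_constant Nc (f := id))=> //; last exact: (subgroup1 sN).
move=> x Nx; apply: filterS (nbhs_translate1 x cover_small_scalar) => y h Ny.
have Nxy : N (x^-1 * y)%g by apply: (subgroupM sN)=> //; exact: (subgroupV sN).
rewrite -[y](mulVKg x) (h _) ?mulg1 //; apply/negP => h'; apply: hn; by exists (x^-1 * y)%g.
Qed.

(** A connected normal subgroup other than 1 maps onto SL2. So does each term of its derived series,
    because the commutator of the two standard unipotents is not scalar; hence the series never
    reaches 1. *)
Lemma cover_semisimple : connected_semisimple G.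
Proof.
split; first exact: cover_connected.
have s1 : is_subgroup [set 1%g : G] by split=> [|x y -> ->|x ->]; rewrite /= ?mulg1 ?invg1.
split; first split=> //; first by move=> g x _ ->; rewrite /= conj1g.
- exact: connected1.
- by exists 0%N.
move=> N [sN nN Nc [k hk]]; have [->//|[x Nx hx]] := cover_normal_dichotomy sN nN Nc.
exfalso; have u1 : SL2 (mx2 1 1 0 1 : 'M[R]_2) by rewrite /SL2 /= det_mx2; ring.
have l1 : SL2 (mx2 1 0 1 1 : 'M[R]_2) by rewrite /SL2 /= det_mx2; ring.
suff full : [/\ is_subgroup (iter k (fun K => commutator_subgroup K K) N),
  normalized_by [set: G] (iter k (fun K => commutator_subgroup K K) N) &
  forall M, SL2 M -> exists2 y, iter k (fun K => commutator_subgroup K K) N y & p y = M].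
 case: full => _ _ /(_ _ u1)[y /hk -> ]; rewrite p1 => /matrixP /(_ 0 1).
 by rewrite !mxE /= => /eqP; rewrite eq_sym oner_eq0.
elim: k {hk} => [|k [sK nK fK]] /=; first by split=> //; exact: (SL2_normal_full pM pR sN nN Nx hx).
set K := iter k _ N in sK nK fK *; split; [exact: generatedG|exact: commutator_subgroup_normal|].
have [y Ky py] := fK _ u1; have [z Kz pz] := fK _ l1.
apply: (SL2_normal_full pM pR (generatedG _) _ (commutator_subgroup_intro Ky Kz)).
 exact: commutator_subgroup_normal.
rewrite commgEl conjgE !pM (coverV pM pR py) (coverV pM pR pz) py pz !mx2M !mxE /=.
apply/orP; left; apply/orP; left; apply/eqP; lra.
Qed.

(** A simple factor maps onto SL2, whose upper right entries are unbounded, whereas this entry is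
    bounded on a compact set. *)
Lemma cover_no_compact_factors : no_compact_simple_factors G.
Proof.
move=> H [[sH Hc [x [y [Hx Hy xy]]] _] nH _] Hcpt.
have [H1|[z Hz hz]] := cover_normal_dichotomy sH nH Hc.
 by apply: xy; move: Hx Hy; rewrite H1 => -> ->.
have cn g : nbhs g [set x | `|p x 0 1| < `|p g 0 1| + 1].
 have e1 : nbhs (p g 0 1) (ball (p g 0 1) 1) by apply: nbhsx_ballx.
 have e2 : nbhs g [set x | ball (p g 0 1) 1 (p x 0 1)] := @cover_entry_continuous 0 1 g _ e1.
 apply: filterS e2 => u /=.
 rewrite -ball_normE /= distrC => h; rewrite -(subrK (p g 0 1) (p u 0 1)).
 by rewrite [_ + 1]addrC; apply: le_lt_trans (ler_normD _ _) _; rewrite ltrD2r.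
have [s [_ hs]] := compact_nbhs_cover Hcpt cn.
pose t := \sum_(g <- s) (`|p g 0 1| + 1) + 1.
have St : SL2 (mx2 1 t 0 1) by rewrite /SL2 /= det_mx2; ring.
have [w Hw pw] := SL2_normal_full pM pR sH nH Hz hz St.
have [g [gs]] := hs _ Hw; rewrite /= pw mxE /=.
have : `|p g 0 1| + 1 <= \sum_(g <- s) (`|p g 0 1| + 1).
 rewrite (big_rem g gs) /= lerDl sumr_ge0 // => i _; exact: addr_ge0.
have := ler_norm t; rewrite {1}/t; lra.
Qed.
Notation W := 'rV[R]_3.
Variables (V : set 'M[R]_2) (U : set G) (s : 'M[R]_2 -> G).
Hypotheses (Vo : open V) (V1 : V 1%:M) (Uo : open U) (U1 : U 1%g).
Hypotheses (UV : forall x, U x -> V (p x)) (sK : forall x, U x -> s (p x) = x)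
 (sP : forall M, SL2 M -> V M -> U (s M) /\ p (s M) = M)
 (sc : forall M O, SL2 M -> V M -> nbhs (s M) O -> nbhs M [set M' | SL2 M' -> V M' -> O (s M')]).

Definition SL2_param (v : W) := mx2 (v 0 0) (v 0 1) (v 0 ord_max) ((1 + v 0 1 * v 0 ord_max) / v 0 0).
Definition SL2_coord (M : 'M[R]_2) : W := \row_j (if j == 0 then M 0 0 else if j == 1 then M 0 1 else M 1 0).

Lemma SL2_paramK (v : W) : SL2_coord (SL2_param v) = v.
Proof.
apply/rowP => j; rewrite !mxE /=; case: eqP => [->//|j0]; case: eqP => [->//|j1].
congr (v 0 _); apply: val_inj; case: j j0 j1 => -[|[|[]]] // i h1 h2; [case: h1|case: h2]; exact: val_inj.
Qed.

Lemma SL2_coordK M : SL2 M -> 0 < M 0 0 -> SL2_param (SL2_coord M) = M.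
Proof.
move=> /SL2P e M0; rewrite [RHS]mx2P /SL2_param !mxE /=; congr mx2.
by apply: (mulIf (lt0r_neq0 M0)); rewrite mulfVK ?lt0r_neq0 // -e; ring.
Qed.

Lemma SL2_paramP (v : W) : 0 < v 0 0 -> SL2 (SL2_param v).
Proof. by move=> v0; rewrite /SL2 /= det_mx2; field; exact: lt0r_neq0. Qed.

Definition V0 : set W := [set v : W | 0 < v 0 0 /\ V (SL2_param v)].
Let H0 : set W := [set v : W | 0 < v 0 0].

Let H0_open : open H0.
Proof.
by apply: (@open_comp _ _ (fun v : W => v 0 0) [set x | 0 < x]) => [v _|]; [exact: coord_continuous|exact: open_gt].
Qed.

Lemma ratmx_param m (O : set 'rV[R]_m) (f : 'rV[R]_m -> W) : (forall j, ratfun O (fun v => f v 0 j)) ->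
 (forall v, O v -> 0 < f v 0 0) -> ratmx O (fun v => SL2_param (f v)).
Proof.
move=> hf f0; apply: ratmx_mx2=> //; apply: ratfun_mul.
 by apply: ratfun_add; [exact: ratfun_cst|exact: ratfun_mul].
by apply: ratfun_inv=> // v /f0 /lt0r_neq0.
Qed.

Lemma SL2_param_continuous (v : W) : 0 < v 0 0 -> {for v, continuous SL2_param}.
Proof.
move=> v0; apply: (@cvg_mx_coord _ _ (nbhs v)) => i j.
apply: (ratfun_continuous H0_open _ (v0 : H0 v)).
exact: (@ratmx_param _ H0 id (fun j => ratfun_coord _ j)).
Qed.

Let V0_open : open V0.
Proof.
rewrite openE => v [v0 Vv]; apply: filterI; first exact: (open_nbhs_nbhs (conj H0_open v0)).
exact: (SL2_param_continuous v0 (open_nbhs_nbhs (conj Vo Vv))).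
Qed.

Definition cover_chart (g : G) : chart R 3 G :=
 Chart [set x | U (g^-1 * x)%g /\ 0 < p (g^-1 * x)%g 0 0] (fun x => SL2_coord (p (g^-1 * x)%g))
  (fun v => (g * s (SL2_param v))%g).

Definition cover_atlas : set (chart R 3 G) := range cover_chart.

Lemma cover_chart_dom g x : chart_dom (cover_chart g) x -> V0 (SL2_coord (p (g^-1 * x)%g)).
Proof.
move=> [Ux x0]; split; first by rewrite mxE.
by rewrite SL2_coordK //; [exact: UV|exact: cover_SL2].
Qed.

Lemma cover_chart_inv g v : V0 v -> chart_dom (cover_chart g) (g * s (SL2_param v))%g.
Proof.
move=> [v0 Vv]; have [h1 h2] := sP (SL2_paramP v0) Vv.
by rewrite /= mulKg; split=> //; rewrite h2 mxE.
Qed.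

Lemma cover_chart_fun_inv g v : V0 v -> chart_fun (cover_chart g) (g * s (SL2_param v))%g = v.
Proof.
by move=> [v0 Vv]; have [h1 h2] := sP (SL2_paramP v0) Vv; rewrite /= mulKg h2 SL2_paramK.
Qed.

Lemma cover_chart_cod g : chart_cod (cover_chart g) = V0.
Proof.
apply/seteqP; split=> [_ [x /cover_chart_dom h <-]//|v Vv].
by exists (g * s (SL2_param v))%g; [exact: cover_chart_inv|exact: cover_chart_fun_inv].
Qed.

Let pVc g i j : continuous (fun x => p (g^-1 * x)%g i j).
Proof.
move=> x; apply: (@cvg_comp _ _ _ (fun x => g^-1 * x)%g (fun x => p x i j)); last exact: cover_entry_continuous.
by apply: cvgMg; [exact: cvg_cst|exact: cvg_id].
Qed.

Lemma section_continuous (v : W) : V0 v -> {for v, continuous (fun v => s (SL2_param v))}.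
Proof.
move=> Vv O hO; have [v0 Vv'] := Vv.
have h := SL2_param_continuous v0 (sc (SL2_paramP v0) Vv' hO).
have {}h : nbhs v [set w | SL2 (SL2_param w) -> V (SL2_param w) -> O (s (SL2_param w))] := h.
suff : nbhs v [set w | O (s (SL2_param w))] by [].
by apply: filterS (filterI h (open_nbhs_nbhs (conj V0_open Vv))) => w /= [h' [w0 Vw]]; apply: h' => //; exact: SL2_paramP.
Qed.

Lemma cover_is_chart g : is_chart (cover_chart g).
Proof.
split.
- rewrite openE => x [Ux x0]; apply: filterI.
  have h : (fun x => g^-1 * x)%g @ x --> (g^-1 * x)%g by apply: cvgMg; [exact: cvg_cst|exact: cvg_id].
  exact: (h _ (open_nbhs_nbhs (conj Uo Ux))).
 exact: (pVc (lt_nbhsr x0)).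
- by rewrite cover_chart_cod.
- move=> x /set_mem [Ux x0] /=; rewrite SL2_coordK //; last exact: cover_SL2.
 by rewrite sK // mulVKg.
- move=> x _; apply: (@cvg_mx_coord _ _ (nbhs x)) => i j; rewrite mxE /=.
 by under eq_fun do rewrite mxE; do 2?case: ifP => _; exact: pVc.
- rewrite cover_chart_cod => v /set_mem Vv; apply: (@cvgMg _ _ (nbhs v) (fun=> g) (fun v => s (SL2_param v))); [exact: cvg_cst|exact: section_continuous].
Qed.

Let smooth_coord m (O : set 'rV[R]_m) S (F : 'rV[R]_m -> G) (F' : 'rV[R]_m -> 'M[R]_2) : open O -> S `<=` O ->
 ratmx O F' -> (forall v, O v -> p (F v) = F' v) -> smooth_on S (fun v => SL2_coord (p (F v))).
Proof.
move=> oO SO hF e; apply: (ratfun_smooth oO SO) => j.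
have [a [b hab]] : exists a b, forall M, SL2_coord M 0 j = M a b.
 case j0 : (j == 0); first by exists 0, 0 => M; rewrite mxE j0.
 case j1 : (j == 1); first by exists 0, 1 => M; rewrite mxE j0 j1.
 by exists 1, 0 => M; rewrite mxE j0 j1.
by apply: ratfun_ext (hF a b) _ => v Ov; rewrite hab e.
Qed.

Let p_chart g v : V0 v -> p (g * s (SL2_param v))%g = p g *m SL2_param v.
Proof. by move=> [v0 Vv]; rewrite pM (sP (SL2_paramP v0) Vv).2. Qed.
Let param_V0 : ratmx V0 SL2_param.
Proof. by apply: (@ratmx_param _ V0 id) => [j|v []//]; exact: ratfun_coord. Qed.
Lemma cover_smooth_atlas : is_smooth_atlas cover_atlas.
Proof.
split=> [_ [g _ <-]|| _ _ [g _ <-] [h _ <-]]; first exact: cover_is_chart.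
 apply/seteqP; split=> // x _; exists (cover_chart x); first by exists x.
 by rewrite /= mulVg p1 mxE ltr01.
apply: (smooth_coord V0_open (F' := fun v => p h^-1%g *m (p g *m SL2_param v))).
- by move=> _ [x [hx _] <-]; exact: cover_chart_dom.
- apply: ratmx_mul; [exact: ratmx_cst|apply: ratmx_mul; [exact: ratmx_cst|exact: param_V0]].
- by move=> v Vv; rewrite pM p_chart.
Qed.

Lemma cover_mul_smooth : smooth_map (prod_atlas cover_atlas cover_atlas) cover_atlas (fun x : G * G => (x.1 * x.2)%g).
Proof.
split; first exact: mulg_continuous.
move=> _ _ [_ [_ [[g1 _ <-] [g2 _ <-] ->]]] [h _ <-].
have lc : continuous (lsubmx : 'rV[R]_(3 + 3) -> W) := lipschitz1_continuous (@lsubmx_dist R 3 3).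
have rc : continuous (rsubmx : 'rV[R]_(3 + 3) -> W) := lipschitz1_continuous (@rsubmx_dist R 3 3).
pose O := (lsubmx : 'rV[R]_(3 + 3) -> W) @^-1` V0 `&` (rsubmx : 'rV[R]_(3 + 3) -> W) @^-1` V0.
apply: (smooth_coord (O := O) (F' := fun v => p h^-1%g *m (p g1 *m SL2_param (lsubmx v) *m (p g2 *m SL2_param (rsubmx v))))).
- by apply: openI; [apply: open_comp V0_open => z _; exact: lc|apply: open_comp V0_open => z _; exact: rc].
- move=> _ [[[x y] [/= hx hy] <-] _]; split; rewrite /= ?row_mxKl ?row_mxKr; exact: cover_chart_dom.
- apply: ratmx_mul; first exact: ratmx_cst.
 apply: ratmx_mul; (apply: ratmx_mul; first exact: ratmx_cst).
  by apply: ratmx_param => [j|v [[]]//]; apply: ratfun_ext (ratfun_coord _ (lshift 3 j)) _ => v _; rewrite mxE.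
 by apply: ratmx_param => [j|v [_ []]//]; apply: ratfun_ext (ratfun_coord _ (rshift 3 j)) _ => v _; rewrite mxE.
- by move=> v [h1 h2]; rewrite pM /= pM !p_chart.
Qed.

Lemma cover_inv_smooth : smooth_map cover_atlas cover_atlas (fun x : G => x^-1%g).
Proof.
split; first exact: invg_continuous.
move=> _ _ [g _ <-] [h _ <-].
apply: (smooth_coord V0_open (F' := fun v => p h^-1%g *m
 (mx2 (SL2_param v 1 1) (- SL2_param v 0 1) (- SL2_param v 1 0) (SL2_param v 0 0) *m p g^-1%g))).
- by move=> v [hv _]; rewrite -(cover_chart_cod g).
- apply: ratmx_mul; first exact: ratmx_cst.
 have mN (f : W -> R) : ratfun V0 f -> ratfun V0 (fun v => - f v).
  by move=> hf; apply: ratfun_ext (ratfun_mul (ratfun_cst _ (-1)) hf) _ => v _; rewrite -[RHS]mulN1r.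
 by apply: ratmx_mul; [apply: ratmx_mx2; [exact: param_V0|exact: mN (param_V0 _ _)|exact: mN (param_V0 _ _)|exact: param_V0]|exact: ratmx_cst].
- move=> v [v0 Vv]; have [_ h2] := sP (SL2_paramP v0) Vv.
 by rewrite pM /= invgM pM (coverV pM pR (etrans h2 (mx2P _))).
Qed.

(** Words in the points with rational coordinates form a countable subgroup. Its closure is a
    subgroup containing a neighborhood of 1, hence all of the connected group. *)
Let word (w : seq (bool * 'rV[rat]_3)) : G := foldr (fun bq x =>
 ((if bq.1 then s (SL2_param (map_mx ratr bq.2)) else (s (SL2_param (map_mx ratr bq.2)))^-1) * x)%g) 1%g w.
Let ball1 k : set G := U `&` p @^-1` ball (1%:M : 'M[R]_2) k.+1%:R^-1.

Let word_cat w1 w2 : word (w1 ++ w2) = (word w1 * word w2)%g.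
Proof. by elim: w1 => [|a w1 IH]; rewrite /= ?mul1g // IH mulgA. Qed.
Let word_dense : closure (range word) = [set: G].
Proof.
apply: connected_subgroup_full; first exact: cover_connected.
 apply: subgroup_closure; split; first by exists [::].
  by move=> _ _ [w1 _ <-] [w2 _ <-]; exists (w1 ++ w2)=> //; rewrite word_cat.
 move=> _ [w _ <-]; exists (rev [seq (~~ bq.1, bq.2) | bq <- w])=> //.
 elim: w => [|a w IH] /=; first by rewrite invg1.
 by rewrite rev_cons -cats1 word_cat IH /= mulg1 invgM; case: a.1; rewrite /= ?invgK.
have h0 := cover_pos.

apply: filterS (filterI h0 (open_nbhs_nbhs (conj Uo U1))) => x [/= x0 Ux] O hO.
have Sx := cover_SL2 pR x; have xE := SL2_coordK Sx x0.
have Vx : V0 (SL2_coord (p x)) by split; [rewrite mxE|rewrite xE; exact: UV].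
have := section_continuous Vx; rewrite /prop_for /continuous_at xE (sK Ux) => /(_ O hO) /nbhs_ballP[e /= e0 he].
have /choice[q hq] : forall j, exists q : rat, `|SL2_coord (p x) 0 j - ratr q| < e.
 move=> j; have [q] := @rat_in_itvoo R (SL2_coord (p x) 0 j) (SL2_coord (p x) 0 j + e) ltac:(by rewrite ltrDl).
 by rewrite in_itv /= => /andP[h1 h2]; exists q; rewrite ltr0_norm; lra.
exists (s (SL2_param (map_mx ratr (\row_j q j)))); split.
 by exists [:: (true, \row_j q j)]=> //=; rewrite mulg1.
by apply: he; split=> // i j; rewrite ord1 /ball /= !mxE; have := hq j; rewrite mxE.
Qed.

Let ball1_open k : open (ball1 k).
Proof. by apply: openI=> //; apply: open_comp => [x _|]; [exact: pc|exact: ball_open]. Qed.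
Let ball1_1 k : ball1 k 1%g.
Proof. by split=> //; rewrite /preimage /= p1; exact: ballxx. Qed.
(** The base consists of translates, by words, of the parts of the sheet U above small balls. *)
Lemma cover_second_countable : @second_countable G.
Proof.
exists (range (fun wk => (fun x => (word wk.1)^-1 * x)%g @^-1` ball1 wk.2)).
 exact: (sub_countable (card_image_le _ _) (countableP _)).
split=> [_ [[w k] _ <-]|x N hN].
 by apply: open_comp=> // x _; apply: cvgMg; [exact: cvg_cst|exact: cvg_id].
have [W0 W01 hW] := nbhs1_div (nbhs1_translate hN).
have S1 : SL2 (1%:M : 'M[R]_2) by rewrite /SL2 /= det1.
have s1 : s 1%:M = 1%g by rewrite -p1 sK.
have : nbhs (1%:M : 'M[R]_2) [set M' | SL2 M' -> V M' -> W0 (s M')] by apply: sc=> //; rewrite s1.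
move=> /nbhs_ballP[e /= e0 he].
have [k hk] : exists k, k.+1%:R^-1 < e by exists (Num.truncn e^-1); rewrite invf_plt ?posrE // truncnS_gt.
have kW y : ball1 k y -> W0 y.
 move=> [Uy hy]; rewrite -(sK Uy); apply: he; [|exact: cover_SL2|exact: UV].
 by apply: le_ball hy; exact: ltW.
have hx B : nbhs (1%g : G) B -> nbhs x [set q | B (q^-1 * x)%g].
 move=> hB; have h : (fun z => z^-1 * x)%g @ x --> (x^-1 * x)%g.
  by apply: cvgMg; [apply: cvgVg; exact: cvg_id|exact: cvg_cst].
 by apply: h; rewrite mulVg.
have : closure (range word) x by rewrite word_dense.
move=> /(_ _ (hx _ (open_nbhs_nbhs (conj (ball1_open k) (ball1_1 k)))))[_ [[w _ <-] hw]].
exists ((fun x => (word w)^-1 * x)%g @^-1` ball1 k); first by split=> //; exists (w, k).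
move=> y /kW hy; have /= := hW _ _ (kW _ hw) hy.
by rewrite invgM invgK -!mulgA mulVKg mulVKg.
Qed.
End SL2Cover.

Lemma cover_is_lie (R : realType) (G : topGroupType) (p : G -> 'M[R]_2) : is_universal_cover_SL2 p ->
 exists A : set (chart R 3 G), is_lie_group A.
Proof.
move=> hp; have [V [U [s [[Vo V1 Uo U1] [UV sK sP sc]]]]] := cover_section hp.
exists (cover_atlas p U s); split.
- exact: (cover_hausdorff hp).
- exact: (cover_second_countable hp Vo V1 Uo U1 UV sK sc).
- exact: (cover_smooth_atlas hp Vo Uo U1 UV sK sP sc).
- exact: (cover_mul_smooth hp Vo UV sP).
- exact: (cover_inv_smooth hp Vo UV sP).
Qed.

(** * Assembly of the theorem *)

Lemma type_absolutely_connected_minap (G : groupType) : type_absolutely_connected G <-> minap G.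
Proof. by split; [exact: TAC_minap|exact: minap_TAC]. Qed.

Theorem mainTheorem4 (R : realType) :
 (forall (n m : nat) (G S : topGroupType)
   (A : set (chart R n G)) (B : set (chart R m S))
   (Rad : set G) (iota : S -> G),
   is_lie_group A -> connected [set: G] ->
   is_solvable_radical Rad -> is_levi_subgroup A B Rad iota ->
   (type_absolutely_connected G <->
    no_compact_simple_factors S /\
    Rad = commutator_subgroup [set: G] Rad) /\
   (type_absolutely_connected G <->
    von_neumann_radical (discrete_topology G) = [set: discrete_topology G]))
 /\
 (forall (n : nat) (G : topGroupType) (A : set (chart R n G)),
   is_lie_group A -> connected_semisimple G -> no_compact_simple_factors G ->
   type_absolutely_connected G)
 /\
 (forall (G : topGroupType) (p : G -> 'M[R]_2),
   is_universal_cover_SL2 p ->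
   [/\ (exists (n : nat) (A : set (chart R n G)), is_lie_group A),
     connected_semisimple G,
     no_compact_simple_factors G
    & type_absolutely_connected G]).
Proof.
have part2 (n : nat) (G : topGroupType) (A : set (chart R n G)) :
  is_lie_group A -> connected_semisimple G -> no_compact_simple_factors G -> type_absolutely_connected G.
 by move=> hA ss ncf; apply: minap_TAC; exact: semisimple_minap hA ss ncf.
split=> [n m G S A B Rad iota hA Gc hR hL|].
 split; apply: (iff_trans (type_absolutely_connected_minap G)); first exact: levi_minap_iff hA Gc hR hL.
 exact: iff_sym (von_neumann_minap G).
split=> // G p hp; have [A hA] := cover_is_lie hp.
have ss := cover_semisimple hp; have ncf := cover_no_compact_factors hp.
by split=> //; [exists 3, A|exact: part2 hA ss ncf].
Qed.
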